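(* Let $\Omega \subset \mathbb{R}^2$ be an open, bounded, strictly convex set with $C^1$ boundary. Then for every $f \in BV(\partial\Omega)$ there exists a solution of the least gradient problem for $f$, i.e. there exists $u \in BV(\Omega)$ with $Tu = f$ such that $\int_\Omega |Du| \leq \int_\Omega |D(u+v)|$ for every $v \in BV(\Omega)$ with $Tv = 0$.
   Context: $T: BV(\Omega) \to L^1(\partial\Omega)$ denotes the trace operator and $\int_\Omega |Du|$ the total variation of $Du$ in $\Omega$. The space $BV(\partial\Omega)$: $\partial\Omega$ is parametrized by arc length and equipped with the one-dimensional Hausdorff measure; $f \in L^1(\partial\Omega)$ belongs to $BV(\partial\Omega)$ if, after removing from $\partial\Omega$ a point $p$ of approximate continuity of $f$, we have $f \in BV(\partial\Omega \setminus \{p\})$, where $\partial\Omega\setminus\{p\}$ is identified via arc length with an open interval (i.e. $\sum_i |f(x_i) - f(x_{i-1})| \leq M < \infty$ for all finite ordered sequences of points $x_0,\dots,x_n$ of approximate continuity of $f$ in that interval). This does not depend on the choice of $p$. *)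

(* Defs.v *)
From HB Require Import structures.
From mathcomp Require Import all_boot all_order all_algebra.
From mathcomp Require Import all_classical all_reals all_analysis.

Set Implicit Arguments.
Unset Strict Implicit.
Unset Printing Implicit Defensive.

Import Order.TTheory GRing.Theory Num.Theory.
Import numFieldNormedType.Exports.

Local Open Scope classical_set_scope.
Local Open Scope ring_scope.

(* The canonical norm of R * R is the sup norm, so the Euclidean structure is
   defined by hand; both norms give the topology carried by R * R. *)
Section euclidean_plane.
Context {R : realType}.
Implicit Types x y : R * R.

Definition dot x y : R := x.1 * y.1 + x.2 * y.2.

Definition enorm x : R := Num.sqrt (dot x x).

Definition eball x (r : R) : set (R * R) := [set y | enorm (y - x) < r].

Definition lebesgue2 := (@lebesgue_measure R \x @lebesgue_measure R)%E.

End euclidean_plane.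

Section hausdorff_measure.
Context {R : realType}.
Local Open Scope ereal_scope.
Implicit Types A : set (R * R).

(* The maximum with 0 matters only for A = set0, where the supremum is -oo. *)
Definition diameter A : \bar R :=
  maxe 0 (ereal_sup [set (enorm (p.1 - p.2)%R)%:E | p in A `*` A]).

Definition delta_cover (delta : R) A : set ((set (R * R))^nat) :=
  [set C | A `<=` \bigcup_k C k /\ forall k, diameter (C k) <= delta%:E].

Definition hausdorff1_delta (delta : R) A : \bar R :=
  ereal_inf [set \sum_(k <oo) diameter (C k) | C in delta_cover delta A].

Definition hausdorff1 A : \bar R :=
  ereal_sup [set hausdorff1_delta delta A | delta in [set d : R | (0 < d)%R]].

Lemma diameter_ge0 A : 0 <= diameter A.
Proof. by rewrite /diameter le_max lexx. Qed.

Lemma diameter0 : diameter set0 = 0.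
Proof.
rewrite /diameter (_ : [set _ | _ in _] = set0); last first.
  by apply/seteqP; split => // x [p []].
by rewrite ereal_sup0; apply/max_idPl; rewrite leNye.
Qed.

Lemma hausdorff1_delta_ge0 delta A : 0 <= hausdorff1_delta delta A.
Proof.
apply: le_ereal_inf_tmp => x [B _ <-{x}].
by apply: nneseries_ge0 => n _ _; exact: diameter_ge0.
Qed.

Lemma hausdorff1_delta0 delta : (0 < delta)%R -> hausdorff1_delta delta set0 = 0.
Proof.
move=> d0; apply/eqP; rewrite eq_le hausdorff1_delta_ge0 andbT.
apply: ereal_inf_lbound; exists (fun=> set0).
  by split => // k; rewrite diameter0 lee_fin ltW.
by rewrite eseries0 // => k _ _; rewrite diameter0.
Qed.

Lemma le_hausdorff1_delta delta :
  {homo hausdorff1_delta delta : A B / A `<=` B >-> A <= B}.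
Proof.
move=> A B AB; apply/ereal_inf_le_tmp => x [C [BC dC]] <-.
by exists C => //; split => //; exact: subset_trans BC.
Qed.

Lemma hausdorff1_delta_sigma_subadditive delta :
  sigma_subadditive (hausdorff1_delta delta).
Proof.
move=> A; have [[i ioo]|] := pselect (exists i, hausdorff1_delta delta (A i) = +oo).
  rewrite (eseries_pinfty _ _ ioo) ?leey// => n _.
  by rewrite -ltNye (lt_le_trans _ (hausdorff1_delta_ge0 _ _)).
rewrite -forallNE => Aoo.
apply/lee_addgt0Pr => _/posnumP[e].
rewrite (le_trans _ (epsilon_trick _ _ _))//; last first.
  by move=> n; exact: hausdorff1_delta_ge0.
pose P n (B : (set (R * R))^nat) := delta_cover delta (A n) B /\
  \sum_(k <oo) diameter (B k)
    <= hausdorff1_delta delta (A n) + (e%:num / (2 ^ n.+1)%:R)%:E.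
have [G PG] : {G : ((set (R * R))^nat)^nat & forall n, P n (G n)}.
  apply: (@choice _ _ P) => n; rewrite /P /hausdorff1_delta.
  set S := (X in ereal_inf X).
  have Sfin : ereal_inf S \is a fin_num.
    rewrite ge0_fin_numE ?hausdorff1_delta_ge0// ltey.
    exact/eqP/Aoo.
  have en1 : (0 < e%:num / (2 ^ n.+1)%:R)%R by [].
  have [x [B AnB xS] muBx] := lb_ereal_inf_adherent en1 Sfin.
  by exists B; split => //; rewrite xS; exact/ltW.
pose m := diameter \o uncurry G.
have m_ge0 x : 0 <= m x by exact: diameter_ge0.
apply: (@le_trans _ _ (\esum_(i in setT) m i)).
  apply: ereal_inf_lbound => /=.
  have /card_esym/ppcard_eqP[f] := card_nat2.
  exists (uncurry G \o f).
    split; last by move=> k /=; case: (f k) => a b; exact: (PG a).1.2.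
    move=> t [i _ /((PG i).1.1 t)[j _ Bijt]].
    by exists (f^-1%FUN (i, j)) => //=; rewrite invK ?inE.
  rewrite -(esum_pred_image m _ xpredT) ?[fun=> _]set_true//.
  by rewrite image_eq.
rewrite (_ : esum _ _ = \sum_(i <oo) \sum_(j <oo) diameter (G i j)); last first.
  pose J : nat -> set (nat * nat) := fun i => [set (i, j) | j in setT].
  rewrite (_ : setT = \bigcup_k J k); last first.
    by rewrite predeqE => -[a b]; split => // _; exists a => //; exists b.
  rewrite esum_bigcupT /=; last 2 first.
    - apply/trivIsetP => i j _ _ ij.
      rewrite predeqE => -[n k] /=; split => //= -[] [_] _ [<-{n} _].
      by move=> [m' _] [] /esym/eqP; rewrite (negbTE ij).
    - by move=> x; exact: m_ge0.
  rewrite -(image_id [set: nat]) -fun_true esum_pred_image//; last first.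
    by move=> n _; exact: esum_ge0.
  apply: eq_eseriesr => /= j _.
  rewrite -(esum_pred_image m (pair j) predT)//=; last first.
    by move=> ? ? _ _; exact: (@can_inj _ _ _ snd).
  by congr esum; rewrite predeqE => -[a b]; split; move=> [i _ <-]; exists i.
apply: lee_lim.
- apply: is_cvg_nneseries => n *.
  by apply: nneseries_ge0 => k *; exact: diameter_ge0.
- apply: is_cvg_nneseries => n *; apply: adde_ge0 => //.
  exact: hausdorff1_delta_ge0.
- by near=> n; apply: lee_sum => i _; exact: (PG i).2.
Unshelve. all: by end_near. Qed.

Lemma hausdorff1_delta_le delta A :
  (0 < delta)%R -> hausdorff1_delta delta A <= hausdorff1 A.
Proof. by move=> d0; apply: ereal_sup_ubound; exists delta. Qed.

Lemma hausdorff1_ge0 A : 0 <= hausdorff1 A.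
Proof.
by apply: le_trans (hausdorff1_delta_le A ltr01); exact: hausdorff1_delta_ge0.
Qed.

Lemma hausdorff1_0 : hausdorff1 set0 = 0.
Proof.
apply/eqP; rewrite eq_le hausdorff1_ge0 andbT.
by apply: ge_ereal_sup => _ [d d0 <-]; rewrite hausdorff1_delta0.
Qed.

Lemma le_hausdorff1 : {homo hausdorff1 : A B / A `<=` B >-> A <= B}.
Proof.
move=> A B AB; apply: ge_ereal_sup => _ [d d0 <-].
apply: (@le_trans _ _ (hausdorff1_delta d B)).
  exact: le_hausdorff1_delta.
exact: hausdorff1_delta_le.
Qed.

Lemma hausdorff1_sigma_subadditive : sigma_subadditive hausdorff1.
Proof.
move=> F; apply: ge_ereal_sup => _ [d d0 <-].
apply: (le_trans (hausdorff1_delta_sigma_subadditive d F)).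
apply: lee_nneseries => n _ *; first exact: hausdorff1_delta_ge0.
exact: hausdorff1_delta_le.
Qed.

HB.instance Definition _ := isOuterMeasure.Build R (R * R)%type hausdorff1
  hausdorff1_0 hausdorff1_ge0 le_hausdorff1 hausdorff1_sigma_subadditive.

(* H^1 as a measure on its Caratheodory-measurable sets *)
Definition hausdorff1_measure : set (caratheodory_type hausdorff1) -> \bar R :=
  (hausdorff1 : {outer_measure set (R * R) -> \bar R}).

HB.instance Definition _ := Measure.on hausdorff1_measure.

End hausdorff_measure.

Section domains.
Context {R : realType}.
Implicit Types Omega : set (R * R).

Definition boundary Omega : set (R * R) := closure Omega `\` interior Omega.

Definition strictly_convex Omega : Prop :=
  forall x y, closure Omega x -> closure Omega y -> x != y ->
  forall t : R, 0 < t < 1 -> interior Omega (t *: x + (1 - t) *: y).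

(* Near each boundary point, Omega is the strict epigraph of a C^1 function in
   some orthonormal coordinates (dot y e1, dot y e2). *)
Definition C1_boundary Omega : Prop :=
  forall x, boundary Omega x ->
  exists (e1 e2 : R * R) (r : R) (h : R -> R),
    [/\ dot e1 e1 = 1, dot e2 e2 = 1 & dot e1 e2 = 0] /\
    [/\ 0 < r,
        forall t, derivable h t 1,
        continuous (derive1 h) &
        forall y, eball x r y -> (Omega y <-> h (dot y e1) < dot y e2)].

(* Closed curves are periodic maps on the whole line, G being swept exactly once
   per period; removing the point gamma p from G leaves the image of the open
   interval ]p, p + L[. *)
Record arc_length_param (G : set (R * R)) (L : R) (gamma : R -> R * R) : Prop :=
  ArcLengthParam {
    alp_length_gt0 : 0 < L ;
    alp_derivable : forall t, derivable gamma t 1 ;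
    alp_derive_continuous : continuous (derive1 gamma) ;
    alp_unit_speed : forall t, enorm (derive1 gamma t) = 1 ;
    alp_periodic : forall t, gamma (t + L) = gamma t ;
    alp_injective : {in `[0, L[ &, injective gamma} ;
    alp_range : range gamma = G }.

End domains.

Section bounded_variation.
Context {R : realType}.
Implicit Types (Omega : set (R * R)) (u f : R * R -> R).

(* Asking this of every direction v is the same as asking it of the two
   coordinate directions. *)
Definition C1_field (phi : R * R -> R * R) : Prop :=
  forall v : R * R,
    (forall x, derivable phi x v) /\ continuous (fun x => 'D_v phi x).

Definition divergence (phi : R * R -> R * R) (x : R * R) : R :=
  ('D_(1, 0) phi x).1 + ('D_(0, 1) phi x).2.

Definition test_field Omega : set (R * R -> R * R) :=
  [set phi | [/\ C1_field phi,
                 compact (closure [set x | phi x != 0]),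
                 closure [set x | phi x != 0] `<=` Omega &
                 forall x, enorm (phi x) <= 1]].

(* \int_Omega |Du|, possibly +oo *)
Definition total_var Omega u : \bar R :=
  ereal_sup [set (\int[lebesgue2]_(x in Omega) (u x * divergence phi x)%:E)%E
            | phi in test_field Omega].

(* Elements of BV(Omega) are represented by functions on the whole plane; the
   values outside Omega are irrelevant. The same convention is used on the
   boundary. *)
Definition BV Omega u : Prop :=
  lebesgue2.-integrable Omega (EFin \o u) /\ (total_var Omega u < +oo)%E.

Definition L1_boundary Omega f : Prop :=
  hausdorff1_measure.-integrable (boundary Omega) (EFin \o f).

(* T u = f: f is integrable on the boundary and, for H^1-almost every boundary
   point x, r^-2 \int_(Omega `&` B(x, r)) |u - f(x)| tends to 0 with r. This
   determines f up to an H^1-negligible set. *)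
Definition trace Omega u f : Prop :=
  L1_boundary Omega f /\
  hausdorff1 [set x | boundary Omega x /\
    ~ ((r ^- 2)%:E *
         \int[lebesgue2]_(y in Omega `&` eball x r) `|u y - f x|%:E @[r --> 0^'+]
       --> 0)%E] = 0%E.

(* completed_lebesgue_measure: the composite of an H^1-measurable function with
   an arc length parametrization is Lebesgue, but maybe not Borel, measurable. *)
Definition approx_continuous (F : R -> R) (t : R) : Prop :=
  forall e : R, 0 < e ->
  (((2 * r)^-1)%:E *
     completed_lebesgue_measure [set s : R | (`|s - t| < r)%R /\
                                          (e <= `|F s - F t|)%R]
   @[r --> 0^'+] --> 0)%E.

Definition essential_variation_le (F : R -> R) (a b M : R) : Prop :=
  forall (n : nat) (x : nat -> R),
    (forall i, (i <= n)%N -> a < x i < b /\ approx_continuous F (x i)) ->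
    (forall i, (i < n)%N -> x i < x i.+1) ->
    \sum_(i < n) `|F (x i.+1) - F (x i)| <= M.

Definition BV_boundary Omega f : Prop :=
  L1_boundary Omega f /\
  exists (L : R) (gamma : R -> R * R),
    arc_length_param (boundary Omega) L gamma /\
    exists p : R, approx_continuous (f \o gamma) p /\
    exists M : R, essential_variation_le (f \o gamma) p (p + L) M.

(* u solves the least gradient problem with boundary datum f. *)
Definition least_gradient_solution Omega f u : Prop :=
  [/\ BV Omega u, trace Omega u f &
      forall v, BV Omega v -> trace Omega v (fun=> 0) ->
        (total_var Omega u <= total_var Omega (fun x => u x + v x)%R)%E].

End bounded_variation.

(* Main.v *)
Require Import Defs.
From HB Require Import structures.
From mathcomp Require Import all_boot all_order all_algebra.
From mathcomp Require Import all_classical all_reals all_analysis.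
From mathcomp Require Import measurable_realfun.
From mathcomp Require Import ring lra zify.

Set Implicit Arguments.
Unset Strict Implicit.
Unset Printing Implicit Defensive.

Import Order.TTheory GRing.Theory Num.Theory.
Import numFieldNormedType.Exports.

Local Open Scope classical_set_scope.
Local Open Scope ring_scope.

(* A cap is the part of Omega in a half-plane that misses a fixed boundary point
   q and is so small that the cap lies in one C^1 chart. If f <= k (or f >= k) on
   the boundary arc of a cap, then truncating a function with trace f at the
   level k inside the cap does not increase its total variation: for a mollified
   function this is the divergence theorem, up to a term on a thin strip along
   the arc, which vanishes in the limit because (w - k)^+ has trace 0 there. It
   follows that minimising over all functions with trace f is the same as
   minimising over the convex class of functions that satisfy u <= k (or u >= k)
   on each of the countably many rational caps of this kind. This class is closed
   under pointwise limits, unlike the set of functions with trace f, so it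
   contains a minimiser, and strict convexity provides arbitrarily small caps at
   every boundary point, so every function in the class has the value f as its
   trace wherever f is continuous along its approximate continuity points, that
   is, almost everywhere. Finally the class contains a function of finite
   variation: along the boundary f is a difference of monotone functions;
   transported into Omega along the rays issuing from q, their superlevel sets
   are intersections of Omega with half-planes, whose perimeters are bounded. *)

(** * Integration on the plane *)

(** Minimising over the functions with trace f by the direct method fails because a minimising
    sequence may detach from its boundary values; one-sided bounds on caps cannot be lost in this
    way. There are two reasons for requiring the caps to miss q. A ray from q that enters such a cap
    leaves Omega through the arc of the cap, so the function transported along the rays inherits the
    bounds that f satisfies there. Moreover, two overlapping caps that miss q have a common boundary
    point other than q, hence a common arc, so an upper level on one is never below a lower level on
    the other; this is why cutting from above and then from below does not undo the first operation.
    The point q itself is negligible for the trace. Rational parameters make the constraints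
    countable, so that they can be imposed one after another. All functions of the class are bounded
    by a constant W that exceeds |f| by at least 1: boundedness makes dominated convergence
    available for every limit, and the margin 1 leaves room for rational levels slightly above f and
    slightly above - f. *)

Section plane_measure.
Context {R : realType}.
Notation mu := (@lebesgue_measure R).
Notation mu2 := (mu \x mu)%E.
Implicit Types (s f g : R * R -> R) (M : R).

(** The sigma-algebra on the plane is the product one, so this needs a proof: [A] is the union of
    the countably many squares with rational centre and radius 1/(n + 1) that it contains. *)
Lemma open_measurable2 (A : set (R * R)) : open A -> measurable A.
Proof.
move=> oA.
pose B (q : rat * rat * nat) : set (R * R) :=
  ball (ratr q.1.1 : R) q.2.+1%:R^-1 `*` ball (ratr q.1.2 : R) q.2.+1%:R^-1.
have -> : A = \bigcup_q (if pselect (B q `<=` A) then B q else set0).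
  apply/seteqP; split => [x Ax|x [q _]]; last by case: pselect => // BA /BA.
  have /nbhs_ballP[e /= e0 eA] := open_nbhs_nbhs (conj oA Ax).
  pose n := Num.bound (2 / e).
  have n0 : (0 : R) < n.+1%:R^-1 by rewrite invr_gt0 ltr0n.
  have ne : n.+1%:R^-1 < e / 2.
    rewrite -[e / 2]invrK ltf_pV2 ?posrE ?ltr0n ?invr_gt0 ?divr_gt0//.
    rewrite invf_div; have /archi_boundP/lt_le_trans : 0 <= 2 / e by rewrite divr_ge0 ?ltW.
    by apply; rewrite ler_nat.
  have [q1 /andP[q1l q1r]] : exists q : rat, x.1 - n.+1%:R^-1 < ratr q < x.1.
    have [|q] := @rat_in_itvoo R (x.1 - n.+1%:R^-1) x.1; first by rewrite ltrBlDr ltrDl.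
    by rewrite in_itv /= => qx; exists q.
  have [q2 /andP[q2l q2r]] : exists q : rat, x.2 - n.+1%:R^-1 < ratr q < x.2.
    have [|q] := @rat_in_itvoo R (x.2 - n.+1%:R^-1) x.2; first by rewrite ltrBlDr ltrDl.
    by rewrite in_itv /= => qx; exists q.
  exists (q1, q2, n) => //; case: pselect => /= [BA|nBA].
    rewrite /B -!ball_normE /=; move: (n.+1%:R^-1) n0 q1l q1r q2l q2r => r *.
    by split => /=; rewrite ltr_norml; apply/andP; split; lra.
  case: nBA => y; rewrite /B -!ball_normE /= => -[].
  move: (n.+1%:R^-1) n0 ne q1l q1r q2l q2r => r r0 re q1l q1r q2l q2r.
  rewrite !ltr_norml => /andP[? ?] /andP[? ?].
  by apply: eA; rewrite -ball_normE /= prod_normE gt_max /= !ltr_norml; apply/andP; split; apply/andP; split; lra.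
apply: countable_bigcupT_measurable => // q.
case: pselect => /= BA; last exact: measurable0.
by apply: measurableX; apply: open_measurable; apply: ball_open; rewrite invr_gt0 ltr0n.
Qed.

Lemma closed_measurable2 (A : set (R * R)) : closed A -> measurable A.
Proof. by move=> /closed_openC/open_measurable2/measurableC; rewrite setCK. Qed.

Lemma continuous_measurable2 s : continuous s -> measurable_fun setT s.
Proof.
move=> /continuousP cs; apply: (measurability _ (RGenOpens.measurableE R)).
move=> _ [_ [a [b ->] <-]]; rewrite setTI; apply: open_measurable2; apply: cs; exact: interval_open.
Qed.

Definition box M : set (R * R) := `[- M, M] `*` `[- M, M].

Lemma boxP M (x : R * R) : box M x <-> `|x| <= M.
Proof.
rewrite /box /= !in_itv /= prod_normE ge_max !ler_norml; split.
  by move=> [-> ->].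
by move=> /andP[].
Qed.

Lemma compact_box M : compact (box M).
Proof. by apply: compact_setX; exact: segment_compact. Qed.

Lemma measurable_box M : measurable (box M).
Proof. by apply: measurableX; exact: measurable_itv. Qed.

Lemma box_lty M : (mu2 (box M) < +oo)%E.
Proof.
have h : (mu `[(- M)%R, M] < +oo)%E.
  by rewrite /= lebesgue_measure_itv /=; case: ifP => // _; rewrite -EFinB ltry.
rewrite product_measure1E; [|exact: measurable_itv..].
by rewrite lte_mul_pinfty // ge0_fin_numE.
Qed.

Lemma compact_box_bounded (A : set (R * R)) : compact A -> exists M, A `<=` box M.
Proof.
move=> /compact_bounded [M [Mr AM]]; exists (M + 1) => x Ax.
by apply/boxP; apply: AM => //; rewrite ltrDl.
Qed.

Lemma bounded_box_integrable s (C M : R) : measurable_fun setT s ->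
  (forall x, `|s x| <= C) -> (forall x, M < `|x| -> s x = 0) ->
  mu2.-integrable setT (EFin \o s).
Proof.
move=> ms sC sM.
have -> : EFin \o s = (EFin \o s) \_ (box M).
  apply/funext => x; rewrite patchE; case: ifPn => // /negP.
  rewrite inE => /boxP/negP; rewrite -ltNge => /sM /= -> //.
apply/(integrable_restrict mu2 (measurable_box M) measurableT).
rewrite setTI; apply: measurable_bounded_integrable.
- exact: measurable_box.
- exact: box_lty.
- exact: measurable_funTS.
- by exists C; split; [rewrite num_real|move=> y Cy x _; apply: le_trans (ltW Cy)].
Qed.

Lemma compact_support_bounded s M : continuous s ->
  (forall x, M < `|x| -> s x = 0) -> exists C, 0 <= C /\ forall x, `|s x| <= C.
Proof.
move=> cs sM.
have : compact [set s x | x in box M].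
  by apply: continuous_compact; [exact: continuous_subspaceT|exact: compact_box].
move=> /compact_bounded [C [Cr sC]].
exists (`|C| + 1); split; first by rewrite addr_ge0.
move=> x; have [/boxP xM|/sM ->] := leP `|x| M; last by rewrite normr0 addr_ge0.
by apply: sC; [rewrite (le_lt_trans (ler_norm _)) // ltrDl|exists x].
Qed.

Lemma continuous_box_integrable s M : continuous s ->
  (forall x, M < `|x| -> s x = 0) -> mu2.-integrable setT (EFin \o s).
Proof.
move=> cs sM; have [C [_ sC]] := compact_support_bounded cs sM.
apply: bounded_box_integrable sC sM; exact: continuous_measurable2.
Qed.

(** Partial derivatives are handled along coordinate lines, with the derivative named explicitly, so
    that the product and chain rules of one variable apply directly. *)
Definition has_pd1 s s1 := forall a b, is_derive a (1 : R) (fun t => s (t, b)) (s1 (a, b)).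
Definition has_pd2 s s2 := forall a b, is_derive b (1 : R) (fun t => s (a, t)) (s2 (a, b)).

Lemma derive_outside (h h1 : R -> R) M : (forall x, is_derive x (1 : R) h (h1 x)) ->
  (forall x, M < `|x| -> h x = 0) -> forall x, M < `|x| -> h1 x = 0.
Proof.
move=> dh hM x Mx.
have : is_derive x (1 : R) h 0.
  apply: (@near_eq_is_derive _ _ _ (cst 0)).
  have oM : nbhs x [set y : R | M < `|y|].
    apply: open_nbhs_nbhs; split => //.
    apply: (@open_comp _ _ (fun y : R => `|y|) [set z | M < z]); last exact: open_gt.
    by move=> y _; exact: norm_continuous.
  by apply: filterS oM => y /hM ->.
by move=> [_ <-]; have [_ <-] := dh x.
Qed.

Lemma integral_derive_compact (h h1 : R -> R) M : continuous h1 ->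
  (forall x, is_derive x (1 : R) h (h1 x)) ->
  (forall x, M < `|x| -> h x = 0) -> \int[mu]_x h1 x = 0.
Proof.
(* [M] may be negative, and [h] is not assumed to vanish where |x| = M, so the interval of
   integration is enlarged until both endpoints lie strictly outside. *)
move=> ch1 dh hM; pose N := `|M| + 1.
have MN x : N <= `|x| -> M < `|x|.
  by apply: lt_le_trans; rewrite (le_lt_trans (ler_norm _)) // ltrDl.
have N0 : 0 < N by rewrite /N ltr_pwDr.
have -> : h1 = h1 \_ `[- N, N].
  apply/funext => x; rewrite patchE; case: ifPn => // /negP; rewrite inE /= in_itv /=.
  rewrite -ler_norml => /negP; rewrite -ltNge => /ltW/MN Mx.
  by rewrite (derive_outside dh hM Mx).
rewrite -Rintegral_mkcond /Rintegral.
have ch : continuous h.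
  by move=> x; apply: differentiable_continuous; apply/derivable1_diffP; have [] := dh x.
rewrite (@continuous_FTC2 _ h1 h); last first.
- by move=> x _; rewrite derive1E; have [_ ->] := dh x.
- split; first by move=> x _; have [] := dh x.
  + exact/cvg_at_right_filter/ch.
  + exact/cvg_at_left_filter/ch.
- exact: continuous_subspaceT.
- lra.
have hN : h N = 0 by apply/hM/MN; rewrite ger0_norm // ltW.
have hNN : h (- N) = 0 by apply/hM/MN; rewrite normrN ger0_norm // ltW.
by rewrite hN hNN /= subrr.
Qed.

Lemma continuous_pair2 s b : continuous s -> continuous (fun t : R => s (t, b)).
Proof.
move=> cs t; apply: (@continuous_comp _ _ _ (fun t : R => (t, b)) s); last exact: cs.
by apply: (@cvg_pair _ _ _ (nbhs t) (nbhs t) (nbhs b) _ _ _ id (cst b)); [exact: cvg_id|exact: cvg_cst].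
Qed.

Lemma continuous_pair1 s a : continuous s -> continuous (fun t : R => s (a, t)).
Proof.
move=> cs t; apply: (@continuous_comp _ _ _ (fun t : R => (a, t)) s); last exact: cs.
by apply: (@cvg_pair _ _ _ (nbhs t) (nbhs a) (nbhs t) _ _ _ (cst a) id); [exact: cvg_cst|exact: cvg_id].
Qed.

Lemma pd1_outside s s1 M : has_pd1 s s1 ->
  (forall x, M < `|x| -> s x = 0) -> forall x, M < `|x| -> s1 x = 0.
Proof.
move=> d1 sM [a b]; rewrite prod_normE /= lt_max => /orP[|] h.
  apply: (@derive_outside (fun t => s (t, b)) (fun t => s1 (t, b)) M) => // x Mx.
  by apply: sM; rewrite prod_normE lt_max Mx.
have [_ <-] := d1 a b; rewrite (_ : (fun t => _) = cst 0) ?derive_cst //.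
by apply/funext => x; apply: sM; rewrite prod_normE lt_max h orbT.
Qed.

Lemma pd2_outside s s2 M : has_pd2 s s2 ->
  (forall x, M < `|x| -> s x = 0) -> forall x, M < `|x| -> s2 x = 0.
Proof.
move=> d2 sM [a b]; rewrite prod_normE /= lt_max => /orP[|] h.
  have [_ <-] := d2 a b; rewrite (_ : (fun t => _) = cst 0) ?derive_cst //.
  by apply/funext => x; apply: sM; rewrite prod_normE lt_max h.
apply: (@derive_outside (fun t => s (a, t)) (fun t => s2 (a, t)) M) => // x Mx.
by apply: sM; rewrite prod_normE lt_max Mx orbT.
Qed.

Lemma integral_pd1 s s1 M : continuous s1 -> has_pd1 s s1 ->
  (forall x, M < `|x| -> s x = 0) -> \int[mu2]_x s1 x = 0.
Proof.
move=> cs1 d1 sM.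
have is1 := continuous_box_integrable cs1 (pd1_outside d1 sM).
rewrite /Rintegral -(integral21_prod_meas1 is1) integral0_eq // => b _.
rewrite /fubini_G /=.
have i1 : mu.-integrable setT (fun x => (s1 (x, b))%:E).
  have -> : (fun x => (s1 (x, b))%:E) = (EFin \o (fun x => s1 (x, b))) \_ (`[- M, M]).
    apply/funext => x; rewrite patchE; case: ifPn => // /negP; rewrite inE /= in_itv /=.
    rewrite -ler_norml => /negP; rewrite -ltNge => Mx.
    by rewrite (pd1_outside d1 sM) // prod_normE lt_max Mx.
  apply/(integrable_restrict mu (measurable_itv _) measurableT).
  rewrite setTI; apply: continuous_compact_integrable; first exact: segment_compact.
  exact/continuous_subspaceT/continuous_pair2.
rewrite -[LHS]fineK ?integrable_fin_num //; congr EFin.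
apply: (@integral_derive_compact (fun t => s (t, b)) _ M) => //.
  exact: continuous_pair2.
by move=> x Mx; apply: sM; rewrite prod_normE lt_max Mx.
Qed.

Lemma integral_pd2 s s2 M : continuous s2 -> has_pd2 s s2 ->
  (forall x, M < `|x| -> s x = 0) -> \int[mu2]_x s2 x = 0.
Proof.
move=> cs2 d2 sM.
have is2 := continuous_box_integrable cs2 (pd2_outside d2 sM).
rewrite /Rintegral -(integral12_prod_meas1 is2) integral0_eq // => a _.
rewrite /fubini_F /=.
have i2 : mu.-integrable setT (fun x => (s2 (a, x))%:E).
  have -> : (fun x => (s2 (a, x))%:E) = (EFin \o (fun x => s2 (a, x))) \_ (`[- M, M]).
    apply/funext => x; rewrite patchE; case: ifPn => // /negP; rewrite inE /= in_itv /=.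
    rewrite -ler_norml => /negP; rewrite -ltNge => Mx.
    by rewrite (pd2_outside d2 sM) // prod_normE lt_max Mx orbT.
  apply/(integrable_restrict mu (measurable_itv _) measurableT).
  rewrite setTI; apply: continuous_compact_integrable; first exact: segment_compact.
  exact/continuous_subspaceT/continuous_pair1.
rewrite -[LHS]fineK ?integrable_fin_num //; congr EFin.
apply: (@integral_derive_compact (fun t => s (a, t)) _ M) => //.
  exact: continuous_pair1.
by move=> x Mx; apply: sM; rewrite prod_normE lt_max Mx orbT.
Qed.

End plane_measure.

Lemma Rdominated_convergence d (T : measurableType d) (R : realType)
  (mu : {measure set T -> \bar R}) (D : set T) (f_ : nat -> T -> R) (f g : T -> R) :
  measurable D -> (forall n, measurable_fun D (f_ n)) ->
  (forall x, D x -> f_ ^~ x @ \oo --> f x) ->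
  mu.-integrable D (EFin \o g) ->
  (forall n x, D x -> `|f_ n x| <= g x) ->
  mu.-integrable D (EFin \o f) /\
  \int[mu]_(x in D) f_ n x @[n --> \oo] --> \int[mu]_(x in D) f x.
Proof.
move=> mD mf_ f_f ig f_g.
have mf : measurable_fun D f by apply: measurable_fun_cvg f_f.
have [] := @dominated_convergence _ _ _ mu D mD (fun n => EFin \o f_ n) (EFin \o f) (EFin \o g).
- by move=> n; apply/measurable_EFinP.
- exact/measurable_EFinP.
- by apply: aeW => x Dx; apply: cvg_EFin; [exact: nearW|exact: f_f].
- exact: ig.
- by apply: aeW => x n Dx; rewrite /= lee_fin f_g.
move=> if_ _ cf; split => //.
by apply: fine_cvg; rewrite fineK; [exact: cf|exact: integrable_fin_num].
Qed.

(** * Differentiability from quadratic error bounds *)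

Section quadratic_estimates.
Context {R : realType}.

(** A quadratic error bound, unlike a limit of difference quotients, can be integrated against an
    L^1 function; this replaces differentiation under the integral sign. *)
Lemma is_derive_quadratic (V W : normedModType R) (f : V -> W) (x v : V) (L : W) (K d : R) :
  0 < d -> (forall h : R, `|h| < d -> `|f (h *: v + x) - f x - h *: L| <= K * h ^+ 2) ->
  is_derive x v f L.
Proof.
move=> d0 fK.
have cL : h^-1 *: ((f \o shift x) (h *: v) - f x) @[h --> 0^'] --> L.
  apply/cvgrPdist_le => e e0.
  pose d' := Num.min d (e / (`|K| + 1)).
  have d'0 : 0 < d' by rewrite lt_min d0 divr_gt0 // ltr_wpDl.
  near=> h.
  have h0 : h != 0 by near: h; exact: nbhs_dnbhs_neq.
  have hd' : `|h| < d' by near: h; exact: dnbhs0_lt.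
  have /fK hK : `|h| < d by rewrite (lt_le_trans hd') // ge_min lexx.
  have -> : L - h^-1 *: ((f \o shift x) (h *: v) - f x) =
      - (h^-1 *: (f (h *: v + x) - f x - h *: L)).
    rewrite /= [in RHS]scalerBr scalerA mulVf // scale1r.
    by rewrite opprB.
  rewrite normrN normrZ normrV ?unitfE // ler_pdivrMl ?normr_gt0 //.
  apply: (le_trans hK); rewrite -real_normK ?num_real // expr2 mulrCA ler_pM2l ?normr_gt0 //.
  have hd : `|h| <= e / (`|K| + 1) by rewrite (le_trans (ltW hd')) // ge_min lexx orbT.
  rewrite (le_trans (ler_wpM2r (normr_ge0 h) (ler_norm K))) //.
  apply: (@le_trans _ _ ((`|K| + 1) * `|h|)); first by rewrite ler_wpM2r // lerDl.
  by rewrite mulrC -ler_pdivlMr // ltr_wpDl.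
apply: DeriveDef; first by apply/cvg_ex; exists L.
exact: cvg_lim.
Unshelve. all: by end_near. Qed.

Lemma continuous_lipschitz_at (V W : normedModType R) (f : V -> W) (x : V) (K d : R) :
  0 < d -> (forall u, `|u| < d -> `|f (u + x) - f x| <= K * `|u|) ->
  {for x, continuous f}.
Proof.
move=> d0 fK; apply/cvgrPdist_le => e e0.
pose d' := Num.min d (e / (`|K| + 1)).
have d'0 : 0 < d' by rewrite lt_min d0 divr_gt0 // ltr_wpDl.
near=> y.
have yd' : `|y - x| < d'.
  rewrite distrC; near: y; apply/nbhs_normP; exists d' => //.
have yd : `|y - x| < d by rewrite (lt_le_trans yd') // ge_min lexx.
have := fK _ yd; rewrite subrK distrC => /le_trans -> //.
have hd : `|y - x| <= e / (`|K| + 1) by rewrite (le_trans (ltW yd')) // ge_min lexx orbT.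
rewrite (le_trans (ler_wpM2r (normr_ge0 _) (ler_norm K))) //.
apply: (@le_trans _ _ ((`|K| + 1) * `|y - x|)); first by rewrite ler_wpM2r // lerDl.
by rewrite mulrC -ler_pdivlMr // ltr_wpDl.
Unshelve. all: by end_near. Qed.

Definition pos (s : R) := Num.max s 0.

Lemma pos_ge0 s : 0 <= pos s. Proof. by rewrite /pos le_max lexx orbT. Qed.

Lemma pos_lip s t : `|pos (s + t) - pos s| <= `|t|.
Proof.
have := ler_norm t; have := ler_norm (- t); rewrite normrN /pos => hN hP.
by case: (leP s 0); case: (leP (s + t) 0) => h1 h2; rewrite ler_norml; apply/andP; split; lra.
Qed.

Lemma pos_le s t : s <= t -> 0 <= t -> pos s <= t.
Proof. by rewrite /pos ge_max => -> ->. Qed.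

Lemma pos0 s : s <= 0 -> pos s = 0.
Proof. by rewrite /pos => /max_idPr. Qed.

(** The squared positive part is the only source of smoothness in the proof: the mollification
    kernel, the smoothed truncation and the cutoffs are built from it. It is C^1, which is exactly
    the regularity asked of a test field. *)
Lemma possq_taylor s t : `|pos (s + t) ^+ 2 - pos s ^+ 2 - 2 * pos s * t| <= t ^+ 2.
Proof.
by rewrite /pos; case: (leP s 0); case: (leP (s + t) 0) => h1 h2; rewrite ler_norml; apply/andP; split; nra.
Qed.

Lemma is_derive_possq s : is_derive s (1 : R) (fun s => pos s ^+ 2) (2 * pos s).
Proof.
apply: (@is_derive_quadratic _ _ _ _ _ _ 1 1) => // h _.
rewrite mul1r /= /GRing.scale /= mulr1 (addrC h) (mulrC h).
exact: possq_taylor.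
Qed.

Lemma continuous_pos : continuous pos.
Proof.
move=> s; apply: (@continuous_lipschitz_at _ _ _ _ 1 1) => // u _.
by rewrite mul1r (addrC u) pos_lip.
Qed.

End quadratic_estimates.

(** * Mollification *)

Section kernel.
Context {R : realType}.
Notation mu := (@lebesgue_measure R).
Notation mu2 := (mu \x mu)%E.
Implicit Types (e : R) (x y z u v : R * R) (w : R * R -> R).

Lemma dotC x y : dot x y = dot y x.
Proof. by rewrite /dot mulrC [x.2 * _]mulrC. Qed.

Lemma dotDl x y z : dot (x + y) z = dot x z + dot y z.
Proof. rewrite /dot /=; ring. Qed.

Lemma dotDr x y z : dot z (x + y) = dot z x + dot z y.
Proof. rewrite /dot /=; ring. Qed.

Lemma dotZl (k : R) x y : dot (k *: x) y = k * dot x y.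
Proof. rewrite /dot /= /GRing.scale /=; ring. Qed.

Lemma dotZr (k : R) x y : dot x (k *: y) = k * dot x y.
Proof. rewrite /dot /= /GRing.scale /=; ring. Qed.

Lemma dotNl x y : dot (- x) y = - dot x y.
Proof. rewrite /dot /=; ring. Qed.

Lemma dotNr x y : dot x (- y) = - dot x y.
Proof. rewrite /dot /=; ring. Qed.

Lemma dotBl x y z : dot (x - y) z = dot x z - dot y z.
Proof. by rewrite dotDl dotNl. Qed.

Lemma dotBr x y z : dot z (x - y) = dot z x - dot z y.
Proof. by rewrite dotDr dotNr. Qed.

Lemma dot_ge0 x : 0 <= dot x x.
Proof. by rewrite /dot -!expr2 addr_ge0 ?sqr_ge0. Qed.

Lemma normr_dot x : `|x| ^+ 2 <= dot x x.
Proof.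
rewrite /dot prod_normE -!expr2; case: (leP `|x.1| `|x.2|) => _; rewrite real_normK ?num_real //.
  by rewrite lerDr sqr_ge0.
by rewrite lerDl sqr_ge0.
Qed.

Lemma dot_le_norm x y : `|dot x y| <= 2 * (`|x| * `|y|).
Proof.
rewrite /dot (le_trans (ler_normD _ _)) // mulr2n mulrDl mul1r !normrM.
by rewrite lerD // ler_pM // prod_normE le_max lexx ?orbT.
Qed.

(** An unnormalised C^1 mollifier supported in the Euclidean ball of radius [e]; [drho e v] is its
    derivative in the direction [v]. Being a squared positive part of a quadratic polynomial, it has
    an explicit Taylor bound. *)
Definition rho e z := pos (e ^+ 2 - dot z z) ^+ 2.
Definition drho e v z := - 4 * pos (e ^+ 2 - dot z z) * dot z v.

Lemma rhoN e z : rho e (- z) = rho e z.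
Proof. by rewrite /rho dotNl dotNr opprK. Qed.

Lemma drhoN e v z : drho e v (- z) = - drho e v z.
Proof. by rewrite /drho !dotNl !dotNr opprK mulrN. Qed.

Lemma rho_ge0 e z : 0 <= rho e z. Proof. by rewrite /rho sqr_ge0. Qed.

Lemma rho_le e z : rho e z <= e ^+ 4.
Proof.
have -> : e ^+ 4 = (e ^+ 2) ^+ 2 by rewrite -exprM.
rewrite ler_pXn2r ?nnegrE ?pos_ge0 ?sqr_ge0 //.
by rewrite pos_le ?sqr_ge0 // lerBlDl lerDr dot_ge0.
Qed.

Lemma pos_outside e z : 0 <= e -> e <= `|z| -> pos (e ^+ 2 - dot z z) = 0.
Proof.
move=> e0 ez; apply: pos0; rewrite subr_le0 (le_trans _ (normr_dot z)) //.
by rewrite ler_pXn2r // nnegrE.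
Qed.

Lemma rho_outside e z : 0 <= e -> e <= `|z| -> rho e z = 0.
Proof. by move=> e0 ez; rewrite /rho pos_outside // expr0n. Qed.

Lemma drho_outside e v z : 0 <= e -> e <= `|z| -> drho e v z = 0.
Proof. by move=> e0 ez; rewrite /drho pos_outside // mulr0 mul0r. Qed.

(** Far from the origin all terms vanish. Otherwise the argument of [pos] changes by t = - (2 z.u +
    u.u), which is O(|u|), and [possq_taylor] applies; its linear term differs from [drho] only by a
    multiple of u.u. *)
Lemma rho_taylor e : 0 <= e -> exists C, 0 <= C /\ forall z u, `|u| <= 1 ->
  `|rho e (z + u) - rho e z - drho e u z| <= C * `|u| ^+ 2.
Proof.
move=> e0; exists (4 * e ^+ 2 + (4 * e + 10) ^+ 2); split.
  by rewrite addr_ge0 ?sqr_ge0 // mulr_ge0 // sqr_ge0.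
move=> z u u1.
have C0 : 0 <= (4 * e ^+ 2 + (4 * e + 10) ^+ 2) * `|u| ^+ 2.
  by rewrite mulr_ge0 ?sqr_ge0 // addr_ge0 ?sqr_ge0 // mulr_ge0 // sqr_ge0.
have [ze|ze] := leP (e + 2) `|z|.
  rewrite !rho_outside ?drho_outside ?subrr ?normr0 //; try lra.
  have := ler_normB (z + u) u; rewrite addrK; lra.
have zz := dot_le_norm z u; have uu := dot_le_norm u u.
set s := e ^+ 2 - dot z z; set t := - (2 * dot z u + dot u u).
have pse : pos s <= e ^+ 2.
  by rewrite pos_le ?sqr_ge0 // /s lerBlDl lerDr dot_ge0.
have dE : e ^+ 2 - dot (z + u) (z + u) = s + t.
  by rewrite /s /t dotDl !dotDr (dotC u z); ring.
have := possq_taylor s t.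
rewrite /rho dE -/s.
have tle : `|t| <= (4 * e + 10) * `|u|.
  rewrite /t normrN (le_trans (ler_normD _ _)) // normrM ger0_norm //.
  have : `|z| * `|u| <= (e + 2) * `|u| by rewrite ler_wpM2r // ltW.
  have : `|u| * `|u| <= `|u| by rewrite ler_piMr.
  have := normr_ge0 u; nra.
have t2 : t ^+ 2 <= (4 * e + 10) ^+ 2 * `|u| ^+ 2.
  by rewrite -exprMn -real_normK ?num_real // ler_pXn2r ?nnegrE // mulr_ge0 //; lra.
have du : `|2 * pos s * dot u u| <= 4 * e ^+ 2 * `|u| ^+ 2.
  rewrite normrM ger0_norm ?mulr_ge0 ?pos_ge0 //.
  have -> : 4 * e ^+ 2 * `|u| ^+ 2 = 2 * (e ^+ 2 * (2 * (`|u| * `|u|))) by ring.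
  by rewrite -mulrA ler_wpM2l // ler_pM ?pos_ge0.
move=> ht.
have -> : pos (s + t) ^+ 2 - pos s ^+ 2 - drho e u z =
  (pos (s + t) ^+ 2 - pos s ^+ 2 - 2 * pos s * t) - 2 * pos s * dot u u.
  by rewrite /drho -/s /t; ring.
apply: (le_trans (ler_normB _ _)); rewrite [leRHS]mulrDl [leLHS]addrC.
by apply: lerD => //; exact: le_trans t2.
Qed.

Lemma drho_lip e v : 0 <= e -> exists C, 0 <= C /\ forall z u, `|u| <= 1 ->
  `|drho e v (z + u) - drho e v z| <= C * `|u|.
Proof.
move=> e0; exists (4 * ((4 * e + 10) * (2 * ((e + 2) * `|v|)) + e ^+ 2 * (2 * `|v|))); split.
  by rewrite mulr_ge0 // addr_ge0 // !mulr_ge0 // ?sqr_ge0 //; lra.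
move=> z u u1.
have [ze|ze] := leP (e + 2) `|z|.
  rewrite !drho_outside ?subrr ?normr0 //; try lra.
    by rewrite !mulr_ge0 // addr_ge0 // !mulr_ge0 // ?sqr_ge0 //; lra.
  have := ler_normB (z + u) u; rewrite addrK; lra.
have zz := dot_le_norm z u; have uu := dot_le_norm u u.
set s := e ^+ 2 - dot z z; set t := - (2 * dot z u + dot u u).
have pse : pos (s + t) <= e ^+ 2.
  rewrite pos_le ?sqr_ge0 //; suff : 0 <= dot (z + u) (z + u).
    by rewrite /s /t dotDl !dotDr (dotC u z); lra.
  exact: dot_ge0.
have dE : e ^+ 2 - dot (z + u) (z + u) = s + t.
  by rewrite /s /t dotDl !dotDr (dotC u z); ring.
rewrite /drho dE -/s.
have tle : `|t| <= (4 * e + 10) * `|u|.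
  rewrite /t normrN (le_trans (ler_normD _ _)) // normrM ger0_norm //.
  have : `|z| * `|u| <= (e + 2) * `|u| by rewrite ler_wpM2r // ltW.
  have : `|u| * `|u| <= `|u| by rewrite ler_piMr.
  have := normr_ge0 u; nra.
have -> : - 4 * pos (s + t) * dot (z + u) v - - 4 * pos s * dot z v =
  - 4 * ((pos (s + t) - pos s) * dot z v + pos (s + t) * dot u v).
  by rewrite dotDl; ring.
have n4 : `|- 4 : R| = 4 by rewrite normrN ger0_norm.
rewrite normrM n4 -(mulrA 4) ler_wpM2l // [leRHS]mulrDl.
rewrite (le_trans (ler_normD _ _)) // lerD // normrM.
  rewrite mulrAC ler_pM // ?(le_trans (pos_lip _ _)) //.
  rewrite (le_trans (dot_le_norm _ _)) // ler_wpM2l // ler_wpM2r // ltW //.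
rewrite ger0_norm ?pos_ge0 // -mulrA ler_pM ?pos_ge0 // (le_trans (dot_le_norm _ _)) //.
by rewrite -mulrA [X in _ * X]mulrC.
Qed.

Lemma continuous_dot (a : R * R) : continuous (fun z => dot z a).
Proof.
move=> x; apply: (@continuous_lipschitz_at _ _ _ _ _ (2 * `|a|) 1) => // u _.
rewrite -dotBl addrK (le_trans (dot_le_norm _ _)) //.
by rewrite -mulrA [X in _ * X]mulrC.
Qed.

Lemma rho_lip e : 0 <= e -> exists C, 0 <= C /\ forall z u, `|u| <= 1 ->
  `|rho e (z + u) - rho e z| <= C * `|u|.
Proof.
move=> e0; have [C [C0 hC]] := rho_taylor e0.
exists (C + 8 * e ^+ 2 * e); split.
  by rewrite addr_ge0 // !mulr_ge0.
move=> z u u1.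
have h := hC z u u1.
have -> : rho e (z + u) - rho e z = (rho e (z + u) - rho e z - drho e u z) + drho e u z by ring.
rewrite (le_trans (ler_normD _ _)) // mulrDl lerD //.
  by rewrite (le_trans h) // ler_wpM2l // expr2 ler_piMr.
have [ze|/ltW ze] := leP e `|z|.
  by rewrite drho_outside // normr0 !mulr_ge0.
have n4 : `|- 4 : R| = 4 by rewrite normrN ger0_norm.
rewrite /drho !normrM n4 ger0_norm ?pos_ge0 //.
have ps : pos (e ^+ 2 - dot z z) <= e ^+ 2.
  by rewrite pos_le ?sqr_ge0 // lerBlDl lerDr dot_ge0.
apply: (@le_trans _ _ (4 * e ^+ 2 * (2 * (e * `|u|)))).
  rewrite ler_pM ?mulr_ge0 ?pos_ge0 // ?ler_wpM2l // (le_trans (dot_le_norm _ _)) //.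
  by rewrite ler_wpM2l // ler_wpM2r.
rewrite le_eqVlt; apply/orP; left; apply/eqP; ring.
Qed.

Lemma continuous_rho e : 0 <= e -> continuous (rho e).
Proof.
move=> e0 z; have [C [C0 hC]] := rho_lip e0.
apply: (@continuous_lipschitz_at _ _ _ _ _ C 1) => // u u1.
by rewrite (addrC u); apply: hC; exact: ltW.
Qed.

Lemma continuous_drho e v : 0 <= e -> continuous (drho e v).
Proof.
move=> e0 z; have [C [C0 hC]] := drho_lip v e0.
apply: (@continuous_lipschitz_at _ _ _ _ _ C 1) => // u u1.
by rewrite (addrC u); apply: hC; exact: ltW.
Qed.

Lemma drho_bounded e v : 0 <= e -> exists C, 0 <= C /\ forall z, `|drho e v z| <= C.
Proof.
move=> e0; apply: (@compact_support_bounded _ _ e); first exact: continuous_drho.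
by move=> z /ltW ez; rewrite drho_outside.
Qed.

End kernel.

Section integrability.
Context d (T : measurableType d) (R : realType) (m : {measure set T -> \bar R}).
Implicit Types (w b : T -> R).

Lemma integrable_scale D w (c : R) : measurable D -> m.-integrable D (EFin \o w) ->
  m.-integrable D (EFin \o (fun x => c * w x)).
Proof. by move=> mD iw; exact: (@integrableZl _ _ _ m D mD c (EFin \o w) iw). Qed.

Lemma integrable_mul_bounded D w b (C : R) : measurable D -> m.-integrable D (EFin \o w) ->
  measurable_fun D b -> (forall x, D x -> `|b x| <= C) ->
  m.-integrable D (EFin \o (fun x => w x * b x)).
Proof.
move=> mD iw mb bC.
have mw : measurable_fun D w by apply/measurable_EFinP; exact: measurable_int iw.
apply: (@le_integrable _ _ _ m D mD _ (fun x => (`|C| * w x)%:E)).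
- by apply/measurable_EFinP; exact: measurable_funM.
- move=> x Dx; rewrite /= lee_fin !normrM normr_id mulrC ler_wpM2r //.
  by rewrite (le_trans (bC _ Dx)) // ler_norm.
- exact: integrable_scale.
Qed.

Lemma integrable_norm_fin D w : measurable D -> m.-integrable D (EFin \o w) ->
  m.-integrable D (EFin \o (fun x => `|w x|)).
Proof. by move=> mD iw; exact: integrable_norm. Qed.

Lemma norm_Rintegral_mul_le D w b (C : R) : measurable D -> m.-integrable D (EFin \o w) ->
  measurable_fun D b -> (forall x, D x -> `|b x| <= C) ->
  `|\int[m]_(x in D) (w x * b x)| <= C * \int[m]_(x in D) `|w x|.
Proof.
move=> mD iw mb bC.
have iwb := integrable_mul_bounded mD iw mb bC.
rewrite (le_trans (le_normr_Rintegral mD iwb)) // -RintegralZl //; last exact: integrable_norm_fin.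
apply: le_Rintegral => //.
- exact: integrable_norm_fin.
- by apply: integrable_scale => //; exact: integrable_norm_fin.
- by move=> x Dx; rewrite normrM mulrC ler_wpM2r // bC.
Qed.

End integrability.

Section kernel_fubini.
Context d1 d2 (T1 : measurableType d1) (T2 : measurableType d2) (R : realType).
Variables (m1 : {sigma_finite_measure set T1 -> \bar R})
          (m2 : {sigma_finite_measure set T2 -> \bar R}).
Variables (g : T1 -> R) (w : T2 -> R) (k : T1 * T2 -> R) (C : R).
Hypotheses (ig : m1.-integrable setT (EFin \o g)) (iw : m2.-integrable setT (EFin \o w)).
Hypotheses (mk : measurable_fun setT k) (kC : forall z, `|k z| <= C).

Let mg : measurable_fun setT g. Proof. by apply/measurable_EFinP; exact: measurable_int ig. Qed.
Let mw : measurable_fun setT w. Proof. by apply/measurable_EFinP; exact: measurable_int iw. Qed.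

Let F (z : T1 * T2) : R := g z.1 * (w z.2 * k z).

Let mF : measurable_fun setT F.
Proof.
apply: measurable_funM; first exact: measurableT_comp.
by apply: measurable_funM => //; exact: measurableT_comp.
Qed.

Let mk1 x : measurable_fun setT (fun y => k (x, y)).
Proof. exact: measurableT_comp. Qed.

Let mk2 y : measurable_fun setT (fun x => k (x, y)).
Proof. exact: measurableT_comp. Qed.

Let iF : (m1 \x m2)%E.-integrable setT (EFin \o F).
Proof.
apply/integrable12ltyP; first exact/measurable_EFinP.
have h x : (\int[m2]_y `|(F (x, y))%:E| <= (`|g x| * (C * \int[m2]_y `|w y|))%:E)%E.
  have iwk : m2.-integrable setT (EFin \o (fun y => w y * k (x, y))).
    by apply: integrable_mul_bounded => //.
  have iFx : m2.-integrable setT (EFin \o (fun y => `|F (x, y)|)).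
    by apply: integrable_norm_fin => //; exact: (integrable_scale (g x) measurableT iwk).
  have -> : (\int[m2]_y `|(F (x, y))%:E|)%E = (\int[m2]_y `|F (x, y)|)%:E.
    by rewrite /Rintegral fineK // integrable_fin_num.
  rewrite lee_fin.
  under eq_Rintegral do rewrite /F /= normrM.
  rewrite RintegralZl //; last exact: integrable_norm_fin.
  rewrite ler_wpM2l // -RintegralZl //; last exact: integrable_norm_fin.
  apply: le_Rintegral => //.
  - exact: integrable_norm_fin.
  - by apply: integrable_scale => //; exact: integrable_norm_fin.
  - by move=> y _; rewrite normrM mulrC ler_wpM2r.
apply: (@le_lt_trans _ _ (\int[m1]_x (`|g x| * (C * \int[m2]_y `|w y|))%:E)%E).
  apply: ge0_le_integral => //.
  - by move=> x _; exact: integral_ge0.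
  - have := @measurable_fun_fubini_tonelli_F _ _ _ _ _ m2 (fun z => `|(F z)%:E|%E).
    apply => //; apply: measurableT_comp => //; exact/measurable_EFinP.
  - by apply/measurable_EFinP; apply: measurable_funM => //; apply: measurableT_comp.
  - by move=> x _; exact: h.
have iK : m1.-integrable setT (EFin \o (fun x => `|g x| * (C * \int[m2]_y `|w y|))).
  have := integrable_scale (C * \int[m2]_y `|w y|) measurableT (integrable_norm_fin measurableT ig).
  by apply: eq_integrable => // x _ /=; rewrite mulrC.
have := integrable_fin_num measurableT iK.
by rewrite fin_numElt => /andP[].
Qed.

(** The two factors are kept general because it is used twice: on plane times plane for
    mollification, and on line times plane for averages over a strip along a graph. *)
Lemma Rfubini_kernel :
  \int[m1]_x (g x * \int[m2]_y (w y * k (x, y))) =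
  \int[m2]_y (w y * \int[m1]_x (g x * k (x, y))).
Proof.
have e1 x : fubini_F m2 (EFin \o F) x = (g x * \int[m2]_y (w y * k (x, y)))%:E.
  have iwk : m2.-integrable setT (EFin \o (fun y => w y * k (x, y))).
    by apply: integrable_mul_bounded => //.
  rewrite -RintegralZl // /fubini_F /Rintegral fineK //.
  by apply: integrable_fin_num => //; apply: integrable_scale.
have e2 y : fubini_G m1 (EFin \o F) y = (w y * \int[m1]_x (g x * k (x, y)))%:E.
  have igk : m1.-integrable setT (EFin \o (fun x => g x * k (x, y))).
    by apply: integrable_mul_bounded => //.
  rewrite -RintegralZl // /fubini_G /Rintegral fineK; last first.
    by apply: integrable_fin_num => //; apply: integrable_scale.
  by apply: eq_integral => x _ /=; rewrite /F /= mulrCA.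
have := integral12_prod_meas1 iF; rewrite -(integral21_prod_meas1 iF).
under eq_integral do rewrite e1; under [in RHS]eq_integral do rewrite e2.
by rewrite /Rintegral => ->.
Qed.

Lemma integrable_kernel : m1.-integrable setT (EFin \o (fun x => g x * \int[m2]_y (w y * k (x, y)))).
Proof.
have := integrable_fubini_F iF; apply: eq_integrable => // x _ /=.
have iwk : m2.-integrable setT (EFin \o (fun y => w y * k (x, y))).
  by apply: integrable_mul_bounded => //.
rewrite -RintegralZl // /fubini_F /Rintegral fineK //.
by apply: integrable_fin_num => //; apply: integrable_scale.
Qed.

End kernel_fubini.

Section convolution.
Context {R : realType}.
Notation mu := (@lebesgue_measure R).
Notation mu2 := (mu \x mu)%E.
Implicit Types (e : R) (x y z u v : R * R) (w k : R * R -> R).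

Definition conv k w x := \int[mu2]_y (w y * k (x - y)).

Lemma continuous_subl k x : continuous k -> continuous (fun y => k (x - y)).
Proof.
move=> ck y; apply: (@continuous_comp _ _ _ (fun y => x - y) k); last exact: ck.
by apply: continuousB; [exact: cst_continuous|exact: cvg_id].
Qed.

Lemma continuous_subr k y : continuous k -> continuous (fun x => k (x - y)).
Proof.
move=> ck x; apply: (@continuous_comp _ _ _ (fun x => x - y) k); last exact: ck.
by apply: continuousB; [exact: cvg_id|exact: cst_continuous].
Qed.

Lemma measurable_kernel k : continuous k -> measurable_fun setT (fun z : (R * R) * (R * R) => k (z.1 - z.2)).
Proof.
move=> ck; apply: (measurableT_comp (continuous_measurable2 ck)).
have -> : (fun z : (R * R) * (R * R) => z.1 - z.2) =
  (fun z : (R * R) * (R * R) => (z.1.1 - z.2.1, z.1.2 - z.2.2)) by [].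
apply: measurable_fun_pair.
  by apply: measurable_funB; apply: measurableT_comp.
by apply: measurable_funB; apply: measurableT_comp.
Qed.

Lemma rho_bounded e z : `|rho e z| <= e ^+ 4.
Proof. by rewrite ger0_norm ?rho_ge0 // rho_le. Qed.

Lemma integrable_conv k w x (C : R) : mu2.-integrable setT (EFin \o w) ->
  continuous k -> (forall z, `|k z| <= C) ->
  mu2.-integrable setT (EFin \o (fun y => w y * k (x - y))).
Proof.
move=> iw ck kC; apply: integrable_mul_bounded => //.
by apply: continuous_measurable2; exact: continuous_subl.
Qed.

Lemma conv_lipschitz k w (C B : R) : mu2.-integrable setT (EFin \o w) ->
  continuous k -> (forall z, `|k z| <= B) ->
  (forall z u, `|u| <= 1 -> `|k (z + u) - k z| <= C * `|u|) ->
  forall x u, `|u| <= 1 -> `|conv k w (x + u) - conv k w x| <= C * `|u| * \int[mu2]_y `|w y|.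
Proof.
move=> iw ck kB kC x u u1.
rewrite /conv -RintegralB //; [|exact: (integrable_conv _ iw ck kB)..].
under eq_Rintegral do rewrite -mulrBr.
apply: norm_Rintegral_mul_le => //.
  by apply: measurable_funB; apply: continuous_measurable2; exact: continuous_subl.
by move=> y _; rewrite addrAC; exact: kC.
Qed.

Lemma continuous_conv_lipschitz k w (C B : R) : mu2.-integrable setT (EFin \o w) ->
  continuous k -> (forall z, `|k z| <= B) ->
  (forall z u, `|u| <= 1 -> `|k (z + u) - k z| <= C * `|u|) -> continuous (conv k w).
Proof.
move=> iw ck kB kC x.
apply: (@continuous_lipschitz_at _ _ _ _ _ (C * \int[mu2]_y `|w y|) 1) => // u u1.
rewrite (addrC u) (le_trans (conv_lipschitz iw ck kB kC _ (ltW u1))) //.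
by rewrite mulrAC.
Qed.

Lemma continuous_conv_rho e w : 0 <= e -> mu2.-integrable setT (EFin \o w) ->
  continuous (conv (rho e) w).
Proof.
move=> e0 iw; have [C [_ hC]] := rho_lip e0.
exact: continuous_conv_lipschitz iw (continuous_rho e0) (rho_bounded e) hC.
Qed.

Lemma continuous_conv_drho e v w : 0 <= e -> mu2.-integrable setT (EFin \o w) ->
  continuous (conv (drho e v) w).
Proof.
move=> e0 iw; have [C [_ hC]] := drho_lip v e0; have [B [_ hB]] := drho_bounded v e0.
exact: continuous_conv_lipschitz iw (continuous_drho e0) hB hC.
Qed.

Lemma is_derive_conv e w x v : 0 <= e -> mu2.-integrable setT (EFin \o w) ->
  is_derive x v (conv (rho e) w) (conv (drho e v) w x).
Proof.
move=> e0 iw; have [C [C0 hC]] := rho_taylor e0; have [B [_ hB]] := drho_bounded v e0.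
(* For [h] below this radius, [h *: v] has norm at most 1, the range in which [rho_taylor] holds. *)
apply: (@is_derive_quadratic _ _ _ _ _ _ _ (C * `|v| ^+ 2 * \int[mu2]_y `|w y|) (`|v| + 1)^-1).
  by rewrite invr_gt0 ltr_wpDl.
move=> h hv.
have hv1 : `|h *: v| <= 1.
  rewrite prod_norm_scale; move: hv; rewrite -[ltRHS]mul1r ltr_pdivlMr ?ltr_wpDl // mulrDr mulr1.
  by have := normr_ge0 h; lra.
have i1 := integrable_conv x iw (continuous_rho e0) (rho_bounded e).
have i2 := integrable_conv (h *: v + x) iw (continuous_rho e0) (rho_bounded e).
have i3 := integrable_conv x iw (@continuous_drho _ e v e0) hB.
have -> : conv (rho e) w (h *: v + x) - conv (rho e) w x - h *: conv (drho e v) w x =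
  \int[mu2]_y (w y * (rho e (h *: v + x - y) - rho e (x - y) - h * drho e v (x - y))).
  rewrite /conv -RintegralB // /GRing.scale /= -RintegralZl // -RintegralB //.
  - by apply: eq_Rintegral => y _; ring.
  - have := integrableB measurableT i2 i1; exact: eq_integrable.
  - exact: integrable_scale.
have -> : C * `|v| ^+ 2 * \int[mu2]_y `|w y| * h ^+ 2 = C * `|h *: v| ^+ 2 * \int[mu2]_y `|w y|.
  by rewrite prod_norm_scale exprMn real_normK ?num_real //; ring.
apply: norm_Rintegral_mul_le => //.
  apply: measurable_funB.
    by apply: measurable_funB; apply: continuous_measurable2; exact/continuous_subl/continuous_rho.
  by apply: measurable_funM => //; apply: continuous_measurable2; exact/continuous_subl/continuous_drho.
move=> y _; have := hC (x - y) (h *: v) hv1.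
have -> : x - y + h *: v = h *: v + x - y by rewrite addrC addrA.
by rewrite /drho dotZr mulrCA.
Qed.

Lemma conv_outside k w x (M N : R) : (forall z, M <= `|z| -> k z = 0) ->
  (forall y, N < `|y| -> w y = 0) -> M + N <= `|x| -> conv k w x = 0.
Proof.
move=> kM wN xMN; rewrite /conv; under eq_Rintegral.
  move=> y _; have -> : w y * k (x - y) = 0; last over.
  have [yN|/wN ->] := leP `|y| N; last by rewrite mul0r.
  rewrite kM ?mulr0 //; have := ler_distD y x 0; rewrite !subr0; lra.
by rewrite Rintegral_cst // mul0r.
Qed.

Definition mass e := \int[mu2]_x rho e x.

Lemma integrable_rho e : 0 <= e -> mu2.-integrable setT (EFin \o rho e).
Proof.
move=> e0; apply: (@continuous_box_integrable _ _ e); first exact: continuous_rho.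
by move=> x /ltW; exact: rho_outside.
Qed.

(** Translation invariance by the substitution t - a; continuity and nonnegativity are the
    hypotheses of the change of variables. *)
Lemma shift_integral1 (h : R -> R) (a : R) : continuous h -> (forall t, 0 <= h t) ->
  (\int[mu]_t (h (t - a))%:E = \int[mu]_t (h t)%:E)%E.
Proof.
move=> ch h0; rewrite [RHS](@increasing_ge0_integration_by_substitutionT _ (fun t => t - a) h) //.
- have -> : (fun t : R => t - a)^`()%classic = cst 1.
    by apply/funext => t; rewrite derive1E derive_val subr0.
  by apply: eq_integral => t _ /=; rewrite /GRing.mul /= mulr1.
- by move=> x y xy; rewrite ltrD2r.
- have -> : (fun t : R => t - a)^`()%classic = cst 1.
    by apply/funext => t; rewrite derive1E derive_val subr0.
  by move=> ?; exact: cvg_cst.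
- have -> : (fun t : R => t - a)^`()%classic = cst 1.
    by apply/funext => t; rewrite derive1E derive_val subr0.
  exact: is_cvg_cst.
- have -> : (fun t : R => t - a)^`()%classic = cst 1.
    by apply/funext => t; rewrite derive1E derive_val subr0.
  exact: is_cvg_cst.
- exact: cvg_addrr_Ny.
- exact: cvg_addrr.
Qed.

Lemma integral_rho_shift e y : 0 <= e -> \int[mu2]_x rho e (x - y) = mass e.
Proof.
move=> e0; rewrite /mass /Rintegral; congr fine.
have c1 : continuous (rho e) by exact: continuous_rho.
have c2 z : continuous (fun x => rho e (x - z)) by exact: continuous_subr.
have r0 z x : (0 <= (rho e (x - z))%:E)%E by rewrite lee_fin rho_ge0.
(* Only the first coordinate of the shift is kept in [z]: the inner integral absorbs the second
   coordinate, and after exchanging the order of integration the other one absorbs the first. *)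
pose z : R * R := (y.1, 0).
rewrite (@fubini_tonelli1 _ _ _ _ _ mu mu) //; last by apply/measurable_EFinP; exact: continuous_measurable2.
transitivity (\int[mu]_a \int[mu]_b (rho e ((a, b) - z))%:E)%E.
  apply: eq_integral => a _; rewrite /fubini_F /=.
  rewrite -[RHS](@shift_integral1 (fun b => rho e ((a, b) - z)) y.2) //.
  - by apply: eq_integral => b _ /=; rewrite /z; congr (rho e _)%:E; apply/pair_equal_spec; rewrite /= subr0.
  - exact: (@continuous_pair1 _ (fun x => rho e (x - z))).
  - by move=> t; rewrite rho_ge0.
rewrite (@fubini_tonelli _ _ _ _ _ mu mu (fun x => (rho e (x - z))%:E)) //; last first.
  by apply/measurable_EFinP; exact: continuous_measurable2.
have mr : measurable_fun setT (fun x => (rho e x)%:E).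
  by apply/measurable_EFinP; exact: continuous_measurable2.
have r00 x : (0 <= (rho e x)%:E)%E by rewrite lee_fin rho_ge0.
have E := @fubini_tonelli2 _ _ _ _ _ mu mu (fun x => (rho e x)%:E) mr r00.
rewrite [RHS]E; apply: eq_integral => b _; rewrite /fubini_G /=.
rewrite -[RHS](@shift_integral1 (fun a => rho e (a, b)) y.1) //.
- by apply: eq_integral => a _ /=; rewrite /z; congr (rho e _)%:E; apply/pair_equal_spec; rewrite /= subr0.
- exact: continuous_pair2.
- by move=> t; rewrite rho_ge0.
Qed.

Lemma integral_rho_shiftC e x : 0 <= e -> \int[mu2]_y rho e (x - y) = mass e.
Proof.
move=> e0; rewrite -(integral_rho_shift x e0); apply: eq_Rintegral => y _.
by rewrite -rhoN opprB.
Qed.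

Lemma mass_gt0 e : 0 < e -> 0 < mass e.
Proof.
(* On [box (e / 4)] the squared Euclidean norm is at most e^2 / 8, so the kernel is at least (e^2 /
   2)^2 there. *)
move=> e0; pose M := e / 4; have M0 : 0 < M by rewrite /M divr_gt0.
have hM x : box M x -> (e ^+ 2 / 2) ^+ 2 <= rho e x.
  move=> /boxP xM; rewrite /rho ler_pXn2r ?nnegrE ?pos_ge0 ?divr_ge0 ?sqr_ge0 //.
  rewrite /pos le_max; apply/orP; left.
  have := dot_le_norm x x; have := ler_norm (dot x x).
  have : `|x| * `|x| <= M * M by rewrite ler_pM.
  rewrite /M; nra.
have mb := measurable_box M.
have b0 : (0 < fine (mu2 (box M)))%R.
  rewrite /box product_measure1E; [|exact: measurable_itv..].
  rewrite /= !lebesgue_measure_itv /= lte_fin.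
  by rewrite (_ : - M < M) -?EFinB -?EFinM /= ?mulr_gt0 //; lra.
apply: (@lt_le_trans _ _ (\int[mu2]_(x in box M) (e ^+ 2 / 2) ^+ 2)).
  by rewrite Rintegral_cst // mulr_gt0 // exprn_gt0 // divr_gt0 // exprn_gt0.
apply: (@le_trans _ _ (\int[mu2]_(x in box M) rho e x)).
  apply: le_Rintegral => //.
  - apply: measurable_bounded_integrable => //; first exact: box_lty.
    exact: bounded_cst.
  - by apply: integrableS (integrable_rho (ltW e0)).
rewrite /mass Rintegral_mkcond; apply: le_Rintegral => //.
- rewrite -restrict_EFin; apply/(integrable_restrict mu2 (measurable_box M) measurableT).
  by apply: integrableS (integrable_rho (ltW e0)) => //; rewrite setTI.
- exact: integrable_rho (ltW e0).
- by move=> x _; rewrite patchE; case: ifP => // _; exact: rho_ge0.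
Qed.

End convolution.

(** Only [x] has to lie in [K], so no second compact set is needed for the nearby point [y]. The
    near-covering form of compactness turns the local radii into a single one. *)
Lemma compact_unif_cont {R : realType} (V W : normedModType R) (g : V -> W) (K : set V) :
  compact K -> continuous g -> forall e : R, 0 < e ->
  exists d : R, 0 < d /\ forall x y, K x -> `|x - y| < d -> `|g x - g y| <= e.
Proof.
move=> /compact_near_coveringP cK cg e e0.
have [] := cK R (nbhs (0 : R)^'+) (fun d x => forall y, `|x - y| < d -> `|g x - g y| <= e).
  move=> x Kx.
  have /cvgrPdist_le /(_ (e / 2)) := cg x.
  rewrite divr_gt0 // => /(_ isT) /nbhs_normP [d /= d0 dP].
  exists (ball x (d / 2), [set t : R | t < d / 2]).
    split; first by apply: nbhsx_ballx; rewrite divr_gt0.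
    by exists (d / 2); rewrite /= ?divr_gt0 // => t /=; rewrite sub0r normrN => /(le_lt_trans (ler_norm _)).
  move=> [z t] /= [xz td] y zy.
  move: xz; rewrite -ball_normE /= => xz.
  have h1 : `|g x - g z| <= e / 2 by apply: dP => /=; lra.
  have h2 : `|g x - g y| <= e / 2.
    by apply: dP => /=; have := ler_distD z x y; lra.
  by have := ler_distD (g x) (g z) (g y); rewrite (distrC (g z) (g x)); lra.
move=> d /= d0 dP; exists (d / 2); split; first by rewrite divr_gt0.
move=> x y Kx xy; apply: (dP (d / 2)) => //=; last by rewrite divr_gt0.
by rewrite sub0r normrN gtr0_norm ?divr_gt0 //; lra.
Qed.

Section continuity.
Context {R : realType} {T : topologicalType}.
Implicit Types f g : T -> R.

Lemma contD f g : continuous f -> continuous g -> continuous (fun x => f x + g x).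
Proof. by move=> cf cg x; apply: cvgD; [exact: cf|exact: cg]. Qed.

Lemma contB f g : continuous f -> continuous g -> continuous (fun x => f x - g x).
Proof. by move=> cf cg x; apply: cvgB; [exact: cf|exact: cg]. Qed.

Lemma contM f g : continuous f -> continuous g -> continuous (fun x => f x * g x).
Proof. by move=> cf cg x; apply: cvgM; [exact: cf|exact: cg]. Qed.

Lemma contN f : continuous f -> continuous (fun x => - f x).
Proof. by move=> cf x; apply: cvgN; exact: cf. Qed.

Lemma cont_cst (k : R) : continuous (fun _ : T => k).
Proof. by move=> x; exact: cvg_cst. Qed.

Lemma cont_comp (s : R -> R) f : continuous s -> continuous f -> continuous (fun x => s (f x)).
Proof. by move=> cs cf x; apply: (@continuous_comp _ _ _ f s); [exact: cf|exact: cs]. Qed.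

Lemma cont_min f g : continuous f -> continuous g -> continuous (fun x => Num.min (f x) (g x)).
Proof. by move=> cf cg x; apply: (@continuous_min _ _ f g x); [exact: cf|exact: cg]. Qed.

End continuity.

(** * Density of continuous functions in L^1 of the plane *)

Section approximation.
Context {R : realType}.
Notation mu := (@lebesgue_measure R).
Notation mu2 := (mu \x mu)%E.
Implicit Types (f g w : R * R -> R).

(** Membership in the L^1 closure of the continuous functions with bounded support. Density is
    proved by climbing from open rectangles to bounded measurable sets, then to simple and finally
    to integrable functions. *)
Definition approximable f := mu2.-integrable setT (EFin \o f) /\
  forall e : R, 0 < e -> exists g M, [/\ continuous g, (forall x, M < `|x| -> g x = 0) &
    \int[mu2]_x `|f x - g x| <= e].

Lemma integrable_sub f g : mu2.-integrable setT (EFin \o f) -> mu2.-integrable setT (EFin \o g) ->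
  mu2.-integrable setT (EFin \o (fun x => f x - g x)).
Proof. by move=> fi gi; have := integrableB measurableT fi gi; exact: eq_integrable. Qed.

Lemma integrable_add f g : mu2.-integrable setT (EFin \o f) -> mu2.-integrable setT (EFin \o g) ->
  mu2.-integrable setT (EFin \o (fun x => f x + g x)).
Proof. by move=> fi gi; have := integrableD measurableT fi gi; exact: eq_integrable. Qed.

Lemma L1_triangle f g w : mu2.-integrable setT (EFin \o f) -> mu2.-integrable setT (EFin \o g) ->
  mu2.-integrable setT (EFin \o w) ->
  \int[mu2]_x `|f x - w x| <= \int[mu2]_x `|f x - g x| + \int[mu2]_x `|g x - w x|.
Proof.
move=> fi gi wi; rewrite -RintegralD //; [|exact/integrable_norm_fin/integrable_sub..].
apply: le_Rintegral => //.
- exact/integrable_norm_fin/integrable_sub.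
- have := integrableD measurableT (integrable_norm_fin measurableT (integrable_sub fi gi))
    (integrable_norm_fin measurableT (integrable_sub gi wi)).
  exact: eq_integrable.
- by move=> x _; exact: ler_distD.
Qed.

Lemma approximable_limit f : mu2.-integrable setT (EFin \o f) ->
  (forall e : R, 0 < e -> exists h, approximable h /\ \int[mu2]_x `|f x - h x| <= e) ->
  approximable f.
Proof.
move=> fi fh; split => // e e0.
have e20 : 0 < e / 2 by rewrite divr_gt0.
have [h [[hi hg] fhe]] := fh _ e20.
have [g [M [cg gM hge]]] := hg _ e20.
exists g, M; split => //.
rewrite (le_trans (L1_triangle fi hi _)) //; first exact: continuous_box_integrable gM.
by lra.
Qed.

Lemma approximable0 : approximable (fun=> 0).
Proof.
split.
  have := integrable0 mu2 setT; exact: eq_integrable.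
move=> e e0; exists (fun=> 0), 0; split => //; first exact: cst_continuous.
under eq_Rintegral do rewrite subrr normr0.
by rewrite Rintegral_cst // mul0r ltW.
Qed.

Lemma approximableD f g : approximable f -> approximable g -> approximable (fun x => f x + g x).
Proof.
move=> [fi fa] [gi ga]; split; first exact: integrable_add.
move=> e e0; have e20 : 0 < e / 2 by rewrite divr_gt0.
have [f' [M [cf fM ff']]] := fa _ e20.
have [g' [N [cg gN gg']]] := ga _ e20.
have f'i := continuous_box_integrable cf fM.
have g'i := continuous_box_integrable cg gN.
exists (fun x => f' x + g' x), (Num.max M N); split.
- by move=> x; apply: continuousD; [exact: cf|exact: cg].
- by move=> x; rewrite gt_max => /andP[Mx Nx]; rewrite fM // gN // addr0.
apply: (@le_trans _ _ (\int[mu2]_x (`|f x - f' x| + `|g x - g' x|))).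
  apply: le_Rintegral => //.
  - by apply/integrable_norm_fin => //; apply: integrable_sub; exact: integrable_add.
  - by apply: integrable_add; apply/integrable_norm_fin => //; exact: integrable_sub.
  - by move=> x _; rewrite opprD addrACA ler_normD.
rewrite RintegralD //; [|exact/integrable_norm_fin/integrable_sub..].
lra.
Qed.

Lemma approximableZ f (c : R) : approximable f -> approximable (fun x => c * f x).
Proof.
move=> [fi fa]; split; first exact: integrable_scale.
move=> e e0; have e20 : 0 < e / (`|c| + 1) by rewrite divr_gt0 // ltr_wpDl.
have [f' [M [cf fM ff']]] := fa _ e20.
have f'i := continuous_box_integrable cf fM.
exists (fun x => c * f' x), M; split.
- by apply: contM => //; exact: cont_cst.
- by move=> x Mx; rewrite fM // mulr0.
under eq_Rintegral do rewrite -mulrBr normrM.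
rewrite RintegralZl //; last exact/integrable_norm_fin/integrable_sub.
move: ff'; rewrite ler_pdivlMr ?ltr_wpDl // => ff'.
rewrite (le_trans _ ff') // mulrC ler_wpM2l ?lerDl // Rintegral_ge0 //.
Qed.

Lemma approximable_sum (I : eqType) (s : seq I) (F : I -> R * R -> R) :
  (forall i, i \in s -> approximable (F i)) -> approximable (fun x => \sum_(i <- s) F i x).
Proof.
elim: s => [|i s IH] Fa.
  by under eq_fun do rewrite big_nil; exact: approximable0.
under eq_fun do rewrite big_cons.
apply: approximableD; first by apply: Fa; rewrite mem_head.
by apply: IH => j js; apply: Fa; rewrite in_cons js orbT.
Qed.

Lemma approximable_sequence f (h : nat -> R * R -> R) (G : R * R -> R) :
  (forall n, approximable (h n)) -> (forall x, h ^~ x @ \oo --> f x) ->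
  mu2.-integrable setT (EFin \o G) -> (forall n x, `|h n x| <= G x) ->
  approximable f.
Proof.
move=> ha hf iG hG.
have mh n : measurable_fun setT (h n).
  by apply/measurable_EFinP; have [/measurable_int] := ha n.
have [fi _] := @Rdominated_convergence _ _ _ mu2 setT h f G measurableT mh (fun x _ => hf x) iG
  (fun n x _ => hG n x).
have mf : measurable_fun setT f by apply/measurable_EFinP; exact: measurable_int fi.
have fG x : `|f x| <= G x.
  have hn : `|h n x| @[n --> \oo] --> `|f x| by apply: cvg_norm; exact: hf.
  have <- := cvg_lim _ hn => //; apply: limr_le; last exact: nearW.
  by apply/cvg_ex; exists (`|f x|).
apply: approximable_limit => // e e0.
have [||||_] := @Rdominated_convergence _ _ _ mu2 setT (fun n x => `|f x - h n x|) (fun=> 0)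
    (fun x => 2 * G x) measurableT.
- by move=> n; apply: measurableT_comp => //; apply: measurable_funB; [exact: mf|exact: mh].
- move=> x _; rewrite -(normr0 R) -(subrr (f x)); apply: cvg_norm.
  by apply: cvgB; [exact: cvg_cst|exact: hf].
- exact: integrable_scale.
- move=> n x _; rewrite normr_id (le_trans (ler_normB _ _)) //.
  by have := fG x; have := hG n x; lra.
rewrite Rintegral_cst // mul0r => cv.
have /cvgrPdist_le /(_ _ e0) [N _ hN] := cv.
exists (h N); split => //.
have := hN N (leqnn N); rewrite sub0r normrN => /(le_trans _) -> //; exact: ler_norm.
Qed.

Definition orect (a b c d : R) : set (R * R) := `]a, b[ `*` `]c, d[.

(** Continuous functions that increase with [n] to the indicator of the open rectangle: the product
    of the distances to the four sides, magnified and capped at 1. *)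
Definition bump (a b c d : R) (n : nat) (x : R * R) : R :=
  Num.min 1 (n%:R * (pos (x.1 - a) * pos (b - x.1) * (pos (x.2 - c) * pos (d - x.2)))).

Lemma continuous_fst (s : R -> R) : continuous s -> continuous (fun x : R * R => s x.1).
Proof. by move=> cs x; apply: continuous_comp; [exact: cvg_fst|exact: cs]. Qed.

Lemma continuous_snd (s : R -> R) : continuous s -> continuous (fun x : R * R => s x.2).
Proof. by move=> cs x; apply: continuous_comp; [exact: cvg_snd|exact: cs]. Qed.

Lemma continuous_bump a b c d n : continuous (bump a b c d n).
Proof.
have c1 (k : R) : continuous (fun t : R => pos (t - k)).
  move=> t; apply: (@continuous_comp _ _ _ (fun t : R => t - k) pos); last exact: continuous_pos.
  by apply: continuousB; [exact: cvg_id|exact: cst_continuous].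
have c2 (k : R) : continuous (fun t : R => pos (k - t)).
  move=> t; apply: (@continuous_comp _ _ _ (fun t : R => k - t) pos); last exact: continuous_pos.
  by apply: continuousB; [exact: cst_continuous|exact: cvg_id].
apply: cont_min; first exact: cont_cst.
apply: contM; first exact: cont_cst.
apply: contM; apply: contM.
- exact: (continuous_fst (c1 a)).
- exact: (continuous_fst (c2 b)).
- exact: (continuous_snd (c1 c)).
- exact: (continuous_snd (c2 d)).
Qed.

Lemma bump_ge0 a b c d n x : 0 <= bump a b c d n x.
Proof. by rewrite /bump le_min ler01 !mulr_ge0 ?pos_ge0. Qed.

Lemma bump_le1 a b c d n x : bump a b c d n x <= 1.
Proof. by rewrite /bump ge_min lexx. Qed.

Lemma bump_outside a b c d n x : ~ orect a b c d x -> bump a b c d n x = 0.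
Proof.
rewrite /orect /= !in_itv /= => nx.
suff E0 : pos (x.1 - a) * pos (b - x.1) * (pos (x.2 - c) * pos (d - x.2)) = 0.
  by rewrite /bump E0 mulr0; apply/min_idPr.
have [x1|x1] := leP x.1 a; first by rewrite pos0 ?mul0r ?subr_le0.
have [x2|x2] := leP b x.1; first by rewrite (@pos0 _ (b - _)) ?mulr0 ?mul0r ?subr_le0.
have [x3|x3] := leP x.2 c; first by rewrite (@pos0 _ (_ - c)) ?mulr0 ?mul0r ?mulr0 ?subr_le0.
have [x4|x4] := leP d x.2; first by rewrite (@pos0 _ (d - _)) ?mulr0 ?subr_le0.
by exfalso; apply: nx; rewrite x1 x2 x3 x4.
Qed.

Lemma bump_cvg a b c d x : bump a b c d ^~ x @ \oo --> (\1_(orect a b c d) x : R).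
Proof.
have [xr|xr] := pselect (orect a b c d x); last first.
  rewrite indicE memNset //= (_ : bump a b c d ^~ x = cst 0); first exact: cvg_cst.
  by apply/funext => n; rewrite bump_outside.
rewrite indicE mem_set //=.
set k : R := pos (x.1 - a) * pos (b - x.1) * (pos (x.2 - c) * pos (d - x.2)).
have k0 : 0 < k.
  move: xr; rewrite /orect /= !in_itv /= => -[/andP[? ?] /andP[? ?]].
  by rewrite /k; apply: mulr_gt0; apply: mulr_gt0; rewrite /pos lt_max subr_gt0; apply/orP; left.
apply: cvg_near_cst; near=> n.
rewrite /bump -/k; apply/min_idPl; rewrite -ler_pdivrMr // div1r.
have : (Num.bound k^-1 <= n)%N by near: n; exact: nbhs_infty_ge.
rewrite -(ler_nat R); apply: le_trans; apply/ltW/archi_boundP.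
by rewrite invr_ge0 ltW.
Unshelve. all: by end_near. Qed.

Lemma orect_sub_box a b c d : exists M, orect a b c d `<=` box M.
Proof.
exists (`|a| + `|b| + `|c| + `|d|) => x; rewrite /orect /box /= !in_itv /=.
move=> [/andP[? ?] /andP[? ?]].
have ha := ler_norm a; have hb := ler_norm b; have hc := ler_norm c; have hd := ler_norm d.
have ha' := ler_norm (- a); have hb' := ler_norm (- b).
have hc' := ler_norm (- c); have hd' := ler_norm (- d).
rewrite !normrN in ha' hb' hc' hd'.
have := normr_ge0 a; have := normr_ge0 b; have := normr_ge0 c; have := normr_ge0 d.
by move=> *; split; apply/andP; split; lra.
Qed.

Lemma approximable_orect a b c d : approximable (\1_(orect a b c d)).
Proof.
have [M rM] := orect_sub_box a b c d.
have bM n x : M < `|x| -> bump a b c d n x = 0.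
  by move=> Mx; apply: bump_outside => /rM/boxP; rewrite leNgt Mx.
apply: (@approximable_sequence _ (bump a b c d) (\1_(box M))).
- move=> n; split; first exact: (continuous_box_integrable (@continuous_bump a b c d n) (bM n)).
  move=> e e0; exists (bump a b c d n), M; split; [exact: continuous_bump|exact: bM|].
  under eq_Rintegral do rewrite subrr normr0.
  by rewrite Rintegral_cst // mul0r ltW.
- exact: bump_cvg.
- apply: (@bounded_box_integrable _ _ 1 M).
  + by apply: measurable_indic; exact: measurable_box.
  + by move=> x; rewrite indicE; case: (_ \in _); rewrite ?normr1 ?normr0.
  + by move=> x Mx; rewrite indicE memNset // => /boxP; rewrite leNgt Mx.
- move=> n x; rewrite ger0_norm ?bump_ge0 // indicE.
  have [xM|xM] := boolP (x \in box M); first exact: bump_le1.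
  rewrite bM //; move: xM; rewrite notin_setE => /boxP /negP; by rewrite -ltNge.
Qed.

End approximation.

Section density.
Import HBNNSimple.
Context {R : realType}.
Notation mu := (@lebesgue_measure R).
Notation mu2 := (mu \x mu)%E.
Implicit Types (f g w : R * R -> R).

Definition orects : set (set (R * R)) :=
  [set A | exists p : (R * R) * (R * R), A = orect p.1.1 p.1.2 p.2.1 p.2.2].

Lemma measurable_orect (a b c d : R) : measurable (orect a b c d).
Proof. by apply: measurableX; exact: measurable_itv. Qed.

Lemma setI_orect (a b c d a' b' c' d' : R) : orect a b c d `&` orect a' b' c' d' =
  orect (Num.max a a') (Num.min b b') (Num.max c c') (Num.min d d').
Proof.
apply/seteqP; split => x; rewrite /orect /= !in_itv /= !gt_max !lt_min.
  by move=> [[/andP[-> ->] /andP[-> ->]] [/andP[-> ->] /andP[-> ->]]].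
move=> [/andP[/andP[-> ->] /andP[-> ->]] /andP[/andP[-> ->] /andP[-> ->]]].
by [].
Qed.

Lemma setI_closed_orects : setI_closed orects.
Proof.
move=> _ _ [p ->] [q ->].
by exists ((Num.max p.1.1 q.1.1, Num.min p.1.2 q.1.2), (Num.max p.2.1 q.2.1, Num.min p.2.2 q.2.2)); rewrite setI_orect.
Qed.

Lemma itv_bigcup_nat (x : R) : exists n : nat, - n%:R < x < n%:R.
Proof.
exists (Num.bound `|x|); rewrite -ltr_norml; exact: archi_boundP.
Qed.

(** A strip over []a, b[] is a countable union of open rectangles, so both coordinate maps are
    measurable for the sigma-algebra that the rectangles generate. *)
Lemma measurable_orects : @measurable _ (measurableTypeR R * measurableTypeR R)%type = <<s orects >>.
Proof.
apply/seteqP; split; last first.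
  apply: smallest_sub; first exact: sigma_algebra_measurable.
  by move=> _ [p ->]; exact: measurable_orect.
rewrite measurable_prod_measurableType.
apply: smallest_sub; first exact: smallest_sigma_algebra.
pose T := g_sigma_algebraType orects.
have m1 : measurable_fun [set: T] (fun x : T => (x : R * R).1).
  apply: (measurability _ (RGenOpens.measurableE R)).
  move=> _ [_ [a [b ->] <-]]; rewrite setTI.
  have -> : (fun x : T => (x : R * R).1) @^-1` `]a, b[ = \bigcup_n orect a b (- n%:R) n%:R.
    apply/seteqP; split => [x /= xab|x [n _] []//].
    by have [n hn] := itv_bigcup_nat (x : R * R).2; exists n => //; split => //=; rewrite in_itv.
  apply: bigcupT_measurable => n; apply: sub_sigma_algebra.
  by exists ((a, b), (- n%:R, n%:R)).
have m2 : measurable_fun [set: T] (fun x : T => (x : R * R).2).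
  apply: (measurability _ (RGenOpens.measurableE R)).
  move=> _ [_ [a [b ->] <-]]; rewrite setTI.
  have -> : (fun x : T => (x : R * R).2) @^-1` `]a, b[ = \bigcup_n orect (- n%:R) n%:R a b.
    apply/seteqP; split => [x /= xab|x [n _] []//].
    by have [n hn] := itv_bigcup_nat (x : R * R).1; exists n => //; split => //=; rewrite in_itv.
  apply: bigcupT_measurable => n; apply: sub_sigma_algebra.
  by exists ((- n%:R, n%:R), (a, b)).
move=> _ [A mA [B mB <-]].
have := measurableI _ _ (m1 measurableT _ mA) (m2 measurableT _ mB).
by rewrite !setTI.
Qed.

Lemma indic_setCI (A B : set (R * R)) x :
  (\1_(~` A `&` B) x : R) = \1_B x + (- 1) * \1_(A `&` B) x.
Proof.
rewrite !indicE !in_setI in_setC.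
by case: (x \in A); case: (x \in B); rewrite /= ?mulr1 ?mulr0 ?subrr ?addr0 ?mulN1r ?subrr.
Qed.

Definition obox (N : R) : set (R * R) := orect (- N) N (- N) N.

Lemma obox_box N : obox N `<=` box N.
Proof. by move=> x [/= h1 h2]; split; apply: subset_itv_oo_cc. Qed.

Lemma integrable_indic_obox N (S : set (R * R)) : measurable S ->
  mu2.-integrable setT (EFin \o (\1_(S `&` obox N) : R * R -> R)).
Proof.
move=> mS; apply: (@bounded_box_integrable _ _ 1 N).
- by apply: measurable_indic; apply: measurableI => //; exact: measurable_orect.
- by move=> x; rewrite indicE; case: (_ \in _); rewrite ?normr1 ?normr0.
- move=> x Nx; rewrite indicE memNset // => -[_ /obox_box /boxP].
  by rewrite leNgt Nx.
Qed.

(** Dynkin's lemma for the intersection-stable family of open rectangles. Intersecting with a fixed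
    bounded rectangle keeps all indicators integrable, so that complements and countable disjoint
    unions can be treated. *)
Lemma approximable_indic N (S : set (R * R)) : measurable S ->
  approximable (\1_(S `&` obox N) : R * R -> R).
Proof.
move=> mS.
have [|||||_] := @dynkin_induction _ (measurableTypeR R * measurableTypeR R)%type orects
  (fun S => measurable S /\ approximable (\1_(S `&` obox N) : R * R -> R)) measurable_orects
  setI_closed_orects _ _ _ _ S; last by [].
- by split => //; rewrite setTI; exact: approximable_orect.
- move=> _ [p ->]; split; first exact: measurable_orect.
  by rewrite /obox setI_orect; exact: approximable_orect.
- move=> A mA [_ aA]; split; first exact: measurableC.
  have -> : \1_(~` A `&` obox N) = (fun x => \1_(obox N) x + (- 1) * \1_(A `&` obox N) x) :> (R * R -> R).
    by apply/funext => x; exact: indic_setCI.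
  apply: approximableD; first exact: approximable_orect.
  exact: approximableZ.
- move=> F mF tF aF; split; first exact: bigcupT_measurable.
  apply: (@approximable_sequence _ _ (fun n x => \sum_(i <- iota 0 n) \1_(F i `&` obox N) x) (\1_(obox N))).
  + by move=> n; apply: approximable_sum => i _; have [] := aF i.
  + move=> x.
    have [[i _ Fix]|nF] := pselect ((\bigcup_k F k) x); last first.
      rewrite indicE memNset; last by case.
      rewrite (_ : (fun n => _) = cst 0); first exact: cvg_cst.
      apply/funext => n; rewrite big1 // => i _; rewrite indicE memNset // => -[Fix _].
      by apply: nF; exists i.
    apply: cvg_near_cst; near=> n.
    have ni : (i < n)%N by near: n; exact: nbhs_infty_gt.
    rewrite (bigD1_seq i) ?mem_iota ?iota_uniq //= big1 ?addr0.
      rewrite !indicE !in_setI; congr (nat_of_bool (_ && _))%:R.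
      by rewrite !mem_set //; exists i.
    move=> j ji; rewrite indicE memNset // => -[Fjx _].
    move/trivIsetP : tF => /(_ j i I I ji) /seteqP [/(_ x) H _]; exact: H.
  + have := @integrable_indic_obox N setT measurableT; by rewrite setTI.
  + move=> n x; rewrite ger0_norm; last by apply: sumr_ge0 => i _; rewrite indicE.
    elim: n => [|n IHn]; first by rewrite big_nil indicE.
    rewrite -addn1 iotaD big_cat /= big_seq1 add0n.
    have [Fnx|Fnx] := pselect (F n x); last first.
      rewrite [X in _ + X]indicE memNset ?addr0 //; by case.
    rewrite big_seq big1 ?add0r; last first.
      move=> j; rewrite mem_iota add0n => /= jn; rewrite indicE memNset // => -[Fjx _].
      have ji : j != n by rewrite ltn_eqF.
      by move/trivIsetP : tF => /(_ j n I I ji) /seteqP [/(_ x) H _]; exact: H.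
    rewrite !indicE in_setI; case: (x \in F n) => //=; rewrite ler_nat; by case: (_ \in _).
- by rewrite -measurable_orects.
Unshelve. all: by end_near. Qed.

Lemma approximable_bounded w N : measurable_fun setT w -> (forall x, 0 <= w x) ->
  mu2.-integrable setT (EFin \o w) -> (forall x, ~ obox N x -> w x = 0) -> approximable w.
Proof.
move=> mw w0 iw wN.
have mew : measurable_fun setT (EFin \o w) by exact/measurable_EFinP.
pose h := nnsfun_approx measurableT mew.
have hw n x : (h n x <= w x)%R.
  rewrite /h nnsfun_approxE -lee_fin; apply: (@le_approx _ _ _ setT (EFin \o w)) => //.
  by move=> y _; rewrite lee_fin.
apply: (@approximable_sequence _ _ (fun n x => h n x) w) => //.
- move=> n.
  have -> : (fun x => h n x) = (fun x => \sum_(y <- finmap.enum_fset (fset_set (range (h n))))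
       y * \1_((h n) @^-1` [set y] `&` obox N) x).
    apply/funext => x; have [xN|xN] := pselect (obox N x).
      rewrite [LHS]fimfunE fsbig_finite //=; apply: eq_bigr => y _.
      by congr (_ * _); rewrite !indicE in_setI (mem_set xN) andbT.
    have -> : h n x = 0.
      by apply/eqP; rewrite eq_le -{1}(wN _ xN) hw /=; exact: fun_ge0.
    rewrite big1 // => y _; rewrite indicE memNset ?mulr0 //; by case.
  by apply: approximable_sum => y _; apply: approximableZ; apply: approximable_indic.
- move=> x; have w0' y : [set: _] y -> (0 <= (EFin \o w) y)%E by rewrite lee_fin.
  by have /fine_cvgP[] := cvg_nnsfun_approx measurableT mew w0' (I : [set: _] x).
- by move=> n x; rewrite ger0_norm // fun_ge0.
Qed.

Lemma integrable_approximable w N : mu2.-integrable setT (EFin \o w) ->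
  (forall x, N < `|x| -> w x = 0) -> approximable w.
Proof.
move=> iw wN.
have mw : measurable_fun setT w by apply/measurable_EFinP; exact: measurable_int iw.
have out x : ~ obox (N + 1) x -> w x = 0.
  move=> xN; apply: wN; rewrite ltNge; apply/negP => /boxP [/= h1 h2]; apply: xN; split => /=.
    by move: h1; rewrite !in_itv /= => /andP[? ?]; apply/andP; split; lra.
  by move: h2; rewrite !in_itv /= => /andP[? ?]; apply/andP; split; lra.
have posi (v : R * R -> R) : mu2.-integrable setT (EFin \o v) -> (forall x, ~ obox (N + 1) x -> v x = 0) ->
    approximable (fun x => pos (v x)).
  move=> iv vN; apply: (@approximable_bounded _ (N + 1)).
  - by apply: measurable_maxr => //; apply/measurable_EFinP; exact: measurable_int iv.
  - by move=> x; exact: pos_ge0.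
  - apply: (@le_integrable _ _ _ mu2 _ measurableT _ (EFin \o v)) => //.
      by apply/measurable_EFinP; apply: measurable_maxr => //; apply/measurable_EFinP; exact: measurable_int iv.
    move=> x _; rewrite /= lee_fin ger0_norm ?pos_ge0 // pos_le //.
    exact: ler_norm.
  - by move=> x /vN ->; exact: pos0.
have -> : w = (fun x => pos (w x) + (- 1) * pos (- 1 * w x)).
  by apply/funext => x; rewrite /pos; case: (leP (w x) 0); case: (leP (- 1 * w x) 0); lra.
apply: approximableD; first exact: posi.
apply: approximableZ; apply: posi; first exact: integrable_scale.
by move=> x /out ->; rewrite mulr0.
Qed.

End density.

Section lebesgue2_sigma_finite.
Context {R : realType}.

HB.instance Definition _ := Measure.on (@lebesgue2 R).

Lemma lebesgue2_sigma_finite : sigma_finite setT (@lebesgue2 R).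
Proof.
exists (fun n => box n%:R).
  apply/seteqP; split => // x _; exists (Num.bound `|x|) => //.
  by apply/boxP/ltW; exact: archi_boundP.
by move=> n; split; [exact: measurable_box|exact: box_lty].
Qed.

HB.instance Definition _ := Measure_isSigmaFinite.Build _ _ _ (@lebesgue2 R) lebesgue2_sigma_finite.

End lebesgue2_sigma_finite.

(** * Convergence of mollifications in L^1 *)

Section mollification.
Context {R : realType}.
Notation mu := (@lebesgue_measure R).
Notation mu2 := (mu \x mu)%E.
Implicit Types (f g w : R * R -> R) (e : R).

Lemma integrable_kernel2 f g (k : (R * R) * (R * R) -> R) (C : R) :
  mu2.-integrable setT (EFin \o f) -> mu2.-integrable setT (EFin \o g) ->
  measurable_fun setT k -> (forall z, `|k z| <= C) ->
  mu2.-integrable setT (EFin \o (fun x => f x * \int[mu2]_y (g y * k (x, y)))).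
Proof. by move=> fi gi mk kC; exact: (@integrable_kernel _ _ _ _ _ lebesgue2 lebesgue2 f g k C fi gi mk kC). Qed.

Lemma Rfubini_kernel2 f g (k : (R * R) * (R * R) -> R) (C : R) :
  mu2.-integrable setT (EFin \o f) -> mu2.-integrable setT (EFin \o g) ->
  measurable_fun setT k -> (forall z, `|k z| <= C) ->
  \int[mu2]_x (f x * \int[mu2]_y (g y * k (x, y))) =
  \int[mu2]_y (g y * \int[mu2]_x (f x * k (x, y))).
Proof. by move=> fi gi mk kC; exact: (@Rfubini_kernel _ _ _ _ _ lebesgue2 lebesgue2 f g k C fi gi mk kC). Qed.

Definition moll e w x := (mass e)^-1 * conv (rho e) w x.

Lemma conv_rho_le e w x : 0 <= e -> mu2.-integrable setT (EFin \o w) ->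
  `|conv (rho e) w x| <= conv (rho e) (fun y => `|w y|) x.
Proof.
move=> e0 iw.
have i1 := integrable_conv x iw (continuous_rho e0) (rho_bounded e).
rewrite (le_trans (le_normr_Rintegral measurableT i1)) //.
rewrite le_eqVlt; apply/orP; left; apply/eqP; apply: eq_Rintegral => y _.
by rewrite normrM (ger0_norm (rho_ge0 _ _)).
Qed.

Lemma moll_outside e w N x : 0 <= e -> (forall y, N < `|y| -> w y = 0) -> e + N <= `|x| ->
  moll e w x = 0.
Proof.
move=> e0 wN xN; rewrite /moll (conv_outside _ wN xN) ?mulr0 //.
by move=> z; exact: rho_outside.
Qed.

Lemma continuous_moll e w : 0 <= e -> mu2.-integrable setT (EFin \o w) -> continuous (moll e w).
Proof. by move=> e0 iw; apply: contM; [exact: cont_cst|exact: continuous_conv_rho]. Qed.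

Lemma integrable_moll e w N : 0 <= e -> mu2.-integrable setT (EFin \o w) ->
  (forall y, N < `|y| -> w y = 0) -> mu2.-integrable setT (EFin \o moll e w).
Proof.
move=> e0 iw wN; apply: (@continuous_box_integrable _ _ (e + N)); first exact: continuous_moll.
by move=> x /ltW; exact: moll_outside.
Qed.

Lemma integrable_rho_subr e y : 0 <= e -> mu2.-integrable setT (EFin \o (fun x => rho e (x - y))).
Proof.
move=> e0; apply: (@continuous_box_integrable _ _ (e + `|y|)).
  by apply: (@continuous_subr _ (rho e)); exact: continuous_rho.
move=> x xe; apply: rho_outside => //; have := lerB_dist x y; lra.
Qed.

Lemma integrable_rho_subl e x : 0 <= e -> mu2.-integrable setT (EFin \o (fun y => rho e (x - y))).
Proof.
move=> e0; have := integrable_rho_subr x e0; apply: eq_integrable => // y _ /=.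
by rewrite -rhoN opprB.
Qed.

Lemma moll_contraction e w N : 0 < e -> mu2.-integrable setT (EFin \o w) ->
  (forall y, N < `|y| -> w y = 0) -> \int[mu2]_x `|moll e w x| <= \int[mu2]_x `|w x|.
Proof.
move=> e0 iw wN; have e0' := ltW e0; have me := mass_gt0 e0.
(* The mollified function vanishes outside this box; its indicator supplies the integrable outer
   factor that [Rfubini_kernel2] asks for. *)
pose b : R * R -> R := \1_(box (e + N)).
have ib : mu2.-integrable setT (EFin \o b).
  apply: (@bounded_box_integrable _ _ 1 (e + N)).
  + by apply: measurable_indic; exact: measurable_box.
  + by move=> x; rewrite /b indicE; case: (_ \in _); rewrite ?normr1 ?normr0.
  + by move=> x Mx; rewrite /b indicE memNset // => /boxP; rewrite leNgt Mx.
have iaw := integrable_norm_fin measurableT iw.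
have mk := measurable_kernel (@continuous_rho _ e e0').
have kC (z : (R * R) * (R * R)) : `|rho e (z.1 - z.2)| <= e ^+ 4 by exact: rho_bounded.
have ik := integrable_kernel2 ib iaw mk kC.
have fub := Rfubini_kernel2 ib iaw mk kC.
have b01 x : 0 <= b x <= 1 by rewrite /b indicE; case: (_ \in _); rewrite ?lexx ?ler01.
apply: (@le_trans _ _ ((mass e)^-1 * \int[mu2]_x (b x * \int[mu2]_y (`|w y| * rho e (x - y))))).
  rewrite -(RintegralZl _ measurableT ik); apply: le_Rintegral.
  - exact: measurableT.
  - by apply: (integrable_norm_fin measurableT); exact: (integrable_moll e0' iw wN).
  - exact: (integrable_scale _ measurableT ik).
  - move=> x _; have ime : 0 <= (mass e)^-1 by rewrite invr_ge0 ltW.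
    rewrite /moll normrM (ger0_norm ime); apply: (ler_wpM2l ime).
    rewrite /b indicE; have [xb|xb] := boolP (x \in box (e + N)).
      by rewrite mul1r; exact: conv_rho_le.
    have rout z : e <= `|z| -> rho e z = 0 by exact: rho_outside.
    have xN : e + N <= `|x|.
      by rewrite leNgt; apply/negP => /ltW /boxP h; move: xb; rewrite mem_set.
    by rewrite mul0r (conv_outside rout wN xN) normr0.
rewrite fub (ler_pdivrMl _ _ me) -(RintegralZl _ measurableT iaw); apply: le_Rintegral.
- exact: measurableT.
- have mk' : measurable_fun setT (fun z : (R * R) * (R * R) => rho e (z.2 - z.1)).
    have := measurable_kernel (@continuous_rho _ e e0').
    by apply: eq_measurable_fun => z _; rewrite -rhoN opprB.
  exact: (integrable_kernel2 iaw ib mk' (fun z => rho_bounded e _)).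
- exact: integrable_scale.
move=> y _; rewrite mulrC; apply: ler_wpM2r; first exact: normr_ge0.
rewrite -(integral_rho_shift y e0'); apply: le_Rintegral.
- exact: measurableT.
- by apply: (integrable_mul_bounded measurableT ib); [by apply: continuous_measurable2; apply: (@continuous_subr _ (rho e)); exact: continuous_rho|move=> x _; exact: rho_bounded].
- exact: integrable_rho_subr.
- by move=> x _; apply: ler_piMl; [exact: rho_ge0|have /andP[] := b01 x].
Qed.

Lemma mollB e f g x : 0 <= e -> mu2.-integrable setT (EFin \o f) -> mu2.-integrable setT (EFin \o g) ->
  moll e (fun y => f y - g y) x = moll e f x - moll e g x.
Proof.
move=> e0 fi gi; rewrite /moll -mulrBr; congr (_ * _); rewrite /conv -RintegralB //.
- by apply: eq_Rintegral => y _; rewrite mulrBl.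
- exact: integrable_conv fi (continuous_rho e0) (rho_bounded e).
- exact: integrable_conv gi (continuous_rho e0) (rho_bounded e).
Qed.

Lemma moll_unif e g x (d : R) : 0 < e -> mu2.-integrable setT (EFin \o g) ->
  (forall y, `|x - y| < e -> `|g x - g y| <= d) -> `|moll e g x - g x| <= d.
Proof.
move=> e0 gi gd; have e0' := ltW e0; have me := mass_gt0 e0.
have i1 := integrable_conv x gi (continuous_rho e0') (rho_bounded e).
have i2 := integrable_rho_subl x e0'.
have i2g := @integrable_scale _ _ _ mu2 setT _ (g x) measurableT i2.
have -> : moll e g x - g x = (mass e)^-1 * \int[mu2]_y ((g y - g x) * rho e (x - y)).
  transitivity ((mass e)^-1 * (conv (rho e) g x - g x * mass e)).
    by rewrite mulrBr mulrCA mulVf ?mulr1 // gt_eqF.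
  congr (_ * _); rewrite -(integral_rho_shiftC x e0') -RintegralZl // -RintegralB //.
  by apply: eq_Rintegral => y _; rewrite mulrBl.
rewrite normrM ger0_norm ?invr_ge0 ?(ltW me) // ler_pdivrMl //.
have i3 : mu2.-integrable setT (EFin \o (fun y => (g y - g x) * rho e (x - y))).
  have := integrableB measurableT i1 i2g; apply: eq_integrable => // y _ /=.
  by rewrite -EFinB mulrBl.
rewrite (le_trans (le_normr_Rintegral measurableT i3)) // mulrC -(integral_rho_shiftC x e0') -RintegralZl //.
apply: le_Rintegral => //.
- exact: integrable_norm_fin.
- exact: integrable_scale.
- move=> y _; rewrite normrM (ger0_norm (rho_ge0 _ _)).
  have [xy|xy] := ltP `|x - y| e; last by rewrite rho_outside // !mulr0.
  by rewrite ler_wpM2r ?rho_ge0 // distrC gd.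
Qed.

(** Three-epsilon argument: a continuous [g] close to [w] in L^1 is approximated uniformly by its
    mollifications, and mollification does not increase the L^1 norm of [w] - [g]. *)
Lemma moll_L1 w N : mu2.-integrable setT (EFin \o w) -> (forall y, N < `|y| -> w y = 0) ->
  forall d, 0 < d -> exists e0 : R, 0 < e0 /\ forall e, 0 < e < e0 -> \int[mu2]_x `|moll e w x - w x| <= d.
Proof.
move=> iw wN d d0.
have [_] := integrable_approximable iw wN.
have d30 : 0 < d / 3 by rewrite divr_gt0.
move=> /(_ _ d30) [g [M0 [cg gM0 wg]]].
pose M := Num.max M0 N.
have gM x : M < `|x| -> g x = 0 by rewrite gt_max => /andP[? _]; exact: gM0.
have ig := continuous_box_integrable cg gM.
pose A := fine (mu2 (box (M + 1))).
have A0 : 0 <= A by apply: fine_ge0; exact: measure_ge0.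
have dA : 0 < d / 3 / (A + 1) by rewrite divr_gt0 // ltr_wpDl.
have [e1 [e10 he1]] := @compact_unif_cont _ _ _ g (box (M + 2)) (@compact_box _ _) cg _ dA.
exists (Num.min e1 1); split; first by rewrite lt_min e10 ltr01.
move=> e /andP[e0]; rewrite lt_min => /andP[ee1 e1'].
have imw := integrable_moll (ltW e0) iw wN.
have img := integrable_moll (ltW e0) ig gM.
have t1 := L1_triangle imw img iw.
have t2 := L1_triangle img ig iw.
have h1 : \int[mu2]_x `|moll e w x - moll e g x| <= d / 3.
  have E : (fun x => moll e w x - moll e g x) = moll e (fun y => w y - g y).
    by apply/funext => x; rewrite mollB // ltW.
  under eq_Rintegral do rewrite (congr1 (@^~ _) E).
  rewrite (le_trans (@moll_contraction e _ M e0 _ _)) //; first exact: integrable_sub.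
  by move=> y My; rewrite gM // wN ?subrr // (le_lt_trans _ My) // le_max lexx orbT.
have h3 : \int[mu2]_x `|g x - w x| <= d / 3.
  by under eq_Rintegral do rewrite distrC.
have bb : mu2.-integrable setT (EFin \o (\1_(box (M + 1)) : R * R -> R)).
  apply: (@bounded_box_integrable _ _ 1 (M + 1)).
  + by apply: measurable_indic; exact: measurable_box.
  + by move=> x; rewrite indicE; case: (_ \in _); rewrite ?normr1 ?normr0.
  + by move=> x Mx; rewrite indicE memNset // => /boxP; rewrite leNgt Mx.
have h2 : \int[mu2]_x `|moll e g x - g x| <= d / 3.
  apply: (@le_trans _ _ (\int[mu2]_x (d / 3 / (A + 1) * \1_(box (M + 1)) x))).
    apply: le_Rintegral => //.
    - by apply: integrable_norm_fin => //; exact: integrable_sub.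
    - exact: integrable_scale.
    - move=> x _; rewrite indicE; have [xb|xb] := boolP (x \in box (M + 1)).
        rewrite mulr1; apply: moll_unif => // y xy; apply: he1; last exact: lt_trans ee1.
        by move: xb; rewrite inE => /boxP xb; apply/boxP; apply: (le_trans xb); rewrite lerD2l ler1n.
      rewrite mulr0; have xM : M + 1 < `|x|.
        by rewrite ltNge; apply/negP => /boxP h; move: xb; rewrite mem_set.
      have xM' : M < `|x| by apply: le_lt_trans xM; rewrite lerDl ler01.
      rewrite (gM _ xM') subr0 (moll_outside (ltW e0) gM) ?normr0 //.
      by rewrite (le_trans _ (ltW xM)) // addrC lerD2l ltW.
  rewrite RintegralZl // (_ : \int[mu2]_x \1_(box (M + 1)) x = A); last first.
    rewrite /Rintegral integral_indic ?setIT //; exact: measurable_box.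
  rewrite mulrAC -mulrA ler_piMr ?(ltW d30) // ler_pdivrMr ?ltr_wpDl // mul1r lerDl; exact: ler01.
have -> : d = d / 3 + (d / 3 + d / 3) by field.
apply: (le_trans t1); apply: lerD => //; apply: (le_trans t2); exact: lerD.
Qed.

End mollification.

Lemma Rintegral_lincomb d (T : measurableType d) (R : realType) (m : {measure set T -> \bar R})
  (a b : R) (f g : T -> R) : m.-integrable setT (EFin \o f) -> m.-integrable setT (EFin \o g) ->
  \int[m]_x (a * f x + b * g x) = a * \int[m]_x f x + b * \int[m]_x g x.
Proof.
move=> fi gi; rewrite -(RintegralZl _ measurableT fi) -(RintegralZl _ measurableT gi).
exact: (RintegralD measurableT (integrable_scale _ measurableT fi) (integrable_scale _ measurableT gi)).
Qed.

(** * Truncation against a test field *)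

Section test_fields.
Context {R : realType}.
Notation mu := (@lebesgue_measure R).
Notation mu2 := (mu \x mu)%E.
Implicit Types (f g w s : R * R -> R) (phi : R * R -> R * R) (e : R) (Omega : set (R * R)).

Lemma cont_pair (T : topologicalType) (f g : T -> R) : continuous f -> continuous g ->
  continuous (fun x => (f x, g x)).
Proof.
move=> cf cg x; apply: (@cvg_pair _ _ _ _ (nbhs (f x)) (nbhs (g x))); [exact: cf|exact: cg].
Qed.

(** The bridge from directional derivatives in the plane to the one-variable derivatives behind
    [has_pd1] and [has_pd2]; [p] is a coordinate projection or the identity. *)
Lemma is_derive_line (W : normedModType R) (p : W -> R) (phi : R * R -> W) (x v : R * R) (l : R -> R * R) (a : R) :
  continuous p -> (forall y z, p (y - z) = p y - p z) -> (forall k y, p (k *: y) = k * p y) ->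
  (forall h, l (h + a) = h *: v + x) -> derivable phi x v ->
  is_derive a (1 : R) (fun t => p (phi (l t))) (p ('D_v phi x)).
Proof.
move=> cp pB pZ lE cD.
have la : l a = x by rewrite -[a]add0r lE scale0r add0r.
have cl : h^-1 *: (((fun t => p (phi (l t))) \o shift a) (h *: (1 : R)) - p (phi (l a))) @[h --> (0 : R)^'] -->
    p ('D_v phi x).
  have E : (fun h : R => h^-1 *: (((fun t => p (phi (l t))) \o shift a) (h *: (1 : R)) - p (phi (l a)))) =
     p \o (fun h : R => h^-1 *: ((phi \o shift x) (h *: v) - phi x)).
    apply/funext => h; rewrite /= pZ pB la; congr (_ * (p (phi _) - _)).
    by rewrite /GRing.scale /= mulr1 lE.
  rewrite E; apply: (@cvg_comp _ _ _ _ p _ (nbhs ('D_v phi x))); [exact: cD|exact: cp].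
by apply: DeriveDef; [apply/cvg_ex; eexists; exact: cl|exact: cvg_lim].
Qed.

Lemma continuous_fstR : continuous (fun x : R * R => x.1).
Proof. by move=> x; exact: cvg_fst. Qed.

Lemma continuous_sndR : continuous (fun x : R * R => x.2).
Proof. by move=> x; exact: cvg_snd. Qed.

Lemma derivable_pd1 (p : R * R -> R) phi : continuous p ->
  (forall y z, p (y - z) = p y - p z) -> (forall k y, p (k *: y) = k * p y) ->
  (forall x, derivable phi x (1, 0)) -> has_pd1 (fun x => p (phi x)) (fun x => p ('D_(1, 0) phi x)).
Proof.
move=> cp pB pZ d a b; apply: (@is_derive_line (R * R)%type p phi (a, b) (1, 0) (fun t => (t, b))) => // h.
by apply/pair_equal_spec; rewrite /= /GRing.scale /= mulr1 mulr0 add0r.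
Qed.

Lemma derivable_pd2 (p : R * R -> R) phi : continuous p ->
  (forall y z, p (y - z) = p y - p z) -> (forall k y, p (k *: y) = k * p y) ->
  (forall x, derivable phi x (0, 1)) -> has_pd2 (fun x => p (phi x)) (fun x => p ('D_(0, 1) phi x)).
Proof.
move=> cp pB pZ d a b; apply: (@is_derive_line (R * R)%type p phi (a, b) (0, 1) (fun t => (a, t))) => // h.
by apply/pair_equal_spec; rewrite /= /GRing.scale /= mulr1 mulr0 add0r.
Qed.

Lemma mvt_lipschitz (h dh : R -> R) (C : R) : (forall x, is_derive x (1 : R) h (dh x)) ->
  (forall x, `|dh x| <= C) -> forall x y, `|h x - h y| <= C * `|x - y|.
Proof.
move=> hd dC x y; wlog xy : x y / y <= x.
  by move=> H; have [/H//|/ltW/H] := leP y x; rewrite distrC (distrC y).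
have ch : continuous h.
  by move=> z; apply: differentiable_continuous; apply/derivable1_diffP; have [] := hd z.
have [c _ ->] := MVT_segment xy (fun z _ => hd z) (continuous_subspaceT ch).
by rewrite normrM ler_wpM2r.
Qed.

(** A test field is only required to have continuous directional derivatives. Its own continuity
    comes from bounded partial derivatives, by the mean value theorem on one horizontal and one
    vertical segment. *)
Lemma pd_continuous s s1 s2 (C : R) : has_pd1 s s1 -> has_pd2 s s2 ->
  (forall x, `|s1 x| <= C) -> (forall x, `|s2 x| <= C) -> continuous s.
Proof.
move=> d1 d2 c1 c2 x; apply: (@continuous_lipschitz_at _ _ _ _ _ (C + C) 1) => // u _.
have h1 : `|s (u + x) - s (x.1, (u + x).2)| <= C * `|u|.
  have := mvt_lipschitz (fun t => d1 t (u + x).2) (fun t => c1 (t, (u + x).2)) (u + x).1 x.1.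
  rewrite -surjective_pairing => /le_trans -> //=; rewrite addrK ler_wpM2l //.
    by rewrite (le_trans (normr_ge0 _) (c1 x)).
  by rewrite prod_normE le_max lexx.
have h2 : `|s (x.1, (u + x).2) - s x| <= C * `|u|.
  have := mvt_lipschitz (fun t => d2 x.1 t) (fun t => c2 (x.1, t)) (u + x).2 x.2.
  rewrite -surjective_pairing => /le_trans -> //=; rewrite addrK ler_wpM2l //.
    by rewrite (le_trans (normr_ge0 _) (c1 x)).
  by rewrite prod_normE le_max lexx orbT.
by rewrite mulrDl (le_trans (ler_distD (s (x.1, (u + x).2)) _ _)) // lerD.
Qed.

Lemma enorm_le1 (x : R * R) : enorm x <= 1 <-> dot x x <= 1.
Proof.
by rewrite /enorm -{1}(@sqrtr1 R) ler_psqrt ?nnegrE ?dot_ge0.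
Qed.

(** What the calculus with partial derivatives takes from a test field. The closed support is
    weakened to any compact set off which the field vanishes. *)
Record regular_field Omega phi : Prop := RegularField {
  rf_cont1 : continuous (fun x => (phi x).1) ;
  rf_cont2 : continuous (fun x => (phi x).2) ;
  rf_pd1 : has_pd1 (fun x => (phi x).1) (fun x => ('D_(1, 0) phi x).1) ;
  rf_pd2 : has_pd2 (fun x => (phi x).2) (fun x => ('D_(0, 1) phi x).2) ;
  rf_cpd1 : continuous (fun x => ('D_(1, 0) phi x).1) ;
  rf_cpd2 : continuous (fun x => ('D_(0, 1) phi x).2) ;
  rf_dot : forall x, dot (phi x) (phi x) <= 1 ;
  rf_supp : exists S, [/\ compact S, S `<=` Omega & forall x, ~ S x -> phi x = 0] }.

Lemma continuous_fst_comp phi : continuous phi -> continuous (fun x => (phi x).1).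
Proof. by move=> cphi x; apply: (@continuous_comp _ _ _ phi fst); [exact: cphi|exact: cvg_fst]. Qed.

Lemma continuous_snd_comp phi : continuous phi -> continuous (fun x => (phi x).2).
Proof. by move=> cphi x; apply: (@continuous_comp _ _ _ phi snd); [exact: cphi|exact: cvg_snd]. Qed.

Lemma test_field_regular Omega phi : test_field Omega phi -> regular_field Omega phi.
Proof.
move=> [C1 cS SO phi1].
have S0 x : ~ closure [set x | phi x != 0] x -> phi x = 0.
  move=> nS; apply/eqP/negPn/negP => px; apply: nS; exact: subset_closure.
have [M SM] := compact_box_bounded cS.
have out x : M < `|x| -> phi x = 0.
  by move=> Mx; apply: S0 => /SM/boxP; rewrite leNgt Mx.
have [d1 c1] := C1 (1, 0); have [d2 c2] := C1 (0, 1).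
have p11 : has_pd1 (fun x => (phi x).1) (fun x => ('D_(1, 0) phi x).1).
  exact: (derivable_pd1 continuous_fstR (fun _ _ => erefl) (fun _ _ => erefl) d1).
have p21 : has_pd1 (fun x => (phi x).2) (fun x => ('D_(1, 0) phi x).2).
  exact: (derivable_pd1 continuous_sndR (fun _ _ => erefl) (fun _ _ => erefl) d1).
have p12 : has_pd2 (fun x => (phi x).1) (fun x => ('D_(0, 1) phi x).1).
  exact: (derivable_pd2 continuous_fstR (fun _ _ => erefl) (fun _ _ => erefl) d2).
have p22 : has_pd2 (fun x => (phi x).2) (fun x => ('D_(0, 1) phi x).2).
  exact: (derivable_pd2 continuous_sndR (fun _ _ => erefl) (fun _ _ => erefl) d2).
have out1 x : M < `|x| -> (phi x).1 = 0 by move=> /out ->.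
have out2 x : M < `|x| -> (phi x).2 = 0 by move=> /out ->.
have [C11 [_ h11]] := compact_support_bounded (continuous_fst_comp c1) (pd1_outside p11 out1).
have [C12 [_ h12]] := compact_support_bounded (continuous_fst_comp c2) (pd2_outside p12 out1).
have [C21 [_ h21]] := compact_support_bounded (continuous_snd_comp c1) (pd1_outside p21 out2).
have [C22 [_ h22]] := compact_support_bounded (continuous_snd_comp c2) (pd2_outside p22 out2).
split => //.
- apply: (@pd_continuous _ _ _ (Num.max C11 C12) p11 p12) => x; rewrite le_max.
    by rewrite h11.
  by rewrite h12 orbT.
- apply: (@pd_continuous _ _ _ (Num.max C21 C22) p21 p22) => x; rewrite le_max.
    by rewrite h21.
  by rewrite h22 orbT.
- exact: (continuous_fst_comp c1).
- exact: (continuous_snd_comp c2).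
- by move=> x; apply/enorm_le1.
- by exists (closure [set x | phi x != 0]).
Qed.

Lemma is_derive_pair f g x v (a b : R) : is_derive x v f a -> is_derive x v g b ->
  is_derive x v (fun y => (f y, g y)) (a, b).
Proof.
move=> [df <-] [dg <-].
have cl : h^-1 *: (((fun y => (f y, g y)) \o shift x) (h *: v) - (f x, g x)) @[h --> (0 : R)^'] -->
    ('D_v f x, 'D_v g x).
  exact: (@cvg_pair _ _ _ _ (nbhs ('D_v f x)) (nbhs ('D_v g x)) _ _ _ _ _ df dg).
by apply: DeriveDef; [apply/cvg_ex; eexists; exact: cl|exact: cvg_lim].
Qed.

Lemma compact_thick Omega (S : set (R * R)) : open Omega -> compact S -> S `<=` Omega ->
  exists e : R, 0 < e /\ forall x y, S x -> `|x - y| <= e -> Omega y.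
Proof.
move=> oO /compact_near_coveringP cS SO.
have [] := cS R (nbhs (0 : R)^'+) (fun d x => forall y, `|x - y| <= d -> Omega y).
  move=> x Sx; have /nbhs_normP [d /= d0 dP] := open_nbhs_nbhs (conj oO (SO _ Sx)).
  exists (ball x (d / 2), [set t : R | t < d / 2]).
    split; first by apply: nbhsx_ballx; rewrite divr_gt0.
    by exists (d / 2); rewrite /= ?divr_gt0 // => t /=; rewrite sub0r normrN => /(le_lt_trans (ler_norm _)).
  move=> [z t] /= [xz td] y zy; apply: dP => /=.
  move: xz; rewrite -ball_normE /= => xz.
  by have := ler_distD z x y; lra.
move=> d /= d0 dP; exists (d / 2); split; first by rewrite divr_gt0.
move=> x y Sx xy; apply: (dP (d / 2)) xy => //=; last by rewrite divr_gt0.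
by rewrite sub0r normrN gtr0_norm ?divr_gt0 //; lra.
Qed.

(** A variation bound free of suprema and infinite values. The integral may run over the whole plane
    because the divergence of a test field vanishes off [Omega]; [total_var_tv_le] relates it to
    [total_var]. *)
Definition tv_le Omega w (V : R) := forall phi, test_field Omega phi ->
  \int[mu2]_x (w x * divergence phi x) <= V.

Lemma dot_le1_bound1 (x : R * R) : dot x x <= 1 -> `|x.1| <= 1.
Proof.
move=> x1; have : `|x.1| ^+ 2 <= 1.
  by rewrite real_normK ?num_real //; move: x1; rewrite /dot -!expr2; have := sqr_ge0 x.2; lra.
by rewrite -[X in _ <= X](expr1n R 2) ler_pXn2r ?nnegrE.
Qed.

Lemma dot_le1_bound2 (x : R * R) : dot x x <= 1 -> `|x.2| <= 1.
Proof. by move=> x1; apply: (@dot_le1_bound1 (x.2, x.1)); rewrite /dot /= addrC. Qed.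

Lemma CauchySchwarz (x y : R * R) : dot x y ^+ 2 <= dot x x * dot y y.
Proof.
rewrite -subr_ge0; have -> : dot x x * dot y y - dot x y ^+ 2 = (x.1 * y.2 - x.2 * y.1) ^+ 2.
  by rewrite /dot; ring.
exact: sqr_ge0.
Qed.

Lemma dot_le_enorm (x y : R * R) : dot y y <= 1 -> dot x y <= enorm x.
Proof.
move=> y1; rewrite (le_trans (ler_norm _)) // -sqrtr_sqr /enorm ler_sqrt ?dot_ge0 //.
by rewrite (le_trans (CauchySchwarz x y)) // ler_piMr // dot_ge0.
Qed.

(* The mollified field is admissible in the definition of the variation, and mollification is self-adjoint. *)
Lemma tv_mollify Omega (S : set (R * R)) w (V : R) : open Omega -> compact S -> S `<=` Omega ->
  mu2.-integrable setT (EFin \o w) -> tv_le Omega w V ->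
  exists e0 : R, 0 < e0 /\ forall e (f1 f2 : R * R -> R), 0 < e < e0 ->
    continuous f1 -> continuous f2 -> (forall x, dot (f1 x, f2 x) (f1 x, f2 x) <= 1) ->
    (forall x, ~ S x -> f1 x = 0) -> (forall x, ~ S x -> f2 x = 0) ->
    - ((mass e)^-1 * \int[mu2]_x (f1 x * conv (drho e (1, 0)) w x) +
       (mass e)^-1 * \int[mu2]_x (f2 x * conv (drho e (0, 1)) w x)) <= V.
Proof.
move=> oO cS SO iw wV; have [e0 [e00 he0]] := compact_thick oO cS SO.
exists e0; split => // e f1 f2 /andP[egt0 ele] cf1 cf2 f12 fS1 fS2.
have ege0 := ltW egt0; have me := mass_gt0 egt0.
have ime : 0 <= (mass e)^-1 by rewrite invr_ge0 ltW.
have [M SM] := compact_box_bounded cS.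
have out1 x : M < `|x| -> f1 x = 0.
  by move=> Mx; apply: fS1 => /SM/boxP; rewrite leNgt Mx.
have out2 x : M < `|x| -> f2 x = 0.
  by move=> Mx; apply: fS2 => /SM/boxP; rewrite leNgt Mx.
have if1 := continuous_box_integrable cf1 out1.
have if2 := continuous_box_integrable cf2 out2.
pose phi (x : R * R) : R * R := (moll e f1 x, moll e f2 x).
have dphi x v : is_derive x v phi ((mass e)^-1 * conv (drho e v) f1 x, (mass e)^-1 * conv (drho e v) f2 x).
  apply: is_derive_pair.
    exact: (is_deriveZ (mass e)^-1 (is_derive_conv x v ege0 if1)).
  exact: (is_deriveZ (mass e)^-1 (is_derive_conv x v ege0 if2)).
(* Mollifying enlarges the support by at most [e] in the sup norm, so it stays inside [Omega] by the
   choice of [e0]. *)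
pose K := [set x + y | x in S & y in box e].
have cK : compact K.
  have -> : K = (fun z : (R * R) * (R * R) => z.1 + z.2) @` (S `*` box e).
    apply/seteqP; split => [_ [x Sx [y ey <-]]|_ [[x y] [/= Sx ey] <-]]; first by exists (x, y).
    by exists x => //; exists y.
  apply: continuous_compact; last by apply: compact_setX => //; exact: compact_box.
  apply: continuous_subspaceT => z; apply: cvgD; [exact: cvg_fst|exact: cvg_snd].
have phiK x : phi x != 0 -> K x.
  move=> px; apply: contrapT => nK; move/negP : px; apply; apply/eqP.
  have r0 y : S y -> rho e (x - y) = 0.
    move=> Sy; apply: rho_outside => //; rewrite leNgt; apply/negP => xy; apply: nK.
    exists y => //; exists (x - y); last by rewrite addrC subrK.
    exact/boxP/ltW.
  rewrite /phi /moll /conv.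
  have -> : (fun y => f1 y * rho e (x - y)) = (fun=> 0).
    by apply/funext => y; have [/r0 ->|/fS1 ->] := pselect (S y); rewrite ?mulr0 ?mul0r.
  have -> : (fun y => f2 y * rho e (x - y)) = (fun=> 0).
    by apply/funext => y; have [/r0 ->|/fS2 ->] := pselect (S y); rewrite ?mulr0 ?mul0r.
  by rewrite Rintegral_cst // mul0r mulr0.
have KO : K `<=` Omega.
  move=> _ [x Sx [y /boxP ey <-]]; apply: (he0 x) => //.
  by rewrite opprD addNKr normrN (le_trans ey) // ltW.
have clK : closed K by apply: compact_closed => //; exact: norm_hausdorff.
have clphi : closure [set x | phi x != 0] `<=` K.
  by rewrite ((closure_id K).1 clK); apply: closure_subset => x /=; exact: phiK.
have tphi : test_field Omega phi.
  split.
  - move=> v; split => [x|]; first by have [] := dphi x v.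
    have -> : (fun x => 'D_v phi x) = (fun x => ((mass e)^-1 * conv (drho e v) f1 x, (mass e)^-1 * conv (drho e v) f2 x)).
      by apply/funext => x; have [_ ->] := dphi x v.
    by apply: cont_pair; apply: contM; [exact: cont_cst|exact: continuous_conv_drho|exact: cont_cst|exact: continuous_conv_drho].
  - by apply: subclosed_compact clphi => //; exact: closed_closure.
  - exact: subset_trans clphi KO.
  (* The norm of a vector average is estimated through scalars: E^2 is the average of the scalar
     products of phi x with the vectors (f1 y, f2 y) of norm at most 1, so E^2 <= E and hence E <=
     1. *)
  - move=> x; pose E := enorm (phi x).
    have i1 := integrable_conv x if1 (continuous_rho ege0) (rho_bounded e).
    have i2 := integrable_conv x if2 (continuous_rho ege0) (rho_bounded e).
    have ir := integrable_rho_subl x ege0.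
    have EE : E ^+ 2 = (mass e)^-1 * \int[mu2]_y (dot (phi x) (f1 y, f2 y) * rho e (x - y)).
      rewrite /E /enorm sqr_sqrtr ?dot_ge0 //.
      have -> : \int[mu2]_y (dot (phi x) (f1 y, f2 y) * rho e (x - y)) =
          (phi x).1 * conv (rho e) f1 x + (phi x).2 * conv (rho e) f2 x.
        rewrite /conv -(RintegralZl _ measurableT i1) -(RintegralZl _ measurableT i2).
        rewrite -(RintegralD measurableT (integrable_scale _ measurableT i1) (integrable_scale _ measurableT i2)).
        by apply: eq_Rintegral => y _; rewrite /dot /= mulrDl !mulrA.
      by rewrite mulrDr /dot; congr (_ + _); rewrite mulrCA.
    have EE1 : E ^+ 2 <= E.
      have E0 : 0 <= E by rewrite /E /enorm sqrtr_ge0.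
      rewrite {}EE (ler_pdivrMl _ _ me) -(integral_rho_shiftC x ege0) mulrC -(RintegralZl _ measurableT ir).
      have E1 y : dot (phi x) (f1 y, f2 y) * rho e (x - y) = (phi x).1 * (f1 y * rho e (x - y)) + (phi x).2 * (f2 y * rho e (x - y)).
        by rewrite /dot /= mulrDl !mulrA.
      apply: le_Rintegral.
      - exact: measurableT.
      - have := integrable_add (integrable_scale (phi x).1 measurableT i1) (integrable_scale (phi x).2 measurableT i2).
        by apply: eq_integrable => // y _ /=; rewrite E1.
      - exact: (integrable_scale _ measurableT ir).
      - by move=> y _; apply: ler_wpM2r; [exact: rho_ge0|apply: dot_le_enorm].
    by rewrite -/E; nra.
have := wV _ tphi.
have mk v : measurable_fun setT (fun z : (R * R) * (R * R) => drho e v (z.1 - z.2)).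
  by apply: measurable_kernel; exact: continuous_drho.
(* Exchanging the two functions reverses the argument of the kernel, and [drho] is odd: hence the
   minus sign. *)
have swap v f : mu2.-integrable setT (EFin \o f) ->
    \int[mu2]_x (f x * conv (drho e v) w x) = - \int[mu2]_x (w x * conv (drho e v) f x).
  move=> fi; have [B [_ hB]] := drho_bounded v ege0.
  have := Rfubini_kernel2 fi iw (mk v) (fun z => hB _) => /= ->.
  rewrite -[RHS]mulN1r -RintegralZl //; last first.
    have := integrable_kernel2 iw fi (mk v) (fun z => hB _); exact: eq_integrable.
  apply: eq_Rintegral => y _; rewrite mulN1r -mulrN; congr (_ * _).
  rewrite -mulN1r -RintegralZl //; last exact: (integrable_conv y fi (continuous_drho (v := v) ege0) hB).
  by apply: eq_Rintegral => x _; rewrite mulN1r -mulrN -drhoN opprB.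
have aux (m a b a' b' : R) : a = - a' -> b = - b' -> m * a' + m * b' <= V -> - (m * a + m * b) <= V.
  by move=> -> ->; rewrite !mulrN opprD !opprK.
move=> tV; apply: (aux _ _ _ _ _ (swap (1, 0) f1 if1) (swap (0, 1) f2 if2)).
apply: le_trans tV.
have iwc v f : mu2.-integrable setT (EFin \o f) -> mu2.-integrable setT (EFin \o (fun x => w x * conv (drho e v) f x)).
  move=> fi; have [B [_ hB]] := drho_bounded v ege0.
  have := integrable_kernel2 iw fi (mk v) (fun z => hB _); exact: eq_integrable.
have E := Rintegral_lincomb (mass e)^-1 (mass e)^-1 (iwc (1, 0) f1 if1) (iwc (0, 1) f2 if2).
rewrite -{}E le_eqVlt; apply/orP; left; apply/eqP; apply: eq_Rintegral => x _.
rewrite /divergence; have [_ ->] := dphi x (1, 0); have [_ ->] := dphi x (0, 1).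
by rewrite /= mulrDr; congr (_ + _); rewrite mulrCA.
Qed.

End test_fields.

(** * Rules for partial derivatives and a smoothed truncation *)

Section partial_calculus.
Context {R : realType}.
Implicit Types (f g w : R * R -> R) (e : R).

Lemma has_pd1D f f1 g g1 : has_pd1 f f1 -> has_pd1 g g1 ->
  has_pd1 (fun x => f x + g x) (fun x => f1 x + g1 x).
Proof. by move=> df dg a b; exact: is_deriveD (df a b) (dg a b). Qed.

Lemma has_pd2D f f1 g g1 : has_pd2 f f1 -> has_pd2 g g1 ->
  has_pd2 (fun x => f x + g x) (fun x => f1 x + g1 x).
Proof. by move=> df dg a b; exact: is_deriveD (df a b) (dg a b). Qed.

Lemma has_pd1B f f1 g g1 : has_pd1 f f1 -> has_pd1 g g1 ->
  has_pd1 (fun x => f x - g x) (fun x => f1 x - g1 x).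
Proof. by move=> df dg a b; exact: is_deriveB (df a b) (dg a b). Qed.

Lemma has_pd2B f f1 g g1 : has_pd2 f f1 -> has_pd2 g g1 ->
  has_pd2 (fun x => f x - g x) (fun x => f1 x - g1 x).
Proof. by move=> df dg a b; exact: is_deriveB (df a b) (dg a b). Qed.

Lemma has_pd1M f f1 g g1 : has_pd1 f f1 -> has_pd1 g g1 ->
  has_pd1 (fun x => f x * g x) (fun x => f x * g1 x + g x * f1 x).
Proof. by move=> df dg a b; exact: is_deriveM (df a b) (dg a b). Qed.

Lemma has_pd2M f f1 g g1 : has_pd2 f f1 -> has_pd2 g g1 ->
  has_pd2 (fun x => f x * g x) (fun x => f x * g1 x + g x * f1 x).
Proof. by move=> df dg a b; exact: is_deriveM (df a b) (dg a b). Qed.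

Lemma has_pd1_cst (k : R) : has_pd1 (fun=> k) (fun=> 0).
Proof. by move=> a b; exact: is_derive_cst. Qed.

Lemma has_pd2_cst (k : R) : has_pd2 (fun=> k) (fun=> 0).
Proof. by move=> a b; exact: is_derive_cst. Qed.

Lemma has_pd1_comp (s ds : R -> R) f f1 : (forall t, is_derive t (1 : R) s (ds t)) ->
  has_pd1 f f1 -> has_pd1 (fun x => s (f x)) (fun x => ds (f x) * f1 x).
Proof. by move=> hs df a b; apply: (@is_derive1_comp _ s (fun t => f (t, b))). Qed.

Lemma has_pd2_comp (s ds : R -> R) f f1 : (forall t, is_derive t (1 : R) s (ds t)) ->
  has_pd2 f f1 -> has_pd2 (fun x => s (f x)) (fun x => ds (f x) * f1 x).
Proof. by move=> hs df a b; apply: (@is_derive1_comp _ s (fun t => f (a, t))). Qed.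

Lemma has_pd1_dot (n : R * R) : has_pd1 (fun x => dot x n) (fun=> n.1).
Proof.
move=> a b; apply: (@is_derive_quadratic _ _ _ _ _ _ _ 0 1) => // h _.
by rewrite mul0r /dot /= /GRing.scale /= (_ : _ - _ = 0) ?normr0 //; ring.
Qed.

Lemma has_pd2_dot (n : R * R) : has_pd2 (fun x => dot x n) (fun=> n.2).
Proof.
move=> a b; apply: (@is_derive_quadratic _ _ _ _ _ _ _ 0 1) => // h _.
by rewrite mul0r /dot /= /GRing.scale /= (_ : _ - _ = 0) ?normr0 //; ring.
Qed.

(** A C^1 substitute for the positive part of s - k, within [d] of it. Its slope [dbeta] is 0 up to
    k, rises linearly on [k, k + d] and is 1 afterwards. *)
Definition beta (k d s : R) := (2 * d)^-1 * (pos (s - k) ^+ 2 - pos (s - k - d) ^+ 2).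
Definition dbeta (k d s : R) := d^-1 * (pos (s - k) - pos (s - k - d)).

Lemma is_derive_beta k d s : 0 < d -> is_derive s (1 : R) (beta k d) (dbeta k d s).
Proof.
move=> d0.
have h (c : R) : is_derive s (1 : R) (fun s => pos (s - c) ^+ 2) (2 * pos (s - c) * 1).
  have := @is_derive1_comp _ (fun s => pos s ^+ 2) (fun s => s - c) s _ 1 (is_derive_possq (s - c)).
  apply; apply: (@is_derive_quadratic _ _ _ _ _ _ _ 0 1) => // t _.
  by rewrite mul0r /GRing.scale /= (_ : _ - _ = 0) ?normr0 //; ring.
have E : beta k d = (fun s => (2 * d)^-1 *: (pos (s - k) ^+ 2 - pos (s - (k + d)) ^+ 2)).
  by apply/funext => t; rewrite /beta opprD addrA.
rewrite E; have := is_deriveZ (2 * d)^-1 (is_deriveB (h k) (h (k + d))).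
move=> H; apply: (is_derive_eq H); rewrite /dbeta /GRing.scale /= !mulr1 opprD addrA.
by field; rewrite gt_eqF.
Qed.

Lemma dbeta_01 k d s : 0 < d -> 0 <= dbeta k d s <= 1.
Proof.
move=> d0; rewrite /dbeta mulrC ler_pdivrMr // ler_pdivlMr // mul0r mul1r.
by rewrite /pos; case: (leP (s - k) 0); case: (leP (s - k - d) 0) => *; apply/andP; split; lra.
Qed.

Lemma beta_ge0 k d s : 0 < d -> 0 <= beta k d s.
Proof.
move=> d0; rewrite /beta mulr_ge0 ?invr_ge0 ?mulr_ge0 ?(ltW d0) // subr_ge0.
rewrite ler_pXn2r ?nnegrE ?pos_ge0 //.
by rewrite /pos; case: (leP (s - k) 0); case: (leP (s - k - d) 0) => *; lra.
Qed.

Lemma beta_pos k d s : 0 < d -> `|pos (s - k) - beta k d s| <= d.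
Proof.
move=> d0; have E : 2 * d * beta k d s = pos (s - k) ^+ 2 - pos (s - k - d) ^+ 2.
  by rewrite /beta mulrA divff ?mul1r // mulf_neq0 // gt_eqF.
move: E; rewrite /pos; case: (leP (s - k) 0); case: (leP (s - k - d) 0) => h1 h2 E.
- by rewrite (_ : beta k d s = 0) ?subrr ?normr0 ?ltW //; nra.
- lra.
- rewrite ler_norml; apply/andP; split; nra.
- rewrite ler_norml; apply/andP; split; nra.
Qed.

Lemma continuous_dbeta k d : continuous (dbeta k d).
Proof.
have c (l : R) : continuous (fun t : R => pos (t - l)).
  by apply: cont_comp; [exact: continuous_pos|apply: contB; [move=> t; exact: cvg_id|exact: cont_cst]].
apply: contM; first exact: cont_cst.
apply: contB => //.
have -> : (fun s => pos (s - k - d)) = (fun s => pos (s - (k + d))) by apply/funext => s; rewrite opprD addrA.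
exact: c.
Qed.

Lemma continuous_beta k d : 0 < d -> continuous (beta k d).
Proof.
move=> d0 x; apply: differentiable_continuous; apply/derivable1_diffP.
by have [] := is_derive_beta k x d0.
Qed.

Lemma has_pd1_moll e w : 0 <= e -> (lebesgue_measure \x lebesgue_measure)%E.-integrable setT (EFin \o w) ->
  has_pd1 (moll e w) (fun x => (mass e)^-1 * conv (drho e (1, 0)) w x).
Proof.
move=> e0 iw a b.
have [dd dE] := is_deriveZ (mass e)^-1 (is_derive_conv (a, b) (1, 0) e0 iw).
have {dE} : 'D_(1, 0) (moll e w) (a, b) = (mass e)^-1 * conv (drho e (1, 0)) w (a, b) := dE.
move=> <-.
apply: (@is_derive_line _ R id (moll e w) (a, b) (1, 0) (fun t => (t, b))) => //; first by move=> x; exact: cvg_id.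
by move=> h; apply/pair_equal_spec; rewrite /= /GRing.scale /= mulr1 mulr0 add0r.
Qed.

Lemma has_pd2_moll e w : 0 <= e -> (lebesgue_measure \x lebesgue_measure)%E.-integrable setT (EFin \o w) ->
  has_pd2 (moll e w) (fun x => (mass e)^-1 * conv (drho e (0, 1)) w x).
Proof.
move=> e0 iw a b.
have [dd dE] := is_deriveZ (mass e)^-1 (is_derive_conv (a, b) (0, 1) e0 iw).
have {dE} : 'D_(0, 1) (moll e w) (a, b) = (mass e)^-1 * conv (drho e (0, 1)) w (a, b) := dE.
move=> <-.
apply: (@is_derive_line _ R id (moll e w) (a, b) (0, 1) (fun t => (a, t))) => //; first by move=> x; exact: cvg_id.
by move=> h; apply/pair_equal_spec; rewrite /= /GRing.scale /= mulr1 mulr0 add0r.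
Qed.

End partial_calculus.

Section divergence_identity.
Context {R : realType}.
Notation mu := (@lebesgue_measure R).
Notation mu2 := (mu \x mu)%E.
Variables (u u1 u2 g g1 g2 p1 p2 p11 p22 h h1 h2 : R * R -> R) (a b M : R).
Hypotheses (cu : continuous u) (cu1 : continuous u1) (cu2 : continuous u2).
Hypotheses (cg : continuous g) (cg1 : continuous g1) (cg2 : continuous g2).
Hypotheses (cp1 : continuous p1) (cp2 : continuous p2) (cp11 : continuous p11) (cp22 : continuous p22).
Hypotheses (ch : continuous h) (ch1 : continuous h1) (ch2 : continuous h2).
Hypotheses (du1 : has_pd1 u u1) (du2 : has_pd2 u u2) (dg1 : has_pd1 g g1) (dg2 : has_pd2 g g2).
Hypotheses (dp1 : has_pd1 p1 p11) (dp2 : has_pd2 p2 p22) (dh1 : has_pd1 h h1) (dh2 : has_pd2 h h2).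
Hypotheses (p1M : forall x, M < `|x| -> p1 x = 0) (p2M : forall x, M < `|x| -> p2 x = 0)
  (hM : forall x, M < `|x| -> h x = 0).

Let lhs x := (u x - g x) * (p11 x + p22 x) + g x * (a * h1 x + b * h2 x).
Let rhs x := (u1 x - g1 x) * p1 x + (u2 x - g2 x) * p2 x + h x * (a * g1 x + b * g2 x).

Let clhs : continuous lhs.
Proof.
apply: contD; apply: contM => //; first exact: contB; first exact: contD.
by apply: contD; apply: contM => //; exact: cont_cst.
Qed.

Let crhs : continuous rhs.
Proof.
apply: contD; first by apply: contD; apply: contM => //; exact: contB.
by apply: contM => //; apply: contD; apply: contM => //; exact: cont_cst.
Qed.

Lemma integrable_divergence_lhs : mu2.-integrable setT (EFin \o lhs).
Proof.
apply: (continuous_box_integrable clhs (M := M)) => x Mx.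
rewrite /lhs (pd1_outside dp1 p1M Mx) (pd2_outside dp2 p2M Mx) (pd1_outside dh1 hM Mx) (pd2_outside dh2 hM Mx).
by rewrite !(mulr0, addr0).
Qed.

Lemma integrable_divergence_rhs : mu2.-integrable setT (EFin \o rhs).
Proof.
apply: (continuous_box_integrable crhs (M := M)) => x Mx.
by rewrite /rhs p1M // p2M // hM // !(mulr0, mul0r, addr0).
Qed.

(** The integral of the divergence of ((u - g) p1 + a g h, (u - g) p2 + b g h) is zero, since [p1],
    [p2] and [h] have bounded support; the product rule splits it into the two sides. *)
Lemma divergence_identity : \int[mu2]_x lhs x = - \int[mu2]_x rhs x.
Proof.
pose f1 x := ((u x - g x) * p11 x + p1 x * (u1 x - g1 x)) + (a * (g x * h1 x + h x * g1 x) + g x * h x * 0).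
pose f2 x := ((u x - g x) * p22 x + p2 x * (u2 x - g2 x)) + (b * (g x * h2 x + h x * g2 x) + g x * h x * 0).
have cf1 : continuous f1.
  apply: contD; first by apply: contD; apply: contM => //; exact: contB.
  apply: contD; last by apply: contM; [exact: contM|exact: cont_cst].
  by apply: contM; [exact: cont_cst|apply: contD; exact: contM].
have cf2 : continuous f2.
  apply: contD; first by apply: contD; apply: contM => //; exact: contB.
  apply: contD; last by apply: contM; [exact: contM|exact: cont_cst].
  by apply: contM; [exact: cont_cst|apply: contD; exact: contM].
have F1 : has_pd1 (fun x => (u x - g x) * p1 x + a * (g x * h x)) f1.
  exact: (has_pd1D (has_pd1M (has_pd1B du1 dg1) dp1) (has_pd1M (has_pd1_cst a) (has_pd1M dg1 dh1))).
have F2 : has_pd2 (fun x => (u x - g x) * p2 x + b * (g x * h x)) f2.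
  exact: (has_pd2D (has_pd2M (has_pd2B du2 dg2) dp2) (has_pd2M (has_pd2_cst b) (has_pd2M dg2 dh2))).
have oF1 x : M < `|x| -> (u x - g x) * p1 x + a * (g x * h x) = 0.
  by move=> Mx; rewrite p1M // hM // !mulr0 addr0.
have oF2 x : M < `|x| -> (u x - g x) * p2 x + b * (g x * h x) = 0.
  by move=> Mx; rewrite p2M // hM // !mulr0 addr0.
have I1 := integral_pd1 cf1 F1 oF1.
have I2 := integral_pd2 cf2 F2 oF2.
have if1 := continuous_box_integrable cf1 (pd1_outside F1 oF1).
have if2 := continuous_box_integrable cf2 (pd2_outside F2 oF2).
have aux (l r s t : R) : s = 0 -> t = 0 -> l + r = s + t -> l = - r by move=> -> ->; lra.
apply: (aux _ _ _ _ I1 I2) => {I1 I2 aux}.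
rewrite -(RintegralD measurableT integrable_divergence_lhs integrable_divergence_rhs).
rewrite -(RintegralD measurableT if1 if2).
by apply: eq_Rintegral => x _; rewrite /lhs /rhs /f1 /f2; ring.
Qed.

End divergence_identity.

Lemma mollified_pointwise_aux (R : realType) (a v t C1 C2 d : R) : 0 <= a -> 0 <= v -> 0 <= t ->
  t <= C2 -> v <= C1 -> a * v + (a + d) * v + (a + d) * t <= (2 * C1 + C2) * a + d * (v + t).
Proof. by move=> *; nra. Qed.

Lemma mollified_integral_aux (R : realType) (g a B C1 C2 d q V : R) : 0 <= C1 -> 0 <= C2 -> 0 < d ->
  g <= V -> a <= d -> d * (2 * (C1 + C2) + B + 1) = q -> g + ((2 * C1 + C2) * a + d * B) <= V + q.
Proof.
move=> C10 C20 d0 gV ad dA.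
have : (2 * C1 + C2) * a <= (2 * C1 + C2) * d by rewrite ler_wpM2l // addr_ge0 ?mulr_ge0.
by nra.
Qed.

Section core.
Context {R : realType}.
Notation mu := (@lebesgue_measure R).
Notation mu2 := (mu \x mu)%E.
Implicit Types (f g w : R * R -> R) (phi : R * R -> R * R) (e : R) (Omega : set (R * R)).

Variables (Omega : set (R * R)) (w : R * R -> R) (V N : R).
Hypotheses (oO : open Omega) (iw : mu2.-integrable setT (EFin \o w)).
Hypotheses (wN : forall x, N < `|x| -> w x = 0) (wV : tv_le Omega w V).
Variables (phi : R * R -> R * R).
Hypothesis rphi : regular_field Omega phi.
Variables (n : R * R) (X dX : R -> R) (eta eta1 eta2 : R * R -> R) (S : set (R * R)) (k : R).
Hypotheses (n1 : dot n n = 1) (hX : forall t, is_derive t (1 : R) X (dX t)) (cdX : continuous dX).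
Hypotheses (X01 : forall t, 0 <= X t <= 1).
Hypotheses (ceta : continuous eta) (peta1 : has_pd1 eta eta1) (peta2 : has_pd2 eta eta2).
Hypotheses (ceta1 : continuous eta1) (ceta2 : continuous eta2) (eta01 : forall x, 0 <= eta x <= 1).
Hypotheses (cS : compact S) (SO : S `<=` Omega) (etaS : forall x, ~ S x -> eta x = 0).
Hypotheses (flux : forall x, 0 <= dX (dot x n) * (eta x - dot (phi x) n)).

Let chi (x : R * R) := X (dot x n).
Let deta (x : R * R) := n.1 * eta1 x + n.2 * eta2 x.

Let cX : continuous X.
Proof. by move=> x; apply: differentiable_continuous; apply/derivable1_diffP; have [] := hX x. Qed.

Let cchi : continuous chi.
Proof. by apply: cont_comp => //; exact: continuous_dot. Qed.

Let cdchi : continuous (fun x => dX (dot x n)).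
Proof. by apply: cont_comp => //; exact: continuous_dot. Qed.

Let p1 x := (phi x).1.
Let p2 x := (phi x).2.
Let p11 x := ('D_(1, 0) phi x).1.
Let p22 x := ('D_(0, 1) phi x).2.

Let smooth_identity_bound (e d : R) : 0 < e -> 0 < d ->
  let we := moll e w in
  let we1 x := (mass e)^-1 * conv (drho e (1, 0)) w x in
  let we2 x := (mass e)^-1 * conv (drho e (0, 1)) w x in
  let psi1 x := (1 - chi x * dbeta k d (we x)) * p1 x + chi x * dbeta k d (we x) * eta x * n.1 in
  let psi2 x := (1 - chi x * dbeta k d (we x)) * p2 x + chi x * dbeta k d (we x) * eta x * n.2 in
  [/\ continuous psi1, continuous psi2, forall x, dot (psi1 x, psi2 x) (psi1 x, psi2 x) <= 1 &
  \int[mu2]_x ((we x - chi x * beta k d (we x)) * divergence phi x + chi x * beta k d (we x) * deta x)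
    <= - (\int[mu2]_x (psi1 x * we1 x) + \int[mu2]_x (psi2 x * we2 x))].
Proof.
move=> e0 d0 we we1 we2 psi1 psi2; have e0' := ltW e0.
have [cp1 cp2 pp1 pp2 cp11 cp22 phi1 [K [cK KO phiK]]] := rphi.
have cwe : continuous we by exact: continuous_moll.
have cwe1 : continuous we1 by apply: contM; [exact: cont_cst|exact: continuous_conv_drho].
have cwe2 : continuous we2 by apply: contM; [exact: cont_cst|exact: continuous_conv_drho].
have dwe1 : has_pd1 we we1 by exact: has_pd1_moll.
have dwe2 : has_pd2 we we2 by exact: has_pd2_moll.
clearbody we we1 we2.
have cb : continuous (fun x => beta k d (we x)) by apply: cont_comp => //; exact: continuous_beta.
have cdb : continuous (fun x => dbeta k d (we x)) by apply: cont_comp => //; exact: continuous_dbeta.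
have cc : continuous (fun x => chi x * dbeta k d (we x)) by exact: (contM cchi cdb).
have cpsi1 : continuous psi1.
  exact: (contD (contM (contB (@cont_cst _ _ 1) cc) cp1) (contM (contM cc ceta) (@cont_cst _ _ n.1))).
have cpsi2 : continuous psi2.
  exact: (contD (contM (contB (@cont_cst _ _ 1) cc) cp2) (contM (contM cc ceta) (@cont_cst _ _ n.2))).
have [M1 KM] := compact_box_bounded cK; have [M2 SM] := compact_box_bounded cS.
pose M := Num.max M1 M2.
have outphi x : M < `|x| -> phi x = 0.
  by rewrite gt_max => /andP[Mx _]; apply: phiK => /KM/boxP; rewrite leNgt Mx.
have outeta x : M < `|x| -> eta x = 0.
  by rewrite gt_max => /andP[_ Mx]; apply: etaS => /SM/boxP; rewrite leNgt Mx.
have outeta1 := pd1_outside peta1 outeta; have outeta2 := pd2_outside peta2 outeta.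
have outp1 x : M < `|x| -> p1 x = 0 by move=> /outphi h; rewrite /p1 h.
have outp2 x : M < `|x| -> p2 x = 0 by move=> /outphi h; rewrite /p2 h.
have outp11 := pd1_outside pp1 outp1; have outp22 := pd2_outside pp2 outp2.
split => //.
  move=> x; have phix := phi1 x; have [/andP[X0 X1] /andP[b0 b1]] := (X01 (dot x n), dbeta_01 k (we x) d0).
  have /andP[e01 e11] := eta01 x.
  have : 0 <= chi x * dbeta k d (we x) <= 1.
    by rewrite mulr_ge0 //= -[leRHS]mulr1 ler_pM.
  rewrite /psi1 /psi2; move: (chi x * dbeta k d (we x)) => c /andP[c0 c1].
  have E2 : c * eta x <= c by rewrite ler_piMr.
  have cs : dot (phi x) n <= 1.
    have := CauchySchwarz (phi x) n; rewrite n1 mulr1; have := dot_ge0 (phi x); nra.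
  have cs' : - 1 <= dot (phi x) n.
    have := CauchySchwarz (phi x) n; rewrite n1 mulr1; have := dot_ge0 (phi x); nra.
  have -> : dot ((1 - c) * p1 x + c * eta x * n.1, (1 - c) * p2 x + c * eta x * n.2)
    ((1 - c) * p1 x + c * eta x * n.1, (1 - c) * p2 x + c * eta x * n.2) =
    (1 - c) ^+ 2 * dot (phi x) (phi x) + 2 * (1 - c) * (c * eta x) * dot (phi x) n + (c * eta x) ^+ 2 * dot n n.
    by rewrite /dot /p1 /p2 /=; ring.
  have E0 : 0 <= c * eta x by rewrite mulr_ge0.
  rewrite n1 mulr1; move: (c * eta x) E2 E0 => ce E2 E0.
  (* Replacing both phi.phi and phi.n by their bound 1 leaves the square of 1 - c + ce, a number in
     [0, 1]. *)
  apply: (@le_trans _ _ ((1 - c) ^+ 2 * 1 + 2 * (1 - c) * ce * 1 + ce ^+ 2)).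
    rewrite lerD2r; apply: lerD; first by rewrite ler_wpM2l ?sqr_ge0.
    by rewrite ler_wpM2l // !mulr_ge0 // subr_ge0.
  have : 0 <= 1 - c + ce <= 1 by apply/andP; split; lra.
  move=> /andP[h1 h2]; nra.
pose b x := beta k d (we x); pose db x := dbeta k d (we x); pose dchi (x : R * R) := dX (dot x n).
have pchi1 : has_pd1 chi (fun x => dchi x * n.1) by exact: (has_pd1_comp hX (has_pd1_dot n)).
have pchi2 : has_pd2 chi (fun x => dchi x * n.2) by exact: (has_pd2_comp hX (has_pd2_dot n)).
have pb1 : has_pd1 b (fun x => db x * we1 x).
  by apply: has_pd1_comp dwe1 => t; exact: is_derive_beta.
have pb2 : has_pd2 b (fun x => db x * we2 x).
  by apply: has_pd2_comp dwe2 => t; exact: is_derive_beta.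
have pcb1 := has_pd1M pchi1 pb1; have pcb2 := has_pd2M pchi2 pb2.
have cg : continuous (fun x => chi x * b x) by exact: (contM cchi cb).
have cg1 : continuous (fun x => chi x * (db x * we1 x) + b x * (dchi x * n.1)).
  exact: (contD (contM cchi (contM cdb cwe1)) (contM cb (contM cdchi (@cont_cst _ _ n.1)))).
have cg2 : continuous (fun x => chi x * (db x * we2 x) + b x * (dchi x * n.2)).
  exact: (contD (contM cchi (contM cdb cwe2)) (contM cb (contM cdchi (@cont_cst _ _ n.2)))).
have I := divergence_identity n.1 n.2 cwe cwe1 cwe2 cg cg1 cg2 cp1 cp2 cp11 cp22 ceta ceta1 ceta2
  dwe1 dwe2 pcb1 pcb2 pp1 pp2 peta1 peta2 outp1 outp2 outeta.
have iR := integrable_divergence_rhs n.1 n.2 cwe1 cwe2 cg1 cg2 cp1 cp2 ceta outp1 outp2 outeta.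
have ip1 : mu2.-integrable setT (EFin \o (fun x => psi1 x * we1 x)).
  apply: (continuous_box_integrable (contM cpsi1 cwe1) (M := M)) => x Mx.
  by rewrite /psi1 outp1 // outeta // !(mulr0, mul0r, addr0).
have ip2 : mu2.-integrable setT (EFin \o (fun x => psi2 x * we2 x)).
  apply: (continuous_box_integrable (contM cpsi2 cwe2) (M := M)) => x Mx.
  by rewrite /psi2 outp2 // outeta // !(mulr0, mul0r, addr0).
rewrite [leLHS]I lerN2 -(RintegralD measurableT ip1 ip2).
apply: le_Rintegral.
- exact: measurableT.
- exact: integrable_add ip1 ip2.
- exact: iR.
move=> x _; rewrite -subr_ge0.
have bx0 : 0 <= b x by exact: beta_ge0.
have := mulr_ge0 bx0 (flux x); congr (0 <= _).
have nn : n.1 * n.1 + n.2 * n.2 = 1 by exact: n1.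
have -> : dot (phi x) n = p1 x * n.1 + p2 x * n.2 by [].
rewrite -[eta x in LHS]mulr1 -nn /psi1 /psi2 /dchi /db /b /chi /p1 /p2; ring.
Qed.

Let cdiv : continuous (fun x => divergence phi x).
Proof. by have [_ _ _ _ c1 c2 _ _] := rphi; exact: (contD c1 c2). Qed.

Let cdeta : continuous deta.
Proof. exact: (contD (contM (@cont_cst _ _ n.1) ceta1) (contM (@cont_cst _ _ n.2) ceta2)). Qed.

Let supports : exists M, [/\ forall x, M < `|x| -> divergence phi x = 0 & forall x, M < `|x| -> deta x = 0].
Proof.
have [cp1 cp2 pp1 pp2 cp11 cp22 phi1 [K [cK KO phiK]]] := rphi.
have [M1 KM] := compact_box_bounded cK; have [M2 SM] := compact_box_bounded cS.
pose M := Num.max M1 M2.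
have outphi x : M < `|x| -> phi x = 0.
  by rewrite gt_max => /andP[Mx _]; apply: phiK => /KM/boxP; rewrite leNgt Mx.
have outeta x : M < `|x| -> eta x = 0.
  by rewrite gt_max => /andP[_ Mx]; apply: etaS => /SM/boxP; rewrite leNgt Mx.
have outp1 x : M < `|x| -> (phi x).1 = 0 by move=> /outphi ->.
have outp2 x : M < `|x| -> (phi x).2 = 0 by move=> /outphi ->.
exists M; split => x Mx.
  by rewrite /divergence (pd1_outside pp1 outp1 Mx) (pd2_outside pp2 outp2 Mx) addr0.
by rewrite /deta (pd1_outside peta1 outeta Mx) (pd2_outside peta2 outeta Mx) !mulr0 addr0.
Qed.

Let mw : measurable_fun setT w. Proof. by apply/measurable_EFinP; exact: measurable_int iw. Qed.

Let mtrunc : measurable_fun setT (fun x => pos (w x - k)).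
Proof. by apply: measurable_maxr => //; exact: measurable_funB. Qed.

(* In terms of the mollified w, the left-hand side tests w with the field
   (1 - chi beta'(w)) phi + chi beta'(w) eta n, a convex combination of phi and
   eta n, hence of norm at most 1. *)
Lemma truncation_bound :
  mu2.-integrable setT (EFin \o (fun x => (w x - chi x * pos (w x - k)) * divergence phi x + chi x * pos (w x - k) * deta x)) /\
  \int[mu2]_x ((w x - chi x * pos (w x - k)) * divergence phi x + chi x * pos (w x - k) * deta x) <= V.
Proof.
have [M [divM detaM]] := supports.
have [C1 [C10 hC1]] := compact_support_bounded cdiv divM.
have [C2 [C20 hC2]] := compact_support_bounded cdeta detaM.
have idiv := continuous_box_integrable cdiv divM.
have ideta := continuous_box_integrable cdeta detaM.
have chi01 x : 0 <= chi x <= 1 by exact: X01.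
pose G x := (w x - chi x * pos (w x - k)) * divergence phi x + chi x * pos (w x - k) * deta x.
have mG : measurable_fun setT G.
  apply: measurable_funD; apply: measurable_funM.
  - apply: measurable_funB => //; apply: measurable_funM => //; exact: continuous_measurable2.
  - exact: continuous_measurable2.
  - apply: measurable_funM => //; exact: continuous_measurable2.
  - exact: continuous_measurable2.
have pw x : pos (w x - k) <= `|w x| + `|k|.
  by apply: pos_le; [exact: le_trans (ler_norm _) (ler_normB _ _)|exact: addr_ge0].
have iaw := integrable_norm_fin measurableT iw.
have iadiv := integrable_norm_fin measurableT idiv.
have iadeta := integrable_norm_fin measurableT ideta.
have iD := integrable_add (integrable_scale (2 * C1 + C2) measurableT iaw)
   (integrable_scale `|k| measurableT (integrable_add iadiv iadeta)).
have iG : mu2.-integrable setT (EFin \o G).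
  apply: (le_integrable measurableT _ _ iD); first exact/measurable_EFinP.
  move=> x _; rewrite /= lee_fin [leRHS]ger0_norm; last first.
    by rewrite addr_ge0 // mulr_ge0 // addr_ge0 // mulr_ge0.
  have := pw x; have := pos_ge0 (w x - k); have /andP[] := chi01 x.
  have := hC1 x; have := hC2 x; rewrite /G.
  move: (pos _) (chi x) (divergence phi x) (deta x) => p c dv dt hdt hdv c0 c1 p0 ple.
  have cp : 0 <= c * p <= `|w x| + `|k|.
    by rewrite mulr_ge0 //= (le_trans _ ple) // ler_piMl.
  move/andP: cp => [cp0 cple].
  rewrite (le_trans (ler_normD _ _)) // !normrM [`|c|]ger0_norm // [`|p|]ger0_norm //.
  have h1 : `|w x - c * p| <= 2 * `|w x| + `|k|.
    by rewrite (le_trans (ler_normB _ _)) // [`|c * p|]ger0_norm //; lra.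
  have a0 := normr_ge0 (w x); have b0 := normr_ge0 k.
  have v0 := normr_ge0 dv; have t0 := normr_ge0 dt.
  apply: (@le_trans _ _ ((2 * `|w x| + `|k|) * `|dv| + (`|w x| + `|k|) * `|dt|)).
    by apply: lerD; apply: ler_wpM2r.
  nra.
split; first exact: iG.
apply/ler_addgt0Pr => q q0.
(* Replacing [w] by its mollification costs at most (2 C1 + C2) d, replacing [pos] by [beta] costs
   [d] times the two L^1 norms; [d] is chosen so that the sum is at most [q]. *)
pose A := 2 * (C1 + C2) + (\int[mu2]_x `|divergence phi x| + \int[mu2]_x `|deta x|).
have A0 : 0 <= A by rewrite /A !addr_ge0 ?mulr_ge0 ?addr_ge0 ?Rintegral_ge0.
pose d := q / (A + 1).
have d0 : 0 < d by rewrite divr_gt0 // ltr_wpDl.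
have [e1 [e10 he1]] := moll_L1 iw wN d0.
have [cp1 cp2 pp1 pp2 cp11 cp22 phi1 [K [cK KO phiK]]] := rphi.
have cKS : compact (K `|` S) by exact: compactU.
have KSO : K `|` S `<=` Omega by rewrite subUset.
have [e2 [e20 he2]] := tv_mollify oO cKS KSO iw wV.
pose e := Num.min e1 e2 / 2.
have m0 : 0 < Num.min e1 e2 by rewrite lt_min e10.
have e0 : 0 < e by rewrite divr_gt0.
have em : e < Num.min e1 e2 by rewrite /e ltr_pdivrMr //; lra.
have ee1 : 0 < e < e1 by rewrite e0 (lt_le_trans em) // ge_min lexx.
have ee2 : 0 < e < e2 by rewrite e0 (lt_le_trans em) // ge_min lexx orbT.
have e0' := ltW e0.
have [cpsi1 cpsi2 psi_le1 Ile] := smooth_identity_bound e0 d0.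
have cwe : continuous (moll e w) by exact: continuous_moll.
have cb : continuous (fun x => beta k d (moll e w x)) by apply: cont_comp => //; exact: continuous_beta.
pose Ge x := (moll e w x - chi x * beta k d (moll e w x)) * divergence phi x + chi x * beta k d (moll e w x) * deta x.
have IGe : \int[mu2]_x Ge x <= V.
  apply: (le_trans Ile).
  set psi1 := fun x => _ in cpsi1 psi_le1 *; set psi2 := fun x => _ in cpsi2 psi_le1 *.
  have z1 x : ~ (K `|` S) x -> psi1 x = 0.
    move=> nKS; have nK : ~ K x by move=> ?; apply: nKS; left.
    have nS : ~ S x by move=> ?; apply: nKS; right.
    by rewrite /psi1 /p1 (phiK _ nK) (etaS nS) !(mulr0, mul0r, addr0).
  have z2 x : ~ (K `|` S) x -> psi2 x = 0.
    move=> nKS; have nK : ~ K x by move=> ?; apply: nKS; left.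
    have nS : ~ S x by move=> ?; apply: nKS; right.
    by rewrite /psi2 /p2 (phiK _ nK) (etaS nS) !(mulr0, mul0r, addr0).
  have [MM KSM] := compact_box_bounded cKS.
  have Z1 x : MM < `|x| -> psi1 x = 0.
    by move=> Mx; apply: z1 => /KSM/boxP; rewrite leNgt Mx.
  have Z2 x : MM < `|x| -> psi2 x = 0.
    by move=> Mx; apply: z2 => /KSM/boxP; rewrite leNgt Mx.
  have := he2 e psi1 psi2 ee2 cpsi1 cpsi2 psi_le1 z1 z2; congr (- (_ + _) <= _).
    have J : mu2.-integrable setT (EFin \o (fun x => psi1 x * conv (drho e (1, 0)) w x)).
      apply: (continuous_box_integrable (M := MM)).
        by apply: contM => //; exact: continuous_conv_drho.
      by move=> x /Z1 ->; rewrite mul0r.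
    rewrite -(RintegralZl _ measurableT J); apply: eq_Rintegral => x _.
    by rewrite mulrCA.
  have J : mu2.-integrable setT (EFin \o (fun x => psi2 x * conv (drho e (0, 1)) w x)).
    apply: (continuous_box_integrable (M := MM)).
      by apply: contM => //; exact: continuous_conv_drho.
    by move=> x /Z2 ->; rewrite mul0r.
  rewrite -(RintegralZl _ measurableT J); apply: eq_Rintegral => x _.
  by rewrite mulrCA.
have iGe : mu2.-integrable setT (EFin \o Ge).
  apply: (continuous_box_integrable (M := M)).
    apply: contD; apply: contM => //.
      by apply: contB => //; apply: contM.
    exact: contM.
  by move=> x Mx; rewrite /Ge divM // detaM // !mulr0 addr0.
have iwe := integrable_moll e0' iw wN.
have idif := integrable_norm_fin measurableT (integrable_sub iwe iw).
have iE := integrable_add (integrable_scale (2 * C1 + C2) measurableT idif)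
   (integrable_scale d measurableT (integrable_add iadiv iadeta)).
have Gle x : G x <= Ge x + ((2 * C1 + C2) * `|moll e w x - w x| + d * (`|divergence phi x| + `|deta x|)).
  have hb : `|pos (w x - k) - beta k d (moll e w x)| <= `|moll e w x - w x| + d.
    apply: le_trans (ler_distD (pos (moll e w x - k)) _ _) _; apply: lerD; last exact: beta_pos.
    have := pos_lip (moll e w x - k) (w x - moll e w x); rewrite distrC.
    have -> : moll e w x - k + (w x - moll e w x) = w x - k by ring.
    by rewrite distrC [leRHS]distrC.
  have := hC1 x; have := hC2 x; have /andP[] := chi01 x; move: hb; rewrite /G /Ge.
  move: (w x) (moll e w x) (chi x) (divergence phi x) (deta x) (pos (w x - k)) (beta k d (moll e w x)) => ww we c dv dt p b hb c0 c1 hdt hdv.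
  rewrite -lerBlDl.
  have -> : (ww - c * p) * dv + c * p * dt - ((we - c * b) * dv + c * b * dt) =
    (ww - we) * dv + (- c * (p - b)) * dv + c * (p - b) * dt by ring.
  have q1 : (ww - we) * dv <= `|we - ww| * `|dv| by rewrite (le_trans (ler_norm _)) // normrM distrC.
  have hcp : `|c * (p - b)| <= `|we - ww| + d.
    by rewrite normrM ger0_norm // (le_trans _ hb) // ler_piMl.
  have q2 : (- c * (p - b)) * dv <= (`|we - ww| + d) * `|dv|.
    by rewrite (le_trans (ler_norm _)) // normrM mulNr normrN ler_wpM2r.
  have q3 : c * (p - b) * dt <= (`|we - ww| + d) * `|dt|.
    by rewrite (le_trans (ler_norm _)) // normrM ler_wpM2r.
  apply: le_trans (lerD (lerD q1 q2) q3) _.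
  exact: mollified_pointwise_aux (normr_ge0 _) (normr_ge0 _) (normr_ge0 _) hdt hdv.
have E1 := le_Rintegral measurableT iG (integrable_add iGe iE) (fun x _ => Gle x).
have E2 : \int[mu2]_x (Ge x + ((2 * C1 + C2) * `|moll e w x - w x| + d * (`|divergence phi x| + `|deta x|))) =
  \int[mu2]_x Ge x + ((2 * C1 + C2) * \int[mu2]_x `|moll e w x - w x| + d * (\int[mu2]_x `|divergence phi x| + \int[mu2]_x `|deta x|)).
  rewrite (RintegralD measurableT iGe iE); congr (_ + _).
  rewrite (Rintegral_lincomb _ _ idif (integrable_add iadiv iadeta)); congr (_ + _ * _).
  exact: (RintegralD measurableT iadiv iadeta).
have E3 := he1 e ee1.
have dA : d * (A + 1) = q by rewrite /d divfK // gt_eqF // ltr_wpDl.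
rewrite E2 in E1; apply: (le_trans E1); exact: mollified_integral_aux C10 C20 d0 IGe E3 dA.
Qed.

End core.

Lemma Rdominated_convergence_ae d (T : measurableType d) (R : realType)
  (mu : {measure set T -> \bar R}) (N : set T) (f_ : nat -> T -> R) (f g : T -> R) :
  mu.-negligible N -> (forall n, measurable_fun setT (f_ n)) -> measurable_fun setT f ->
  (forall x, ~ N x -> f_ ^~ x @ \oo --> f x) ->
  mu.-integrable setT (EFin \o g) ->
  (forall n x, `|f_ n x| <= g x) ->
  mu.-integrable setT (EFin \o f) /\
  \int[mu]_x f_ n x @[n --> \oo] --> \int[mu]_x f x.
Proof.
move=> [N' [mN' N'0 NN']] mf_ mf f_f ig f_g.
have [] := @dominated_convergence _ _ _ mu setT measurableT (fun n => EFin \o f_ n) (EFin \o f) (EFin \o g).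
- by move=> n; apply/measurable_EFinP.
- exact/measurable_EFinP.
- exists N'; split => // x /= nx; apply: NN'; apply: contrapT => Nx; apply: nx => _.
  by apply: cvg_EFin; [exact: nearW|exact: f_f].
- exact: ig.
- by apply: aeW => x n Dx; rewrite /= lee_fin f_g.
move=> if_ _ cf; split; first exact: if_.
by apply: fine_cvg; rewrite fineK; [exact: cf|exact: integrable_fin_num].
Qed.

(** * Cutoffs and Hausdorff measure of graphs *)

Section step_function.
Context {R : realType}.
Implicit Types s a c : R.

(* The C^1 quadratic spline rising from 0 at 0 to 1 at 1. *)
Definition stp s := 2 * pos s ^+ 2 - 4 * pos (s - 2^-1) ^+ 2 + 2 * pos (s - 1) ^+ 2.
Definition dstp s := 4 * pos s - 8 * pos (s - 2^-1) + 4 * pos (s - 1).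

Lemma is_derive_possq_shift k s : is_derive s (1 : R) (fun s => pos (s - k) ^+ 2) (2 * pos (s - k)).
Proof.
have h : is_derive s (1 : R) (fun t => t - k) (1 : R).
  have := is_deriveB (is_derive_id s (1 : R)) (is_derive_cst k s (1 : R)); rewrite subr0.
  by rewrite /= (_ : id - cst k = fun t => t - k).
by have := @is_derive1_comp _ (fun u => pos u ^+ 2) (fun t => t - k) s _ _ (is_derive_possq (s - k)) h; rewrite mulr1.
Qed.

Lemma is_derive_stp s : is_derive s (1 : R) stp (dstp s).
Proof.
have h0 := is_deriveZ 2 (is_derive_possq s).
have h1 := is_deriveZ 4 (is_derive_possq_shift 2^-1 s).
have h2 := is_deriveZ 2 (is_derive_possq_shift 1 s).
have := is_deriveD (is_deriveB h0 h1) h2; congr is_derive.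
by rewrite /dstp /GRing.scale /=; ring.
Qed.

Lemma pos_id s : 0 <= s -> pos s = s. Proof. by move=> s0; rewrite /pos max_l. Qed.

Lemma stp_0 s : s <= 0 -> stp s = 0.
Proof. by move=> s0; rewrite /stp !pos0 ?expr0n ?mulr0 ?subr0 ?addr0 //; lra. Qed.

Lemma stp_1 s : 1 <= s -> stp s = 1.
Proof. by move=> s1; rewrite /stp !pos_id; [field|lra..]. Qed.

Lemma dstp_0 s : s <= 0 -> dstp s = 0.
Proof. by move=> s0; rewrite /dstp !pos0 ?mulr0 ?subr0 ?addr0 //; lra. Qed.

Lemma dstp_1 s : 1 <= s -> dstp s = 0.
Proof. by move=> s1; rewrite /dstp !pos_id; [field|lra..]. Qed.

Lemma stp01 s : 0 <= stp s <= 1.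
Proof.
have [s0|s0] := leP s 0; first by rewrite stp_0 // lexx ler01.
have [s1|s1] := leP 1 s; first by rewrite stp_1 // lexx ler01.
have p1 : pos (s - 1) = 0 by apply: pos0; lra.
have [sh|sh] := leP s 2^-1.
  have p2 : pos (s - 2^-1) = 0 by apply: pos0; lra.
  rewrite /stp (pos_id (ltW s0)) p1 p2 expr0n /= !mulr0 subr0 addr0.
  by apply/andP; split; nra.
have p2 : pos (s - 2^-1) = s - 2^-1 by apply: pos_id; lra.
rewrite /stp (pos_id (ltW s0)) p1 p2 expr0n /= mulr0 addr0.
have : (2 * 2^-1 : R) = 1 by rewrite divff.
by move: sh; move: (2^-1 : R) => i sh i2; apply/andP; split; nra.
Qed.

Lemma dstp02 s : 0 <= dstp s <= 2.
Proof.
have [s0|s0] := leP s 0; first by rewrite dstp_0 // lexx ler0n.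
have [s1|s1] := leP 1 s; first by rewrite dstp_1 // lexx ler0n.
have p1 : pos (s - 1) = 0 by apply: pos0; lra.
have [sh|sh] := leP s 2^-1.
  have p2 : pos (s - 2^-1) = 0 by apply: pos0; lra.
  rewrite /dstp (pos_id (ltW s0)) p1 p2 !mulr0 subr0 addr0.
  by apply/andP; split; lra.
have p2 : pos (s - 2^-1) = s - 2^-1 by apply: pos_id; lra.
rewrite /dstp (pos_id (ltW s0)) p1 p2 mulr0 addr0.
by apply/andP; split; lra.
Qed.

Lemma continuous_pos_shift k : continuous (fun s : R => pos (s - k)).
Proof.
have c : continuous (fun s : R => s - k) by apply: contB; [by move=> x; exact: cvg_id|exact: cont_cst].
exact: cont_comp continuous_pos c.
Qed.

Lemma continuous_dstp : continuous dstp.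
Proof.
apply: contD; last by apply: contM; [exact: cont_cst|exact: continuous_pos_shift].
apply: contB; apply: contM; [exact: cont_cst|exact: continuous_pos|exact: cont_cst|exact: continuous_pos_shift].
Qed.

(** For [a] > 0 the step goes from 0 at [c] to 1 at c + 1/a. *)
Definition astp a c s := stp (a * (s - c)).
Definition dastp a c s := a * dstp (a * (s - c)).

Lemma is_derive_astp a c s : is_derive s (1 : R) (astp a c) (dastp a c s).
Proof.
have h : is_derive s (1 : R) (fun t => a * (t - c)) a.
  have h0 := is_deriveB (is_derive_id s (1 : R)) (is_derive_cst c s (1 : R)).
  have := is_deriveZ a h0; rewrite subr0 /GRing.scale /= mulr1.
  by congr is_derive.
by have := @is_derive1_comp _ stp (fun t => a * (t - c)) s _ _ (is_derive_stp (a * (s - c))) h; rewrite mulrC.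
Qed.

Lemma continuous_affine a c : continuous (fun s => a * (s - c)).
Proof.
apply: contM; first exact: cont_cst.
by apply: contB; [by move=> x; exact: cvg_id|exact: cont_cst].
Qed.

Lemma continuous_dastp a c : continuous (dastp a c).
Proof.
apply: contM; first exact: cont_cst.
exact: (@cont_comp _ _ dstp (fun s => a * (s - c)) continuous_dstp (@continuous_affine a c)).
Qed.

Lemma continuous_astp a c : continuous (astp a c).
Proof. by move=> x; apply: differentiable_continuous; apply/derivable1_diffP; have [] := is_derive_astp a c x. Qed.

End step_function.

Section euclidean.
Context {R : realType}.
Notation mu := (@lebesgue_measure R).
Notation mu2 := (mu \x mu)%E.
Implicit Types x y z : R * R.

Lemma enorm_ge0 x : 0 <= enorm x. Proof. exact: sqrtr_ge0. Qed.

Lemma enorm_sqr x : enorm x ^+ 2 = dot x x.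
Proof. by rewrite sqr_sqrtr // dot_ge0. Qed.

Lemma enormN x : enorm (- x) = enorm x.
Proof. by rewrite /enorm dotNl dotNr opprK. Qed.

Lemma norm_dot_le x y : `|dot x y| <= enorm x * enorm y.
Proof.
rewrite -(@ler_pXn2r _ 2) ?nnegrE ?mulr_ge0 ?enorm_ge0 //.
by rewrite real_normK ?num_real // exprMn !enorm_sqr CauchySchwarz.
Qed.

Lemma enormD x y : enorm (x + y) <= enorm x + enorm y.
Proof.
rewrite -(@ler_pXn2r _ 2) ?nnegrE ?addr_ge0 ?enorm_ge0 //.
rewrite sqrrD !enorm_sqr dotDl !dotDr (dotC y x).
have := norm_dot_le x y; rewrite ler_norml => /andP[_]; lra.
Qed.

Lemma enormB x y : enorm (x - y) = enorm (y - x).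
Proof. by rewrite -enormN opprB. Qed.

Lemma enorm_dist z x y : enorm (x - y) <= enorm (x - z) + enorm (z - y).
Proof. by have := enormD (x - z) (z - y); rewrite addrA subrK. Qed.

Lemma norm_le_enorm x : `|x| <= enorm x.
Proof.
by rewrite -(@ler_pXn2r _ 2) ?nnegrE ?enorm_ge0 // enorm_sqr normr_dot.
Qed.

Lemma enorm_le_norm x : enorm x <= 2 * `|x|.
Proof.
rewrite -(@ler_pXn2r _ 2) ?nnegrE ?enorm_ge0 ?mulr_ge0 // enorm_sqr.
have := dot_le_norm x x; rewrite ger0_norm ?dot_ge0 // => h; apply: (le_trans h).
by rewrite exprMn expr2; have := mulr_ge0 (normr_ge0 x) (normr_ge0 x); rewrite expr2; lra.
Qed.

Lemma enormZ (k : R) x : enorm (k *: x) = `|k| * enorm x.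
Proof.
apply/eqP; rewrite -(@eqrXn2 _ 2) ?mulr_ge0 ?enorm_ge0 //.
by rewrite exprMn !enorm_sqr dotZl dotZr real_normK ?num_real // mulrA expr2.
Qed.

Lemma continuous_enorm_sub x : continuous (fun y => enorm (y - x)).
Proof.
move=> y; apply: (@continuous_lipschitz_at _ _ _ _ _ 2 1) => // u _.
apply: le_trans (enorm_le_norm u); rewrite ler_norml; apply/andP; split.
  have := enorm_dist (u + y) y x; rewrite (enormB y (u + y)) addrK; lra.
have := enorm_dist y (u + y) x; rewrite addrK; lra.
Qed.

Lemma open_eball x (r : R) : open (eball x r).
Proof.
have -> : eball x r = (fun y => enorm (y - x)) @^-1` [set t | t < r] by [].
by apply: open_comp; [by move=> y _; exact: continuous_enorm_sub|exact: open_lt].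
Qed.

Lemma measurable_eball x (r : R) : measurable (eball x r).
Proof. by apply: open_measurable2; exact: open_eball. Qed.

Lemma nbhs_eball x (A : set (R * R)) : nbhs x A -> exists r : R, 0 < r /\ eball x r `<=` A.
Proof.
move=> /nbhs_normP [r /= r0 rA]; exists r; split => // y xy; apply: rA => /=.
by rewrite distrC (le_lt_trans (norm_le_enorm _)).
Qed.

Lemma eball_orect x (r : R) : eball x r `<=` orect (x.1 - r) (x.1 + r) (x.2 - r) (x.2 + r).
Proof.
move=> y xy; have := le_lt_trans (norm_le_enorm _) xy; rewrite prod_normE gt_max !ltr_norml /= => /andP[/andP[a b] /andP[c d]].
by split; rewrite /= in_itv /=; apply/andP; split; lra.
Qed.

Lemma orect_measure (a b c d : R) : a <= b -> c <= d -> mu2 (orect a b c d) = ((b - a) * (d - c))%:E.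
Proof.
move=> ab cd; rewrite /orect product_measure1E; [|exact: measurable_itv|exact: measurable_itv].
rewrite (_ : _ * _ = mu `]a, b[ * mu `]c, d[)%E // !lebesgue_measure_itv /= !lte_fin.
move: ab cd; rewrite !le_eqVlt => /predU1P[->|ab] /predU1P[->|cd]; rewrite ?ltxx ?subrr ?mul0e ?mule0 ?mulr0 ?mul0r //.
by rewrite ab cd.
Qed.

Lemma integrable_indic_eball x (r : R) : mu2.-integrable setT (EFin \o (\1_(eball x r) : R * R -> R)).
Proof.
apply: (@bounded_box_integrable _ _ 1 (`|x| + `|r|)).
- by apply: measurable_indic; exact: measurable_eball.
- by move=> y; rewrite indicE; case: (_ \in _); rewrite ?normr1 ?normr0.
move=> y yr; rewrite indicE memNset // => /= yx; move: yr; apply/negP; rewrite -leNgt.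
have := norm_le_enorm (y - x); have := ler_dist_dist y x; rewrite ler_norml => /andP[_].
by have := ler_norm r; move: yx; rewrite /eball /=; lra.
Qed.

Lemma area_eball x (r : R) : 0 <= r -> \int[mu2]_y \1_(eball x r) y <= 4 * r ^+ 2.
Proof.
move=> r0.
have -> : \int[mu2]_y \1_(eball x r) y = fine (mu2 (eball x r)).
  rewrite /Rintegral; congr fine; rewrite -[in RHS](setIT (eball x r)).
  exact: (integral_indic mu2 measurableT (measurable_eball x r)).
have E : mu2 (orect (x.1 - r) (x.1 + r) (x.2 - r) (x.2 + r)) = (4 * r ^+ 2)%:E.
  by rewrite orect_measure; [congr EFin; ring|lra|lra].
have le : (mu2 (eball x r) <= (4 * r ^+ 2)%:E)%E.
  rewrite -E; apply: le_measure; rewrite ?inE //; [exact: measurable_eball|exact: measurable_orect|exact: eball_orect].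
rewrite -lee_fin fineK //; rewrite ge0_fin_numE //; exact: le_lt_trans le (ltry _).
Qed.

Lemma orthonormal_basis (e1 e2 : R * R) : dot e1 e1 = 1 -> dot e2 e2 = 1 -> dot e1 e2 = 0 ->
  forall z, z = dot z e1 *: e1 + dot z e2 *: e2.
Proof.
case: e1 e2 => [a b] [c d]; rewrite /dot /= => n1 n2 o [u v].
(* [D] is the determinant of the frame: the second vector is [D] times the first one turned by a
   right angle, and D^2 = 1. *)
pose D := a * d - b * c.
have cE : c = - b * D.
  have -> : - b * D = b * b * c - a * (b * d) by rewrite /D; ring.
  have -> : b * d = - (a * c) by lra.
  have -> : b * b * c - a * - (a * c) = (a * a + b * b) * c by ring.
  by rewrite n1 mul1r.
have dE : d = a * D.
  have -> : a * D = a * a * d - b * (a * c) by rewrite /D; ring.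
  have -> : a * c = - (b * d) by lra.
  have -> : a * a * d - b * - (b * d) = (a * a + b * b) * d by ring.
  by rewrite n1 mul1r.
have DD : D * D = 1.
  by move: n2; rewrite {1 2}cE dE => n2; rewrite -n2 -[LHS]mul1r -n1; ring.
apply/pair_equal_spec; rewrite /= /GRing.scale /= cE dE; split.
  have -> : (u * a + v * b) * a + (u * (- b * D) + v * (a * D)) * (- b * D) =
    u * (a * a + b * b * (D * D)) + v * (a * b - a * b * (D * D)) by ring.
  by rewrite DD !mulr1 n1 subrr mulr0 addr0 mulr1.
have -> : (u * a + v * b) * b + (u * (- b * D) + v * (a * D)) * (a * D) =
    v * (b * b + a * a * (D * D)) + u * (a * b - a * b * (D * D)) by ring.
by rewrite DD !mulr1 addrC (addrC (b * b)) n1 subrr mulr0 add0r mulr1.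
Qed.

Lemma orthonormal_dot (e1 e2 : R * R) : dot e1 e1 = 1 -> dot e2 e2 = 1 -> dot e1 e2 = 0 ->
  forall z, dot z z = dot z e1 ^+ 2 + dot z e2 ^+ 2.
Proof.
move=> n1 n2 o z; rewrite {1 2}(orthonormal_basis n1 n2 o z).
by rewrite !dotDl !dotDr !dotZl !dotZr n1 n2 (dotC e2 e1) o; ring.
Qed.

End euclidean.

(** * Hausdorff measure against Lebesgue outer measure on the line *)

Section hausdorff_lebesgue.
Context {R : realType}.
Notation mu := (@lebesgue_measure R).
Notation lambda := ((@wlength R idfun)^*%mu).
Implicit Types (A : set (R * R)) (T : set R).
Local Open Scope ereal_scope.

Lemma le_lambda (S T : set R) : S `<=` T -> lambda S <= lambda T.
Proof. by move=> ST; exact: (@le_outer_measure R (ocitv_type R) lambda S T ST). Qed.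

Lemma lambda_ge0 T : 0 <= lambda T.
Proof. exact: outer_measure_ge0. Qed.

Lemma lambda_subadditive (F : nat -> set R) : lambda (\bigcup_k F k) <= \sum_(k <oo) lambda (F k).
Proof. exact: outer_measure_sigma_subadditive. Qed.

Lemma lambda_negligible T : lambda T = 0 -> mu.-negligible T.
Proof.
move=> T0; have [G [oG TG G0]] := outer_measure_Gdelta T.
exists (\bigcap_i G i); split => //; last by rewrite -T0.
by apply: bigcapT_measurable => k; exact: open_measurable.
Qed.

Lemma diameter_le A (x y : R * R) : A x -> A y -> (enorm (x - y))%:E <= diameter A.
Proof.
move=> Ax Ay; rewrite /diameter le_max; apply/orP; right.
by apply: ereal_sup_ubound; exists (x, y).
Qed.

Lemma lambda_itv (a b : R) : (a <= b)%R -> lambda `[a, b] = (b - a)%:E.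
Proof.
move=> ab; have -> : lambda `[a, b] = mu `[a, b] by [].
rewrite lebesgue_measure_itv /= lte_fin; move: ab; rewrite le_eqVlt => /predU1P[->|->] //.
by rewrite ltxx subrr.
Qed.

Lemma lambda_bounded T (d : R) : (0 <= d)%R ->
  (forall s t, T s -> T t -> `|s - t| <= d)%R -> lambda T <= d%:E.
Proof.
move=> d0 Td; have [->|/set0P[t0 Tt0]] := eqVneq T set0.
  by rewrite outer_measure0 lee_fin.
have ub t : T t -> (t <= t0 + d)%R by move=> Tt; have := Td _ _ Tt Tt0; rewrite ler_norml; lra.
have lb t : T t -> (t0 - d <= t)%R by move=> Tt; have := Td _ _ Tt Tt0; rewrite ler_norml; lra.
have hs : has_sup T by split; [exists t0|exists (t0 + d)%R].
have hi : has_inf T by split; [exists t0|exists (t0 - d)%R].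
have sub : T `<=` `[inf T, sup T].
  by move=> t Tt; rewrite /= in_itv /=; apply/andP; split; [apply: ge_inf => //; exact: hi.2|apply: ub_le_sup => //; exact: hs.2].
apply: (le_trans (le_lambda sub)).
have le : (inf T <= sup T)%R by have := sub _ Tt0; rewrite /= in_itv /= => /andP[]; exact: le_trans.
rewrite lambda_itv // lee_fin lerBlDr; apply: ge_sup; first by exists t0.
move=> t Tt; rewrite -lerBlDl; apply: lb_le_inf; first by exists t0.
by move=> s Ts; have := Td _ _ Tt Ts; rewrite ler_norml; lra.
Qed.

(** A cover of the image pulls back to a cover of [T] by sets whose diameters grow at most by the
    factor [K]. The outer measure [lambda] is used because [T] need not be measurable. *)
Lemma lambda_le_hausdorff1 (K : R) (g : R -> R * R) T : (0 < K)%R ->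
  (forall s t, T s -> T t -> `|s - t| <= K * enorm (g s - g t))%R ->
  lambda T <= K%:E * hausdorff1 (g @` T).
Proof.
move=> K0 gK.
apply: (@le_trans _ _ (K%:E * hausdorff1_delta 1 (g @` T))); last first.
  by apply: lee_wpmul2l; [rewrite lee_fin ltW|exact: hausdorff1_delta_le].
rewrite -lee_pdivrMl //; apply: le_ereal_inf_tmp => _ [C [TC dC] <-].
rewrite lee_pdivrMl // -nneseriesZl; last by move=> k _; exact: diameter_ge0.
pose Tk k := T `&` g @^-1` (C k).
have sub : T `<=` \bigcup_k Tk k.
  by move=> t Tt; have [k _ Ck] := TC (g t) (ex_intro2 _ _ t Tt erefl); exists k.
apply: (le_trans (le_lambda sub)).
apply: (le_trans (lambda_subadditive Tk)).
apply: lee_nneseries => [k _ _|k _]; first exact: lambda_ge0.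
have dfin : diameter (C k) \is a fin_num.
  by rewrite ge0_fin_numE ?diameter_ge0 // (le_lt_trans (dC k)) // ltry.
rewrite -(fineK dfin) -EFinM; apply: lambda_bounded.
  by apply: mulr_ge0; [exact: ltW|apply: fine_ge0; exact: diameter_ge0].
move=> s t [Ts Cs] [Tt Ct]; apply: (le_trans (gK _ _ Ts Tt)).
apply: ler_wpM2l; first exact: ltW.
by rewrite -lee_fin fineK // diameter_le.
Qed.

(** Since [P] does not increase distances, a choice of preimages [g] does not decrease them, and
    [lambda_le_hausdorff1] applies to [g] with factor 1. *)
Lemma hausdorff1_null_image (P : R * R -> R) A :
  (forall x y, `|P x - P y| <= enorm (x - y))%R -> hausdorff1 A = 0 -> mu.-negligible (P @` A).
Proof.
move=> P1 A0.
have ex (t : R) : exists x, (P @` A) t -> A x /\ P x = t.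
  have [[x Ax <-]|nt] := pselect ((P @` A) t); first by exists x.
  by exists (0, 0)%R.
have [g gP] := choice ex.
have l0 : lambda (P @` A) = 0.
  apply/eqP; rewrite eq_le lambda_ge0 andbT.
  apply: (le_trans (@lambda_le_hausdorff1 1 g (P @` A) ltr01 _)).
    by move=> s t /gP [_ {1}<-] /gP [_ {1}<-]; rewrite mul1r.
  rewrite mul1e -A0; apply: le_hausdorff1 => _ [t /gP [Ag _] <-]; exact: Ag.
exact: lambda_negligible.
Qed.
End hausdorff_lebesgue.

Lemma ler_sqr_norm_aux (R : realType) (s t : R) : 0 <= t -> (`|s| <= t) = (s ^+ 2 <= t ^+ 2).
Proof.
by move=> t0; rewrite -[s ^+ 2]real_normK ?num_real // ler_pXn2r ?nnegrE.
Qed.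

(** * Truncation on a cap *)

Section strip.
Context {R : realType}.
Notation mu := (@lebesgue_measure R).
Notation mu2 := (mu \x mu)%E.
Implicit Types (x y z : R * R) (g : R * R -> R) (t d : R).

(** The limit in the definition of [trace], with real integrals and in epsilon-delta form, for a
    function extended by 0 off the domain; see [vanishing_meanP]. *)
Definition vanishing_mean g x := forall e : R, 0 < e -> exists d : R, 0 < d /\
  forall s : R, 0 < s < d -> \int[mu2]_y (g y * \1_(eball x s) y) <= e * s ^+ 2.

(** The local data of [C1_boundary] around one point, bundled with the derivative [dh] of the graph
    function. *)
Record C1_chart (Omega : set (R * R)) (x0 e1 e2 : R * R) (r : R) (h dh : R -> R) : Prop := C1Chart {
  cc_e11 : dot e1 e1 = 1 ; cc_e22 : dot e2 e2 = 1 ; cc_e12 : dot e1 e2 = 0 ;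
  cc_r : 0 < r ; cc_dh : forall t, is_derive t (1 : R) h (dh t) ; cc_cdh : continuous dh ;
  cc_graph : forall y, eball x0 r y -> (Omega y <-> h (dot y e1) < dot y e2) }.

Definition strip (e1 e2 : R * R) (h : R -> R) d : set (R * R) :=
  [set y | d <= dot y e2 - h (dot y e1) <= 2 * d].

Variables (Omega : set (R * R)) (x0 e1 e2 n : R * R) (r c c' B : R) (h dh : R -> R) (g : R * R -> R).
Hypotheses (oO : open Omega) (chart : C1_chart Omega x0 e1 e2 r h dh) (cc' : c < c') (n1 : dot n n = 1).
Hypotheses (mg : measurable_fun setT g) (g0 : forall y, 0 <= g y) (gB : forall y, g y <= B).
Hypotheses (g_supp : forall y, g y != 0 -> Omega y /\ c' <= dot y n).
Hypotheses (cap_sub : forall y, Omega y -> c < dot y n -> eball x0 (r / 2) y).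
Hypotheses (g_trace : hausdorff1 [set x | boundary Omega x /\ c < dot x n /\ ~ vanishing_mean g x] = 0%E).

Let n11 := cc_e11 chart.
Let n22 := cc_e22 chart.
Let n12 := cc_e12 chart.
Let r0 := cc_r chart.
Let p t : R * R := t *: e1 + h t *: e2.

Let ch : continuous h.
Proof. by move=> t; apply: differentiable_continuous; apply/derivable1_diffP; have [] := cc_dh chart t. Qed.

Let csd : continuous (fun y => dot y e2 - h (dot y e1)).
Proof. by apply: contB; [exact: continuous_dot|apply: cont_comp => //; exact: continuous_dot]. Qed.

Let dot_p1 t : dot (p t) e1 = t.
Proof. by rewrite /p dotDl !dotZl n11 (dotC e2) n12 mulr1 mulr0 addr0. Qed.

Let dot_p2 t : dot (p t) e2 = h t.
Proof. by rewrite /p dotDl !dotZl n22 n12 mulr1 mulr0 add0r. Qed.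

Let p_boundary t : eball x0 r (p t) -> boundary Omega (p t).
Proof.
move=> pt; have nO : ~ Omega (p t) by move=> /(cc_graph chart pt); rewrite dot_p1 dot_p2 ltxx.
split; last by move=> /interior_subset.
move=> A /nbhs_eball [s [s0 sA]].
have d0 : 0 < Num.min s (r - enorm (p t - x0)) by rewrite lt_min s0 subr_gt0.
set d := Num.min _ _ in d0; pose y := p t + (d / 2) *: e2.
have e2n : enorm e2 = 1 by rewrite /enorm n22 sqrtr1.
have yp : enorm (y - p t) < d.
  by rewrite /y addrAC subrr add0r enormZ e2n mulr1 ger0_norm; lra.
exists y; split; last by apply: sA; rewrite /eball /= (lt_le_trans yp) // ge_min lexx.
apply/(cc_graph chart (y := y)).
  rewrite /eball /= (le_lt_trans (enorm_dist (p t) _ _)) //.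
  have : d <= r - enorm (p t - x0) by rewrite ge_min lexx orbT.
  by lra.
have y1 : dot y e1 = t by rewrite /y dotDl dot_p1 dotZl (dotC e2) n12 mulr0 addr0.
have y2 : dot y e2 = h t + d / 2 by rewrite /y dotDl dot_p2 dotZl n22 mulr1.
by rewrite y1 y2 ltrDl divr_gt0.
Qed.

Let lip : exists L, 0 <= L /\ forall s t, `|s - dot x0 e1| < r -> `|t - dot x0 e1| < r -> `|h s - h t| <= L * `|s - t|.
Proof.
set a := dot x0 e1.
have [L1 hL] := @compact_bounded _ _ (dh @` `[a - r, a + r]) (continuous_compact (continuous_subspaceT (cc_cdh chart)) (@segment_compact _ (a - r) (a + r))).
have hL' t : t \in `[a - r, a + r] -> `|dh t| <= `|L1| + 1.
  move=> ta; apply: (hL.2 (`|L1| + 1)); first by rewrite ltr_pwDr // ler_norm.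
  by exists t.
exists (`|L1| + 1); split; first by rewrite addr_ge0.
move=> s t sa ta; wlog st : s t sa ta / t <= s.
  by move=> H; have [ts|/ltW ts] := leP t s; [exact: H|rewrite distrC (distrC s); exact: H].
have [u ust ->] := MVT_segment st (fun u _ => cc_dh chart u) (continuous_subspaceT ch).
rewrite normrM ler_wpM2r //; apply: hL'.
move: ust sa ta; rewrite !in_itv /= !ltr_norml => /andP[tu us] /andP[a1 a2] /andP[a3 a4].
by apply/andP; split; lra.
Qed.

Let g_ball y : g y != 0 -> eball x0 (r / 2) y.
Proof. by move=> /g_supp [Oy cy]; apply: cap_sub => //; exact: lt_le_trans cc' cy. Qed.

Let B0 : 0 <= B. Proof. exact: le_trans (g0 0) (gB 0). Qed.

Let g_norm y : `|g y| <= B. Proof. by rewrite ger0_norm. Qed.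

Let ig : mu2.-integrable setT (EFin \o g).
Proof.
apply: (@bounded_box_integrable _ _ B (`|x0| + r)) => // y yM.
apply: contraTeq yM => /g_ball; rewrite /eball /= -leNgt => yx.
have := norm_le_enorm (y - x0); have := ler_dist_dist y x0; rewrite ler_norml => /andP[_].
by have := r0; lra.
Qed.

Let a0 := dot x0 e1.
Let I t : R := \1_(`]a0 - r, a0 + r[ : set R) t.

Let IE t : I t = if `|t - a0| < r then 1 else 0.
Proof.
rewrite /I indicE (_ : (t \in _) = (`|t - a0| < r)); first by case: (_ < _).
apply/idP/idP => [/set_mem|]; rewrite /= ?in_itv /= ltr_norml.
  by move=> /andP[? ?]; apply/andP; split; lra.
by move=> /andP[? ?]; apply/mem_set; rewrite /= in_itv /=; apply/andP; split; lra.
Qed.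

Let iI : mu.-integrable setT (EFin \o I).
Proof. exact: integrable_indic_itv. Qed.

Let S d := strip e1 e2 h d.

Let mS d : measurable (S d).
Proof.
have -> : S d = (fun y => dot y e2 - h (dot y e1)) @^-1` `[d, 2 * d].
  by apply/seteqP; split => y; rewrite /S /strip /= in_itv.
rewrite -[X in measurable X]setTI; apply: (continuous_measurable2 csd) => //.
Qed.

Let w d y := g y * \1_(S d) y.

Let iw d : mu2.-integrable setT (EFin \o w d).
Proof.
have mb : measurable_fun setT (\1_(S d) : R * R -> R) by apply: measurable_indic; exact: mS.
have b1 x : setT x -> `|\1_(S d) x : R| <= 1.
  by move=> _; rewrite indicE; case: (_ \in _); rewrite ?normr1 ?normr0.
exact: (integrable_mul_bounded measurableT ig mb b1).
Qed.

(** Pairs of a parameter [t] and a point whose first frame coordinate is within [d] of [t]. For a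
    fixed point the admissible parameters have total length 2 d, which turns an integral over the
    strip into an average over [t]. *)
Let K d : set (R * (R * R)) := [set q | `|q.1 - dot q.2 e1| < d].

Let mK d : measurable (K d).
Proof.
have -> : K d = (fun q => `|q.1 - dot q.2 e1|) @^-1` `]-oo, d[.
  by apply/seteqP; split => y; rewrite /K /= in_itv.
rewrite -[X in measurable X]setTI; apply: (_ : measurable_fun setT _) => //.
apply: measurableT_comp; first exact: normr_measurable.
apply: measurable_funB; first exact: measurable_fst.
apply: measurable_funD; apply: measurable_funM; try exact: measurable_cst.
  exact: (measurableT_comp measurable_fst measurable_snd).
exact: (measurableT_comp measurable_snd measurable_snd).
Qed.

Let kk d (q : R * (R * R)) : R := \1_(K d) q.

Let mkk d : measurable_fun setT (kk d).
Proof. by apply: measurable_indic; exact: mK. Qed.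

Let kk1 d q : `|kk d q| <= 1.
Proof. by rewrite /kk indicE; case: (_ \in _); rewrite ?normr1 ?normr0. Qed.

Let inner_itv d y : 0 < d < r / 2 -> w d y != 0 -> \int[mu]_t (I t * kk d (t, y)) = 2 * d.
Proof.
move=> /andP[d0 dr] wy; have gy : g y != 0 by apply: contraNneq wy => gy; rewrite /w gy mul0r.
have ya : `|dot y e1 - a0| < r / 2.
  rewrite /a0 -dotBl; apply: le_lt_trans (g_ball gy).
  by rewrite (le_trans (norm_dot_le _ _)) // /enorm n11 sqrtr1 mulr1.
have E t : I t * kk d (t, y) = \1_(`]dot y e1 - d, dot y e1 + d[ : set R) t.
  rewrite IE /kk !indicE.
  have -> : ((t, y) \in K d) = (`|t - dot y e1| < d) by apply/idP/idP => [/set_mem|h1]; [|apply/mem_set].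
  have -> : (t \in `]dot y e1 - d, dot y e1 + d[%classic) = (`|t - dot y e1| < d).
    apply/idP/idP => [/set_mem|]; rewrite /= ?in_itv /= ltr_norml.
      by move=> /andP[? ?]; apply/andP; split; lra.
    by move=> /andP[? ?]; apply/mem_set; rewrite /= in_itv /=; apply/andP; split; lra.
  have [td|td] := ltP `|t - dot y e1| d; last by rewrite mulr0.
  by rewrite mulr1 ifT //; have := ler_distD (dot y e1) t a0; lra.
have -> : \int[mu]_t (I t * kk d (t, y)) = \int[mu]_t \1_(`]dot y e1 - d, dot y e1 + d[%classic) t.
  by apply: eq_Rintegral => t _; exact: E.
transitivity (fine (mu (`]dot y e1 - d, dot y e1 + d[%classic))).
  rewrite /Rintegral; congr fine; rewrite -[in RHS](setIT (`]_, _[%classic)).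
  exact: (integral_indic mu measurableT (measurable_itv _)).
by rewrite lebesgue_measure_itv /= lte_fin ifT /=; lra.
Qed.

Let fubini d : 0 < d < r / 2 ->
  \int[mu]_t (I t * \int[mu2]_y (w d y * kk d (t, y))) = 2 * d * \int[mu2]_y w d y.
Proof.
move=> dr.
transitivity (\int[mu2]_y (w d y * \int[mu]_t (I t * kk d (t, y)))).
  exact: (@Rfubini_kernel _ _ _ _ _ mu lebesgue2 I (w d) (kk d) 1 iI (iw d) (@mkk d) (@kk1 d)).
rewrite -(RintegralZl _ measurableT (iw d)); apply: eq_Rintegral => y _.
have [->|wy] := eqVneq (w d y) 0; first by rewrite mul0r mulr0.
by rewrite inner_itv // mulrC.
Qed.

Let near_graph : exists Rr, 1 <= Rr /\ forall d t, 0 < d -> `|t - a0| < r -> forall y,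
  w d y * kk d (t, y) <= g y * \1_(eball (p t) (Rr * d)) y.
Proof.
(* A point of the strip whose first coordinate is within [d] of [t] lies within [d] of p t
   horizontally and within (2 + L) d vertically, where [L] is a Lipschitz constant of the graph. *)
have [L [L0 hL]] := lip; exists (4 + L); split; first by lra.
move=> d t d0 ta y; have [gy|gy] := eqVneq (g y) 0; first by rewrite /w gy !mul0r.
rewrite /w -mulrA ler_wpM2l // /kk !indicE.
have [/set_mem Sy|] := boolP (y \in S d); last by rewrite mul0r ler0n.
have [/set_mem|] := boolP (_ \in K d); last by rewrite mulr0 ler0n.
rewrite /K /= => tyd; rewrite mulr1 mem_set //.
have ya : `|dot y e1 - a0| < r.
  rewrite /a0 -dotBl; have := g_ball gy; rewrite /eball /= => gb.
  have := norm_dot_le (y - x0) e1; rewrite /enorm n11 sqrtr1 mulr1 -/(enorm _).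
  by move: r0; lra.
have hyt := hL _ _ ya ta.
have sy : `|dot y e2 - h t| <= (2 + L) * d.
  move: Sy; rewrite /S /strip /= => /andP[s1 s2].
  have := ler_distD (h (dot y e1)) (dot y e2) (h t).
  have : `|dot y e2 - h (dot y e1)| <= 2 * d by rewrite ger0_norm //; lra.
  have : L * `|dot y e1 - t| <= L * d by rewrite ler_wpM2l // distrC ltW.
  lra.
suff : enorm (y - p t) ^+ 2 < ((4 + L) * d) ^+ 2.
  by rewrite ltr_pXn2r ?nnegrE ?enorm_ge0 // mulr_ge0 ?addr_ge0 // ltW.
rewrite enorm_sqr (orthonormal_dot n11 n22 n12) !dotBl dot_p1 dot_p2.
have e1' : (dot y e1 - t) ^+ 2 <= d ^+ 2.
  by rewrite -ler_sqr_norm_aux ?(ltW d0) // distrC ltW.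
have e2' : (dot y e2 - h t) ^+ 2 <= ((2 + L) * d) ^+ 2.
  by rewrite -ler_sqr_norm_aux // mulr_ge0 ?addr_ge0 // ltW.
have := mulr_ge0 L0 (sqr_ge0 d); have : 0 < d ^+ 2 by rewrite exprn_gt0.
rewrite !exprMn in e2' *; nra.
Qed.

(** By Fubini, the integral over the strip divided by its height is half the integral over [t] of a
    quantity bounded by d^-2 times the integral of [g] over a ball of radius proportional to d
    around the graph point p t. The trace hypothesis makes this tend to 0 for almost every [t], and
    the area of the balls gives the constant bound needed for dominated convergence. *)
Lemma strip_average (d : nat -> R) : (forall j, 0 < d j < r / 2) -> d @ \oo --> 0 ->
  (fun j => (d j)^-1 * \int[mu2]_y (g y * \1_(strip e1 e2 h (d j)) y)) @ \oo --> 0.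
Proof.
move=> dr d_to0; have [Rr [R1 hR]] := near_graph.
have R0 : 0 < Rr by lra.
pose F j t := (d j ^+ 2)^-1 * (I t * \int[mu2]_y (w (d j) y * kk (d j) (t, y))).
have iF j : mu.-integrable setT (EFin \o (fun t => I t * \int[mu2]_y (w (d j) y * kk (d j) (t, y)))).
  exact: (@integrable_kernel _ _ _ _ _ mu lebesgue2 I (w (d j)) (kk (d j)) 1 iI (iw (d j)) (@mkk (d j)) (@kk1 (d j))).
have mF j : measurable_fun setT (F j).
  by have /measurable_int/measurable_EFinP := integrable_scale (d j ^+ 2)^-1 measurableT (iF j).
have iwk j t : mu2.-integrable setT (EFin \o (fun y => w (d j) y * kk (d j) (t, y))).
  have mb : measurable_fun setT (fun y => kk (d j) (t, y)).
    by apply: (measurableT_comp (@mkk (d j))); exact: pair1_measurable.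
  exact: (integrable_mul_bounded measurableT (iw (d j)) mb (fun y _ => @kk1 (d j) (t, y))).
have ige x s : mu2.-integrable setT (EFin \o (fun y => g y * \1_(eball x s) y)).
  have mb : measurable_fun setT (\1_(eball x s) : R * R -> R) by apply: measurable_indic; exact: measurable_eball.
  have b1 z : setT z -> `|\1_(eball x s) z : R| <= 1.
    by move=> _; rewrite indicE; case: (_ \in _); rewrite ?normr1 ?normr0.
  exact: (integrable_mul_bounded measurableT ig mb b1).
have dj0 j : 0 < d j by have /andP[] := dr j.
have F0 j t : 0 <= F j t.
  apply: mulr_ge0; first by rewrite invr_ge0 exprn_ge0 // ltW.
  apply: mulr_ge0; first by rewrite IE; case: ifP.
  apply: Rintegral_ge0 => y _; apply: mulr_ge0; last by rewrite /kk indicE.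
  by apply: mulr_ge0 => //; rewrite indicE.
have FB j t : `|t - a0| < r -> F j t <= (d j ^+ 2)^-1 * \int[mu2]_y (g y * \1_(eball (p t) (Rr * d j)) y).
  move=> ta; rewrite /F IE ta mul1r; apply: ler_wpM2l; first by rewrite invr_ge0 exprn_ge0 // ltW.
  apply: le_Rintegral; [exact: measurableT|exact: iwk|exact: ige|].
  by move=> y _; exact: hR.
have FM j t : `|F j t| <= (4 * Rr ^+ 2 * B) * I t.
  rewrite ger0_norm //; rewrite IE; case: ifP => [ta|]; last first.
    by move=> ta; rewrite /F IE ta mul0r !mulr0.
  apply: (le_trans (FB _ _ ta)); rewrite mulr1 ler_pdivrMl ?exprn_gt0 //.
  apply: (@le_trans _ _ (B * \int[mu2]_y \1_(eball (p t) (Rr * d j)) y)).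
    rewrite -(RintegralZl _ measurableT (integrable_indic_eball _ _)).
    apply: le_Rintegral; [exact: measurableT|exact: ige|exact: (integrable_scale B measurableT (integrable_indic_eball _ _))|].
    by move=> y _; apply: ler_wpM2r => //; rewrite indicE.
  have h2 := area_eball (p t) (ltW (mulr_gt0 R0 (dj0 j))).
  apply: le_trans (ler_wpM2l B0 h2) _.
  by rewrite exprMn le_eqVlt; apply/orP; left; apply/eqP; ring.
pose N := (fun x => dot x e1) @` [set x | boundary Omega x /\ c < dot x n /\ ~ vanishing_mean g x].
have negN : mu.-negligible N.
  apply: hausdorff1_null_image g_trace => x y.
  by rewrite -dotBl (le_trans (norm_dot_le _ _)) // /enorm n11 sqrtr1 mulr1.
have F_to0 t : ~ N t -> F ^~ t @ \oo --> 0.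
  move=> nN; have [ta|ta] := ltP `|t - a0| r; last first.
    have -> : F ^~ t = fun=> 0 by apply/funext => j; rewrite /F IE ltNge ta /= mul0r mulr0.
    exact: cvg_cst.
  have vanish s d0 : (forall y, g y != 0 -> d0 <= enorm (y - p t)) -> s < d0 ->
      \int[mu2]_y (g y * \1_(eball (p t) s) y) = 0.
    move=> far sd; rewrite (_ : (fun y => _) = fun=> 0) ?Rintegral_cst ?mul0r //.
    apply/funext => y; have [->|/far gy] := eqVneq (g y) 0; first by rewrite mul0r.
    by rewrite indicE memNset ?mulr0 //= /eball /= => ys; have := lt_trans ys sd; rewrite ltNge gy.
  (* If the graph point is outside the chart ball or outside the half-plane, [g] vanishes near it:
     this is the room left by r / 2 against r and by [c] against [c']. Otherwise it is a boundary
     point to which the trace hypothesis applies. *)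
  have van : vanishing_mean g (p t).
    have far d0 : 0 < d0 -> (forall y, g y != 0 -> d0 <= enorm (y - p t)) -> vanishing_mean g (p t).
      move=> d00 gd e e0; exists d0; split => // s /andP[s0 sd].
      by rewrite (vanish s d0) // mulr_ge0 ?sqr_ge0 ?ltW.
    have [tr|tr] := pselect (eball x0 r (p t)); last first.
      apply: (far (r / 2)); first by have := r0; lra.
      move=> y /g_ball; rewrite /eball /= => yx; move/negP : tr; rewrite /eball /= -leNgt => tr.
      by have := enorm_dist y (p t) x0; rewrite (enormB (p t) y); lra.
    have [tc|tc] := leP (dot (p t) n) c; last first.
      apply: contrapT => nv; apply: nN; exists (p t); last exact: dot_p1.
      by split => //; exact: p_boundary.
    apply: (far (c' - c)); first by rewrite subr_gt0.
    move=> y /g_supp [_ yc]; have := norm_dot_le (y - p t) n.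
    by rewrite /enorm n1 sqrtr1 mulr1 dotBl ler_norml => /andP[_]; rewrite -/(enorm _); lra.
  apply/cvgr0Pnorm_lt => e e0.
  have e1' : 0 < e / (2 * Rr ^+ 2) by rewrite divr_gt0 // mulr_gt0 // exprn_gt0.
  have [d0 [d00 hd0]] := van _ e1'.
  have dd : 0 < d0 / Rr by rewrite divr_gt0.
  have /cvgr0Pnorm_lt /(_ _ dd) := d_to0; apply: filterS => j.
  rewrite (gtr0_norm (dj0 j)) ltr_pdivlMr // mulrC => jd.
  rewrite ger0_norm //; apply: le_lt_trans (FB _ _ ta) _.
  rewrite ltr_pdivrMl ?exprn_gt0 //.
  have := hd0 (Rr * d j); rewrite jd mulr_gt0 // => /(_ isT) h1.
  apply: (le_lt_trans h1); rewrite exprMn.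
  have -> : e / (2 * Rr ^+ 2) * (Rr ^+ 2 * d j ^+ 2) = d j ^+ 2 * (e / 2).
    by field; rewrite gt_eqF.
  by rewrite ltr_pM2l ?exprn_gt0 //; lra.
have mz : measurable_fun [set: R] (fun=> 0 : R) by exact: measurable_cst.
have [_ ] := Rdominated_convergence_ae negN mF mz F_to0 (integrable_scale _ measurableT iI) FM.
rewrite Rintegral_cst // mul0r => Fc.
have E j : (d j)^-1 * \int[mu2]_y (g y * \1_(strip e1 e2 h (d j)) y) = 2^-1 * \int[mu]_t F j t.
  rewrite (RintegralZl _ measurableT (iF j)) (fubini (dr j)) -/(w _).
  by rewrite /w /S; field; rewrite ?gt_eqF.
rewrite (_ : (fun j => _) = (fun j => 2^-1 * \int[mu]_t F j t)); last by apply/funext.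
by rewrite -[X in _ --> X](mulr0 2^-1); apply: cvgM => //; exact: cvg_cst.
Qed.

End strip.

Lemma compact_positive_min (R : realType) (T : pseudoMetricNormedZmodType R) (K : set T) (f : T -> R) :
  compact K -> continuous f -> (forall x, K x -> 0 < f x) ->
  exists d : R, 0 < d /\ forall x, K x -> d <= f x.
Proof.
move=> /compact_near_coveringP cK cf fpos.
have [] := cK R (nbhs (0 : R)^'+) (fun d x => d <= f x).
  move=> x Kx; have fx := fpos _ Kx.
  exists ([set y | f x / 2 < f y], [set t : R | t < f x / 2]).
    split; first by apply: (cvgr_gt (f x)); [exact: cf|lra].
    by exists (f x / 2); rewrite /= ?divr_gt0 // => t /=; rewrite sub0r normrN => /(le_lt_trans (ler_norm _)).
  by move=> [z t] /= [xz td]; rewrite ltW // (lt_trans td).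
move=> d /= d0 dP; exists (d / 2); split; first by rewrite divr_gt0.
apply: dP; rewrite /= ?divr_gt0 //.
by rewrite sub0r normrN gtr0_norm ?divr_gt0 //; lra.
Qed.

Lemma continuous_segment_bounded (R : realType) (f : R -> R) (a r : R) : continuous f ->
  exists M : R, 0 <= M /\ forall t, `|t - a| <= r -> `|f t| <= M.
Proof.
move=> cf.
have [L1 hL] := @compact_bounded _ _ (f @` `[a - r, a + r]) (continuous_compact (continuous_subspaceT cf) (@segment_compact _ (a - r) (a + r))).
exists (`|L1| + 1); split; first by rewrite addr_ge0.
move=> t; rewrite ler_norml => /andP[h1 h2]; apply: (hL.2 (`|L1| + 1)); first by rewrite ltr_pwDr // ler_norm.
by exists t => //; rewrite /= in_itv /=; apply/andP; split; lra.
Qed.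

(** * A cutoff function along a C^1 graph *)

Section graph_cutoff.
Context {R : realType}.
Variables (e1 e2 x0 : R * R) (r d : R) (h dh : R -> R).
Hypotheses (n11 : dot e1 e1 = 1) (n22 : dot e2 e2 = 1) (n12 : dot e1 e2 = 0) (r0 : 0 < r) (d0 : 0 < d).
Hypotheses (hdh : forall t, is_derive t (1 : R) h (dh t)) (cdh : continuous dh).
Implicit Types y : R * R.

Let sd y := dot y e2 - h (dot y e1).
Let u y := dot y e1 - dot x0 e1.
Let v y := dot y e2 - dot x0 e2.
Let q y := u y * u y + v y * v y.
(** The radial factor is a step in the squared distance [q]: b = (r / 2)^2 and b + 1/A = (3 r /
    4)^2, so it falls from 1 to 0 between these two radii. *)
Let A := 16 / (5 * r ^+ 2).
Let b := r ^+ 2 / 4.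

(* Vanishes where the height over the graph is below d and outside eball x0 (3 r / 4); equals 1
   where the height exceeds 2 d, inside eball x0 (r / 2). *)
Definition cutoff y := astp d^-1 d (sd y) * (1 - astp A b (q y)).
(* The derivative in the direction with coordinates (a, c) in the frame (e1, e2). *)
Definition dcutoff (a c : R) y :=
  dastp d^-1 d (sd y) * (c - dh (dot y e1) * a) * (1 - astp A b (q y)) -
  astp d^-1 d (sd y) * (dastp A b (q y) * (2 * (u y * a + v y * c))).

Let ch : continuous h.
Proof. by move=> t; apply: differentiable_continuous; apply/derivable1_diffP; have [] := hdh t. Qed.

Let csd : continuous sd.
Proof. by apply: contB; [exact: continuous_dot|apply: cont_comp => //; exact: continuous_dot]. Qed.

Let cu : continuous u.
Proof. by apply: contB; [exact: continuous_dot|exact: cont_cst]. Qed.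

Let cv : continuous v.
Proof. by apply: contB; [exact: continuous_dot|exact: cont_cst]. Qed.

Let cq : continuous q.
Proof. by apply: contD; apply: contM. Qed.

Let c1 : continuous (fun y => astp d^-1 d (sd y)).
Proof. by apply: cont_comp => //; exact: continuous_astp. Qed.

Let c2 : continuous (fun y => 1 - astp A b (q y)).
Proof. by apply: contB; [exact: cont_cst|apply: cont_comp => //; exact: continuous_astp]. Qed.

Lemma continuous_cutoff : continuous cutoff.
Proof. exact: contM. Qed.

Lemma continuous_dcutoff a c : continuous (dcutoff a c).
Proof.
apply: contB; apply: contM => //.
  apply: contM; first by apply: cont_comp => //; exact: continuous_dastp.
  apply: contB; first exact: cont_cst.
  by apply: contM; [apply: cont_comp => //; exact: continuous_dot|exact: cont_cst].
apply: contM; first by apply: cont_comp => //; exact: continuous_dastp.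
apply: contM; first exact: cont_cst.
by apply: contD; apply: contM => //; exact: cont_cst.
Qed.

Lemma has_pd1_cutoff : has_pd1 cutoff (dcutoff e1.1 e2.1).
Proof.
have psd := has_pd1B (has_pd1_dot e2) (has_pd1_comp hdh (has_pd1_dot e1)).
have pu := has_pd1B (has_pd1_dot e1) (has_pd1_cst (dot x0 e1)).
have pv := has_pd1B (has_pd1_dot e2) (has_pd1_cst (dot x0 e2)).
have pq := has_pd1D (has_pd1M pu pu) (has_pd1M pv pv).
have := has_pd1M (has_pd1_comp (is_derive_astp d^-1 d) psd)
  (has_pd1B (has_pd1_cst 1) (has_pd1_comp (is_derive_astp A b) pq)).
congr has_pd1; apply/funext => y; rewrite /dcutoff /sd /q /u /v.
by move: (dastp A b _) => da; ring.
Qed.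

Lemma has_pd2_cutoff : has_pd2 cutoff (dcutoff e1.2 e2.2).
Proof.
have psd := has_pd2B (has_pd2_dot e2) (has_pd2_comp hdh (has_pd2_dot e1)).
have pu := has_pd2B (has_pd2_dot e1) (has_pd2_cst (dot x0 e1)).
have pv := has_pd2B (has_pd2_dot e2) (has_pd2_cst (dot x0 e2)).
have pq := has_pd2D (has_pd2M pu pu) (has_pd2M pv pv).
have := has_pd2M (has_pd2_comp (is_derive_astp d^-1 d) psd)
  (has_pd2B (has_pd2_cst 1) (has_pd2_comp (is_derive_astp A b) pq)).
congr has_pd2; apply/funext => y; rewrite /dcutoff /sd /q /u /v.
by move: (dastp A b _) => da; ring.
Qed.

Lemma cutoff01 y : 0 <= cutoff y <= 1.
Proof.
have /andP[a0 a1] := stp01 (d^-1 * (sd y - d)); have /andP[b0 b1] := stp01 (A * (q y - b)).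
rewrite /cutoff /astp; apply/andP; split; first by rewrite mulr_ge0 // subr_ge0.
by rewrite mulr_ile1 ?subr_ge0 // gerBl.
Qed.

Let qE y : q y = enorm (y - x0) ^+ 2.
Proof. by rewrite enorm_sqr (orthonormal_dot n11 n22 n12) !dotBl /q /u /v !expr2. Qed.

Let A0 : 0 < A. Proof. by rewrite divr_gt0 // mulr_gt0 // exprn_gt0. Qed.

Let q_small y : eball x0 (r / 2) y -> A * (q y - b) <= 0.
Proof.
rewrite /eball /= => yx; rewrite pmulr_rle0 // subr_le0 qE /b.
have := enorm_ge0 (y - x0); nra.
Qed.

Let q_large y : 3 * r / 4 <= enorm (y - x0) -> 1 <= A * (q y - b).
Proof.
move=> yx; have h1 : 9 * r ^+ 2 / 16 <= q y by rewrite qE; have := enorm_ge0 (y - x0); move: r0; nra.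
apply: (@le_trans _ _ (A * (9 * r ^+ 2 / 16 - b))); last by rewrite ler_pM2l // lerB.
by rewrite /A /b le_eqVlt; apply/orP; left; apply/eqP; field; rewrite gt_eqF.
Qed.

Let sd_small y : sd y <= d -> d^-1 * (sd y - d) <= 0.
Proof. by move=> yd; rewrite pmulr_rle0 ?invr_gt0 // subr_le0. Qed.

Let sd_large y : 2 * d <= sd y -> 1 <= d^-1 * (sd y - d).
Proof. by move=> yd; rewrite ler_pdivlMl // mulr1; lra. Qed.

Lemma cutoff_1 y : eball x0 (r / 2) y -> 2 * d <= sd y -> cutoff y = 1.
Proof. by move=> /q_small h1 /sd_large h2; rewrite /cutoff /astp stp_1 // stp_0 // subr0 mulr1. Qed.

Lemma cutoff_supp y : cutoff y != 0 -> enorm (y - x0) < 3 * r / 4 /\ d < sd y.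
Proof.
move=> y0; split; rewrite ltNge; apply: contraNN y0.
  by move=> /q_large h1; rewrite /cutoff /astp (stp_1 h1) subrr mulr0.
by move=> /sd_small h1; rewrite /cutoff /astp (stp_0 h1) mul0r.
Qed.

Lemma dcutoff_low a c y : sd y <= 0 -> dcutoff a c y = 0.
Proof.
move=> y0; have h1 : d^-1 * (sd y - d) <= 0 by apply: sd_small; rewrite (le_trans y0) // ltW.
by rewrite /dcutoff /dastp /astp (stp_0 h1) (dstp_0 h1) !(mulr0, mul0r) subrr.
Qed.

Lemma dcutoff_far a c y : r <= enorm (y - x0) -> dcutoff a c y = 0.
Proof.
move=> yr; have h1 : 1 <= A * (q y - b) by apply: q_large; move: r0; lra.
by rewrite /dcutoff /dastp /astp (stp_1 h1) (dstp_1 h1) subrr !(mulr0, mul0r) subrr.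
Qed.

(** Inside [eball x0 (r / 2)] the radial factor is constant, so only the step in the height varies;
    it does so within the strip, with slope at most 2 / d. *)
Lemma dcutoff_le a c M y : eball x0 (r / 2) y -> `|a| <= 1 -> `|c| <= 1 -> `|dh (dot y e1)| <= M ->
  `|dcutoff a c y| <= d^-1 * (2 * (1 + M)) * \1_(strip e1 e2 h d) y.
Proof.
move=> /q_small h1 a1 c1' dM; rewrite /dcutoff /dastp /astp (stp_0 h1) (dstp_0 h1).
rewrite subr0 mulr1 !mulr0 mul0r mulr0 subr0 indicE.
have M0 : 0 <= M by exact: le_trans (normr_ge0 _) dM.
have [/set_mem S|/negP nS] := boolP (y \in _).
  rewrite mulr1 !normrM -mulrA ger0_norm ?invr_ge0 ?(ltW d0) // ler_pM2l ?invr_gt0 //.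
  have /andP[s0 s2] := dstp02 (d^-1 * (sd y - d)); rewrite (ger0_norm s0).
  apply: ler_pM => //; rewrite (le_trans (ler_normB _ _)) // lerD // normrM.
  by rewrite -[leRHS]mulr1 ler_pM.
suff -> : dstp (d^-1 * (sd y - d)) = 0 by rewrite !(mulr0, mul0r) normr0.
have [sl|sl] := leP (sd y) d; first by rewrite dstp_0 // sd_small.
have [sl'|sl'] := leP (2 * d) (sd y); first by rewrite dstp_1 // sd_large.
by exfalso; apply: nS; apply/mem_set; rewrite /strip /=; rewrite /sd in sl sl'; rewrite !ltW.
Qed.

End graph_cutoff.

Lemma closed_ge_fun (R : realType) (T : topologicalType) (f : T -> R) (a : R) : continuous f -> closed [set y | a <= f y].
Proof.
move=> cf; have -> : [set y | a <= f y] = f @^-1` [set t | a <= t] by [].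
by apply: closed_comp; [move=> y _; exact: cf|exact: closed_ge].
Qed.

Lemma closed_le_fun (R : realType) (T : topologicalType) (f : T -> R) (a : R) : continuous f -> closed [set y | f y <= a].
Proof.
move=> cf; have -> : [set y | f y <= a] = f @^-1` [set t | t <= a] by [].
by apply: closed_comp; [move=> y _; exact: cf|exact: closed_le].
Qed.

Lemma open_gt_fun (R : realType) (T : topologicalType) (f : T -> R) (a : R) : continuous f -> open [set y | a < f y].
Proof.
move=> cf; have -> : [set y | a < f y] = f @^-1` [set t | a < t] by [].
by apply: open_comp; [move=> y _; exact: cf|exact: open_gt].
Qed.

Lemma measurable_half_closed (R : realType) (n : R * R) (c : R) : measurable [set y | c <= dot y n].
Proof. by apply: closed_measurable2; apply: closed_ge_fun; exact: continuous_dot. Qed.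

Lemma measurable_half_open (R : realType) (n : R * R) (c : R) : measurable [set y | c < dot y n].
Proof. by apply: open_measurable2; apply: open_gt_fun; exact: continuous_dot. Qed.

Section cap_truncation.
Context {R : realType}.
Notation mu := (@lebesgue_measure R).
Notation mu2 := (mu \x mu)%E.
Implicit Types (y : R * R).
Variables (Omega : set (R * R)) (w : R * R -> R) (V N W k : R).
Hypotheses (oO : open Omega) (iw : mu2.-integrable setT (EFin \o w)).
Hypotheses (wN : forall y, N < `|y| -> w y = 0) (wV : tv_le Omega w V) (wW : forall y, `|w y| <= W).
Variables (x0 e1 e2 n : R * R) (r c : R) (h dh : R -> R).
Hypotheses (chart : C1_chart Omega x0 e1 e2 r h dh) (n1 : dot n n = 1).
Hypotheses (cap_sub : forall y, Omega y -> c < dot y n -> eball x0 (r / 2) y).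

Let cap : set (R * R) := [set y | Omega y /\ c < dot y n].
Hypothesis trace0 : hausdorff1 [set x | boundary Omega x /\ c < dot x n /\
  ~ vanishing_mean (fun y => \1_cap y * pos (w y - k)) x] = 0%E.

Let mw : measurable_fun setT w. Proof. by apply/measurable_EFinP; exact: measurable_int iw. Qed.

Let mp : measurable_fun setT (fun y => pos (w y - k)).
Proof. by apply: measurable_maxr => //; exact: measurable_funB. Qed.

Let p y := pos (w y - k).

Let p0 y : 0 <= p y. Proof. exact: pos_ge0. Qed.

Let B := W + `|k|.

Let W0 : 0 <= W. Proof. exact: le_trans (normr_ge0 _) (wW 0). Qed.

Let pB y : p y <= B.
Proof.
apply: pos_le; last by rewrite addr_ge0.
by rewrite (le_trans (ler_norm _)) // (le_trans (ler_normB _ _)) // lerD2r.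
Qed.

Let half_measurable (c' : R) : measurable [set y | Omega y /\ c' <= dot y n].
Proof.
exact: (measurableI _ _ (open_measurable2 oO) (measurable_half_closed n c')).
Qed.

Let cap_measurable : measurable cap.
Proof.
exact: (measurableI _ _ (open_measurable2 oO) (measurable_half_open n c)).
Qed.

Section smooth.
Variables (phi : R * R -> R * R) (c1 c2 : R).
Hypotheses (tphi : test_field Omega phi) (cc1 : c < c1) (c12 : c1 < c2).

Let X := astp (c2 - c1)^-1 c1.
Let dX := dastp (c2 - c1)^-1 c1.
Let rphi := test_field_regular tphi.

Let i0 : 0 < (c2 - c1)^-1. Proof. by rewrite invr_gt0 subr_gt0. Qed.

Let g y := \1_[set y | Omega y /\ c1 <= dot y n] y * p y.

Let gcap y : g y <= \1_cap y * p y.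
Proof.
apply: ler_wpM2r => //; rewrite !indicE ler_nat.
have [/set_mem [Oy yc]|//] := boolP (y \in [set y | Omega y /\ c1 <= dot y n]).
by rewrite mem_set //; split => //; exact: lt_le_trans yc.
Qed.

Let indic_mul_integrable (A : set (R * R)) x s : measurable A ->
  mu2.-integrable setT (EFin \o (fun y => \1_A y * p y * \1_(eball x s) y)).
Proof.
move=> mA; apply: (@bounded_box_integrable _ _ B (`|x| + `|s|)).
- apply: measurable_funM; last by apply: measurable_indic; exact: measurable_eball.
  by apply: measurable_funM => //; exact: measurable_indic.
- move=> y; rewrite !indicE !normrM (ger0_norm (p0 y)).
  by do 2 case: (_ \in _); rewrite ?normr1 ?normr0 ?mul0r ?mulr0 ?mul1r ?mulr1 // addr_ge0.
move=> y yM; rewrite [\1_(eball x s) y]indicE memNset ?mulr0 //= => yx.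
move: yM; apply/negP; rewrite -leNgt; move: yx; rewrite /eball /=.
have := norm_le_enorm (y - x); have := ler_dist_dist y x; rewrite ler_norml => /andP[_].
by have := ler_norm s; lra.
Qed.

Let g_trace : hausdorff1 [set x | boundary Omega x /\ c < dot x n /\ ~ vanishing_mean g x] = 0%E.
Proof.
apply/eqP; rewrite eq_le hausdorff1_ge0 andbT -trace0; apply: le_hausdorff1.
move=> x [bx [cx nv]]; split => //; split => // van; apply: nv => e e0.
have [d [d0 hd]] := van e e0; exists d; split => // s sd; apply: le_trans (hd s sd).
apply: le_Rintegral; [exact: measurableT| | |].
- by apply: indic_mul_integrable; exact: half_measurable.
- by apply: indic_mul_integrable; exact: cap_measurable.
by move=> y _; apply: ler_wpM2r; [rewrite indicE|exact: gcap].
Qed.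

Let sd y := dot y e2 - h (dot y e1).

Let csd : continuous sd.
Proof.
apply: contB; first exact: continuous_dot.
apply: cont_comp; last exact: continuous_dot.
by move=> t; apply: differentiable_continuous; apply/derivable1_diffP; have [] := cc_dh chart t.
Qed.

(** The part of the support of [phi] beyond [c1] is a compact subset of the cap, hence at positive
    height over the graph. For small strips the cutoff is therefore 1 wherever [phi] acts there. *)
Let height : exists d0 : R, 0 < d0 /\ forall y, phi y != 0 -> c1 <= dot y n -> d0 <= sd y.
Proof.
have [K [cK KO phiK]] := rf_supp rphi.
pose K' := K `&` [set y | c1 <= dot y n].
have cK' : compact K'.
  apply: (subclosed_compact _ cK); last exact: subIsetl.
  apply: (@closedI _ K [set y | c1 <= dot y n]); first by apply: compact_closed => //; exact: norm_hausdorff.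
  by apply: closed_ge_fun; exact: continuous_dot.
have pos' y : K' y -> 0 < sd y.
  move=> [Ky yc]; rewrite subr_gt0; apply/(cc_graph chart); last exact: KO.
  have := cap_sub (KO _ Ky) (lt_le_trans cc1 yc); rewrite /eball /=.
  by have := cc_r chart; lra.
have [d [d0 hd]] := @compact_positive_min _ _ K' sd cK' csd pos'.
exists d; split => // y py yc; apply: hd; split => //.
by apply: contrapT => /phiK py0; rewrite py0 eqxx in py.
Qed.

Let dnorm1 : `|dot n e1| <= 1.
Proof. by rewrite (le_trans (norm_dot_le _ _)) // /enorm n1 (cc_e11 chart) sqrtr1 mulr1. Qed.

Let dnorm2 : `|dot n e2| <= 1.
Proof. by rewrite (le_trans (norm_dot_le _ _)) // /enorm n1 (cc_e22 chart) sqrtr1 mulr1. Qed.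

Let integrand y := (w y - X (dot y n) * p y) * divergence phi y.

Let cdiv : continuous (fun y => divergence phi y).
Proof. by have [_ _ _ _ k1 k2 _ _] := rphi; exact: (contD k1 k2). Qed.

Let mX : measurable_fun setT (fun y => X (dot y n)).
Proof. by apply: continuous_measurable2; apply: cont_comp; [exact: continuous_astp|exact: continuous_dot]. Qed.

Let X01 t : 0 <= X t <= 1. Proof. exact: stp01. Qed.

Let div_supp : exists M, forall y, M < `|y| -> divergence phi y = 0.
Proof.
have [_ _ pp1 pp2 _ _ _ [K [cK KO phiK]]] := rphi.
have [M KM] := compact_box_bounded cK.
have out y : M < `|y| -> phi y = 0 by move=> yM; apply: phiK => /KM/boxP; rewrite leNgt yM.
have o1 y : M < `|y| -> (phi y).1 = 0 by move=> /out ->.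
have o2 y : M < `|y| -> (phi y).2 = 0 by move=> /out ->.
by exists M => y yM; rewrite /divergence (pd1_outside pp1 o1 yM) (pd2_outside pp2 o2 yM) addr0.
Qed.

Let integrand_le y : `|integrand y| <= (W + B) * `|divergence phi y|.
Proof.
rewrite normrM ler_wpM2r // (le_trans (ler_normB _ _)) // lerD // normrM.
have /andP[h0 h1] := X01 (dot y n); rewrite !ger0_norm //.
by rewrite (le_trans _ (pB y)) // ler_piMl.
Qed.

Let iintegrand : mu2.-integrable setT (EFin \o integrand).
Proof.
have [M hM] := div_supp; have [C [C0 hC]] := compact_support_bounded cdiv hM.
apply: (@bounded_box_integrable _ _ ((W + B) * C) M).
- by apply: measurable_funM; [apply: measurable_funB => //; exact: measurable_funM|exact: continuous_measurable2].
- move=> y; apply: (le_trans (integrand_le y)); apply: ler_wpM2l => //.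
  by rewrite !addr_ge0.
by move=> y yM; rewrite /integrand hM // mulr0.
Qed.

(** [truncation_bound] with the cutoff along the arc as [eta]. The price is the derivative of [eta],
    which is of order 1/d and confined to the strip, so that it becomes an average of [g] over the
    strip. *)
Let level_bound : exists C d0 : R, 0 <= C /\ 0 < d0 /\ forall d, 0 < d < d0 ->
  \int[mu2]_y integrand y <= V + C * (d^-1 * \int[mu2]_y (g y * \1_(strip e1 e2 h d) y)).
Proof.
have r0 := cc_r chart.
have [M [M0 hM]] := continuous_segment_bounded (dot x0 e1) r (cc_cdh chart).
have [d0 [d00 hd0]] := height.
exists (2 * (1 + M)), (d0 / 2); split; first by rewrite mulr_ge0 // addr_ge0.
split; first by rewrite divr_gt0.
move=> d /andP[dgt0 dlt].
pose eta := cutoff e1 e2 x0 r d h.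
pose eta1 := dcutoff e1 e2 x0 r d h dh e1.1 e2.1.
pose eta2 := dcutoff e1 e2 x0 r d h dh e1.2 e2.2.
pose S : set (R * R) := [set y | enorm (y - x0) <= 3 * r / 4 /\ d <= sd y].
have cS : compact S.
  apply: (subclosed_compact _ (@compact_box _ (`|x0| + r))).
    apply: (@closedI _ [set y | enorm (y - x0) <= 3 * r / 4] [set y | d <= sd y]).
      by apply: closed_le_fun; exact: continuous_enorm_sub.
    exact: closed_ge_fun.
  move=> y [yx _]; apply/boxP; have := norm_le_enorm (y - x0).
  by have := ler_dist_dist y x0; rewrite ler_norml => /andP[_]; lra.
have SO : S `<=` Omega.
  move=> y [yx yd]; apply/(cc_graph chart); first by rewrite /eball /=; lra.
  by rewrite -subr_gt0 (lt_le_trans dgt0).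
have etaS y : ~ S y -> eta y = 0.
  move=> nS; apply/eqP/negPn/negP => /cutoff_supp [] //; try exact: (cc_e11 chart).
  - exact: (cc_e22 chart).
  - exact: (cc_e12 chart).
  by move=> h1 h2; apply: nS; split; exact: ltW.
(* Where the derivative of the step is nonzero, either [phi] vanishes and [eta] >= 0 suffices, or
   the point is high enough for [eta] = 1, while phi.n <= 1. *)
have flux y : 0 <= dX (dot y n) * (eta y - dot (phi y) n).
  have /andP[s0 _] := dstp02 ((c2 - c1)^-1 * (dot y n - c1)).
  have dX0 : 0 <= dX (dot y n) by rewrite mulr_ge0 // ltW.
  have /andP[t0 t1] := cutoff01 e1 e2 x0 r d h y.
  have [py|py] := eqVneq (phi y) 0; first by rewrite mulr_ge0 // py /dot /= !mul0r addr0 subr0.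
  have [yc|yc] := leP (dot y n) c1.
    by rewrite /dX /dastp dstp_0 ?mulr0 ?mul0r // pmulr_rle0 // subr_le0.
  apply: mulr_ge0 => //; rewrite subr_ge0 /eta cutoff_1 //.
  - by rewrite (le_trans (ler_norm _)) // (le_trans (norm_dot_le _ _)) // {2}/enorm n1 sqrtr1 mulr1; apply/enorm_le1; exact: (rf_dot rphi).
  - exact: (cc_e11 chart).
  - exact: (cc_e22 chart).
  - exact: (cc_e12 chart).
  - have [K [cK KO phiK]] := rf_supp rphi; apply: cap_sub; last exact: lt_trans cc1 yc.
    by apply: KO; apply: contrapT => /phiK p00; rewrite p00 eqxx in py.
  - by have := hd0 _ py (ltW yc); rewrite /sd; lra.
have dhh := cc_dh chart; have cdh := cc_cdh chart.
have k1 : continuous eta by apply: continuous_cutoff; exact: dhh.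
have k2 : continuous eta1 by apply: continuous_dcutoff; first [exact: dhh|exact: cdh].
have k3 : continuous eta2 by apply: continuous_dcutoff; first [exact: dhh|exact: cdh].
have k4 : has_pd1 eta eta1 by apply: has_pd1_cutoff; exact: dhh.
have k5 : has_pd2 eta eta2 by apply: has_pd2_cutoff; exact: dhh.
have k6 : continuous dX by exact: continuous_dastp.
have [iT Tle] := @truncation_bound _ Omega w V N oO iw wN wV phi rphi n X dX eta eta1 eta2 S k n1
  (is_derive_astp _ _) k6 X01 k1 k4 k5 k2 k3 (cutoff01 e1 e2 x0 r d h) cS SO etaS flux.
pose K := d^-1 * (2 * (1 + M)).
have K0 : 0 <= K by rewrite mulr_ge0 // ?invr_ge0 ?(ltW dgt0) // mulr_ge0 // addr_ge0.
pose T y := (w y - X (dot y n) * pos (w y - k)) * divergence phi y +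
  X (dot y n) * pos (w y - k) * (n.1 * eta1 y + n.2 * eta2 y).
have mS : measurable (strip e1 e2 h d).
  have -> : strip e1 e2 h d = [set y | d <= sd y] `&` [set y | sd y <= 2 * d].
    by apply/seteqP; split => [y /andP[]//|y [s1 s2]]; apply/andP.
  by apply: measurableI; apply: closed_measurable2; [apply: closed_ge_fun; exact: csd|apply: closed_le_fun; exact: csd].
have igs : mu2.-integrable setT (EFin \o (fun y => g y * \1_(strip e1 e2 h d) y)).
  apply: (@bounded_box_integrable _ _ B (`|x0| + `|r|)).
  - apply: measurable_funM; last exact: measurable_indic.
    by apply: measurable_funM => //; apply: measurable_indic; exact: half_measurable.
  - move=> y; rewrite /g !indicE !normrM (ger0_norm (p0 y)).
    by do 2 case: (_ \in _); rewrite ?normr1 ?normr0 ?mul0r ?mulr0 ?mul1r ?mulr1 // addr_ge0.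
  move=> y yM; rewrite /g indicE memNset ?mul0r //= => -[Oy yc].
  have := cap_sub Oy (lt_le_trans cc1 yc); move: yM; rewrite /eball /=.
  have := norm_le_enorm (y - x0); have := ler_dist_dist y x0; rewrite ler_norml => /andP[_].
  by have := ler_norm r; lra.
have point y : integrand y <= T y + K * (g y * \1_(strip e1 e2 h d) y).
  rewrite /T -/(integrand y) -addrA lerDl.
  have -> : n.1 * eta1 y + n.2 * eta2 y = dcutoff e1 e2 x0 r d h dh (dot n e1) (dot n e2) y.
    by rewrite /eta1 /eta2 /dcutoff /dot; ring.
  rewrite -lerBlDl sub0r (le_trans _ (_ : `|X (dot y n) * p y * dcutoff e1 e2 x0 r d h dh (dot n e1) (dot n e2) y| <= _)) //.
    by rewrite -/(p y) (le_trans (ler_norm _)) // normrN.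
  have R0 : 0 <= K * (g y * \1_(strip e1 e2 h d) y).
    by apply: mulr_ge0 => //; apply: mulr_ge0; rewrite ?indicE // /g mulr_ge0 // indicE.
  have [yc|yc] := leP (dot y n) c1.
    by rewrite /X /astp stp_0 ?mul0r ?normr0 // pmulr_rle0 // subr_le0.
  have [Oy|nO] := pselect (Omega y); last first.
    suff -> : dcutoff e1 e2 x0 r d h dh (dot n e1) (dot n e2) y = 0 by rewrite mulr0 normr0.
    have [yr|yr] := leP r (enorm (y - x0)).
      by apply: dcutoff_far => //; [exact: (cc_e11 chart)|exact: (cc_e22 chart)|exact: (cc_e12 chart)].
    apply: dcutoff_low => //; rewrite subr_le0 leNgt; apply/negP => hy.
    by apply: nO; apply/(cc_graph chart yr).
  have yb : eball x0 (r / 2) y by apply: cap_sub => //; exact: lt_trans yc.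
  have gE : g y = p y by rewrite /g indicE mem_set ?mul1r //; split => //; exact: ltW.
  have dM : `|dh (dot y e1)| <= M.
    apply: hM; rewrite -dotBl (le_trans (norm_dot_le _ _)) // {2}/enorm (cc_e11 chart) sqrtr1 mulr1.
    by move: yb; rewrite /eball /=; move: r0; lra.
  have h1 := dcutoff_le h (cc_e11 chart) (cc_e22 chart) (cc_e12 chart) r0 dgt0 yb dnorm1 dnorm2 dM.
  have /andP[x0' x1] := X01 (dot y n).
  rewrite gE normrM mulrCA; apply: ler_pM => //.
  by rewrite normrM (ger0_norm x0') (ger0_norm (p0 y)) ler_piMl.
have E := le_Rintegral measurableT iintegrand (integrable_add iT (integrable_scale K measurableT igs)) (fun y _ => point y).
apply: (le_trans E).
rewrite (RintegralD measurableT iT (integrable_scale K measurableT igs)) (RintegralZl _ measurableT igs).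
by apply: lerD; [exact: Tle|rewrite /K (mulrC d^-1 (2 * (1 + M))) -!mulrA].
Qed.

Lemma smooth_cap_bound : mu2.-integrable setT (EFin \o integrand) /\ \int[mu2]_y integrand y <= V.
Proof.
split; first exact: iintegrand.
have [C [d0 [C0 [d00 hd]]]] := level_bound; have r0 := cc_r chart.
pose m := Num.min (r / 2) d0; have m0 : 0 < m by rewrite lt_min divr_gt0.
(* Starting the denominators at 2 makes every [d j] strictly smaller than [m]. *)
pose d (j : nat) := m / j.+2%:R.
have djm j : 0 < d j < m.
  by rewrite divr_gt0 //= ltr_pdivrMr // ltr_pMr // ltr1n.
have dj0 : d @ \oo --> 0.
  rewrite -[X in _ --> X](mulr0 m); apply: cvgM; first exact: cvg_cst.
  by have := @cvg_harmonic R; rewrite -(@cvg_shiftn 1) /harmonic /=; under eq_fun do rewrite addn1.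
have dr j : 0 < d j < r / 2.
  by have /andP[-> h1] := djm j; rewrite (lt_le_trans h1) // ge_min lexx.
have mg : measurable_fun setT g.
  by apply: measurable_funM => //; apply: measurable_indic; exact: half_measurable.
have g0 y : 0 <= g y by rewrite /g mulr_ge0 // indicE.
have gB y : g y <= B.
  by rewrite /g (le_trans _ (pB y)) // ler_piMl // indicE; case: (_ \in _).
have gs y : g y != 0 -> Omega y /\ c1 <= dot y n.
  by rewrite /g indicE; case: (boolP (y \in _)) => [/set_mem//|]; rewrite mul0r eqxx.
have S0 := strip_average chart cc1 n1 mg g0 gB gs cap_sub g_trace dr dj0.
have S1 : (fun j => V + C * ((d j)^-1 * \int[mu2]_y (g y * \1_(strip e1 e2 h (d j)) y))) @ \oo --> V.
  rewrite -[X in _ --> X]addr0 -[X in _ --> _ + X](mulr0 C).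
  by apply: cvgD; [exact: cvg_cst|apply: cvgM; [exact: cvg_cst|exact: S0]].
apply: (@cvgr_to_ge _ _ _ _ _ _ _ S1); apply: nearW => j; apply: hd.
by have /andP[-> h1] := djm j; rewrite (lt_le_trans h1) // ge_min lexx orbT.
Qed.

End smooth.

Lemma cap_truncation : tv_le Omega (fun y => w y - \1_[set y | c < dot y n] y * pos (w y - k)) V.
Proof.
move=> phi tphi.
(* The steps from c + ci to c + 2 ci converge pointwise to the indicator of the open half-plane; on
   its bounding line all of them are 0, like the indicator. *)
pose ci (j : nat) := j.+1%:R^-1 : R.
have ci0 j : 0 < ci j by rewrite invr_gt0.
have h1 j : c < c + ci j by rewrite ltrDl.
have h2 j : c + ci j < c + 2 * ci j by have := ci0 j; lra.
pose F j y := (w y - astp (c + 2 * ci j - (c + ci j))^-1 (c + ci j) (dot y n) * pos (w y - k)) * divergence phi y.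
have FV j : \int[mu2]_y F j y <= V by have [_] := smooth_cap_bound tphi (h1 j) (h2 j).
have iF j : mu2.-integrable setT (EFin \o F j) by have [] := smooth_cap_bound tphi (h1 j) (h2 j).
have mF j : measurable_fun setT (F j) by have /measurable_int/measurable_EFinP := iF j.
have rphi := test_field_regular tphi.
have cdiv : continuous (fun y => divergence phi y).
  by have [_ _ _ _ k1 k2 _ _] := rphi; exact: (contD k1 k2).
have [M hM] : exists M, forall y, M < `|y| -> divergence phi y = 0.
  have [_ _ pp1 pp2 _ _ _ [K [cK KO phiK]]] := rphi.
  have [M KM] := compact_box_bounded cK.
  have out y : M < `|y| -> phi y = 0 by move=> yM; apply: phiK => /KM/boxP; rewrite leNgt yM.
  have o1 y : M < `|y| -> (phi y).1 = 0 by move=> /out ->.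
  have o2 y : M < `|y| -> (phi y).2 = 0 by move=> /out ->.
  by exists M => y yM; rewrite /divergence (pd1_outside pp1 o1 yM) (pd2_outside pp2 o2 yM) addr0.
have idiv := continuous_box_integrable cdiv hM.
have FB j y : `|F j y| <= (W + B) * `|divergence phi y|.
  rewrite normrM ler_wpM2r // (le_trans (ler_normB _ _)) // lerD // normrM.
  have /andP[s0 s1] := stp01 ((c + 2 * ci j - (c + ci j))^-1 * (dot y n - (c + ci j))).
  rewrite (ger0_norm s0) (ger0_norm (pos_ge0 _)).
  exact: (le_trans (ler_piMl (pos_ge0 _) s1) (pB y)).
have Fc y : F ^~ y @ \oo --> (w y - \1_[set y | c < dot y n] y * pos (w y - k)) * divergence phi y.
  apply: cvgM; last exact: cvg_cst.
  apply: cvgB; first exact: cvg_cst.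
  apply: cvgM; last exact: cvg_cst.
  have [yc|yc] := leP (dot y n) c.
    rewrite indicE memNset /=; last by apply/negP; rewrite -leNgt.
    apply: (@cvg_trans _ ((fun=> 0 : R) @ \oo)); last exact: cvg_cst.
    apply: near_eq_cvg; apply: nearW => j; rewrite /astp stp_0 //.
    rewrite pmulr_rle0 ?subr_le0; first by rewrite (le_trans yc) // ltW.
    by rewrite invr_gt0 subr_gt0.
  rewrite indicE mem_set //=.
  apply: (@cvg_trans _ ((fun=> 1 : R) @ \oo)); last exact: cvg_cst.
  apply: near_eq_cvg.
  have e0 : 0 < (dot y n - c) / 2 by rewrite divr_gt0 // subr_gt0.
  have := @cvg_harmonic R => /cvgr0Pnorm_lt /(_ _ e0); apply: filterS => j.
  rewrite /harmonic /= -/(ci j) gtr0_norm // => cj.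
  rewrite /astp stp_1 // ler_pdivlMl ?mulr1; last by rewrite subr_gt0.
  by lra.
have iG := integrable_norm_fin measurableT idiv.
have iG' : mu2.-integrable setT (EFin \o (fun y => (W + B) * `|divergence phi y|)) by exact: (integrable_scale (W + B) measurableT iG).
have [_ Ic] := @Rdominated_convergence _ _ _ mu2 setT F _ _ measurableT mF (fun y _ => Fc y) iG' (fun j y _ => FB j y).
by apply: (@cvgr_to_le _ _ _ _ _ _ _ Ic); apply: nearW.
Qed.
End cap_truncation.

(** * Total variation of bounded functions, minimisation *)

Section variation.
Context {R : realType}.
Notation mu := (@lebesgue_measure R).
Notation mu2 := (mu \x mu)%E.
Implicit Types (Omega : set (R * R)) (u v w : R * R -> R) (phi : R * R -> R * R) (V N W k : R).

Lemma continuous_divergence Omega phi : test_field Omega phi -> continuous (fun y => divergence phi y).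
Proof. by move=> /test_field_regular [_ _ _ _ k1 k2 _ _]; exact: (contD k1 k2). Qed.

Lemma divergence_outside Omega phi : test_field Omega phi -> forall y, ~ Omega y -> divergence phi y = 0.
Proof.
move=> tphi y nO; have [_ cS SO _] := tphi; set S := closure _ in cS SO.
have clS : closed S by exact: closed_closure.
have nS : ~ S y by move=> /SO.
have S0 x : ~ S x -> phi x = 0.
  by move=> nSx; apply/eqP/negPn/negP => px; apply: nSx; exact: subset_closure.
have oS : open (~` S) by exact: closed_openC.
have D0 (z : R * R) : 'D_z phi y = 0.
  have E : \forall h \near (0 : R)^', h^-1 *: ((phi \o shift y) (h *: z) - phi y) = 0.
    have /nbhs_normP [e /= e0 he] := open_nbhs_nbhs (conj oS nS).
    have d0 : 0 < e / (`|z| + 1) by rewrite divr_gt0 // ltr_wpDl.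
    exists (e / (`|z| + 1)) => // h /=; rewrite sub0r normrN => hd _.
    have nSh : ~ S (h *: z + y).
      apply: he => /=; rewrite opprD addrCA subrr addr0 normrN normrZ.
      move: hd; rewrite ltr_pdivlMr ?ltr_wpDl //; apply: le_lt_trans.
      by rewrite ler_wpM2l // lerDl.
    by rewrite (S0 _ nSh) (S0 _ nS) subrr scaler0.
  rewrite /derive; apply: cvg_lim; first exact: norm_hausdorff.
  apply: (@cvg_trans _ ((fun=> 0 : R * R) @ (0 : R)^')); last exact: cvg_cst.
  by apply: near_eq_cvg; apply: filterS E => h ->.
by rewrite /divergence !D0 addr0.
Qed.

Lemma divergence_support Omega phi : test_field Omega phi ->
  exists M : R, forall y, M < `|y| -> divergence phi y = 0.
Proof.
move=> /test_field_regular [_ _ pp1 pp2 _ _ _ [K [cK KO phiK]]].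
have [M KM] := compact_box_bounded cK.
have out y : M < `|y| -> phi y = 0 by move=> yM; apply: phiK => /KM/boxP; rewrite leNgt yM.
have o1 y : M < `|y| -> (phi y).1 = 0 by move=> /out ->.
have o2 y : M < `|y| -> (phi y).2 = 0 by move=> /out ->.
by exists M => y yM; rewrite /divergence (pd1_outside pp1 o1 yM) (pd2_outside pp2 o2 yM) addr0.
Qed.

Lemma integrable_divergence Omega phi : test_field Omega phi ->
  mu2.-integrable setT (EFin \o (fun y => divergence phi y)).
Proof.
move=> tphi; have [M hM] := divergence_support tphi.
by apply: (continuous_box_integrable _ hM); exact: continuous_divergence tphi.
Qed.

Lemma bounded_divergence Omega phi : test_field Omega phi ->
  exists C : R, 0 <= C /\ forall y, `|divergence phi y| <= C.
Proof.
move=> tphi; have [M hM] := divergence_support tphi.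
by apply: (compact_support_bounded _ hM); exact: continuous_divergence tphi.
Qed.

Lemma integrable_mul_divergence Omega phi w : test_field Omega phi ->
  mu2.-integrable setT (EFin \o w) -> mu2.-integrable setT (EFin \o (fun y => w y * divergence phi y)).
Proof.
move=> tphi iw; have [C [C0 hC]] := bounded_divergence tphi.
have mdiv : measurable_fun setT (fun y => divergence phi y).
  by apply: continuous_measurable2; exact: continuous_divergence tphi.
exact: (integrable_mul_bounded measurableT iw mdiv (fun y _ => hC y)).
Qed.

Lemma tv_le_ext Omega u v V : (forall y, Omega y -> u y = v y) -> tv_le Omega u V -> tv_le Omega v V.
Proof.
move=> uv uV phi tphi; rewrite (le_trans _ (uV phi tphi)) //.
rewrite le_eqVlt; apply/orP; left; apply/eqP; apply: eq_Rintegral => y _.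
have [/uv ->//|nO] := pselect (Omega y).
by rewrite (divergence_outside tphi nO) !mulr0.
Qed.

Lemma test_field0 Omega : test_field Omega (fun=> 0).
Proof.
have D0 (z : R * R) : (fun x => 'D_z (fun _ : R * R => 0 : R * R) x) = fun=> 0.
  by apply/funext => x; exact: derive_cst.
have S0 : [set x : R * R | (fun _ : R * R => 0 : R * R) x != 0] = set0.
  by apply/seteqP; split => // x /=; rewrite eqxx.
split; [|by rewrite S0 closure0; exact: compact0|by rewrite S0 closure0|].
  by move=> v; split => [x|]; [exact: derivable_cst|rewrite D0 => x; exact: cvg_cst].
by move=> x; apply/enorm_le1; rewrite /dot /= !mul0r addr0 ler01.
Qed.

Lemma tv_le_ge0 Omega u V : tv_le Omega u V -> 0 <= V.
Proof.
move=> /(_ _ (test_field0 Omega)); apply: le_trans.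
have D0 x : divergence (fun _ : R * R => 0 : R * R) x = 0 by rewrite /divergence !derive_cst addr0.
rewrite (_ : (fun y => _) = fun=> 0) ?Rintegral_cst ?mul0r //.
by apply/funext => y; rewrite D0 mulr0.
Qed.

Lemma test_fieldN Omega phi : test_field Omega phi -> test_field Omega (fun x => - phi x).
Proof.
move=> [C1 cS SO phi1].
have DN (z x : R * R) : is_derive x z (fun x => - phi x) (- 'D_z phi x).
  have d : derivable phi x z by have [] := C1 z.
  by apply: is_deriveN; exact: DeriveDef.
have SE : [set x | - phi x != 0] = [set x | phi x != 0].
  by apply/seteqP; split => x /=; rewrite oppr_eq0.
split; [|by rewrite SE; exact: cS|by rewrite SE; exact: SO|].
  move=> z; split => [x|]; first by have [] := DN z x.
  have -> : (fun x => 'D_z (fun x0 => - phi x0) x) = (fun x => - 'D_z phi x).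
    by apply/funext => x; have [_ ->] := DN z x.
  by move=> x; apply: cvgN; have [_] := C1 z; exact.
by move=> x; rewrite enormN; exact: phi1.
Qed.

Lemma divergenceN Omega phi x : test_field Omega phi ->
  divergence (fun x => - phi x) x = - divergence phi x.
Proof.
move=> [C1 _ _ _].
have DN (z : R * R) : 'D_z (fun x => - phi x) x = - 'D_z phi x.
  by apply: deriveN; have [] := C1 z.
by rewrite /divergence !DN /= opprD.
Qed.

Lemma tv_leN Omega u V : tv_le Omega u V -> tv_le Omega (fun y => - u y) V.
Proof.
move=> uV phi tphi; apply: le_trans (uV _ (test_fieldN tphi)).
rewrite le_eqVlt; apply/orP; left; apply/eqP; apply: eq_Rintegral => y _.
by rewrite (divergenceN _ tphi) mulrN mulNr.
Qed.

Definition bdd W N w := [/\ measurable_fun setT w, forall y, `|w y| <= W & forall y, N < `|y| -> w y = 0].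

Lemma bdd_integrable W N w : bdd W N w -> mu2.-integrable setT (EFin \o w).
Proof. by move=> [mw wW wN]; exact: bounded_box_integrable mw wW wN. Qed.

Lemma bddN W N w : bdd W N w -> bdd W N (fun y => - w y).
Proof.
move=> [mw wW wN]; split => [|y|y /wN ->]; [exact: measurableT_comp|by rewrite normrN|by rewrite oppr0].
Qed.

(** The case of [truncation_bound] with chi = 1 and eta = 0: truncation in the whole domain involves
    no half-plane, hence no term along the boundary. *)
Lemma tv_le_truncate Omega w V N k : open Omega -> mu2.-integrable setT (EFin \o w) ->
  (forall y, N < `|y| -> w y = 0) -> tv_le Omega w V ->
  tv_le Omega (fun y => w y - pos (w y - k)) V.
Proof.
move=> oO iw wN wV phi tphi; have rphi := test_field_regular tphi.
have n1 : dot ((1, 0) : R * R) (1, 0) = 1 by rewrite /dot /= mulr1 mulr0 addr0.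
have c0 (T : topologicalType) : continuous (fun _ : T => 0 : R) by exact: cont_cst.
have X01 (t : R) : 0 <= (fun=> 1 : R) t <= 1 by rewrite ler01 lexx.
have e01 (x : R * R) : 0 <= (fun=> 0 : R) x <= 1 by rewrite lexx ler01.
have fl (x : R * R) : 0 <= (fun=> 0 : R) (dot x (1, 0)) * ((fun=> 0) x - dot (phi x) (1, 0)) by rewrite mul0r.
have [_] := @truncation_bound _ Omega w V N oO iw wN wV phi rphi (1, 0) (fun=> 1) (fun=> 0)
  (fun=> 0) (fun=> 0) (fun=> 0) set0 k n1 (fun t => is_derive_cst (1 : R) t (1 : R)) (@c0 R)
  X01 (@c0 (R * R)%type) (has_pd1_cst 0) (has_pd2_cst 0) (@c0 (R * R)%type) (@c0 (R * R)%type) e01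
  (@compact0 _) (@sub0set _ Omega) (fun _ _ => erefl) fl.
apply: le_trans; rewrite le_eqVlt; apply/orP; left; apply/eqP; apply: eq_Rintegral => y _.
by rewrite !mul1r !mulr0 addr0 mulr0 addr0.
Qed.

(** Lower semicontinuity of the variation. Each test field has a bounded divergence of bounded
    support, so dominated convergence can be applied to one field at a time. *)
Lemma tv_le_limit Omega (N0 : set (R * R)) (w_ : nat -> R * R -> R) w W N (V_ : nat -> R) V :
  mu2.-negligible N0 -> (forall j, bdd W N (w_ j)) -> measurable_fun setT w ->
  (forall y, ~ N0 y -> w_ ^~ y @ \oo --> w y) ->
  (forall j, tv_le Omega (w_ j) (V_ j)) -> V_ @ \oo --> V -> tv_le Omega w V.
Proof.
move=> nN0 bw mw ww wV V_V phi tphi.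
have iw j := integrable_mul_divergence tphi (bdd_integrable (bw j)).
have mF j : measurable_fun setT (fun y => w_ j y * divergence phi y).
  by have /measurable_int/measurable_EFinP := iw j.
have mdiv : measurable_fun setT (fun y => divergence phi y).
  by apply: continuous_measurable2; exact: continuous_divergence tphi.
have mf : measurable_fun setT (fun y => w y * divergence phi y) by exact: measurable_funM.
have iG := integrable_norm_fin measurableT (integrable_divergence tphi).
have iG' : mu2.-integrable setT (EFin \o (fun y => W * `|divergence phi y|)) by exact: (integrable_scale W measurableT iG).
have FG j y : `|w_ j y * divergence phi y| <= W * `|divergence phi y|.
  by rewrite normrM ler_wpM2r //; have [_ + _] := bw j; apply.
have Fc y : ~ N0 y -> (fun j => w_ j y * divergence phi y) @ \oo --> w y * divergence phi y.
  by move=> /ww h; apply: cvgM; [exact: h|exact: cvg_cst].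
have [_ Ic] := @Rdominated_convergence_ae _ _ _ mu2 N0 (fun j y => w_ j y * divergence phi y) _ _ nN0 mF mf Fc iG' FG.
by apply: (ler_cvg_to Ic V_V); apply: nearW => j; exact: wV.
Qed.

Lemma tv_le_lincomb Omega u v (a b V1 V2 : R) : 0 <= a -> 0 <= b ->
  mu2.-integrable setT (EFin \o u) -> mu2.-integrable setT (EFin \o v) ->
  tv_le Omega u V1 -> tv_le Omega v V2 -> tv_le Omega (fun y => a * u y + b * v y) (a * V1 + b * V2).
Proof.
move=> a0 b0 iu iv uV vV phi tphi.
have -> : \int[mu2]_y ((a * u y + b * v y) * divergence phi y) =
  \int[mu2]_y (a * (u y * divergence phi y) + b * (v y * divergence phi y)).
  by apply: eq_Rintegral => y _; rewrite mulrDl !mulrA.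
rewrite (Rintegral_lincomb _ _ (integrable_mul_divergence tphi iu) (integrable_mul_divergence tphi iv)).
by apply: lerD; apply: ler_wpM2l => //; [exact: uV|exact: vV].
Qed.

Lemma negligible0 : mu2.-negligible (set0 : set (R * R)).
Proof. exact: negligible_set0. Qed.

(** Cutting on C 0, C 1, ... in turn gives a decreasing sequence, so it converges, and later cuts
    cannot destroy an earlier upper bound. The last clause records that nothing is lowered further
    than the constraints force: it is what protects lower bounds when cuts from above and from below
    are combined. *)
Lemma successive_truncation Omega w W N V (C : nat -> set (R * R)) (k : nat -> R) :
  bdd W N w -> tv_le Omega w V -> (forall j, measurable (C j)) -> (forall j, `|k j| <= W) ->
  (forall j y, C j y -> `|y| <= N) ->
  (forall j w', bdd W N w' -> (forall y, w' y <= w y) -> tv_le Omega w' V ->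
     tv_le Omega (fun y => w' y - \1_(C j) y * pos (w' y - k j)) V) ->
  exists w', [/\ bdd W N w', tv_le Omega w' V, forall y, w' y <= w y,
    forall j y, C j y -> w' y <= k j &
    forall y b, b <= w y -> (forall j, C j y -> b <= k j) -> b <= w' y].
Proof.
move=> bw wV mC kW CN step.
pose S := fix S j := if j is i.+1 then fun y => S i y - \1_(C i) y * pos (S i y - k i) else w.
have SE j y : S j.+1 y = if y \in C j then Num.min (S j y) (k j) else S j y.
  rewrite /= indicE; case: (y \in C j); last by rewrite mul0r subr0.
  by rewrite mul1r /pos; case: (leP (S j y) (k j)) => h; [rewrite max_r ?subr0 // subr_le0|rewrite max_l ?subr_ge0 ?ltW // opprB addrC subrK].
have S_dec j y : S j.+1 y <= S j y.
  by rewrite SE; case: ifP => // _; rewrite ge_min lexx.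
have SI j : bdd W N (S j) /\ tv_le Omega (S j) V /\ forall y, S j y <= w y.
  elim: j => [|j [bS [SV Sw]]]; first by split.
  have bS' : bdd W N (S j.+1).
    have [mS SW SN] := bS; split.
    - apply: measurable_funB => //; apply: measurable_funM; first exact: measurable_indic.
      by apply: measurable_maxr => //; exact: measurable_funB.
    - move=> y; rewrite SE; case: ifP => // _; rewrite ler_norml le_min ge_min.
      have := SW y; have := kW j; rewrite !ler_norml => /andP[-> ->] /andP[-> ->].
      by [].
    - move=> y yN; rewrite SE; case: ifP => [/set_mem /CN|_]; last exact: SN.
      by rewrite leNgt yN.
  split => //; split; last by move=> y; exact: le_trans (S_dec j y) (Sw y).
  exact: step.
have S_nonincr y : nonincreasing_seq (S ^~ y).
  by apply/nonincreasing_seqP => j; exact: S_dec.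
have S_lb y : has_lbound (range (S ^~ y)).
  exists (- W) => _ [j _ <-]; have [[_ SW _] _] := SI j.
  by have := SW y; rewrite ler_norml => /andP[].
have S_cvg y : cvgn (S ^~ y) by exact: nonincreasing_is_cvgn.
pose w' y := limn (S ^~ y).
have w'S j y : w' y <= S j y by exact: nonincreasing_cvgn_ge.
have mw' : measurable_fun setT w'.
  apply: (@measurable_fun_cvg _ _ _ _ S); first by move=> j; have [[]] := SI j.
  by move=> y _; exact: S_cvg.
have lb y b : (forall j, b <= S j y) -> b <= w' y.
  by move=> h; apply: limr_ge; [exact: S_cvg|exact: nearW].
have ub y b j : S j y <= b -> w' y <= b by move=> h; exact: le_trans (w'S j y) h.
exists w'; split.
- split => //.
    move=> y; rewrite ler_norml; apply/andP; split.
      by apply: lb => j; have [[_ SW _] _] := SI j; have := SW y; rewrite ler_norml => /andP[].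
    by have [_ wW _] := bw; apply: (ub _ _ 0%N); have := wW y; rewrite ler_norml => /andP[].
  move=> y yN; rewrite /w' (_ : S ^~ y = fun=> 0) ?lim_cst //.
  by apply/funext => j; have [[_ _ SN] _] := SI j; rewrite SN.
- exact: (@tv_le_limit Omega set0 S w' W N (fun=> V) V negligible0 (fun j => (SI j).1) mw'
    (fun y _ => S_cvg y) (fun j => (SI j).2.1) (cvg_cst _)).
- by move=> y; apply: (w'S 0%N).
- by move=> j y Cy; apply: (ub _ _ j.+1); rewrite SE mem_set // ge_min lexx orbT.
move=> y b bwy bk; apply: lb; elim => // j IH.
by rewrite SE; case: ifP => // /set_mem Cy; rewrite le_min IH bk.
Qed.

End variation.

(** * Existence of a minimiser in a convex class *)

Section minimization.
Context {R : realType}.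
Notation mu := (@lebesgue_measure R).
Notation mu2 := (mu \x mu)%E.
Implicit Types (Omega : set (R * R)) (u v w : R * R -> R) (V N W : R).

(** The sum of the absolute increments has a finite integral, hence is finite almost everywhere, and
    there the telescoping series converges absolutely. *)
Lemma summable_ae_cvg W N (v : nat -> R * R -> R) (A : R) : (forall j, bdd W N (v j)) ->
  (forall j, \int[mu2]_y `|v j.+1 y - v j y| <= A / (2 ^ j.+1)%:R) ->
  exists Z, [/\ measurable Z, mu2 Z = 0%E & forall y, ~ Z y -> cvgn (v ^~ y)].
Proof.
move=> bv vA.
pose d j y := `|v j.+1 y - v j y|.
have id_ j : mu2.-integrable setT (EFin \o d j).
  exact: (integrable_norm_fin measurableT (integrable_sub (bdd_integrable (bv j.+1)) (bdd_integrable (bv j)))).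
have md j : measurable_fun setT (EFin \o d j) by exact: measurable_int (id_ j).
have A0 : 0 <= A.
  have h : 0 <= A / (2 ^ 1)%:R by apply: le_trans (vA 0%N); apply: Rintegral_ge0 => y _; exact: normr_ge0.
  by move: h; rewrite pmulr_lge0.
have dj j : (\int[mu2]_y (d j y)%:E <= (A / (2 ^ j.+1)%:R)%:E)%E.
  rewrite -(fineK (integrable_fin_num measurableT (id_ j))) lee_fin; exact: vA.
pose D y := (\sum_(j <oo) (d j y)%:E)%E.
have mD : measurable_fun setT D.
  apply: (@ge0_emeasurable_sum _ _ _ setT (fun j y => (d j y)%:E) xpredT); last by move=> j _; exact: md.
  by move=> j y _ _; rewrite lee_fin normr_ge0.
have D0 y : (0 <= D y)%E by apply: nneseries_ge0 => j _ _; rewrite lee_fin normr_ge0.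
have geo : (\sum_(j <oo) (A / (2 ^ j.+1)%:R)%:E < +oo)%E.
  have := @epsilon_trick R (fun=> 0%E) A xpredT (fun=> lexx _) A0.
  rewrite [X in (_ <= X + _)%E]eseries0 // add0e => h; apply: (le_lt_trans _ (ltry A)); apply: le_trans h.
  by apply: lee_nneseries => j _; rewrite ?add0e // lee_fin divr_ge0.
have iD : mu2.-integrable setT D.
  apply/integrableP; split => //.
  have -> : (\int[mu2]_y `|D y| = \int[mu2]_y D y)%E by apply: eq_integral => y _; rewrite gee0_abs.
  rewrite (integral_nneseries mu2 measurableT md); last by move=> j y _; rewrite lee_fin normr_ge0.
  apply: le_lt_trans geo; apply: lee_nneseries => [j _ _|j _]; last exact: dj.
  by apply: integral_ge0 => y _; rewrite lee_fin normr_ge0.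
have := integrable_ae measurableT iD => -[Z [mZ Z0 sZ]].
exists Z; split => // y nZ.
have Dfin : D y \is a fin_num.
  apply: contrapT => nf; apply: nZ; apply: sZ => /= h; apply: nf; exact: h.
have vE n : v n y = v 0%N y + \sum_(0 <= j < n) (v j.+1 y - v j y).
  by rewrite telescope_sumr // addrC subrK.
rewrite (_ : v ^~ y = fun n => v 0%N y + series (fun j => v j.+1 y - v j y) n); last exact/funext.
apply: is_cvgD; first exact: is_cvg_cst.
apply: normed_cvg; rewrite (_ : [normed series _] = series (d ^~ y)) //; apply: nondecreasing_is_cvgn.
  by apply/nondecreasing_seqP => n; rewrite /series /= big_nat_recr //= lerDl; exact: normr_ge0.
exists (fine (D y)) => _ [n _ <-].
rewrite -lee_fin fineK // /series /= -sumEFin.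
by apply: nneseries_lim_ge => j _ _; rewrite lee_fin normr_ge0.
Qed.

Lemma measurable_replace (Z : set (R * R)) u v : measurable Z -> measurable_fun setT u ->
  measurable_fun setT v -> measurable_fun setT (fun y => if y \in Z then u y else v y).
Proof.
move=> mZ mu_ mv; apply: measurable_fun_ifT => //.
by apply: (measurable_fun_bool true); rewrite (_ : _ @^-1` _ = Z) ?setTI //; apply/seteqP; split => y /=; [move/set_mem|move/mem_set].
Qed.

Lemma parallelogram_aux (M Ei Ej ai aj pi pj : R) : aj <= M -> Ei < ai + pi -> Ej < aj + pj -> pi <= pj ->
  1 * (2 * Ei + 2 * Ej) + - 4 * M <= 2 * (ai - aj) + 4 * pj.
Proof. by lra. Qed.

(* Nested minimising sets, the elements of nearly least L^2 norm, and the parallelogram identity replace compactness. *)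
Lemma minimizer Omega (K : set (R * R -> R)) W N : (forall u, K u -> bdd W N u) ->
  (forall u v, K u -> K v -> K (fun y => 2^-1 * u y + 2^-1 * v y)) ->
  (forall (u_ : nat -> R * R -> R) u, (forall j, K (u_ j)) -> measurable_fun setT u ->
     (forall y, u_ ^~ y @ \oo --> u y \/ u y = u_ 0%N y) -> K u) ->
  (exists u V, K u /\ tv_le Omega u V) ->
  exists u m, [/\ K u, tv_le Omega u m & forall w V, K w -> tv_le Omega w V -> m <= V].
Proof.
move=> Kb Kmid Klim [u0 [V0 [Ku0 u0V]]].
pose TV := [set V | exists w, K w /\ tv_le Omega w V].
have TVi : has_inf TV.
  split; first by exists V0, u0.
  by exists 0 => V [w [_ /tv_le_ge0]].
pose m := inf TV.
have mle w V : K w -> tv_le Omega w V -> m <= V.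
  by move=> Kw wV; apply: ge_inf; [exact: TVi.2|exists w].
have W0 : 0 <= W by have [_ + _] := Kb _ Ku0; move/(_ 0); exact: le_trans (normr_ge0 _).
pose ep (j : nat) : R := j.+1%:R^-1.
have ep0 j : 0 < ep j by rewrite invr_gt0.
pose Kj j := [set w | K w /\ tv_le Omega w (m + ep j)].
have Kj0 j : exists w, Kj j w.
  have [V [w [Kw wV]] Vm] := inf_adherent (ep0 j) TVi.
  by exists w; split => // phi tphi; rewrite (le_trans (wV _ tphi)) // ltW.
have Kj_dec i j w : (i <= j)%N -> Kj j w -> Kj i w.
  move=> ij [Kw wV]; split => // phi tphi; rewrite (le_trans (wV _ tphi)) // lerD2l.
  by rewrite lef_pV2 ?posrE // ler_nat ltnS.
have iprod u v : K u -> K v -> mu2.-integrable setT (EFin \o (fun y => u y * v y)).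
  move=> Ku Kv; have [mv vW _] := Kb _ Kv.
  exact: (integrable_mul_bounded measurableT (bdd_integrable (Kb _ Ku)) mv (fun y _ => vW y)).
pose E w := \int[mu2]_y (w y * w y).
have E0 w : 0 <= E w by apply: Rintegral_ge0 => y _; rewrite -expr2 sqr_ge0.
pose EE j := E @` Kj j.
have EEi j : has_inf (EE j).
  split; first by have [w Kw] := Kj0 j; exists (E w), w.
  by exists 0 => _ [w _ <-].
pose a j := inf (EE j).
have aE j w : Kj j w -> a j <= E w by move=> Kw; apply: ge_inf; [exact: (EEi j).2|exists w].
have /choice [w_ hw] : forall j, exists w, Kj j w /\ E w < a j + ep j.
  by move=> j; have [_ [w Kw <-] h] := inf_adherent (ep0 j) (EEi j); exists w.
have a_nd : nondecreasing_seq a.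
  move=> i j ij; apply: lb_le_inf; first exact: (EEi j).1.
  by move=> _ [w Kw <-]; apply: aE; exact: Kj_dec Kw.
have B_int : mu2.-integrable setT (EFin \o (\1_(box N) : R * R -> R)).
  apply: (@bounded_box_integrable _ _ 1 N).
  - by apply: measurable_indic; exact: measurable_box.
  - by move=> y; rewrite indicE; case: (_ \in _); rewrite ?normr1 ?normr0.
  by move=> y yN; rewrite indicE memNset // => /boxP; rewrite leNgt yN.
pose S := \int[mu2]_y \1_(box N) y.
have S0 : 0 <= S by apply: Rintegral_ge0 => y _; rewrite indicE.
have a_ub j : a j <= W ^+ 2 * S.
  have [[Kw _] _] := hw j; apply: (le_trans (aE _ _ (hw j).1)).
  rewrite /S -(RintegralZl _ measurableT B_int); apply: le_Rintegral; [exact: measurableT|exact: iprod| |].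
    exact: integrable_scale _ measurableT B_int.
  move=> y _; have [_ wW wN] := Kb _ Kw; rewrite indicE.
  have [/set_mem _|/negP nb] := boolP (y \in box N).
    by rewrite mulr1 -expr2 -[leLHS]real_normK ?num_real // ler_pXn2r ?nnegrE.
  rewrite wN ?mulr0 // ltNge; apply/negP => /boxP bx; exact: nb (mem_set bx).
have a_cvg : cvgn a by apply: nondecreasing_is_cvgn => //; exists (W ^+ 2 * S) => _ [j _ <-].
(* The midpoint of [w_ i] and [w_ j] belongs to [Kj j], so its energy is at least [a j]; the
   parallelogram identity then bounds the energy of the difference. *)
have para i j : (j <= i)%N -> \int[mu2]_y ((w_ i y - w_ j y) * (w_ i y - w_ j y)) <= 2 * (a i - a j) + 4 * ep j.
  move=> ji; have [Kwi Ei] := hw i; have [Kwj Ej] := hw j.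
  have Kmi : Kj j (fun y => 2^-1 * w_ i y + 2^-1 * w_ j y).
    have Kij := Kj_dec _ _ _ ji Kwi; split; first exact: Kmid Kij.1 Kwj.1.
    have := @tv_le_lincomb _ Omega (w_ i) (w_ j) 2^-1 2^-1 (m + ep j) (m + ep j).
    rewrite -mulrDl (_ : 2^-1 + 2^-1 = 1 :> R) ?mul1r; last by field.
    apply; rewrite ?invr_ge0 //.
    - exact: bdd_integrable (Kb _ Kwi.1).
    - exact: bdd_integrable (Kb _ Kwj.1).
    - exact: Kij.2.
    - exact: Kwj.2.
  have hm := aE _ _ Kmi.
  have iii := iprod _ _ Kwi.1 Kwi.1; have ijj := iprod _ _ Kwj.1 Kwj.1; have iij := iprod _ _ Kwi.1 Kwj.1.
  have imm := iprod _ _ Kmi.1 Kmi.1.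
  have -> : \int[mu2]_y ((w_ i y - w_ j y) * (w_ i y - w_ j y)) =
     \int[mu2]_y (1 * (2 * (w_ i y * w_ i y) + 2 * (w_ j y * w_ j y)) + (- 4) * ((2^-1 * w_ i y + 2^-1 * w_ j y) * (2^-1 * w_ i y + 2^-1 * w_ j y))).
    by apply: eq_Rintegral => y _; field.
  have ipp := integrable_add (integrable_scale 2 measurableT iii) (integrable_scale 2 measurableT ijj).
  rewrite (Rintegral_lincomb _ _ ipp imm) (Rintegral_lincomb _ _ iii ijj).
  have epij : ep i <= ep j by rewrite lef_pV2 ?posrE // ler_nat ltnS.
  exact: (parallelogram_aux hm Ei Ej epij).
have small (eta : R) : 0 < eta -> exists J, forall j i, (J <= j)%N -> (j <= i)%N ->
    \int[mu2]_y ((w_ i y - w_ j y) * (w_ i y - w_ j y)) <= eta.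
  move=> eta0; have e4 : 0 < eta / 4 by rewrite divr_gt0.
  have e8 : 0 < eta / 8 by rewrite divr_gt0.
  have [J _ hJ] : \forall j \near \oo, `|limn a - a j| < eta / 4 /\ `|harmonic j : R| < eta / 8.
    have /cvgrPdist_lt /(_ _ e4) h1 : a @ \oo --> limn a := a_cvg.
    by have /cvgr0Pnorm_lt /(_ _ e8) h2 := @cvg_harmonic R; exact: filterI.
  exists J => j i Jj ji; apply: (le_trans (para i j ji)).
  have [h1] := hJ j Jj; rewrite /harmonic /= -/(ep j) (gtr0_norm (ep0 j)) => h2.
  have := nondecreasing_cvgn_le a_nd a_cvg i; have := nondecreasing_cvgn_le a_nd a_cvg j.
  by move: h1; rewrite ltr_norml => /andP[_]; lra.
pose eps (l : nat) : R := ((2 ^ l.+1)%:R)^-1.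
have eps0 l : 0 < eps l by rewrite invr_gt0 ltr0n expn_gt0.
have /choice [J hJ] := fun l => small _ (exprn_gt0 2 (eps0 l)).
(* A nondecreasing choice of indices that dominates both [J l], for the Cauchy estimate, and [l], so
   that the variations tend to the infimum. *)
pose sg l := (\sum_(i < l.+1) J i + l)%N.
have sgJ l : (J l <= sg l)%N by rewrite /sg big_ord_recr /= -addnA addnCA leq_addr.
have sgS l : (sg l <= sg l.+1)%N by rewrite /sg [X in (_ <= X + _)%N]big_ord_recr /= -addnA leq_add2l addnS (leq_trans _ (leqnSn _)) // leq_addl.
have sgl l : (l <= sg l)%N by rewrite leq_addl.
pose v l := w_ (sg l).
have Kv l : K (v l) by have [[]] := hw (sg l).
have bv l := Kb _ (Kv l).
have L1 l : \int[mu2]_y `|v l.+1 y - v l y| <= (1 + S) / (2 ^ l.+1)%:R.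
  have isub := integrable_norm_fin measurableT (integrable_sub (bdd_integrable (bv l.+1)) (bdd_integrable (bv l))).
  have isq : mu2.-integrable setT (EFin \o (fun y => (v l.+1 y - v l y) * (v l.+1 y - v l y))).
    have mb : measurable_fun setT (fun y => v l.+1 y - v l y).
      by apply: measurable_funB; [have [] := bv l.+1|have [] := bv l].
    apply: (integrable_mul_bounded (C := W + W) measurableT (integrable_sub (bdd_integrable (bv l.+1)) (bdd_integrable (bv l))) mb).
    by move=> y _; rewrite (le_trans (ler_normB _ _)) // lerD //; [have [_ + _] := bv l.+1|have [_ + _] := bv l]; apply.
  (* The inequality t <= eps + t^2 / eps passes from L^2 to L^1 on the bounded box; as the L^2
     estimate is of order eps^2, both terms are of order eps. *)
  have pt y : `|v l.+1 y - v l y| <= eps l * \1_(box N) y + (eps l)^-1 * ((v l.+1 y - v l y) * (v l.+1 y - v l y)).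
    have e0 := eps0 l; rewrite indicE; have [_|/negP nb] := boolP (y \in box N).
      rewrite mulr1 -expr2 -(real_normK (num_real (v l.+1 y - v l y))).
      have := normr_ge0 (v l.+1 y - v l y); move: (`|_|) => t t0.
      have : eps l * (eps l)^-1 = 1 by rewrite divff // gt_eqF.
      have : 0 < (eps l)^-1 by rewrite invr_gt0.
      move: ((eps l)^-1) => q q0 eq1; have [te|te] := leP t (eps l).
        by rewrite (le_trans te) // lerDl mulr_ge0 ?sqr_ge0 // ltW.
      rewrite (@le_trans _ _ (q * t ^+ 2)) //; last by rewrite lerDr ltW.
      by rewrite expr2 mulrA ler_peMl // -eq1 mulrC ler_wpM2l // ltW.
    have yN : N < `|y| by rewrite ltNge; apply/negP => /boxP bx; exact: nb (mem_set bx).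
    have [_ _ z1] := bv l.+1; have [_ _ z2] := bv l.
    by rewrite z1 // z2 // subrr normr0 !mulr0 addr0.
  have isum := integrable_add (integrable_scale (eps l) measurableT B_int) (integrable_scale (eps l)^-1 measurableT isq).
  have I1 := le_Rintegral measurableT isub isum (fun y _ => pt y).
  apply: (le_trans I1); rewrite (Rintegral_lincomb _ _ B_int isq) -/S.
  have I2 := hJ l (sg l) (sg l.+1) (sgJ l) (sgS l).
  have I3 : (eps l)^-1 * \int[mu2]_y ((v l.+1 y - v l y) * (v l.+1 y - v l y)) <= eps l.
    by rewrite ler_pdivrMl // -expr2.
  by rewrite -/(eps l) mulrDl mul1r (mulrC S) addrC lerD.
have [Z [mZ Z0 Zc]] := summable_ae_cvg bv L1.
(* On the null set where convergence may fail, [u] takes the value of a member of the class, so that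
   constraints imposed at every point still hold. This is the second alternative in the closure
   hypothesis on [K]. *)
pose u y := if y \in Z then v 0%N y else limn (v ^~ y).
have uc y : (fun l => if y \in Z then v 0%N y else v l y) @ \oo --> u y.
  rewrite /u; case: ifP => [_|/negP nZ]; first exact: cvg_cst.
  by apply: Zc => Zy; apply: nZ; exact: mem_set.
have mu_ : measurable_fun setT u.
  apply: (@measurable_fun_cvg _ _ _ _ (fun l y => if y \in Z then v 0%N y else v l y)).
    by move=> l; apply: measurable_replace => //; [have [] := bv 0%N|have [] := bv l].
  by move=> y _; exact: uc.
have Ku : K u.
  apply: (Klim v) => // y; rewrite /u; case: ifP => [_|/negP nZ]; first by right.
  by left; apply: Zc => Zy; apply: nZ; exact: mem_set.
exists u, m; split => //.
have negZ : mu2.-negligible Z by exists Z; split.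
apply: (@tv_le_limit _ Omega Z v u W N (fun l => m + ep l) m negZ bv mu_).
- move=> y nZ; rewrite /u ifF; first exact: Zc.
  by apply/negP => /set_mem.
- by move=> l; have [] := Kj_dec _ _ _ (sgl l) (hw (sg l)).1.
rewrite -[X in _ --> X]addr0; apply: cvgD; first exact: cvg_cst.
exact: cvg_harmonic.
Qed.

End minimization.

(** * Borel sets and curves for the Hausdorff measure *)

Section hausdorff_metric.
Context {R : realType}.
Notation mu := (@lebesgue_measure R).
Notation lambda := ((@wlength R idfun)^*%mu).
Implicit Types (A P Q X G : set (R * R)) (T : set R) (d : R).
Local Open Scope ereal_scope.

Lemma le_hausdorff1_delta_delta d d' A : (0 < d)%R -> (d <= d')%R ->
  hausdorff1_delta d' A <= hausdorff1_delta d A.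
Proof.
move=> d0 dd'; apply: le_ereal_inf => x [C [AC dC] <-].
by exists C => //; split => // k; rewrite (le_trans (dC k)) // lee_fin.
Qed.

(** A covering set of diameter at most [d] < [s] cannot meet both [P] and [Q], so a cover of the
    union splits into a cover of each. *)
Lemma hausdorff1_delta_separated P Q d s : (0 < d < s)%R ->
  (forall x y, P x -> Q y -> s <= enorm (x - y))%R ->
  hausdorff1_delta d P + hausdorff1_delta d Q <= hausdorff1_delta d (P `|` Q).
Proof.
move=> /andP[d0 ds] sep; apply: le_ereal_inf_tmp => _ [C [PQC dC] <-].
pose CP k := [set x | C k x /\ exists y, C k y /\ P y].
pose CQ k := [set x | C k x /\ ~ exists y, C k y /\ P y].
have dsplit k : diameter (CP k) + diameter (CQ k) <= diameter (C k).
  have [h|h] := pselect (exists y, C k y /\ P y).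
    have -> : CQ k = set0 by apply/seteqP; split => // x [_ /(_ h)].
    have -> : CP k = C k by apply/seteqP; split => [x []//|x Cx]; split.
    by rewrite diameter0 adde0.
  have -> : CP k = set0 by apply/seteqP; split => // x [_ /h].
  have -> : CQ k = C k by apply/seteqP; split => [x []//|x Cx]; split.
  by rewrite diameter0 add0e.
have le1 : hausdorff1_delta d P <= \sum_(k <oo) diameter (CP k).
  apply: ereal_inf_lbound; exists CP => //; split.
    by move=> x Px; have [k _ Ck] := PQC x (or_introl Px); exists k => //; split => //; exists x.
  by move=> k; apply: le_trans (dC k); apply: le_trans (dsplit k); rewrite leeDl // diameter_ge0.
have le2 : hausdorff1_delta d Q <= \sum_(k <oo) diameter (CQ k).
  apply: ereal_inf_lbound; exists CQ => //; split.
    move=> x Qx; have [k _ Ck] := PQC x (or_intror Qx); exists k => //; split => // -[y [Cy Py]].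
    have := sep _ _ Py Qx; rewrite leNgt => /negP; apply; apply: le_lt_trans ds.
    by rewrite -lee_fin; apply: le_trans (dC k); exact: diameter_le.
  by move=> k; apply: le_trans (dC k); apply: le_trans (dsplit k); rewrite leeDr // diameter_ge0.
apply: (le_trans (leeD le1 le2)); rewrite -nneseriesD; [|by move=> *; exact: diameter_ge0..].
by apply: lee_nneseries => [k _ _|k _]; [rewrite adde_ge0 ?diameter_ge0|exact: dsplit].
Qed.

Lemma hausdorff1_separated P Q s : (0 < s)%R ->
  (forall x y, P x -> Q y -> s <= enorm (x - y))%R ->
  hausdorff1 P + hausdorff1 Q <= hausdorff1 (P `|` Q).
Proof.
move=> s0 sep.
have key d1 d2 : (0 < d1)%R -> (0 < d2)%R -> hausdorff1_delta d1 P + hausdorff1_delta d2 Q <= hausdorff1 (P `|` Q).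
  move=> d10 d20; pose d := (Num.min (Num.min d1 d2) (s / 2))%R.
  have d0 : (0 < d)%R by rewrite !lt_min d10 d20 divr_gt0.
  have dd1 : (d <= d1)%R by rewrite !ge_min lexx.
  have dd2 : (d <= d2)%R by rewrite !ge_min lexx !orbT.
  have dss : (d < s)%R by rewrite (@le_lt_trans _ _ (s / 2)%R) ?ge_min ?lexx ?orbT //; lra.
  apply: le_trans (leeD (le_hausdorff1_delta_delta _ d0 dd1) (le_hausdorff1_delta_delta _ d0 dd2)) _.
  apply: le_trans (hausdorff1_delta_le _ d0); apply: hausdorff1_delta_separated sep; exact/andP.
have [->|PQfin] := eqVneq (hausdorff1 (P `|` Q)) +oo; first by rewrite leey.
have fin d1 : (0 < d1)%R -> hausdorff1_delta d1 Q \is a fin_num.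
  move=> d10; rewrite ge0_fin_numE ?hausdorff1_delta_ge0 //.
  apply: le_lt_trans (hausdorff1_delta_le _ d10) _; apply: (@le_lt_trans _ _ (hausdorff1 (P `|` Q))).
    by apply: le_hausdorff1 => x; right.
  by rewrite ltey.
have finP : hausdorff1 P \is a fin_num.
  rewrite ge0_fin_numE ?hausdorff1_ge0 //; apply: (@le_lt_trans _ _ (hausdorff1 (P `|` Q))).
    by apply: le_hausdorff1 => x; left.
  by rewrite ltey.
rewrite addeC -leeBrDr //; apply: ge_ereal_sup => _ [d2 d20 <-].
rewrite leeBrDr // addeC -leeBrDr ?fin //; apply: ge_ereal_sup => _ [d1 d10 <-].
by rewrite leeBrDr ?fin // key.
Qed.

(** The criterion for metric outer measures. With [U n] the points at distance at least 1/(n + 1)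
    from [G], each shell between [U n.+1] and [U n.+2] is separated from [U n], so the measures of
    the shells are summable. Hence the part of [X] outside [G] is exhausted in measure by its
    intersections with the sets [U n], each of which is separated from [G]. *)
Lemma closed_caratheodory G : closed G -> (@hausdorff1 R).-caratheodory G.
Proof.
move=> cG; apply: le_caratheodory_measurable => X.
change (hausdorff1 (X `&` G) + hausdorff1 (X `&` ~` G) <= hausdorff1 X).
have [->|Xfin] := eqVneq (hausdorff1 X) +oo; first by rewrite leey.
have fin A : A `<=` X -> hausdorff1 A \is a fin_num.
  move=> AX; rewrite ge0_fin_numE ?hausdorff1_ge0 //.
  by apply: (le_lt_trans (le_hausdorff1 AX)); rewrite ltey.
have finX : hausdorff1 X \is a fin_num := fin X (@subset_refl _ X).
have finI B : hausdorff1 (X `&` B) \is a fin_num := fin _ (@subIsetl _ X B).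
pose sn (n : nat) : R := (n.+1%:R^-1)%R.
have sn0 n : (0 < sn n)%R by rewrite invr_gt0.
have snS n : (sn n.+1 < sn n)%R by rewrite ltf_pV2 ?posrE // ltr_nat.
pose U n : set (R * R) := [set x | forall g, G g -> (sn n <= enorm (x - g))%R].
have US n : U n `<=` U n.+1 by move=> x Ux g Gg; rewrite (le_trans (ltW (snS n))) // Ux.
have Usep n x y : U n x -> ~ U n.+1 y -> (sn n - sn n.+1 <= enorm (x - y))%R.
  move=> Ux /existsNP [g /not_implyP [Gg /negP]]; rewrite -ltNge => yg.
  by have := Ux g Gg; have := enorm_dist y x g; lra.
pose ph n := fine (hausdorff1 (X `&` U n)).
have phE n : hausdorff1 (X `&` U n) = (ph n)%:E by rewrite fineK.
have ph_X n : (fine (hausdorff1 (X `&` G)) + ph n <= fine (hausdorff1 X))%R.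
  rewrite -lee_fin EFinD -phE (fineK (finI G)) (fineK finX).
  apply: (@le_trans _ _ (hausdorff1 ((X `&` G) `|` (X `&` U n)))).
    by apply: (hausdorff1_separated (sn0 n)) => x y [_ Gx] [_ /(_ _ Gx)]; rewrite enormB.
  by apply: le_hausdorff1 => x [[]|[]].
have ring n : (fine (hausdorff1 (X `&` (U n.+2 `\` U n.+1))) + ph n <= ph n.+2)%R.
  rewrite -lee_fin EFinD -!phE fineK //.
  apply: (@le_trans _ _ (hausdorff1 ((X `&` (U n.+2 `\` U n.+1)) `|` (X `&` U n)))).
    apply: (@hausdorff1_separated _ _ (sn n - sn n.+1)%R); first by rewrite subr_gt0.
    by move=> x y [_ [_ nUx]] [_ Uy]; rewrite enormB; exact: Usep.
  by apply: le_hausdorff1 => x [[Xx [U2 _]]|[Xx Ux]]; split => //; exact: (US _ _ (US _ _ Ux)).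
pose A n k := if k is k'.+1 then X `&` (U (n + k').+2 `\` U (n + k').+1) else X `&` U n.+1.
have bound n : hausdorff1 (X `&` ~` G) <= (ph n + 2 * (sup (range ph) - ph n))%:E.
  have cover : X `&` ~` G `<=` \bigcup_k A n k.
    move=> x [Xx nGx].
    have [r [r0 rG]] : exists r : R, (0 < r)%R /\ forall g, G g -> (r <= enorm (x - g))%R.
      have oG : open (~` G) by exact: closed_openC.
      have [r [r0 rG]] := nbhs_eball (open_nbhs_nbhs (conj oG nGx)).
      exists r; split => // g Gg; rewrite leNgt; apply/negP => xg; apply: (rG g) => //.
      by rewrite /eball /= enormB.
    have [M UM] : exists M, U M x.
      have [M _ hM] : \forall n \near \oo, (`|harmonic n : R| < r)%R.
        by have /cvgr0Pnorm_lt /(_ _ r0) := @cvg_harmonic R.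
      exists M => g Gg; have := hM M (leqnn M); rewrite /harmonic /= gtr0_norm // => h.
      by rewrite (le_trans (ltW h)) // rG.
    have [m Um mmin] : exists2 m, U (n + m).+1 x & forall m', (m' < m)%N -> ~ U (n + m').+1 x.
      have exU : exists m, `[< U (n + m).+1 x >].
        exists M; apply/asboolP; have : (M <= (n + M).+1)%N by rewrite -addSn leq_addl.
        move: ((n + M).+1) => q; elim: q => [|q IH]; first by rewrite leqn0 => /eqP <-.
        by rewrite leq_eqVlt => /predU1P[<-//|/IH]; exact: US.
      exists (ex_minn exU); first by case: ex_minnP => m /asboolP.
      case: ex_minnP => m _ mm m' m'm Um'; have := mm m' (asboolT Um').
      by rewrite leqNgt m'm.
    case: m Um mmin => [|m] Um mmin; first by exists 0%N => //=; split => //; rewrite addn0 in Um.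
    exists m.+1 => //=; split => //; split; first by rewrite addnS in Um.
    exact: (mmin m).
  apply: (le_trans (le_hausdorff1 cover)); apply: (le_trans (hausdorff1_sigma_subadditive _)).
  have phb : has_ubound (range ph).
    exists (fine (hausdorff1 X)) => _ [j _ <-]; have := ph_X j.
    have : (0 <= fine (hausdorff1 (X `&` G)))%R by rewrite fine_ge0 // hausdorff1_ge0.
    by lra.
  have ph_sup j : (ph j <= sup (range ph))%R by apply: ub_le_sup => //; exists j.
  (* Each shell costs at most [ph m.+2 - ph m]; these increments telescope in steps of two, which
     leaves the two last terms. *)
  have part K : \sum_(0 <= k < K.+1) hausdorff1 (A n k) <= (ph (n + K)%N + ph (n + K).+1 - ph n)%:E.
    elim: K => [|K IH].
      rewrite big_nat1 /= phE !addn0 lee_fin.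
      by have -> : (ph n + ph n.+1 - ph n)%R = ph n.+1 by lra.
    rewrite big_nat_recr; last by [].
    have -> : A n K.+1 = X `&` (U (n + K).+2 `\` U (n + K).+1) by [].
    have /leeD : hausdorff1 (X `&` (U (n + K).+2 `\` U (n + K).+1)) <= (ph (n + K).+2 - ph (n + K)%N)%:E.
      rewrite -(fineK (finI _)) lee_fin; have := ring (n + K)%N; lra.
    move=> /(_ _ _ IH); rewrite addeC => h; apply: (le_trans h).
    by rewrite -EFinD lee_fin addnS; lra.
  apply: lime_le; first by apply: is_cvg_nneseries => k _ _; exact: hausdorff1_ge0.
  apply: nearW => -[|K]; last first.
    by apply: (le_trans (part K)); rewrite lee_fin; have := ph_sup (n + K)%N; have := ph_sup (n + K).+1; lra.
  have ph0 : (0 <= ph n)%R by apply: fine_ge0; exact: hausdorff1_ge0.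
  by rewrite big_geq // lee_fin; have := ph_sup n; lra.
rewrite -(fineK (finI G)) -(fineK (finI (~` G))) -(fineK finX) -EFinD lee_fin.
apply/ler_addgt0Pr => e e0.
have hs : has_sup (range ph).
  split; first by exists (ph 0%N), 0%N.
  exists (fine (hausdorff1 X)) => _ [j _ <-]; have := ph_X j.
  have : (0 <= fine (hausdorff1 (X `&` G)))%R by rewrite fine_ge0 // hausdorff1_ge0.
  by lra.
have e2 : (0 < e / 2)%R by lra.
have [_ [n _ <-] hn] := sup_adherent e2 hs.
have := bound n; rewrite -(fineK (finI (~` G))) lee_fin => h1; have := ph_X n.
by move: h1 hn; move: (sup _) => S; lra.
Qed.

End hausdorff_metric.

(** * Images of intervals and null sets under Lipschitz curves *)

Section lipschitz_curves.
Context {R : realType}.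
Notation mu := (@lebesgue_measure R).
Notation lambda := ((@wlength R idfun)^*%mu).
Implicit Types (A B : set (R * R)) (T : set R) (d : R) (g : R -> R * R).
Local Open Scope ereal_scope.

Lemma hausdorff1_delta_single d A : (0 < d)%R -> diameter A <= d%:E -> hausdorff1_delta d A <= diameter A.
Proof.
move=> d0 Ad; apply: ereal_inf_lbound; exists (fun k => if k is 0%N then A else set0).
  split; first by move=> x Ax; exists 0%N.
  by case=> [//|k]; rewrite diameter0 lee_fin ltW.
rewrite (@nneseriesD1 _ _ 0%N) //; last by move=> k _; exact: diameter_ge0.
by rewrite eseries0 ?adde0 // => -[|k] //= _ _; rewrite diameter0.
Qed.

Lemma hausdorff1_deltaU d A B : (0 < d)%R ->
  hausdorff1_delta d (A `|` B) <= hausdorff1_delta d A + hausdorff1_delta d B.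
Proof.
move=> d0; rewrite -bigcup2E.
apply: (le_trans (hausdorff1_delta_sigma_subadditive d _)).
rewrite (@nneseriesD1 _ _ 0%N) //; last by move=> k _; exact: hausdorff1_delta_ge0.
rewrite (@nneseriesD1 _ _ 1%N) //; last by move=> k _; exact: hausdorff1_delta_ge0.
by rewrite eseries0 ?adde0 // => -[|[|k]] //= _ _; rewrite hausdorff1_delta0.
Qed.

Lemma diameter_image_le g T (r : R) : (0 <= r)%R -> (forall s t, enorm (g s - g t) <= `|s - t|)%R ->
  (forall s t, T s -> T t -> `|s - t| <= r)%R -> diameter (g @` T) <= r%:E.
Proof.
move=> r0 g1 Tr; rewrite /diameter ge_max lee_fin r0 /=.
apply: ge_ereal_sup => _ [[_ _] [/= [s Ts <-] [t Tt <-]] <-].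
by rewrite lee_fin (le_trans (g1 _ _)) // Tr.
Qed.

(** Peeling off pieces of length [d] one at a time gives an admissible cover whose diameters sum to
    at most the length of the interval. *)
Lemma hausdorff1_delta_segment g d (a b : R) : (0 < d)%R -> (forall s t, enorm (g s - g t) <= `|s - t|)%R ->
  (a <= b)%R -> hausdorff1_delta d (g @` `[a, b]) <= (b - a)%:E.
Proof.
move=> d0 g1; have [n nd] : exists n : nat, (b - a <= n%:R * d)%R.
  exists (Num.truncn ((b - a) / d)).+1; rewrite -ler_pdivrMr //; exact: ltW (truncnS_gt _).
elim: n a nd => [|n IH] a.
  rewrite mul0r => ba ab; have -> : a = b by lra.
  rewrite subrr; apply: (le_trans (hausdorff1_delta_single d0 _)); last first; apply: diameter_image_le g1 _ => //; try lra;
  move=> s t; rewrite /= !in_itv /= => /andP[? ?] /andP[? ?]; rewrite ler_norml; apply/andP; split; lra.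
move=> nd ab; have [ba|ba] := leP (b - a)%R d.
  apply: (le_trans (hausdorff1_delta_single d0 _)); last first; apply: diameter_image_le g1 _ => //; try lra;
  move=> s t; rewrite /= !in_itv /= => /andP[? ?] /andP[? ?]; rewrite ler_norml; apply/andP; split; lra.
have sub : g @` `[a, b] `<=` (g @` `[a, (a + d)%R]) `|` (g @` `[(a + d)%R, b]).
  move=> _ [t + <-]; rewrite /= in_itv /= => /andP[at_ tb].
  have [tad|tad] := leP t (a + d)%R; [left|right]; exists t => //; rewrite /= in_itv /=; first by apply/andP.
  by apply/andP; split => //; exact: ltW.
apply: (le_trans (@le_hausdorff1_delta _ d _ _ sub)); apply: (le_trans (hausdorff1_deltaU _ _ d0)).
have -> : (b - a)%:E = d%:E + (b - (a + d))%:E by rewrite -EFinD; congr EFin; lra.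
apply: leeD; last by apply: IH; [move: nd; rewrite -natr1 mulrDl mul1r; lra|lra].
apply: (le_trans (hausdorff1_delta_single d0 _)); last first; apply: diameter_image_le g1 _ => //; try lra;
  move=> s t; rewrite /= !in_itv /= => /andP[? ?] /andP[? ?]; rewrite ler_norml; apply/andP; split; lra.
Qed.

Lemma hausdorff1_segment g (a b : R) : (forall s t, enorm (g s - g t) <= `|s - t|)%R ->
  (a <= b)%R -> hausdorff1 (g @` `[a, b]) <= (b - a)%:E.
Proof. by move=> g1 ab; apply: ge_ereal_sup => _ [d d0 <-]; exact: hausdorff1_delta_segment. Qed.

(** Covers of [T] by open intervals are mapped to covers by arcs, and an arc has Hausdorff
    premeasure at most the length of its interval at every scale. *)
Lemma hausdorff1_negligible_image g T : (forall s t, enorm (g s - g t) <= `|s - t|)%R ->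
  mu.-negligible T -> hausdorff1 (g @` T) = 0.
Proof.
move=> g1 [N [mN N0 TN]]; apply/eqP; rewrite eq_le hausdorff1_ge0 andbT.
have lT : lambda T = 0.
  by apply/eqP; rewrite eq_le lambda_ge0 andbT -N0; exact: le_lambda.
apply: ge_ereal_sup => _ [d d0 <-]; rewrite -lT outer_measure_open_itv_cover.
apply: le_ereal_inf_tmp => _ [F [oF TF] <-].
have sub : g @` T `<=` \bigcup_k (g @` F k).
  by move=> _ [t /TF [k _ Fk] <-]; exists k => //; exists t.
apply: (le_trans (@le_hausdorff1_delta _ d _ _ sub)); apply: (le_trans (hausdorff1_delta_sigma_subadditive d _)).
apply: lee_nneseries => [k _ _|k _]; first exact: hausdorff1_delta_ge0.
have [[a b] /= ->] := oF k.
have [ab|ba] := leP a b; last first.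
  rewrite (_ : [set` _] = set0) ?image_set0 ?hausdorff1_delta0 ?wlength0 //.
  by apply: set_itv_ge; rewrite bnd_simp -leNgt ltW.
rewrite wlength_itv_bnd //.
apply: le_trans (hausdorff1_delta_segment d0 g1 ab); apply: (@le_hausdorff1_delta _ d).
by move=> _ [t tab <-]; exists t => //; move: tab; rewrite /= !in_itv /= => /andP[h1 h2]; rewrite !ltW.
Qed.

End lipschitz_curves.

(** * Approximate continuity along the boundary *)

Section arc_length.
Context {R : realType}.
Notation mu := (@lebesgue_measure R).
Notation lambda := ((@wlength R idfun)^*%mu).
Implicit Types (G E : set (R * R)) (L p e s t : R) (gamma : R -> R * R).

Lemma is_derive_dot gamma t w : derivable gamma t 1 ->
  is_derive t (1 : R) (fun s => dot (gamma s) w) (dot (derive1 gamma t) w).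
Proof.
move=> d.
have cp : continuous (fun z : R * R => dot z w) by exact: continuous_dot.
have cl : h^-1 *: (((fun s => dot (gamma s) w) \o shift t) (h *: (1 : R)) - dot (gamma t) w) @[h --> (0 : R)^'] -->
    dot (derive1 gamma t) w.
  have E : (fun h : R => h^-1 *: (((fun s => dot (gamma s) w) \o shift t) (h *: (1 : R)) - dot (gamma t) w)) =
     (fun z => dot z w) \o (fun h : R => h^-1 *: ((gamma \o shift t) (h *: 1) - gamma t)).
    by apply/funext => h; rewrite /= dotZl dotBl.
  rewrite E derive1E; apply: (@cvg_comp _ _ _ _ (fun z => dot z w) _ (nbhs ('D_1 gamma t))); [exact: d|exact: cp].
by apply: DeriveDef; [apply/cvg_ex; eexists; exact: cl|exact: cvg_lim].
Qed.

Lemma unit_dot_ge (a b : R * R) e : dot a a = 1 -> enorm (a - b) <= e -> 1 - e <= dot b a.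
Proof.
move=> a1 ab; have := norm_dot_le (a - b) a.
have -> : enorm a = 1 by rewrite /enorm a1 sqrtr1.
by rewrite mulr1 dotBl a1 ler_norml => /andP[_]; lra.
Qed.

Section curve.
Variables (G : set (R * R)) (L : R) (gamma : R -> R * R).
Hypothesis alp : arc_length_param G L gamma.

Let dgamma := derive1 gamma.

Let mvt w s t : s <= t -> exists c, s <= c <= t /\ dot (gamma t - gamma s) w = dot (dgamma c) w * (t - s).
Proof.
move=> st; have d u : is_derive u (1 : R) (fun s => dot (gamma s) w) (dot (dgamma u) w).
  by apply: is_derive_dot; exact: (alp_derivable alp).
have cd : continuous (fun u => dot (gamma u) w).
  by move=> u; apply: differentiable_continuous; apply/derivable1_diffP; have [] := d u.
have [c ct E] := MVT_segment st (fun u _ => d u) (continuous_subspaceT cd).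
by exists c; split; [move: ct; rewrite in_itv|rewrite dotBl E].
Qed.

(** The mean value theorem is applied to the scalar product of the curve with the chord itself,
    which yields the squared chord on one side and the chord times the parameter length on the
    other. *)
Lemma curve_lipschitz s t : enorm (gamma s - gamma t) <= `|s - t|.
Proof.
wlog st : s t / s <= t.
  by move=> H; have [/H//|/ltW/H] := leP s t; rewrite enormB distrC.
have [c [_ E]] := mvt (gamma t - gamma s) st.
rewrite enormB distrC ger0_norm ?subr_ge0 //.
have h : enorm (gamma t - gamma s) ^+ 2 <= enorm (gamma t - gamma s) * (t - s).
  rewrite enorm_sqr E ler_wpM2r ?subr_ge0 // (le_trans (ler_norm _)) //.
  by rewrite (le_trans (norm_dot_le _ _)) // (alp_unit_speed alp) mul1r.
have := enorm_ge0 (gamma t - gamma s); rewrite le_eqVlt => /predU1P[<-|e0]; first by rewrite subr_ge0.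
by move: h; rewrite expr2 ler_pM2l.
Qed.

Lemma curve_continuous : continuous gamma.
Proof.
move=> t; apply: (@continuous_lipschitz_at _ _ _ _ _ 1 1) => // u _.
by rewrite mul1r (le_trans (norm_le_enorm _)) // (le_trans (curve_lipschitz _ _)) // addrK.
Qed.

(** By uniform continuity the unit tangent turns little on short arcs, so the projection of a chord
    on the tangent at [s] has at least 1 - e times the parameter length. *)
Lemma curve_expand p e : 0 < e < 1 -> exists d : R, 0 < d /\ forall s t,
  s \in `[p, p + L] -> `|s - t| < d -> `|s - t| <= (1 - e)^-1 * enorm (gamma s - gamma t).
Proof.
move=> /andP[e0 e1]; have e2 : 0 < e / 2 by rewrite divr_gt0.
have [d [d0 hd]] := compact_unif_cont (@segment_compact R p (p + L)) (alp_derive_continuous alp) e2.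
exists d; split => // s t sp sd.
have i1 : 0 < 1 - e by rewrite subr_gt0.
rewrite ler_pdivlMl //.
have key u : `|s - u| < d -> 1 - e <= dot (dgamma u) (dgamma s).
  move=> su; have h1 : enorm (dgamma s - dgamma u) <= e.
    by apply: (le_trans (enorm_le_norm _)); have := hd s u sp su; rewrite -/dgamma; lra.
  have h2 : dot (dgamma s) (dgamma s) = 1.
    by rewrite -enorm_sqr (alp_unit_speed alp) expr1n.
  exact: unit_dot_ge.
have main u v : u <= v -> (forall c, u <= c <= v -> `|s - c| < d) -> (1 - e) * (v - u) <= enorm (gamma v - gamma u).
  move=> uv near; have [c [cuv E]] := mvt (dgamma s) uv.
  have h1 : dot (gamma v - gamma u) (dgamma s) <= enorm (gamma v - gamma u).
    by rewrite (le_trans (ler_norm _)) // (le_trans (norm_dot_le _ _)) // (alp_unit_speed alp) mulr1.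
  apply: le_trans h1; rewrite E ler_wpM2r ?subr_ge0 //; apply: key; exact: near.
move: sd; rewrite ltr_norml => /andP[sd1 sd2].
have [st|/ltW ts] := leP s t.
  rewrite distrC ger0_norm ?subr_ge0 // enormB; apply: main => // c /andP[c1 c2].
  by rewrite ltr_norml; apply/andP; split; lra.
rewrite ger0_norm ?subr_ge0 //; apply: main => // c /andP[c1 c2].
by rewrite ltr_norml; apply/andP; split; lra.
Qed.

Local Open Scope ereal_scope.

Lemma lambdaU (S T : set R) : lambda (S `|` T) <= lambda S + lambda T.
Proof. exact: (@outer_measureU2 (ocitv_type R) R lambda S T). Qed.

Let split_segment p e d E (a b : R) : (0 < e < 1)%R ->
  (forall s t, s \in `[p, (p + L)%R] -> (`|s - t| < d)%R -> (`|s - t| <= (1 - e)^-1 * enorm (gamma s - gamma t))%R) ->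
  (@hausdorff1 R).-caratheodory E ->
  (p <= a)%R -> (a <= b)%R -> (b <= p + L)%R -> (b - a < d)%R ->
  lambda (`[a, b] `&` gamma @^-1` E) + lambda (`[a, b] `&` gamma @^-1` (~` E)) <= ((1 - e)^-1 * (b - a))%:E.
Proof.
move=> /andP[e0 e1] exp cE pa ab bL bd.
have K0 : (0 < (1 - e)^-1)%R by rewrite invr_gt0 subr_gt0.
have half A : lambda (`[a, b] `&` gamma @^-1` A) <= (1 - e)^-1%:E * hausdorff1 (gamma @` `[a, b] `&` A).
  apply: (@le_trans _ _ ((1 - e)^-1%:E * hausdorff1 (gamma @` (`[a, b] `&` gamma @^-1` A)))).
    apply: lambda_le_hausdorff1 => // s t [+ _] [+ _]; rewrite /= !in_itv /= => /andP[h1 h2] /andP[h3 h4].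
    apply: exp; first by rewrite in_itv /=; apply/andP; split; lra.
    by rewrite ltr_norml; apply/andP; split; lra.
  apply: lee_wpmul2l; first by rewrite lee_fin ltW.
  by apply: le_hausdorff1 => _ [t [tab At] <-]; split => //; exists t.
apply: (le_trans (leeD (half E) (half (~` E)))).
rewrite -ge0_muleDr ?hausdorff1_ge0 // -(cE (gamma @` `[a, b])) EFinM.
apply: lee_wpmul2l; first by rewrite lee_fin ltW.
by apply: hausdorff1_segment => // s t; exact: curve_lipschitz.
Qed.

(** On short arcs the curve is nearly isometric, so the splitting of the arc by [E] in Hausdorff
    measure pulls back to the parameter interval up to the factor 1 / (1 - e). The pieces are added
    up, and e tends to 0. *)
Lemma curve_caratheodory p E : (@hausdorff1 R).-caratheodory E ->
  lambda (`[p, (p + L)%R] `&` gamma @^-1` E) + lambda (`[p, (p + L)%R] `&` gamma @^-1` (~` E)) <= L%:E.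
Proof.
move=> cE; have L0 := alp_length_gt0 alp.
have bound e : (0 < e < 1)%R ->
    lambda (`[p, (p + L)%R] `&` gamma @^-1` E) + lambda (`[p, (p + L)%R] `&` gamma @^-1` (~` E)) <= ((1 - e)^-1 * L)%:E.
  move=> e01; have [d [d0 hd]] := curve_expand p e01; have /andP[e0 e1] := e01.
  pose n := (Num.truncn (L / d)).+1; pose q := (L / n%:R)%R.
  have n0 : (0 < n%:R :> R)%R by rewrite ltr0n.
  have q0 : (0 < q)%R by rewrite divr_gt0.
  have qd : (q < d)%R.
    by rewrite ltr_pdivrMr // -ltr_pdivrMl // mulrC; exact: truncnS_gt.
  have qL : (n%:R * q)%R = L by rewrite mulrC divfK // gt_eqF.
  suff ind k : (k <= n)%N -> lambda (`[p, (p + k%:R * q)%R] `&` gamma @^-1` E) +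
      lambda (`[p, (p + k%:R * q)%R] `&` gamma @^-1` (~` E)) <= ((1 - e)^-1 * (k%:R * q))%:E.
    by have := ind n (leqnn n); rewrite qL.
  elim: k => [_|k IH kn].
    rewrite mul0r addr0 mulr0.
    have z A : lambda (`[p, p] `&` A) <= 0.
      apply: (@le_trans _ _ (lambda `[p, p])); first by apply: le_lambda; exact: subIsetl.
      by rewrite lambda_itv // subrr.
    by rewrite -[leRHS]adde0; apply: leeD; exact: z.
  pose c := (p + k%:R * q)%R.
  have cE' : (p + k.+1%:R * q)%R = (c + q)%R by rewrite /c -natr1 mulrDl mul1r addrA.
  rewrite cE'.
  have kq0 : (0 <= k%:R * q)%R by rewrite mulr_ge0 // ltW.
  have sub A : lambda (`[p, (c + q)%R] `&` A) <= lambda (`[p, c] `&` A) + lambda (`[c, (c + q)%R] `&` A).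
    apply: le_trans (lambdaU _ _); apply: le_lambda => t [+ At]; rewrite /= in_itv /= => /andP[h1 h2].
    have [tc|tc] := leP t c; [left|right]; split => //=; rewrite in_itv /=; apply/andP; split => //; exact: ltW.
  have kL : (c + q <= p + L)%R.
    have : (k.+1%:R * q <= n%:R * q)%R by apply: ler_wpM2r; [exact: ltW|rewrite ler_nat].
    by rewrite qL -cE' lerD2l.
  have seg := @split_segment p e d E c (c + q)%R e01 hd cE.
  have {}seg := seg (ltac:(rewrite /c; lra)) (ltac:(lra)) kL (ltac:(lra)).
  apply: (le_trans (leeD (sub _) (sub _))); rewrite addeACA.
  apply: (le_trans (leeD (IH (ltnW kn)) seg)).
  by rewrite -EFinD lee_fin -mulrDr -natr1 mulrDl mul1r addrAC subrr add0r.
set S := lambda _ + lambda _ in bound *.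
apply/lee_addgt0Pr => x x0.
(* With this value (1 - e) (L + x) = L + x / 2, so L / (1 - e) is at most L + x. *)
pose e := (x / (2 * (L + x)))%R.
have Lx : (0 < L + x)%R by rewrite addr_gt0.
have e0 : (0 < e)%R by rewrite divr_gt0 // mulr_gt0.
have e1 : (e < 1)%R by rewrite ltr_pdivrMr ?mulr_gt0 // mul1r; lra.
have e01 : (0 < e < 1)%R by rewrite e0.
apply: (le_trans (bound e e01)); rewrite -EFinD lee_fin ler_pdivrMl ?subr_gt0 //.
have : (e * (L + x) = x / 2)%R by rewrite /e; field; rewrite gt_eqF.
by rewrite mulrBl mul1r; lra.
Qed.

(** Two Borel hulls, of the parameters in [E] and of those outside, have total length at most [L]
    but together cover an interval of length [L]. Their overlap is therefore null, and off it the
    first hull is the preimage of [E]. This makes Lebesgue density available although the datum is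
    only measurable for the Hausdorff measure. *)
Lemma curve_level_borel p E : (@hausdorff1 R).-caratheodory E ->
  exists B N : set R, [/\ measurable B, measurable N, mu N = 0 &
    forall t, (p <= t <= p + L)%R -> ~ N t -> (E (gamma t) <-> B t)].
Proof.
move=> cE; have L0 := alp_length_gt0 alp.
have [G1 [oG1 sG1 mG1]] := outer_measure_Gdelta (`[p, (p + L)%R] `&` gamma @^-1` E).
have [G2 [oG2 sG2 mG2]] := outer_measure_Gdelta (`[p, (p + L)%R] `&` gamma @^-1` (~` E)).
pose B1 := \bigcap_i G1 i; pose B2 := \bigcap_i G2 i.
have mB1 : measurable B1 by apply: bigcapT_measurable => k; exact: open_measurable.
have mB2 : measurable B2 by apply: bigcapT_measurable => k; exact: open_measurable.
have tot := curve_caratheodory p cE; rewrite -mG1 -mG2 in tot.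
exists B1, (B1 `&` B2); split => //; first exact: measurableI.
  have f2 : mu B2 < +oo.
    by apply: (@le_lt_trans _ _ L%:E); rewrite ?ltry //; apply: le_trans tot; rewrite leeDr.
  have f1 : mu B1 < +oo.
    by apply: (@le_lt_trans _ _ L%:E); rewrite ?ltry //; apply: le_trans tot; rewrite leeDl.
  have U := @measureUfinr _ _ _ mu B1 B2 mB1 mB2 f2.
  have LU : L%:E <= mu (B1 `|` B2).
    apply: (@le_trans _ _ (mu `[p, (p + L)%R])).
      have ab : (p <= p + L)%R by rewrite lerDl ltW.
      have -> : mu `[p, (p + L)%R] = (p + L - p)%:E by exact: lambda_itv.
      by rewrite lee_fin addrAC subrr add0r.
    apply: le_measure; rewrite ?inE //; first exact: measurableU.
    move=> t tI; have [Et|nEt] := pselect (E (gamma t)); [left; exact: sG1|right; exact: sG2].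
  have fI : mu (B1 `&` B2) \is a fin_num.
    rewrite ge0_fin_numE // (le_lt_trans _ f1) // le_measure ?inE //; exact: measurableI.
  have : L%:E + mu (B1 `&` B2) <= L%:E.
    by apply: le_trans tot; rewrite -leeBrDr // -/B1 -/B2 -U.
  rewrite -(fineK fI) -EFinD lee_fin gerDl => h1.
  have : (0 <= fine (mu (B1 `&` B2)))%R by rewrite fine_ge0.
  by move=> h2; congr EFin; apply/eqP; rewrite eq_le h1 h2.
move=> t tI nN; have It : `[p, (p + L)%R]%classic t by rewrite /= in_itv.
split => [Et|Bt]; first exact: sG1.
by apply: contrapT => nEt; apply: nN; split => //; exact: sG2.
Qed.

End curve.

Lemma closed_boundary (Omega : set (R * R)) : closed (boundary Omega).
Proof. by apply: closedI; [exact: closed_closure|apply: open_closedC; exact: open_interior]. Qed.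

Local Open Scope ereal_scope.

(** Lebesgue's density theorem for the sets where the datum exceeds a rational number and for their
    complements, each replaced by its Borel version along the curve. Countably many rationals yield
    one null set of exceptions. *)
Lemma ae_approx_continuous (Omega : set (R * R)) f L gamma p :
  L1_boundary Omega f -> arc_length_param (boundary Omega) L gamma ->
  exists N : set R, mu.-negligible N /\
    forall t, (p < t < p + L)%R -> ~ N t -> approx_continuous (f \o gamma) t.
Proof.
move=> /integrableP [mf _] alp.
have mB : (@hausdorff1 R).-cara.-measurable (boundary Omega).
  by apply: closed_caratheodory; exact: closed_boundary.
have cE (s : R) : (@hausdorff1 R).-caratheodory (boundary Omega `&` [set x | (s < f x)%R]).
  have := mf mB _ (emeasurable_itv `]s%:E, +oo[).
  rewrite (_ : _ `&` _ = boundary Omega `&` [set x | (s < f x)%R]) //.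
  by apply/seteqP; split => x [bx]; rewrite /= in_itv /= ?andbT lte_fin.
have lev s := curve_level_borel alp p (cE s).
have /choice [BN hBN] : forall s : R, exists BN : set R * set R, [/\ measurable BN.1, measurable BN.2, mu BN.2 = 0 &
    forall t, (p <= t <= p + L)%R -> ~ BN.2 t -> ((s < f (gamma t))%R <-> BN.1 t)].
  move=> s; have [B [N [mB' mN N0 BE]]] := lev s; exists (B, N); split => // t tI nN.
  have BEt := BE t tI nN; split => [sf|/BEt[]//]; apply/BEt; split => //.
  by rewrite -(alp_range alp); exists t.
pose qi (i : nat) : R := ratr (odflt 0%R (unpickle i : option rat)).
have qiE q : exists i, qi i = ratr q by exists (pickle q); rewrite /qi pickleK.
pose D (A : set R) := [set x | ~ ((mu (A `&` ball x r) / mu (ball x r)) @[r --> 0^'+] --> (\1_A x)%:E)].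
have nD A : measurable A -> mu.-negligible (D A) by move=> mA; exact: (lebesgue_density mA).
pose Z i := (BN (qi i)).2 `|` (D (BN (qi i)).1 `|` D (~` (BN (qi i)).1)).
exists (\bigcup_i Z i); split.
  apply: negligible_bigcup => i; have [m1 m2 m3 _] := hBN (qi i).
  apply: negligibleU; first by exists (BN (qi i)).2; split.
  by apply: negligibleU; apply: nD => //; exact: measurableC.
move=> t /andP[pt tL] nZ e e0; set F := f \o gamma.
have tI : (p <= t <= p + L)%R by rewrite !ltW.
have nZi i : ~ Z i t by move=> Zi; apply: nZ; exists i.
have lo : (F t - e < F t)%R by rewrite ltrBlDr ltrDl.
have hi : (F t < F t + e)%R by rewrite ltrDl.
(* Two rational levels bracket [F t] within [e]. Up to sets of density 0 at [t], the function
   exceeds the lower one and does not exceed the upper one. *)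
have [q1] := rat_in_itvoo lo; rewrite in_itv /= => /andP[q1a q1b].
have [q2] := rat_in_itvoo hi; rewrite in_itv /= => /andP[q2a q2b].
have [i1 i1E] := qiE q1; have [i2 i2E] := qiE q2.
rewrite -i1E in q1a q1b; rewrite -i2E in q2a q2b.
have [mB1 mN1 N10 hB1] := hBN (qi i1); have [mB2 mN2 N20 hB2] := hBN (qi i2).
set B1 := (BN (qi i1)).1 in mB1 hB1; set B2 := (BN (qi i2)).1 in mB2 hB2.
set N1 := (BN (qi i1)).2 in mN1 N10 hB1; set N2 := (BN (qi i2)).2 in mN2 N20 hB2.
have B1t : B1 t by apply/hB1 => // N1t; apply: (nZi i1); left.
have B2t : ~ B2 t.
  move=> /(hB2 t tI) h; have := h (fun N2t => nZi i2 (or_introl N2t)).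
  by rewrite ltNge ltW.
have c1 : (mu (~` B1 `&` ball t r) / mu (ball t r)) @[r --> 0^'+] --> 0.
  have : ~ D (~` B1) t by move=> Dt; apply: (nZi i1); right; right.
  by move/contrapT; rewrite indicE memNset //= => /(_ B1t).
have c2 : (mu (B2 `&` ball t r) / mu (ball t r)) @[r --> 0^'+] --> 0.
  have : ~ D B2 t by move=> Dt; apply: (nZi i2); right; left.
  by move/contrapT; rewrite indicE memNset.
have cs : (mu (~` B1 `&` ball t r) / mu (ball t r) + mu (B2 `&` ball t r) / mu (ball t r)) @[r --> 0^'+] --> 0.
  by rewrite -[X in _ --> X]adde0; apply: cvgeD.
apply: (squeeze_cvge _ (cvg_cst 0) cs).
have rp : (0 < Num.min (t - p) (p + L - t))%R by rewrite lt_min !subr_gt0 pt.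
near=> r.
have r0 : (0 < r)%R by near: r; exact: nbhs_right_gt.
have rs : (r < Num.min (t - p) (p + L - t))%R by near: r; exact: nbhs_right_lt.
rewrite mule_ge0 ?lee_fin ?invr_ge0 ?mulr_ge0 ?(ltW r0) //=.
have bE : mu (ball t r) = (2 * r)%:E by rewrite lebesgue_measure_ball ?ltW // mulr_natl.
rewrite bE inver ifF; last by rewrite gt_eqF // mulr_gt0.
rewrite -ge0_muleDl // muleC lee_wpmul2r ?lee_fin ?invr_ge0 ?mulr_ge0 ?(ltW r0) //.
have sub : [set s | (`|s - t| < r)%R /\ (e <= `|F s - F t|)%R] `<=`
    ((~` B1 `&` ball t r) `|` (B2 `&` ball t r)) `|` (N1 `|` N2).
  move=> s [sr es].
  have sI : (p <= s <= p + L)%R.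
    move: rs sr; rewrite lt_min ltr_norml => /andP[h1 h2] /andP[h3 h4]; apply/andP; split; lra.
  have sb : ball t r s by rewrite /ball /= distrC.
  have [nN1|] := pselect (~ N1 s); last by move=> /contrapT; right; left.
  have [nN2|] := pselect (~ N2 s); last by move=> /contrapT; right; right.
  left; have [Fst|Fst] := leP (F t) (F s).
    right; split => //; apply/(hB2 s sI nN2).
    by move: es; rewrite ger0_norm ?subr_ge0 // -/(F s) => es; apply: (lt_le_trans q2b); rewrite -lerBrDl.
  left; split => // /(hB1 s sI nN1) h; move: es; rewrite ltr0_norm ?subr_lt0 // => es.
  move: h; apply/negP; rewrite -leNgt; apply: le_trans (ltW q1a); rewrite opprB in es.
  by rewrite lerBrDl -lerBrDr.
have := le_lambda sub; move=> /le_trans; apply.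
apply: (le_trans (lambdaU _ _)).
have -> : lambda (N1 `|` N2) = 0.
  apply/eqP; rewrite eq_le lambda_ge0 andbT; apply: (le_trans (lambdaU _ _)).
  by rewrite (_ : lambda N1 = 0) // (_ : lambda N2 = 0) // adde0.
rewrite adde0; exact: lambdaU.
Unshelve. all: by end_near. Qed.

End arc_length.

Lemma monotone_continuous_at (R : realType) (A : R -> R) (t : R) :
  {homo A : s t / s <= t} -> ~ discontinuity A t -> {for t, continuous A}.
Proof.
move=> And nd.
have cl : cvg (A x @[x --> t^'-]).
  apply: nondecreasing_at_left_is_cvgr; first by apply: nearW => x u v _ _; exact: And.
  by apply: nearW => x; exists (A t) => _ [y + <-]; rewrite /= in_itv /= => /andP[_ yt]; apply: And; exact: ltW.
have cr : cvg (A x @[x --> t^'+]).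
  apply: nondecreasing_at_right_is_cvgr; first by apply: nearW => x u v _ _; exact: And.
  by apply: nearW => x; exists (A t) => _ [y + <-]; rewrite /= in_itv /= => /andP[ty _]; apply: And; exact: ltW.
have lt_ : lim (A x @[x --> t^'-]) <= A t.
  by apply: limr_le cl _; near=> x; apply: And; apply: ltW; near: x; exact: nbhs_left_lt.
have tr : A t <= lim (A x @[x --> t^'+]).
  by apply: limr_ge cr _; near=> x; apply: And; apply: ltW; near: x; exact: nbhs_right_gt.
have E : lim (A x @[x --> t^'-]) = lim (A x @[x --> t^'+]).
  by apply/eqP; apply: contrapT => /negP ne; apply: nd; split.
apply/left_right_continuousP; split.
  have -> : A t = lim (A x @[x --> t^'-]) by apply/eqP; rewrite eq_le lt_ E tr.
  exact: cl.
have -> : A t = lim (A x @[x --> t^'+]) by apply/eqP; rewrite eq_le tr -E lt_.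
exact: cr.
Unshelve. all: by end_near. Qed.

(** * Monotone decomposition along the approximate continuity points *)

Section bv_decomposition.
Context {R : realType}.
Notation mu := (@lebesgue_measure R).
Variables (F : R -> R) (D : set R) (p L M : R) (N : set R).
Hypotheses (D_sub : forall t, D t -> p < t < p + L) (L0 : 0 < L).
Hypotheses (nN : mu.-negligible N) (D_full : forall t, p < t < p + L -> ~ N t -> D t).
Hypothesis (D_var : forall (n : nat) (x : nat -> R), (forall i, (i <= n)%N -> D (x i)) ->
  (forall i, (i < n)%N -> x i < x i.+1) -> \sum_(i < n) `|F (x i.+1) - F (x i)| <= M).

Lemma full_dense (a b : R) : p <= a -> a < b -> b <= p + L -> exists t, D t /\ a < t < b.
Proof.
move=> pa ab bL; apply: contrapT => nD.
have sub : `]a, b[ `<=` N.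
  move=> t; rewrite /= in_itv /= => /andP[at_ tb]; apply: contrapT => nNt; apply: nD.
  exists t; split; last by rewrite at_.
  by apply: D_full => //; rewrite (le_lt_trans pa at_) (lt_le_trans tb bL).
have : mu `]a, b[ = 0%E.
  have [N' [mN' N'0 NN']] := nN; apply/eqP; rewrite eq_le measure_ge0 andbT -N'0.
  by apply: le_measure; rewrite ?inE //; exact: subset_trans NN'.
rewrite lebesgue_measure_itv /= lte_fin ab => /eqP; rewrite -EFinB eqe subr_eq0 => /eqP ba.
by rewrite ba ltxx in ab.
Qed.

Definition chain (n : nat) (x : nat -> R) (t : R) :=
  (forall i, (i <= n)%N -> D (x i)) /\ (forall i, (i < n)%N -> x i < x i.+1) /\ x n <= t.

Let csum n (x : nat -> R) := \sum_(i < n) `|F (x i.+1) - F (x i)|.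

Let csum_ge0 n x : 0 <= csum n x. Proof. exact: sumr_ge0. Qed.

Let csum_le n x t : chain n x t -> csum n x <= M. Proof. by move=> [h1 [h2 _]]; exact: D_var. Qed.

Let M_ge0 : 0 <= M.
Proof.
have pL : p < p + L by rewrite ltrDl.
have [t [Dt _]] := full_dense (lexx p) pL (lexx (p + L)).
have h i : (i < 0)%N -> (fun=> t : R) i < (fun=> t) i.+1 by [].
by have := @D_var 0 (fun=> t) (fun _ _ => Dt) h; rewrite big_ord0.
Qed.

(* The element 0 keeps the set nonempty before the first point of D. *)
Definition variation_set t : set R := [set s | s = 0 \/ exists n x, chain n x t /\ s = csum n x].
Definition variation t := sup (variation_set t).

Let Vsup t : has_sup (variation_set t).
Proof.
split; first by exists 0; left.
by exists M => s [->|[n [x [cx ->]]]]; [exact: M_ge0|exact: csum_le cx].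
Qed.

Let V_ge0 t : 0 <= variation t. Proof. by apply: ub_le_sup; [exact: (Vsup t).2|left]. Qed.

Let V_le t : variation t <= M.
Proof.
apply: ge_sup; first exact: (Vsup t).1.
by move=> s [->|[n [x [cx ->]]]]; [exact: M_ge0|exact: csum_le cx].
Qed.

Let V_chain n x t : chain n x t -> csum n x <= variation t.
Proof. by move=> cx; apply: ub_le_sup; [exact: (Vsup t).2|right; exists n, x]. Qed.

Let V_nd s t : s <= t -> variation s <= variation t.
Proof.
move=> st; apply: ge_sup; first exact: (Vsup s).1.
move=> z [->//|[n [x [[h1 [h2 h3]] ->]]]]; apply: V_chain.
by split => //; split => //; exact: le_trans st.
Qed.

Let chain_append n x t : chain n x t -> D t ->
  exists n' x', chain n' x' t /\ x' n' = t /\ csum n x <= csum n' x'.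
Proof.
move=> [h1 [h2 h3]] Dt; move: h3; rewrite le_eqVlt => /predU1P[xt|xt].
  by exists n, x; rewrite -xt; split; [split => //; split|].
pose x' i := if (i <= n)%N then x i else t.
have x'n i : (i <= n)%N -> x' i = x i by rewrite /x' => ->.
have x't : x' n.+1 = t by rewrite /x' ltnn.
exists n.+1, x'; split.
  split; first by move=> i; rewrite /x'; case: ifP => // /h1.
  split; last by rewrite x't.
  move=> i; rewrite ltnS leq_eqVlt => /predU1P[->|ilt]; first by rewrite x't x'n.
  by rewrite !x'n ?h2 // ltnW.
split => //; rewrite /csum big_ord_recr /=; apply: (@le_trans _ _ (csum n x)) => //.
rewrite -[leLHS]addr0; apply: lerD => //; rewrite le_eqVlt; apply/orP; left; apply/eqP.
by apply: eq_bigr => i _; rewrite !x'n // ltnW.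
Qed.

Let V_step s t : D s -> D t -> s < t -> variation s + `|F t - F s| <= variation t.
Proof.
move=> Ds Dt st; rewrite -lerBrDr; apply: ge_sup; first exact: (Vsup s).1.
have add n x : chain n x s -> x n = s -> csum n x <= variation t - `|F t - F s|.
  move=> [h1 [h2 _]] xs; rewrite lerBrDr.
  pose x' i := if (i <= n)%N then x i else t.
  have x'n i : (i <= n)%N -> x' i = x i by rewrite /x' => ->.
  have x't : x' n.+1 = t by rewrite /x' ltnn.
  have cx' : chain n.+1 x' t.
    split; first by move=> i; rewrite /x'; case: ifP => // /h1.
    split; last by rewrite x't.
    move=> i; rewrite ltnS leq_eqVlt => /predU1P[->|ilt]; first by rewrite x't x'n // xs.
    by rewrite !x'n ?h2 // ltnW.
  apply: le_trans (V_chain cx'); rewrite /csum big_ord_recr /= x't x'n // xs lerD2r.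
  rewrite le_eqVlt; apply/orP; left; apply/eqP.
  by apply: eq_bigr => i _; rewrite !x'n // ltnW.
move=> z [->|[n [x [cx ->]]]].
  by have /add := (conj (fun _ _ => Ds) (conj (fun i (h : (i < 0)%N) => False_ind _ (notF h)) (lexx s)) : chain 0 (fun=> s) s); rewrite /csum big_ord0; apply.
by have [n' [x' [cx' [xs le]]]] := chain_append cx Ds; apply: (le_trans le); exact: add.
Qed.

Let F_osc s t : D s -> D t -> `|F t - F s| <= M.
Proof.
move=> Ds Dt; wlog st : s t Ds Dt / s < t.
  move=> H; have [st|ts|->] := ltgtP s t; [exact: H|rewrite distrC; exact: H|by rewrite subrr normr0].
by have := V_step Ds Dt st; have := V_ge0 s; have := V_le t; lra.
Qed.

Lemma bv_decomposition : exists (A B : R -> R) (M0 M1 : R),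
  [/\ [/\ {homo A : s t / s <= t}, {homo B : s t / s <= t}, forall t, 0 <= A t <= M1 & forall t, 0 <= B t <= M1],
      forall t, D t -> `|F t| + 1 <= M0,
      forall t eta e, p < t < p + L -> 0 < eta -> 0 < e ->
        (exists s, [/\ D s, `|s - t| < eta & A t - B t + M0 <= F s + e]) /\
        (exists s, [/\ D s, `|s - t| < eta & F s - e <= A t - B t + M0]) &
      exists Z, mu.-negligible Z /\ forall t, p < t < p + L -> ~ Z t ->
        D t /\ forall e, 0 < e -> exists d, 0 < d /\ forall s, D s -> `|s - t| < d -> `|F s - F t| < e].
Proof.
have pL : p < p + L by rewrite ltrDl.
have [t0 [Dt0 _]] := full_dense (lexx p) pL (lexx (p + L)).
pose M0 := `|F t0| + M + 1.
have FM t : D t -> `|F t| + 1 <= M0.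
  move=> Dt; rewrite /M0 lerD2r; have := F_osc Dt0 Dt; have := ler_distD (F t0) (F t) 0.
  by rewrite !subr0; lra.
pose A := variation.
pose b s := A s - F s + M0.
pose BS t : set R := [set z | z = 0 \/ exists s, [/\ D s, s <= t & z = b s]].
pose B t := sup (BS t).
have b01 s : D s -> 0 <= b s <= M + 2 * M0.
  move=> Ds; have := FM _ Ds; have := V_ge0 s; have := V_le s; rewrite /b /A.
  by have := ler_norm (F s); have := ler_norm (- F s); rewrite normrN => h1 h2 h3 h4 h5; apply/andP; split; lra.
have M00 : 0 <= M0 by have := FM _ Dt0; have := normr_ge0 (F t0); lra.
have M1ge : 0 <= M + 2 * M0 by rewrite addr_ge0 // mulr_ge0.
have Bsup t : has_sup (BS t).
  split; first by exists 0; left.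
  by exists (M + 2 * M0) => z [->//|[s [Ds _ ->]]]; have /andP[] := b01 s Ds.
have B0 t : 0 <= B t by apply: ub_le_sup; [exact: (Bsup t).2|left].
have B1 t : B t <= M + 2 * M0.
  apply: ge_sup; first exact: (Bsup t).1.
  by move=> z [->//|[s [Ds _ ->]]]; have /andP[] := b01 s Ds.
have Bge s t : D s -> s <= t -> b s <= B t.
  by move=> Ds st; apply: ub_le_sup; [exact: (Bsup t).2|right; exists s].
have Bnd : {homo B : s t / s <= t}.
  move=> s t st; apply: ge_sup; first exact: (Bsup s).1.
  by move=> z [->//|[r [Dr rs ->]]]; apply: Bge => //; exact: le_trans st.
have And : {homo A : s t / s <= t} by move=> s t; exact: V_nd.
have BD t : D t -> B t = b t.
  move=> Dt; apply/eqP; rewrite eq_le Bge // andbT; apply: ge_sup; first exact: (Bsup t).1.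
  move=> z [->|[s [Ds st ->]]]; first by have /andP[] := b01 t Dt.
  have [->//|st'] : s = t \/ s < t by move: st; rewrite le_eqVlt => /predU1P.
  have := V_step Ds Dt st'; rewrite /b /A.
  by have := ler_norm (F t - F s); lra.
have FE t : D t -> F t = A t - B t + M0 by move=> Dt; rewrite BD // /b; ring.
(* Here [r] is the last point of an almost optimal chain, the point almost attaining [B t], or [p]
   when 0 is almost optimal. Between [r] and [t] one of the two functions is already nearly as large
   as at [t], and the other is not larger. *)
have near_left t eta r : p < t < p + L -> 0 < eta -> r = t \/ r < t ->
    (D r \/ r <= p) -> exists s, [/\ D s, `|s - t| < eta, r <= s & s <= t].
  move=> /andP[pt tL] eta0 rt Dr.
  have [ret|rlt] : r = t /\ D r \/ r < t.
    case: rt => [E|]; last by right.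
    by case: Dr => [Dr|rp]; [left|exfalso; rewrite E in rp; have := lt_le_trans pt rp; rewrite ltxx].
    have [E Dr'] := ret; rewrite E in Dr'; exists t; rewrite E subrr normr0.
    by split.
  have a1 : Num.max p (Num.max r (t - eta)) < t by rewrite !gt_max pt rlt ltrBlDr ltrDl.
  have a0 : p <= Num.max p (Num.max r (t - eta)) by rewrite le_max lexx.
  have [s [Ds /andP[s1 s2]]] := full_dense a0 a1 (ltW tL).
  move: s1; rewrite !gt_max => /andP[_ /andP[s3 s4]].
  by exists s; split => //; [rewrite ltr_norml; apply/andP; split; lra|exact: ltW|exact: ltW].
exists A, B, M0, (M + 2 * M0); split => //.
- split => // t; first by rewrite V_ge0 (le_trans (V_le t)) // lerDl mulr_ge0.
  by rewrite B0 B1.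
- move=> t eta e tI eta0 e0; split.
    have [z Vz zA] := sup_adherent e0 (Vsup t).
    have [r [rt Dr rA]] : exists r, [/\ r = t \/ r < t, D r \/ r <= p & forall s, r <= s -> z <= A s].
      case: Vz => [->|[n [x [cx ->]]]].
        exists p; split; [right; by have /andP[] := tI|by right|by move=> s _; exact: V_ge0].
      have [h1 [h2 h3]] := cx; exists (x n); split; first by move: h3; rewrite le_eqVlt => /predU1P.
        by left; exact: h1.
      by move=> s xs; apply: V_chain; split.
    have [s [Ds st rs st']] := near_left t eta r tI eta0 rt Dr.
    exists s; split => //; rewrite (FE s Ds); have := rA s rs; have := Bnd _ _ st'.
    by have zA' : A t - e < z := zA; lra.
  have [z Bz zB] := sup_adherent e0 (Bsup t).
  have [r [rt Dr rB]] : exists r, [/\ r = t \/ r < t, D r \/ r <= p & forall s, r <= s -> z <= B s].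
    case: Bz => [->|[r [Dr rt ->]]].
      exists p; split; [right; by have /andP[] := tI|by right|by move=> s _].
    exists r; split; first by move: rt; rewrite le_eqVlt => /predU1P.
      by left.
    by move=> s rs; exact: Bge.
  have [s [Ds st rs st']] := near_left t eta r tI eta0 rt Dr.
  exists s; split => //; rewrite (FE s Ds); have := rB s rs; have := And _ _ st'.
  by have zB' : B t - e < z := zB; lra.
pose dis (G : R -> R) := [set x | (x \in `]p, (p + L)[) /\ discontinuity G x].
have cA : countable (dis A) by apply: discontinuity_countable => s t _ _; exact: And.
have cB : countable (dis B) by apply: discontinuity_countable => s t _ _; exact: Bnd.
have negc (S : set R) : countable S -> mu.-negligible S.
  by move=> cS; exists S; split => //; [exact: countable_measurable|exact: countable_lebesgue_measure0].
exists (N `|` (dis A `|` dis B)); split.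
  by apply: negligibleU => //; apply: negligibleU; exact: negc.
move=> t tI nZ; have Dt : D t by apply: D_full => // Nt; apply: nZ; left.
split => // e e0.
have tI' : t \in `]p, (p + L)[ by rewrite in_itv.
have cAt : {for t, continuous A} by apply: (monotone_continuous_at And) => h; apply: nZ; right; left.
have cBt : {for t, continuous B} by apply: (monotone_continuous_at Bnd) => h; apply: nZ; right; right.
have e2 : 0 < e / 2 by rewrite divr_gt0.
have /cvgrPdist_lt /(_ _ e2) /nbhs_normP [d1 /= d10 h1] := cAt.
have /cvgrPdist_lt /(_ _ e2) /nbhs_normP [d2 /= d20 h2] := cBt.
exists (Num.min d1 d2); split; first by rewrite lt_min d10.
move=> s Ds; rewrite lt_min => /andP[s1 s2].
have := h1 s; rewrite /= distrC => /(_ s1) a1; have := h2 s; rewrite /= distrC => /(_ s2) a2.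
rewrite (FE s Ds) (FE t Dt); move: a1 a2; rewrite !ltr_norml => /andP[? ?] /andP[? ?].
by apply/andP; split; lra.
Qed.

End bv_decomposition.

Lemma half_plane_aux (R : realType) (I a b n1 n2 A B : R) : I + (n1 * a + n2 * b) <= 0 ->
  `|a| <= 1 * A -> `|b| <= 1 * B -> `|n1| <= 1 -> `|n2| <= 1 -> I <= A + B.
Proof.
move=> h ha hb h1 h2.
have e1 : - (n1 * a) <= A.
  rewrite (le_trans (ler_norm _)) // normrN normrM; rewrite mul1r in ha.
  by rewrite (le_trans _ ha) // ler_piMl.
have e2 : - (n2 * b) <= B.
  rewrite (le_trans (ler_norm _)) // normrN normrM; rewrite mul1r in hb.
  by rewrite (le_trans _ hb) // ler_piMl.
lra.
Qed.

(** * Half-planes and the layer cake bound *)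

Section half_planes.
Context {R : realType}.
Notation mu := (@lebesgue_measure R).
Notation mu2 := (mu \x mu)%E.
Implicit Types (Omega : set (R * R)) (u v w g : R * R -> R) (phi : R * R -> R * R) (n : R * R).

Lemma test_field_setT Omega phi : test_field Omega phi -> test_field setT phi.
Proof. by move=> [C1 cS SO phi1]; split => //; exact: subsetT. Qed.

(* A smooth function equal to 1 on the ball of squared radius b, with compact support. *)
Let bump2 (b : R) (y : R * R) := 1 - astp 1 b (dot y (1, 0) * dot y (1, 0) + dot y (0, 1) * dot y (0, 1)).
Let dbump2 (b : R) (i j : R) (y : R * R) :=
  - (dastp 1 b (dot y (1, 0) * dot y (1, 0) + dot y (0, 1) * dot y (0, 1)) *
     (2 * (dot y (1, 0) * i + dot y (0, 1) * j))).

(** [truncation_bound] is applied on the whole plane to the function 0 at the level -1, with the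
    field - phi: the positive part is then 1 and the truncated function is minus the smooth step.
    Only the gradient of one fixed bump remains, so the bound depends neither on the direction nor
    on the steepness of the step. *)
Lemma smooth_half_plane Omega N : Omega `<=` box N -> exists P, 0 <= P /\
  forall n a c phi, dot n n = 1 -> 0 < a -> test_field Omega phi ->
    \int[mu2]_y (astp a c (dot y n) * divergence phi y) <= P.
Proof.
(* On [box N] the squared Euclidean norm is at most 2 N^2, so the bump equals 1 on [Omega]. *)
move=> ON; pose b := 2 * `|N| ^+ 2.
pose eta := bump2 b; pose eta1 := dbump2 b 1 0; pose eta2 := dbump2 b 0 1.
pose Q (y : R * R) := dot y (1, 0) * dot y (1, 0) + dot y (0, 1) * dot y (0, 1).
have QE y : Q y = dot y y by rewrite /Q /dot /=; ring.
have cQ : continuous Q by apply: contD; apply: contM; exact: continuous_dot.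
have p1 : has_pd1 eta eta1.
  have q1 := has_pd1D (has_pd1M (@has_pd1_dot R (1, 0)) (@has_pd1_dot R (1, 0))) (has_pd1M (@has_pd1_dot R (0, 1)) (@has_pd1_dot R (0, 1))).
  have := has_pd1B (has_pd1_cst 1) (has_pd1_comp (is_derive_astp 1 b) q1).
  congr has_pd1; apply/funext => y; rewrite /eta1 /dbump2 /=; move: (dastp _ _ _) => z; ring.
have p2 : has_pd2 eta eta2.
  have q1 := has_pd2D (has_pd2M (@has_pd2_dot R (1, 0)) (@has_pd2_dot R (1, 0))) (has_pd2M (@has_pd2_dot R (0, 1)) (@has_pd2_dot R (0, 1))).
  have := has_pd2B (has_pd2_cst 1) (has_pd2_comp (is_derive_astp 1 b) q1).
  congr has_pd2; apply/funext => y; rewrite /eta2 /dbump2 /=; move: (dastp _ _ _) => z; ring.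
have ceta : continuous eta by apply: contB; [exact: cont_cst|apply: cont_comp cQ; exact: continuous_astp].
have cd i j : continuous (dbump2 b i j).
  apply: contN; apply: contM; first by apply: cont_comp cQ; exact: continuous_dastp.
  apply: contM; first exact: cont_cst.
  by apply: contD; apply: contM; [exact: continuous_dot|exact: cont_cst|exact: continuous_dot|exact: cont_cst].
have eta01 y : 0 <= eta y <= 1.
  have /andP[s0 s1] := stp01 (1 * (Q y - b)); rewrite /eta /bump2 /astp -/(Q y).
  by apply/andP; split; lra.
have eta1_in y : Omega y -> eta y = 1.
  move=> /ON /boxP yN; rewrite /eta /bump2 /astp stp_0 ?subr0 // mul1r subr_le0 -/(Q y) QE.
  have := dot_le_norm y y; rewrite ger0_norm ?dot_ge0 // => /le_trans; apply; rewrite /b ler_pM2l //.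
  have h : `|y| <= `|N| by rewrite (le_trans yN) // ler_norm.
  by rewrite expr2 ler_pM.
pose M := Num.sqrt (b + 1).
have etaM y : M < `|y| -> eta y = 0.
  move=> yM; rewrite /eta /bump2 /astp stp_1 ?subrr // mul1r -/(Q y) QE lerBrDl.
  apply: le_trans (normr_dot y); rewrite -(@sqr_sqrtr _ (b + 1)); last by rewrite addr_ge0 // mulr_ge0 // sqr_ge0.
  by rewrite ler_pXn2r ?nnegrE ?sqrtr_ge0 // ltW.
have i1 := continuous_box_integrable (@cd 1 0) (pd1_outside p1 etaM).
have i2 := continuous_box_integrable (@cd 0 1) (pd2_outside p2 etaM).
have ia1 := integrable_norm_fin measurableT i1; have ia2 := integrable_norm_fin measurableT i2.
exists (\int[mu2]_y `|eta1 y| + \int[mu2]_y `|eta2 y|); split.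
  by apply: addr_ge0; apply: Rintegral_ge0 => y _; exact: normr_ge0.
move=> n a c phi n1 a0 tphi.
have tphi' := test_field_setT (test_fieldN tphi).
have rphi := test_field_regular tphi'.
have flux y : 0 <= dastp a c (dot y n) * (eta y - dot (- phi y) n).
  have /andP[s0 _] := dstp02 (a * (dot y n - c)).
  apply: mulr_ge0; first by rewrite mulr_ge0 // ltW.
  have [Oy|nO] := pselect (Omega y).
    rewrite eta1_in // subr_ge0 (le_trans (ler_norm _)) // (le_trans (norm_dot_le _ _)) //.
    by rewrite {2}/enorm n1 sqrtr1 mulr1 enormN; have [_ _ _] := tphi; apply.
  have -> : phi y = 0.
    have [K [cK KO phiK]] := rf_supp (test_field_regular tphi).
    by apply: phiK => /KO.
  by rewrite oppr0 /dot /= !mul0r addr0 subr0; have /andP[] := eta01 y.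
have tv0 : tv_le setT (fun _ : R * R => 0) 0.
  move=> psi _; rewrite (_ : (fun y => _) = fun=> 0) ?Rintegral_cst ?mul0r //.
  by apply/funext => y; rewrite mul0r.
have i0 : mu2.-integrable setT (EFin \o (fun _ : R * R => 0 : R)) by exact: integrable0.
have X01 t : 0 <= astp a c t <= 1 by exact: stp01.
have [_ le] := @truncation_bound _ setT (fun=> 0) 0 0 openT i0 (fun _ _ => erefl) tv0 (fun y => - phi y) rphi
  n (astp a c) (dastp a c) eta eta1 eta2 (box M) (-1) n1 (is_derive_astp a c) (@continuous_dastp _ a c) X01
  ceta p1 p2 (@cd 1 0) (@cd 0 1) eta01 (@compact_box _ M) (@subsetT _ _)
  (fun y nb => etaM y (ltac:(rewrite ltNge; apply/negP => h; apply: nb; exact/boxP))) flux.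
have iX : mu2.-integrable setT (EFin \o (fun y => astp a c (dot y n) * divergence phi y)).
  have [K hK] := divergence_support tphi.
  apply: (continuous_box_integrable (M := K)).
    apply: contM; last exact: continuous_divergence tphi.
    by apply: cont_comp; [exact: continuous_astp|exact: continuous_dot].
  by move=> y yK; rewrite hK // mulr0.
have mX : measurable_fun setT (fun y => astp a c (dot y n)).
  by apply: continuous_measurable2; apply: cont_comp; [exact: continuous_astp|exact: continuous_dot].
have Xb y : setT y -> `|astp a c (dot y n)| <= 1.
  by move=> _; have /andP[s0 s1] := X01 (dot y n); rewrite ger0_norm.
have j1 := integrable_mul_bounded measurableT i1 mX Xb; have j2 := integrable_mul_bounded measurableT i2 mX Xb.
have j12 : mu2.-integrable setT (EFin \o (fun y => n.1 * (eta1 y * astp a c (dot y n)) + n.2 * (eta2 y * astp a c (dot y n)))).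
  exact: (integrable_add (integrable_scale n.1 measurableT j1) (integrable_scale n.2 measurableT j2)).
have E : \int[mu2]_y ((0 - astp a c (dot y n) * pos (0 - -1)) * divergence (fun y => - phi y) y +
    astp a c (dot y n) * pos (0 - -1) * (n.1 * eta1 y + n.2 * eta2 y)) =
  1 * \int[mu2]_y (astp a c (dot y n) * divergence phi y) +
  1 * \int[mu2]_y (n.1 * (eta1 y * astp a c (dot y n)) + n.2 * (eta2 y * astp a c (dot y n))).
  rewrite -(Rintegral_lincomb _ _ iX j12); apply: eq_Rintegral => y _.
  rewrite (divergenceN _ tphi) sub0r opprK pos_id //.
  by move: (divergence _ _) => D; ring.
move: le; rewrite E !mul1r (Rintegral_lincomb _ _ j1 j2) => le.
have b1 : `|\int[mu2]_y (eta1 y * astp a c (dot y n))| <= 1 * \int[mu2]_y `|eta1 y|.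
  exact: norm_Rintegral_mul_le measurableT i1 mX Xb.
have b2 : `|\int[mu2]_y (eta2 y * astp a c (dot y n))| <= 1 * \int[mu2]_y `|eta2 y|.
  exact: norm_Rintegral_mul_le measurableT i2 mX Xb.
have n1' : `|n.1| <= 1 by apply: dot_le1_bound1; rewrite n1.
have n2' : `|n.2| <= 1 by apply: dot_le1_bound2; rewrite n1.
exact: (half_plane_aux le b1 b2 n1' n2').
Qed.

Lemma half_plane_tv Omega N : open Omega -> Omega `<=` box N -> exists P, 0 <= P /\
  forall n c (strict : bool), dot n n = 1 ->
    tv_le Omega (\1_(Omega `&` [set y | if strict then c < dot y n else c <= dot y n])) P.
Proof.
move=> oO ON; have [P [P0 hP]] := smooth_half_plane ON; exists P; split => //.
move=> n c strict n1.
pose H := [set y : R * R | if strict then c < dot y n else c <= dot y n].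
pose ci (j : nat) : R := j.+1%:R^-1.
have ci0 j : 0 < ci j by rewrite invr_gt0.
(* The step begins at [c] for an open half-plane and ends at [c] for a closed one, so that its value
   on the bounding line is already the right one. *)
pose c' (j : nat) := if strict then c else c - ci j.
pose w_ (j : nat) (y : R * R) := \1_Omega y * astp (ci j)^-1 (c' j) (dot y n).
have mO := open_measurable2 oO.
have bw j : bdd 1 N (w_ j).
  split.
  - apply: measurable_funM; first exact: measurable_indic.
    by apply: continuous_measurable2; apply: cont_comp; [exact: continuous_astp|exact: continuous_dot].
  - move=> y; have /andP[s0 s1] := stp01 ((ci j)^-1 * (dot y n - c' j)).
    by rewrite /w_ indicE; case: (_ \in _); rewrite ?mul0r ?normr0 // mul1r ger0_norm.
  by move=> y yN; rewrite /w_ indicE memNset ?mul0r // => /ON/boxP; rewrite leNgt yN.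
have tw j : tv_le Omega (w_ j) P.
  apply: (@tv_le_ext _ _ (fun y => astp (ci j)^-1 (c' j) (dot y n))).
    by move=> y Oy; rewrite /w_ indicE mem_set // mul1r.
  by move=> phi tphi; apply: hP => //; rewrite invr_gt0.
have mH : measurable H.
  by rewrite /H; case: (strict); [exact: measurable_half_open|exact: measurable_half_closed].
have mOH : measurable (Omega `&` H) by exact: measurableI.
apply: (@tv_le_limit _ Omega set0 w_ _ 1 N (fun=> P) P negligible0 bw _ _ tw (cvg_cst _)).
  exact: measurable_indic.
move=> y _; rewrite indicE in_setI.
have [Oy|nO] := boolP (y \in Omega); last first.
  rewrite /= (_ : w_ ^~ y = fun=> 0); first exact: cvg_cst.
  by apply/funext => j; rewrite /w_ indicE (negbTE nO) mul0r.
rewrite (_ : w_ ^~ y = fun j => astp (ci j)^-1 (c' j) (dot y n)); last first.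
  by apply/funext => j; rewrite /w_ indicE Oy mul1r.
have up : (c < dot y n -> (fun j => astp (ci j)^-1 (c' j) (dot y n)) @ \oo --> (1 : R)).
  move=> yc; apply: (@cvg_trans _ ((fun=> 1 : R) @ \oo)); last exact: cvg_cst.
  apply: near_eq_cvg; have e0 : 0 < dot y n - c by rewrite subr_gt0.
  have := @cvg_harmonic R => /cvgr0Pnorm_lt /(_ _ e0); apply: filterS => j.
  rewrite /harmonic /= -/(ci j) gtr0_norm // => cj.
  rewrite /astp stp_1 // ler_pdivlMl // mulr1 /c'; case: (strict); first exact: ltW.
  by have := ci0 j; lra.
have down : (dot y n < c -> (fun j => astp (ci j)^-1 (c' j) (dot y n)) @ \oo --> (0 : R)).
  move=> yc; apply: (@cvg_trans _ ((fun=> 0 : R) @ \oo)); last exact: cvg_cst.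
  apply: near_eq_cvg; have e0 : 0 < c - dot y n by rewrite subr_gt0.
  have := @cvg_harmonic R => /cvgr0Pnorm_lt /(_ _ e0); apply: filterS => j.
  rewrite /harmonic /= -/(ci j) gtr0_norm // => cj.
  rewrite /astp stp_0 // pmulr_rle0 ?invr_gt0 // subr_le0 /c'; case: (strict); first exact: ltW.
  by lra.
rewrite /= ; have -> : (y \in H) = (if strict then c < dot y n else c <= dot y n).
  by apply/idP/idP => [/set_mem//|h]; exact: mem_set.
have [yc|yc|yc] := ltgtP (dot y n) c.
- by case: (strict); exact: down.
- by case: (strict); exact: up.
have E j : astp (ci j)^-1 (c' j) (dot y n) = (~~ strict)%:R.
  rewrite /astp /c' yc; case: (strict) => /=; first by rewrite subrr mulr0 stp_0.
  by rewrite opprB addrC subrK mulVf ?gt_eqF // stp_1.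
rewrite (_ : (fun j => _) = fun=> (~~ strict)%:R); last exact/funext.
by case: (strict); exact: cvg_cst.
Qed.

(** A staircase lying between g and g + dlt once N dlt exceeds g; each summand is a multiple of the
    indicator of a superlevel set. *)
Let layer N (dlt : R) g y : R := \sum_(i < N) dlt * (i%:R * dlt < g y)%R%:R.

Let layer_bounds N (dlt : R) g y : 0 < dlt -> 0 <= g y ->
  Num.min (g y) (N%:R * dlt) <= layer N dlt g y <= g y + dlt /\ layer N dlt g y <= N%:R * dlt.
Proof.
move=> d0 g0; elim: N => [|N [/andP[IH1 IH2] IH3]].
  by rewrite /layer big_ord0 mul0r min_r //; split => //; rewrite lexx addr_ge0 // ltW.
rewrite /layer big_ord_recr /= -/(layer N dlt g y).
have E : N.+1%:R * dlt = N%:R * dlt + dlt by rewrite -natr1 mulrDl mul1r.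
rewrite E; case: (ltP (N%:R * dlt) (g y)) => h /=; rewrite ?mulr1 ?mulr0 ?addr0.
  rewrite min_r in IH1; last exact: ltW.
  split; last by rewrite lerD2r.
  apply/andP; split; first by rewrite ge_min lerD2r IH1 orbT.
  by rewrite lerD2r (le_trans IH3) // ltW.
rewrite min_l in IH1 => //; rewrite IH2 andbT; split; first by rewrite ge_min IH1.
by rewrite (le_trans IH3) // lerDl ltW.
Qed.

(** The inequality part of the coarea formula by Riemann sums: k + 1 superlevel sets with weight M1
    / (k + 1), each of variation at most [P], then lower semicontinuity. *)
Lemma layer_cake_tv Omega N g M1 P : open Omega -> Omega `<=` box N -> (forall y, ~ Omega y -> g y = 0) ->
  (forall y, 0 <= g y <= M1) -> 0 < M1 ->
  (forall s, 0 <= s -> measurable [set y | Omega y /\ s < g y] /\ tv_le Omega (\1_[set y | Omega y /\ s < g y]) P) ->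
  measurable_fun setT g /\ tv_le Omega g (M1 * P).
Proof.
move=> oO ON gO g01 M10 lev.
have g0 y : 0 <= g y by have /andP[] := g01 y.
have gM y : g y <= M1 by have /andP[] := g01 y.
pose dl (k : nat) := M1 / k.+1%:R.
have dl0 k : 0 < dl k by rewrite divr_gt0.
have dlM k : k.+1%:R * dl k = M1 by rewrite mulrC divfK // pnatr_eq0.
pose S s := [set y | Omega y /\ s < g y].
have SE s y : 0 <= s -> (s < g y)%R%:R = \1_(S s) y :> R.
  move=> s0; rewrite indicE; congr (_%:R); congr nat_of_bool; apply/idP/idP => [h|/set_mem[]//].
  by apply/mem_set; split => //; apply: contrapT => /gO gy; move: h; rewrite gy ltNge s0.
pose w_ k y := layer k.+1 (dl k) g y.
have w_E k y : w_ k y = \sum_(i < k.+1) dl k * \1_(S (i%:R * dl k)) y.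
  by apply: eq_bigr => i _; rewrite SE // mulr_ge0 // ltW.
have ms s : 0 <= s -> measurable_fun setT (\1_(S s) : R * R -> R).
  by move=> s0; apply: measurable_indic; have [] := lev s s0.
have mw k : measurable_fun setT (w_ k).
  rewrite (_ : w_ k = fun y => \sum_(i < k.+1) dl k * \1_(S (i%:R * dl k)) y); last exact/funext.
  apply: measurable_sum => i; apply: measurable_funM; first exact: measurable_cst.
  by apply: ms; rewrite mulr_ge0 // ltW.
have wg k y : g y <= w_ k y <= g y + dl k.
  have [/andP[h1 h2] _] := @layer_bounds k.+1 (dl k) g y (dl0 k) (g0 y).
  by rewrite dlM min_l ?gM // in h1; rewrite h1 h2.
have w0 k y : g y = 0 -> w_ k y = 0.
  move=> gy; rewrite /w_ /layer big1 // => i _; rewrite gy ltNge mulr_ge0 ?mulr0 //; exact: ltW.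
have wc y : w_ ^~ y @ \oo --> g y.
  apply: (@squeeze_cvgr _ _ _ _ (fun=> g y) (fun k => g y + dl k)).
  - by apply: nearW => k; exact: wg.
  - exact: cvg_cst.
  rewrite -[X in _ --> X]addr0; apply: cvgD; first exact: cvg_cst.
  rewrite -[X in _ --> X](mulr0 M1); apply: cvgM; [exact: cvg_cst|exact: cvg_harmonic].
have mg : measurable_fun setT g.
  by apply: (@measurable_fun_cvg _ _ _ _ w_) => [k|y _]; [exact: mw|exact: wc].
have bw k : bdd (M1 + M1) N (w_ k).
  split => //.
    move=> y; have /andP[h1 h2] := wg k y; rewrite ger0_norm ?(le_trans (g0 y)) //.
    apply: (le_trans h2); apply: lerD => //.
    by rewrite /dl ler_pdivrMr //; apply: ler_peMr; [exact: ltW|rewrite ler1n].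
  by move=> y yN; apply: w0; apply: gO => /ON/boxP; rewrite leNgt yN.
have tw k : tv_le Omega (w_ k) (M1 * P).
  suff ind m : tv_le Omega (fun y => \sum_(i < m) dl k * \1_(S (i%:R * dl k)) y) (m%:R * dl k * P) /\
      mu2.-integrable setT (EFin \o (fun y => \sum_(i < m) dl k * \1_(S (i%:R * dl k)) y)).
    have [h _] := ind k.+1; rewrite dlM in h.
    by apply: tv_le_ext h => y _; rewrite w_E.
  have iS i : mu2.-integrable setT (EFin \o (\1_(S (i%:R * dl k)) : R * R -> R)).
    apply: (@bounded_box_integrable _ _ 1 N).
    - by apply: ms; rewrite mulr_ge0 // ltW.
    - by move=> y; rewrite indicE; case: (_ \in _); rewrite ?normr1 ?normr0.
    by move=> y yN; rewrite indicE memNset // => -[/ON/boxP]; rewrite leNgt yN.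
  elim: m => [|m [IH1 IH2]].
    rewrite !mul0r (_ : (fun y => _) = fun=> 0); last by apply/funext => y; rewrite big_ord0.
    split; last exact: integrable0.
    move=> phi tphi; rewrite (_ : (fun y => _) = fun=> 0) ?Rintegral_cst ?mul0r //.
    by apply/funext => y; rewrite mul0r.
  have E : (fun y => \sum_(i < m.+1) dl k * \1_(S (i%:R * dl k)) y) =
      (fun y => 1 * (\sum_(i < m) dl k * \1_(S (i%:R * dl k)) y) + dl k * \1_(S (m%:R * dl k)) y).
    by apply/funext => y; rewrite big_ord_recr /= mul1r.
  rewrite E; split; last first.
    exact: (integrable_add (integrable_scale 1 measurableT IH2) (integrable_scale (dl k) measurableT (iS m))).
  have -> : m.+1%:R * dl k * P = 1 * (m%:R * dl k * P) + dl k * P by rewrite -natr1; ring.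
  apply: tv_le_lincomb => //; first exact: ltW.
  by have [] := lev (m%:R * dl k) (ltac:(by rewrite mulr_ge0 // ltW)).
split => //.
exact: (@tv_le_limit _ Omega set0 w_ g (M1 + M1) N (fun=> M1 * P) (M1 * P) negligible0 bw mg (fun y _ => wc y) tw (cvg_cst _)).
Qed.

End half_planes.

(** * Convex geometry *)

Section convex_geometry.
Context {R : realType}.
Implicit Types (x y z a b c v : R * R).
Variables (Omega : set (R * R)).
Hypotheses (oO : open Omega) (bO : bounded_set Omega) (scO : strictly_convex Omega) (cO : C1_boundary Omega).

Definition cross a b : R := a.1 * b.2 - a.2 * b.1.

Lemma interior_Omega : interior Omega = Omega.
Proof. by apply/seteqP; split; [exact: interior_subset|move=> x Ox; exact: (open_nbhs_nbhs (conj oO Ox))]. Qed.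

Lemma boundary_not x : boundary Omega x -> ~ Omega x.
Proof. by move=> [_]; rewrite interior_Omega. Qed.

Lemma boundary_closure x : boundary Omega x -> closure Omega x.
Proof. by case. Qed.

Lemma closure_in_box : exists N : R, 0 <= N /\ closure Omega `<=` box N.
Proof.
have [M [Mr AM]] := bO.
have OM : Omega `<=` box (`|M| + 1).
  by move=> x Ox; apply/boxP; apply: AM => //; rewrite ltr_pwDr // ler_norm.
exists (`|M| + 1); split; first by rewrite addr_ge0.
have cl : closed (box (`|M| + 1) : set (R * R)).
  by apply: compact_closed; [exact: norm_hausdorff|exact: compact_box].
by rewrite ((closure_id _).1 cl); exact: closure_subset.
Qed.

Lemma segment_in x y (t : R) : closure Omega x -> closure Omega y -> x != y -> 0 < t < 1 ->
  Omega (t *: x + (1 - t) *: y).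
Proof. by move=> cx cy xy t01; rewrite -interior_Omega; exact: scO. Qed.

Lemma cross_parallel a b : a != 0 -> cross a b = 0 -> exists k : R, b = k *: a.
Proof.
move=> a0 cab.
have d0 : 0 < dot a a.
  rewrite lt_neqAle dot_ge0 andbT eq_sym; apply: contra_neq a0 => aa; apply/eqP.
  by rewrite -normr_le0 -(@ler_pXn2r _ 2) ?nnegrE // expr0n /=; have := normr_dot a; rewrite aa.
exists (dot b a / dot a a); move: cab; rewrite /cross => /eqP; rewrite subr_eq0 => /eqP cab.
have dn : dot a a != 0 by rewrite gt_eqF.
rewrite (surjective_pairing b) (surjective_pairing (_ *: a)); congr pair.
  apply: (mulIf dn); rewrite mulrAC divfK // /dot.
  have -> : (b.1 * a.1 + b.2 * a.2) * a.1 = b.1 * a.1 * a.1 + (a.1 * b.2) * a.2 by ring.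
  by rewrite cab; ring.
apply: (mulIf dn); rewrite mulrAC divfK // /dot.
have -> : (b.1 * a.1 + b.2 * a.2) * a.2 = (a.2 * b.1) * a.1 + b.2 * a.2 * a.2 by ring.
by rewrite -cab; ring.
Qed.

(** Of three distinct collinear points of the closure the middle one lies in the open set by strict
    convexity, hence not on the boundary. The three cases for [k] say which point is the middle
    one. *)
Lemma boundary_not_collinear a b c : boundary Omega a -> boundary Omega b -> boundary Omega c ->
  a != b -> a != c -> b != c -> cross (b - a) (c - a) != 0.
Proof.
move=> ba bb bc ab ac bc'; apply/eqP => cr0.
have ba0 : b - a != 0 by rewrite subr_eq0 eq_sym.
have [k kE] := cross_parallel ba0 cr0.
have cE : c = k *: b + (1 - k) *: a.
  by rewrite -[c in LHS](subrK a) kE scalerBr scalerBl scale1r -addrA; congr (_ + _); rewrite addrC.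
have k0 : k != 0 by apply: contra_neq ac => k0; rewrite cE k0 scale0r subr0 scale1r add0r.
have k1 : k != 1 by apply: contra_neq bc' => k1; rewrite cE k1 scale1r subrr scale0r addr0.
have ca := boundary_closure ba; have cb := boundary_closure bb; have cc := boundary_closure bc.
have [kneg|kpos] := ltP k 0.
  apply: (boundary_not ba); pose t := (1 - k)^-1.
  have i0 : 0 < 1 - k by lra.
  have -> : a = t *: c + (1 - t) *: b.
    rewrite cE scalerDr !scalerA -addrA [_ *: a + _]addrC addrA -scalerDl /t mulVf ?gt_eqF // scale1r.
    rewrite (_ : (1 - k)^-1 * k + (1 - (1 - k)^-1) = 0) ?scale0r ?add0r //.
    by field; rewrite gt_eqF.
  apply: segment_in => //; first by rewrite eq_sym.
  by rewrite /t invr_gt0 i0 invf_lt1 //; lra.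
have kgt0 : 0 < k by rewrite lt_neqAle eq_sym k0.
have [klt1|kge1] := ltP k 1.
  by apply: (boundary_not bc); rewrite cE; apply: segment_in; rewrite // 1?eq_sym // kgt0.
have kgt1 : 1 < k by rewrite lt_neqAle eq_sym k1.
apply: (boundary_not bb); pose t := k^-1.
have -> : b = t *: c + (1 - t) *: a.
  rewrite cE scalerDr !scalerA -addrA -scalerDl /t mulVf // scale1r.
  by rewrite (_ : k^-1 * (1 - k) + (1 - k^-1) = 0) ?scale0r ?addr0 //; field.
apply: segment_in => //; first by rewrite eq_sym.
by rewrite /t invr_gt0 kgt0 invf_lt1.
Qed.

(** The exit point belongs to the supremum of the parameters at which the ray is in the closure: the
    closure is closed and bounded, and an open set cannot contain a last point of the ray. *)
Lemma ray_exit x v : Omega x -> v != 0 -> exists s : R, 0 < s /\ boundary Omega (x + s *: v).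
Proof.
move=> Ox v0; have [N [N0 hN]] := closure_in_box.
pose S := [set s : R | 0 <= s /\ closure Omega (x + s *: v)].
have v0' : 0 < `|v| by rewrite normr_gt0.
have Sb s : S s -> s <= (2 * N) / `|v|.
  move=> [s0 /hN/boxP xs]; rewrite ler_pdivlMr // -(ger0_norm s0) -normrZ.
  have xN : `|x| <= N by apply/boxP; apply: hN; exact: subset_closure.
  rewrite -[s *: v](addKr x) addrC; apply: (le_trans (ler_normB _ _)); lra.
have S0 : S 0 by split => //; rewrite scale0r addr0; exact: subset_closure.
have hs : has_sup S by split; [exists 0|exists ((2 * N) / `|v|)].
pose s := sup S.
have s0 : 0 <= s by apply: ub_le_sup => //; exact: hs.2.
have cs : closure Omega (x + s *: v).
  apply: contrapT => nc.
  have oc : open (~` closure Omega) by apply: closed_openC; exact: closed_closure.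
  have /nbhs_normP [e /= e0 he] := open_nbhs_nbhs (conj oc nc).
  have ev : 0 < e / `|v| by rewrite divr_gt0.
  have [u [u0 cu] us] := sup_adherent ev hs; apply: (he (x + u *: v)) => //=.
  rewrite opprD addrACA subrr add0r -scalerBl normrZ ger0_norm; last first.
    by rewrite subr_ge0; apply: ub_le_sup; [exact: hs.2|].
  by rewrite -ltr_pdivlMr //; move: us; rewrite -/s; lra.
have nO : ~ Omega (x + s *: v).
  move=> Os; have /nbhs_normP [e /= e0 he] := open_nbhs_nbhs (conj oO Os).
  have ev : 0 < e / (2 * `|v|) by rewrite divr_gt0 // mulr_gt0.
  have : S (s + e / (2 * `|v|)).
    split; first by rewrite addr_ge0 // ltW.
    apply: subset_closure; apply: he => /=.
    rewrite opprD addrACA subrr add0r -scalerBl opprD addrA subrr add0r normrZ normrN gtr0_norm //.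
    have -> : e / (2 * `|v|) * `|v| = e / 2 by field; rewrite gt_eqF.
    by lra.
  by move=> /(ub_le_sup hs.2); rewrite -/s; lra.
exists s; split; last by split => //; rewrite interior_Omega.
rewrite lt_neqAle s0 andbT; apply/eqP => s00; apply: nO.
by rewrite -s00 scale0r addr0.
Qed.

Lemma boundary_chart x : boundary Omega x -> exists e1 e2 r h dh, C1_chart Omega x e1 e2 r h dh.
Proof.
move=> /cO [e1 [e2 [r [h [[n1 n2 n12] [r0 dh cdh gr]]]]]].
exists e1, e2, r, h, (derive1 h); split => // t.
by rewrite derive1E; exact: derivableP.
Qed.

(* The tangent line of the graph supports Omega, strictly by strict convexity. *)
Lemma support_direction x0 : boundary Omega x0 -> exists m, forall y, closure Omega y -> y != x0 -> 0 < dot (y - x0) m.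
Proof.
move=> bx; have [e1 [e2 [r [h [dh ch]]]]] := boundary_chart bx.
pose a0 := dot x0 e1; pose m := e2 - dh a0 *: e1.
have r0 := cc_r ch.
have x0h : dot x0 e2 <= h a0.
  rewrite leNgt; apply/negP => hx; apply: (boundary_not bx); apply/(cc_graph ch) => //.
  by rewrite /eball /= subrr /enorm /dot /= !mulr0 addr0 sqrtr0.
(* If [y] lay strictly below the tangent line, the points of the segment towards [x0], which belong
   to [Omega], would lie below the graph near [x0]. *)
have weak y : closure Omega y -> y != x0 -> 0 <= dot (y - x0) m.
  move=> cy yx; pose al := dot (y - x0) e1; pose be := dot (y - x0) e2.
  have -> : dot (y - x0) m = be - dh a0 * al by rewrite /m dotBr dotZr.
  rewrite leNgt; apply/negP => neg; pose k := dh a0 * al - be.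
  have k0 : 0 < k by rewrite /k; lra.
  have q0 : 0 < k / (`|al| + 1) by rewrite divr_gt0 // ltr_wpDl.
  have cdh0 : {for a0, continuous dh} by exact: (cc_cdh ch).
  have /cvgrPdist_lt /(_ _ q0) /nbhs_normP [d /= d0 hd] := cdh0.
  (* The three bounds keep [z] strictly between [x0] and [y], put it in the chart ball, and keep the
     mean value point where [dh] is close to its value at [a0]. *)
  pose s := Num.min (1 / 2) (Num.min (r / (2 * (enorm (y - x0) + 1))) (d / (2 * (`|al| + 1)))).
  have n1 : 0 < enorm (y - x0) + 1 by rewrite ltr_wpDl // enorm_ge0.
  have n2 : 0 < `|al| + 1 by rewrite ltr_wpDl.
  have s0 : 0 < s by rewrite !lt_min !divr_gt0 // mulr_gt0.
  have s1 : s < 1 by rewrite (@le_lt_trans _ _ (1 / 2)) ?ge_min ?lexx //; lra.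
  have s2 : s * (enorm (y - x0) + 1) <= r / 2.
    rewrite -ler_pdivlMr // (@le_trans _ _ (r / (2 * (enorm (y - x0) + 1)))) ?ge_min ?lexx ?orbT //.
    by rewrite invfM mulrA.
  have s3 : s * (`|al| + 1) <= d / 2.
    rewrite -ler_pdivlMr // (@le_trans _ _ (d / (2 * (`|al| + 1)))) ?ge_min ?lexx ?orbT //.
    by rewrite invfM mulrA.
  pose z := s *: y + (1 - s) *: x0.
  have zE : z - x0 = s *: (y - x0).
    by rewrite /z scalerBl scale1r scalerBr addrCA -addrA [x0 + _]addrC subrK.
  have Oz : Omega z by apply: segment_in => //; [exact: boundary_closure|rewrite s0].
  have zb : eball x0 r z.
    rewrite /eball /= zE enormZ gtr0_norm //; move: s2; rewrite mulrDr mulr1; lra.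
  have hz := (cc_graph ch zb).1 Oz.
  have z1 : dot z e1 = a0 + s * al by rewrite -[z](subrK x0) zE dotDl dotZl addrC.
  have z2 : dot z e2 = dot x0 e2 + s * be by rewrite -[z](subrK x0) zE dotDl dotZl addrC.
  rewrite z1 z2 in hz.
  have key : exists c : R, `|a0 - c| < d /\ h (a0 + s * al) - h a0 = dh c * (s * al).
    have chh : continuous h.
      by move=> t; apply: differentiable_continuous; apply/derivable1_diffP; have [] := cc_dh ch t.
    have small : `|s * al| < d by rewrite normrM gtr0_norm //; move: s3; rewrite mulrDr mulr1; lra.
    have [pos_|neg_] := leP 0 (s * al).
      have [c + E] := MVT_segment (ltac:(by rewrite lerDl) : a0 <= a0 + s * al) (fun t _ => cc_dh ch t) (continuous_subspaceT chh).
      rewrite in_itv /= => /andP[c1 c2]; exists c; split; last by rewrite E addrAC subrr add0r.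
      by move: small; rewrite ger0_norm // ler0_norm; lra.
    have [c + E] := MVT_segment (ltac:(by rewrite gerDl ltW) : a0 + s * al <= a0) (fun t _ => cc_dh ch t) (continuous_subspaceT chh).
    rewrite in_itv /= => /andP[c1 c2]; exists c; split; last by rewrite -[LHS]opprB E; ring.
    by move: small; rewrite ltr0_norm // ger0_norm; lra.
  have [c [cd E]] := key; have := hd c cd; rewrite ltr_pdivlMr // => hc.
  have up : dh c * al < be.
    by rewrite -(ltr_pM2l s0) mulrCA -E; lra.
  have : (dh a0 - dh c) * al < k.
    apply: le_lt_trans hc; rewrite (le_trans (ler_norm _)) // normrM ler_wpM2l //; lra.
  by rewrite mulrBl /k; lra.
exists m => y cy yx.
(* The midpoint can be pushed slightly in the direction - m without leaving [Omega]; the weak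
   inequality at the pushed point is the strict one at [y]. *)
pose z := (1 / 2) *: y + (1 - 1 / 2) *: x0.
have Oz : Omega z by apply: segment_in => //; [exact: boundary_closure|apply/andP; split; lra].
have mm : 0 < dot m m.
  rewrite /m dotBl !dotBr !dotZl !dotZr (cc_e11 ch) (cc_e22 ch) (dotC e2) (cc_e12 ch) !mulr0 subr0 sub0r opprK mulr1.
  by rewrite ltr_pwDl // -expr2 sqr_ge0.
have /nbhs_normP [e /= e0 he] := open_nbhs_nbhs (conj oO Oz).
have m0 : 0 < `|m| + 1 by rewrite ltr_wpDl.
pose q := e / (2 * (`|m| + 1)).
have q0 : 0 < q by rewrite divr_gt0 // mulr_gt0.
have Ow : Omega (z - q *: m).
  apply: he => /=; rewrite opprB addrC subrK normrZ gtr0_norm // /q.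
  have -> : e / (2 * (`|m| + 1)) * `|m| = e / 2 * (`|m| / (`|m| + 1)) by field; rewrite gt_eqF.
  apply: (@le_lt_trans _ _ (e / 2 * 1)); last by lra.
  apply: ler_wpM2l; first lra.
  by rewrite ler_pdivrMr // mul1r lerDl.
have wx : z - q *: m != x0 by apply/eqP => E; apply: (boundary_not bx); rewrite -E.
have := weak _ (subset_closure Ow) wx.
have -> : z - q *: m - x0 = (1 / 2) *: (y - x0) - q *: m.
  rewrite addrAC; congr (_ - _).
  by rewrite /z scalerBl scale1r scalerBr addrCA -addrA [x0 + _]addrC subrK.
rewrite (dotBl ((1 / 2) *: (y - x0))) !dotZl; have := mulr_gt0 q0 mm; lra.
Qed.

(** The approximation avoids 0 so that a direction with such a coordinate is nonzero. *)
Lemma rational_near (u e : R) : 0 < e -> exists q : rat, [/\ u < ratr q, ratr q < u + e & ratr q != 0 :> R].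
Proof.
move=> e0; have [u0|u0] := ltP u 0.
  have lt : u < Num.min (u + e) 0 by rewrite lt_min u0 ltrDl e0.
  have [q] := rat_in_itvoo lt; rewrite in_itv /= lt_min => /andP[h1 /andP[h2 h3]].
  by exists q; split => //; rewrite lt_eqF.
have lt : u < u + e by rewrite ltrDl.
have [q] := rat_in_itvoo lt; rewrite in_itv /= => /andP[h1 h2].
by exists q; split => //; rewrite gt_eqF // (le_lt_trans u0).
Qed.

Definition rdir (q : rat * rat) : R * R := (ratr q.1, ratr q.2).

(** On the compact part of the closure at distance at least [s] from [x0], the supporting functional
    has a positive minimum. This leaves room to replace - m by a rational direction and to separate
    [x0] by a rational offset. *)
Lemma rational_cap x0 (s : R) : boundary Omega x0 -> 0 < s -> exists (q : rat * rat) (c : rat),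
  [/\ rdir q != 0, ratr c < dot x0 (rdir q) & forall y, closure Omega y -> ratr c < dot y (rdir q) -> eball x0 s y].
Proof.
move=> bx s0; have [m hm] := support_direction bx; have [N [N0 hN]] := closure_in_box.
pose K := closure Omega `&` [set y | s <= enorm (y - x0)].
have cK : compact K.
  apply: (subclosed_compact _ (@compact_box _ N)); last by move=> y [/hN].
  by apply: (@closedI _ (closure Omega) [set y | s <= enorm (y - x0)]); [exact: closed_closure|apply: closed_ge_fun; exact: continuous_enorm_sub].
have cf : continuous (fun y => dot (y - x0) m).
  move=> y; apply: (@continuous_comp _ _ _ (fun y => y - x0) (fun z => dot z m)); last exact: continuous_dot.
  by apply: cvgB; [exact: cvg_id|exact: cvg_cst].
have Kpos y : K y -> 0 < dot (y - x0) m.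
  move=> [cy sy]; apply: hm => //; apply/eqP => yx; move: sy; rewrite /= yx subrr.
  by rewrite /enorm /dot /= !mulr0 addr0 sqrtr0 leNgt s0.
have [k [k0 hk]] := @compact_positive_min _ _ K _ cK cf Kpos.
(* Perturbing the direction by at most [e] in each coordinate changes the scalar product with y - x0
   by at most 4 N e, which is at most k / 2. *)
pose e := k / (8 * N + 8).
have e8 : 0 < 8 * N + 8 by rewrite ltr_wpDl // mulr_ge0.
have e0 : 0 < e by rewrite divr_gt0.
have [q1 [a1 b1 nz]] := rational_near (- m.1) e0; have [q2 [a2 b2 _]] := rational_near (- m.2) e0.
pose n := rdir (q1, q2).
have x0N : `|x0| <= N by apply/boxP; apply: hN; exact: boundary_closure.
have Kn y : K y -> dot y n <= dot x0 n - k / 2.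
  move=> Ky; have [cy _] := Ky; have := hk _ Ky.
  have yN : `|y| <= N by apply/boxP; exact: hN.
  have E : dot (y - x0) n = dot (y - x0) (n + m) - dot (y - x0) m by rewrite dotDr addrK.
  have small : `|n + m| <= e.
    have s1 : `|ratr q1 + m.1| <= e by rewrite ger0_norm; lra.
    have s2 : `|ratr q2 + m.2| <= e by rewrite ger0_norm; lra.
    by rewrite prod_normE ge_max; apply/andP; split; [exact: s1|exact: s2].
  have h1 := dot_le_norm (y - x0) (n + m).
  have h2 : `|y - x0| <= 2 * N by rewrite (le_trans (ler_normB _ _)) //; lra.
  have h3 : 2 * (`|y - x0| * `|n + m|) <= 2 * (2 * N * e) by rewrite ler_pM2l // ler_pM.
  have h4 : e * (8 * N + 8) = k by rewrite /e divfK // gt_eqF.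
  have h5 : dot (y - x0) (n + m) <= k / 2.
    by rewrite (le_trans (ler_norm _)) // (le_trans h1) // (le_trans h3) // -h4; nra.
  by move=> h6; move: E; rewrite dotBl; lra.
have lt : dot x0 n - k / 2 < dot x0 n by rewrite gtrDl oppr_lt0 divr_gt0.
have [c] := rat_in_itvoo lt; rewrite in_itv /= => /andP[c1 c2].
exists (q1, q2), c; split => //.
  by apply: contra_neq nz => /pair_equal_spec [].
move=> y cy yc; rewrite /eball /= ltNge; apply/negP => sy.
by have := Kn y (conj cy sy); move: yc; rewrite -/n; lra.
Qed.

End convex_geometry.

(** * The fan of rays from the distinguished boundary point *)

Section fan.
Context {R : realType}.
Notation mu2 := (@lebesgue2 R).
Implicit Types (x y z n m v : R * R).
Variables (Omega : set (R * R)) (L p : R) (gamma : R -> R * R).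
Hypotheses (oO : open Omega) (bO : bounded_set Omega) (scO : strictly_convex Omega) (cO : C1_boundary Omega).
Hypothesis alp : arc_length_param (boundary Omega) L gamma.

Let L0 : 0 < L. Proof. exact: alp_length_gt0 alp. Qed.

Lemma curve_periodic (k : int) t : gamma (t + k%:~R * L) = gamma t.
Proof.
have pos_ (j : nat) s : gamma (s + j%:R * L) = gamma s.
  elim: j s => [|j IH] s; first by rewrite mul0r addr0.
  by rewrite -natr1 mulrDl mul1r addrA (alp_periodic alp).
case: k => j; first exact: pos_.
by rewrite NegzE mulrNz mulNr -[LHS](pos_ j.+1) subrK.
Qed.

Lemma curve_reduce a t : exists k : int, a <= t + k%:~R * L < a + L.
Proof.
pose j := Num.floor ((t - a) / L); exists (- j).
have := Num.Theory.floor_itv ((t - a) / L); rewrite -/j => /andP[].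
rewrite ler_pdivlMr // ltr_pdivrMr // intrD mulrDl mul1r mulrNz mulNr => h1 h2.
by apply/andP; split; lra.
Qed.

Lemma curve_injective s t : p <= s < p + L -> p <= t < p + L -> gamma s = gamma t -> s = t.
Proof.
move=> /andP[s1 s2] /andP[t1 t2] st.
have [k /andP[k1 k2]] := curve_reduce 0 s; have [l /andP[l1 l2]] := curve_reduce 0 t.
rewrite add0r in k2 l2.
have E : s + k%:~R * L = t + l%:~R * L.
  by apply: (alp_injective alp); rewrite ?in_itv /= ?k1 ?l1 // !curve_periodic.
have E' : s - t = (l - k)%:~R * L by rewrite intrB mulrBl; lra.
have h1 : (l - k)%:~R < 1%:~R :> R by rewrite -(ltr_pM2r L0) -E' mul1r; lra.
have h2 : (-1)%:~R < (l - k)%:~R :> R by rewrite -(ltr_pM2r L0) -E' mulrNz mulN1r; lra.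
rewrite !ltr_int in h1 h2; have lk : l - k = 0 by lia.
by apply/eqP; rewrite -subr_eq0 E' lk mul0r.
Qed.

Notation q := (gamma p).

Lemma curve_boundary t : boundary Omega (gamma t).
Proof. by rewrite -(alp_range alp); exists t. Qed.

Lemma curve_neq s t : p <= s -> s < t -> t < p + L -> gamma s != gamma t.
Proof.
move=> ps st tL; apply/eqP => /curve_injective E.
have sE : s = t by apply: E; apply/andP; split; lra.
by rewrite sE ltxx in st.
Qed.

Lemma boundary_param x : boundary Omega x -> x != q -> exists t, p < t < p + L /\ gamma t = x.
Proof.
rewrite -(alp_range alp) => -[s _ <-] xq; have [k /andP[k1 k2]] := curve_reduce p s.
exists (s + k%:~R * L); rewrite curve_periodic k2 andbT; split => //.
rewrite lt_neqAle k1 andbT; apply: contra_neq xq => ->; exact: esym (curve_periodic _ _).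
Qed.

(** Seen from [gamma p], the boundary turns in one direction only. The cross product never vanishes,
    as no three boundary points are collinear, and two admissible pairs of parameters are joined by
    a segment of admissible pairs, so the intermediate value theorem excludes a change of sign. *)
Lemma cross_sign : exists sg : R, (sg = 1 \/ sg = -1) /\
  forall s t, p < s -> s < t -> t < p + L -> 0 < sg * cross (gamma s - q) (gamma t - q).
Proof.
pose s0 := p + L / 3; pose t0 := p + 2 * L / 3.
have ps0 : p < s0 by rewrite ltrDl divr_gt0.
have st0 : s0 < t0 by rewrite ltrD2l ltr_pM2r ?invr_gt0 // ltr_pMl // ltr1n.
have tL0 : t0 < p + L by rewrite ltrD2l ltr_pdivrMr // mulrC ltr_pM2l // ltr_nat.
pose X s t := cross (gamma s - q) (gamma t - q).
have nz s t : p < s -> s < t -> t < p + L -> X s t != 0.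
  move=> ps st tL; apply: (boundary_not_collinear oO scO); try exact: curve_boundary.
  - exact: curve_neq (lexx p) ps (lt_trans st tL).
  - exact: curve_neq (lexx p) (lt_trans ps st) tL.
  - exact: curve_neq (ltW ps) st tL.
have sgX : Num.sg (X s0 t0) = 1 \/ Num.sg (X s0 t0) = -1.
  have := nz _ _ ps0 st0 tL0; case: (ltrgtP (X s0 t0) 0) => // h _; first by right; exact: ltr0_sg.
  by left; exact: gtr0_sg.
exists (Num.sg (X s0 t0)); split => // s t ps st tL; rewrite -/(X s t).
pose Y (th : R) := X (s0 + th * (s - s0)) (t0 + th * (t - t0)).
have cg (u v : R) : continuous (fun th : R => gamma (u + th * v)).
  move=> th; apply: (@continuous_comp _ _ _ (fun th : R => u + th * v) gamma); last exact: (curve_continuous alp).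
  by apply: contD; [exact: cont_cst|apply: contM; [move=> ?; exact: cvg_id|exact: cont_cst]].
have cg1 (u v : R) : continuous (fun th : R => (gamma (u + th * v)).1 - q.1).
  apply: contB; last exact: cont_cst.
  by move=> th; apply: (@continuous_comp _ _ _ (fun th : R => gamma (u + th * v)) fst); [exact: cg|exact: cvg_fst].
have cg2 (u v : R) : continuous (fun th : R => (gamma (u + th * v)).2 - q.2).
  apply: contB; last exact: cont_cst.
  by move=> th; apply: (@continuous_comp _ _ _ (fun th : R => gamma (u + th * v)) snd); [exact: cg|exact: cvg_snd].
have cY : continuous Y.
  by rewrite /Y /X /cross; apply: contB; apply: contM; [exact: cg1|exact: cg2|exact: cg2|exact: cg1].
have conv_gt0 (a b th : R) : 0 < a -> 0 < b -> 0 <= th <= 1 -> 0 < a + th * (b - a).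
  by move=> a0 b0 /andP[th0 th1]; nra.
have Ynz (th : R) : 0 <= th <= 1 -> Y th != 0.
  move=> th01; apply: nz.
  - by have := @conv_gt0 (s0 - p) (s - p) th; rewrite !subr_gt0 => /(_ ps0 ps th01); lra.
  - by have := @conv_gt0 (t0 - s0) (t - s) th; rewrite !subr_gt0 => /(_ st0 st th01); lra.
  - by have := @conv_gt0 (p + L - t0) (p + L - t) th; rewrite !subr_gt0 => /(_ tL0 tL th01); lra.
rewrite lt_neqAle eq_sym mulf_neq0 ?nz //; last by case: sgX => ->; rewrite ?oner_eq0 ?oppr_eq0 ?oner_eq0.
rewrite leNgt; apply/negP => neg.
have Y0 : Y 0 = X s0 t0 by rewrite /Y !mul0r !addr0.
have Y1 : Y 1 = X s t by rewrite /Y !mul1r ![_ + (_ - _)]addrC !subrK.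
have ivt : Num.min (Y 0) (Y 1) <= 0 <= Num.max (Y 0) (Y 1).
  rewrite ge_min le_max Y0 Y1; case: (ltrgtP (X s0 t0) 0) sgX neg => h.
  - by rewrite (ltr0_sg h) mulN1r oppr_lt0 => _ /ltW ->; rewrite orbT.
  - by rewrite (gtr0_sg h) mul1r => _ /ltW ->; rewrite orbT.
  - by [].
have [c] := IVT ler01 (continuous_subspaceT cY) ivt.
by rewrite in_itv /= => c01 /eqP; apply/negP; exact: Ynz.
Qed.

Lemma fan_param x : Omega x -> exists t s, [/\ p < t < p + L, 1 < s & gamma t = q + s *: (x - q)].
Proof.
move=> Ox; have xq : x - q != 0.
  by rewrite subr_eq0; apply/eqP => E; apply: (boundary_not oO (curve_boundary p)); rewrite -E.
have [s [s0 bx]] := ray_exit oO bO Ox xq.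
have E : x + s *: (x - q) = q + (1 + s) *: (x - q) by rewrite scalerDl scale1r addrA [q + _]addrC subrK.
have nq : x + s *: (x - q) != q.
  by rewrite E -subr_eq0 addrAC subrr add0r scaler_eq0 negb_or xq andbT gt_eqF // ltr_wpDl.
have [t [t01 gt]] := boundary_param bx nq.
by exists t, (1 + s); split => //; [rewrite ltrDl|rewrite gt].
Qed.

(* The parameter at which the ray from gamma p through x leaves Omega. *)
Definition fan x : R := xget p [set t | p < t < p + L /\ exists s, 1 < s /\ gamma t = q + s *: (x - q)].

Lemma fanP x : Omega x -> p < fan x < p + L /\ exists s, 1 < s /\ gamma (fan x) = q + s *: (x - q).
Proof.
move=> /fan_param [t [s [t01 s1 gt]]]; rewrite /fan.
by case: xgetP => [y -> //|/(_ t) []]; split => //; exists s.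
Qed.

(** The chord from [gamma p] to [gamma t0] separates the rays with smaller exit parameter from those
    with larger one; [sg] orients its normal towards the latter. *)
Lemma fan_halfplane t0 : p < t0 < p + L -> exists n c, dot n n = 1 /\ forall x, Omega x ->
  (t0 < fan x <-> c < dot x n) /\ (t0 <= fan x <-> c <= dot x n).
Proof.
move=> /andP[pt tL]; have [sg [sg1 hs]] := cross_sign.
pose g := gamma t0 - q.
have g0 : g != 0 by rewrite subr_eq0 eq_sym; exact: curve_neq (lexx p) pt tL.
have en0 : 0 < enorm g.
  rewrite lt_neqAle enorm_ge0 andbT; apply: contra_neq g0 => g0; apply/eqP.
  by rewrite -normr_le0 (le_trans (norm_le_enorm _)) // -g0.
have en : enorm g != 0 by rewrite gt_eqF.
pose n : R * R := (sg / enorm g) *: (- g.2, g.1).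
exists n, (dot q n); split.
  rewrite /n dotZl dotZr mulrA; have -> : dot (- g.2, g.1) (- g.2, g.1) = enorm g ^+ 2.
    by rewrite enorm_sqr /dot /=; ring.
  have -> : sg / enorm g * (sg / enorm g) * enorm g ^+ 2 = sg * sg by field.
  by case: sg1 => ->; rewrite ?mulr1 ?mulrNN ?mulr1.
move=> x Ox; have [/andP[f1 f2] [s [s1 E]]] := fanP Ox.
have s0 : 0 < s by lra.
have dx : (dot x n - dot q n) * (enorm g * s) = sg * cross g (gamma (fan x) - q).
  have -> : gamma (fan x) - q = s *: (x - q) by rewrite E addrAC subrr add0r.
  have crE v : cross g (s *: v) = s * dot v (- g.2, g.1) by rewrite /cross /dot /= /GRing.scale /=; ring.
  by rewrite crE -dotBl /n dotZr; field.
have es : 0 < enorm g * s by rewrite mulr_gt0.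
have sgn : (t0 < fan x -> dot q n < dot x n) /\ (fan x < t0 -> dot x n < dot q n) /\ (fan x = t0 -> dot x n = dot q n).
  split; [|split] => h.
  - by rewrite -subr_gt0 -(pmulr_lgt0 _ es) dx; exact: hs.
  - rewrite -subr_lt0 -(pmulr_llt0 _ es) dx -oppr_gt0.
    by have := hs _ _ f1 h tL; rewrite /cross; congr (0 < _); rewrite /g; ring.
  - apply/eqP; rewrite -subr_eq0; have /eqP := dx; rewrite h /cross [_ * g.2]mulrC subrr mulr0.
    by rewrite mulf_eq0 (gt_eqF es) orbF.
have [h1 [h2 h3]] := sgn; split; split.
- exact: h1.
- by move=> h; rewrite ltNge le_eqVlt; apply/negP => /orP[/eqP/h3 E'|/h2]; [move: h; rewrite E' ltxx|move/(lt_trans h); rewrite ltxx].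
- by rewrite le_eqVlt => /orP[/eqP/esym/h3 ->|/h1/ltW].
- by move=> h; rewrite leNgt; apply/negP => /h2; rewrite ltNge h.
Qed.

(** Leave [x] parallel to the line bounding the first half-plane, in the sense that does not
    decrease the second scalar product. The exit point stays in both half-planes, and it is not
    [gamma p], which the first one misses. *)
Lemma wedge_boundary x n1 n2 (c1 c2 : R) : Omega x -> c1 < dot x n1 -> c2 < dot x n2 -> dot q n1 <= c1 ->
  n1 != 0 -> exists t, [/\ p < t < p + L, c1 < dot (gamma t) n1 & c2 < dot (gamma t) n2].
Proof.
move=> Ox h1 h2 hq n0.
have [v [v0 vn1 vn2]] : exists v, [/\ v != 0, dot v n1 = 0 & 0 <= dot v n2].
  pose v : R * R := (- n1.2, n1.1).
  have v0 : v != 0.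
    apply: contra_neq n0 => v0; have [e1 e2] : - n1.2 = 0 /\ n1.1 = 0 by have := congr1 fst v0; have := congr1 snd v0.
    by rewrite (surjective_pairing n1) e2; move/eqP: e1; rewrite oppr_eq0 => /eqP ->.
  have vn : dot v n1 = 0 by rewrite /dot /v /=; ring.
  have [h|h] := leP 0 (dot v n2); first by exists v.
  by exists (- v); rewrite oppr_eq0 !dotNl vn oppr0 oppr_ge0 ltW.
have [s [s0 bx]] := ray_exit oO bO Ox v0.
have e1 : c1 < dot (x + s *: v) n1 by rewrite dotDl dotZl vn1 mulr0 addr0.
have e2 : c2 < dot (x + s *: v) n2 by rewrite dotDl dotZl ltr_wpDr // mulr_ge0 // ltW.
have nq : x + s *: v != q by apply/eqP => E; move: e1; rewrite E ltNge hq.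
by have [t [t01 gt]] := boundary_param bx nq; exists t; split => //; rewrite gt.
Qed.

(** The parameters with s < A form an interval reaching up to p + L. Its lower end t0 belongs to it
    or not according to the value of [A] there, which decides between a closed and an open
    half-plane. The empty set and all of [Omega] are written with half-planes whose bounding line
    avoids the box. *)
Lemma fan_level_set N (A : R -> R) (s : R) : Omega `<=` box N -> {homo A : t u / t <= u} ->
  exists n c (strict : bool), dot n n = 1 /\
    [set y | Omega y /\ s < A (fan y)] = Omega `&` [set y | if strict then c < dot y n else c <= dot y n].
Proof.
move=> ON Am.
have y1 y : Omega y -> `|y.1| <= N.
  by move=> /ON/boxP; apply: le_trans; rewrite prod_normE le_max lexx.
have n1 : dot ((1, 0) : R * R) (1, 0) = 1 by rewrite /dot /= mulr1 mulr0 addr0.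
have d1 y : dot y (1, 0) = y.1 by rewrite /dot /= mulr1 mulr0 addr0.
pose T := [set t | p < t < p + L /\ s < A t].
have [T0|Tn0] := pselect (exists t, T t); last first.
  exists (1, 0), (N + 1), true; split => //; apply/seteqP; split => y [Oy h].
    by exfalso; apply: Tn0; exists (fan y); split => //; have [] := fanP Oy.
  by move: h (y1 _ Oy) => /=; rewrite d1 ler_norml => h /andP[]; lra.
have iT : has_inf T by split => //; exists p => t [/andP[/ltW]].
pose t0 := inf T.
have pt0 : p <= t0 by apply: lb_le_inf => // t [/andP[/ltW]].
have ltT t : p < t < p + L -> t0 < t -> s < A t.
  move=> t01 tt; have [u [u01 su] ut] := inf_adherent (ltac:(by rewrite subr_gt0; exact: tt) : 0 < t - t0) iT.
  by rewrite (lt_le_trans su) // Am //; move: ut; rewrite -/t0; lra.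
have Tge t : p < t < p + L -> s < A t -> t0 <= t by move=> t01 st; apply: ge_inf; [exact: iT.2|].
have t0L : t0 < p + L.
  by have [t [t01 st]] := T0; rewrite (le_lt_trans (Tge _ t01 st)) //; case/andP: t01.
have [t0p|t0p] := ltP p t0; last first.
  have E : t0 = p by apply/eqP; rewrite eq_le t0p.
  exists (1, 0), (- N - 1), true; split => //; apply/seteqP; split => y [Oy h]; split => //=.
    by rewrite d1; move: (y1 _ Oy); rewrite ler_norml => /andP[]; lra.
  by have [f01 _] := fanP Oy; apply: ltT => //; rewrite E; case/andP: f01.
have t01 : p < t0 < p + L by rewrite t0p.
have [n [c [nn hn]]] := fan_halfplane t01.
have [st|ts] := ltP s (A t0).
  exists n, c, false; split => //; apply/seteqP; split => y [Oy h]; split => //=.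
    by apply/(hn y Oy).2; apply: Tge => //; have [] := fanP Oy.
  by apply: (lt_le_trans st); apply: Am; apply/(hn y Oy).2.
exists n, c, true; split => //; apply/seteqP; split => y [Oy h]; split => //=; have [f01 _] := fanP Oy.
  apply/(hn y Oy).1; rewrite lt_neqAle (Tge _ f01 h) andbT; apply/eqP => E.
  by move: h; rewrite -E ltNge ts.
by apply: ltT => //; apply/(hn y Oy).1.
Qed.

Lemma fan_tv (A : R -> R) (M1 : R) : {homo A : t u / t <= u} -> (forall t, 0 <= A t <= M1) ->
  exists V, measurable_fun setT (fun y => \1_Omega y * A (fan y)) /\ tv_le Omega (fun y => \1_Omega y * A (fan y)) V.
Proof.
move=> Am A01; have [N [N0 hN]] := closure_in_box bO.
have ON : Omega `<=` box N by apply: subset_trans hN; exact: subset_closure.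
have [P [P0 hP]] := half_plane_tv oO ON.
have M1ge : 0 <= M1 by have /andP[] := A01 0; exact: le_trans.
exists ((M1 + 1) * P); apply: (layer_cake_tv oO ON).
- by move=> y nO; rewrite indicE memNset // mul0r.
- move=> y; have /andP[a0 a1] := A01 (fan y); rewrite indicE; case: (y \in Omega).
    by rewrite mul1r a0 /= ler_wpDr.
  by rewrite mul0r lexx /= addr_ge0.
- by rewrite ltr_wpDl.
move=> s s0; have [n [c [strict [nn E]]]] := fan_level_set s ON Am.
have -> : [set y | Omega y /\ s < \1_Omega y * A (fan y)] = [set y | Omega y /\ s < A (fan y)].
  by apply/seteqP; split => y [Oy]; rewrite /= indicE mem_set // mul1r.
rewrite E; split; last exact: hP.
apply: measurableI; first exact: open_measurable2.
by case: strict {E}; [exact: measurable_half_open|exact: measurable_half_closed].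
Qed.

Lemma fan_datum_tv (A B : R -> R) (M0 M1 : R) : {homo A : t u / t <= u} -> {homo B : t u / t <= u} ->
  (forall t, 0 <= A t <= M1) -> (forall t, 0 <= B t <= M1) -> 0 <= M0 ->
  let u y := \1_Omega y * (A (fan y) - B (fan y) + M0) in
  measurable_fun setT u /\ exists V, tv_le Omega u V.
Proof.
move=> Am Bm A01 B01 M00 u; have [N [N0 hN]] := closure_in_box bO.
have ON y : N < `|y| -> ~ Omega y.
  by move=> yN Oy; have /boxP := hN _ (subset_closure Oy); rewrite leNgt yN.
have [VA [mA tA]] := fan_tv Am A01; have [VB [mB tB]] := fan_tv Bm B01.
have [V1 [m1 t1]] := fan_tv (A := fun=> 1) (M1 := 1) (fun _ _ _ => lexx 1) (fun _ => ltac:(by rewrite ler01 lexx)).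
have M1ge : 0 <= M1 by have /andP[] := A01 0; exact: le_trans.
have int (X : R -> R) (K : R) : 0 <= K -> measurable_fun setT (fun y => \1_Omega y * X (fan y)) -> (forall t, 0 <= X t <= K) ->
  mu2.-integrable setT (EFin \o (fun y => \1_Omega y * X (fan y))).
  move=> K0 mX X0; apply: (@bounded_box_integrable _ _ K N) => // y.
    have /andP[x0 x1] := X0 (fan y); rewrite indicE; case: (y \in Omega); last by rewrite mul0r normr0.
    by rewrite mul1r ger0_norm.
  by move=> /ON nO; rewrite indicE memNset // mul0r.
have iA := int A M1 M1ge mA A01; have iB := int B M1 M1ge mB B01.
have i1 := int (fun=> 1) 1 ler01 m1 (fun _ => ltac:(by rewrite ler01 lexx)).
have uE : u = fun y => (1 * (1 * (\1_Omega y * A (fan y)) + 1 * (- (\1_Omega y * B (fan y)))) + M0 * (\1_Omega y * 1)).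
  by apply/funext => y; rewrite /u; ring.
have iNB : mu2.-integrable setT (EFin \o (fun y => - (\1_Omega y * B (fan y)))).
  have := integrable_scale (-1) measurableT iB; apply: eq_integrable => // y _.
  by rewrite /= mulN1r.
split.
  rewrite uE; apply: measurable_funD; apply: measurable_funM => //.
  by apply: measurable_funD; apply: measurable_funM => //; exact: measurableT_comp.
eexists; rewrite uE; apply: (tv_le_lincomb (u := fun y => 1 * (\1_Omega y * A (fan y)) + 1 * (- (\1_Omega y * B (fan y))))) => //.
  exact: integrable_add (integrable_scale 1 measurableT iA) (integrable_scale 1 measurableT iNB).
by apply: tv_le_lincomb => //; [exact: tA|exact: tv_leN tB].
exact: t1.
Qed.

End fan.

(** * Traces and total variation on the domain *)

Section restriction.
Context {R : realType}.
Notation mu := (@lebesgue_measure R).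
Notation mu2 := (mu \x mu)%E.
Implicit Types (x y : R * R) (u v g : R * R -> R) (Omega : set (R * R)).

Lemma restrict_measurable Omega u : open Omega ->
  mu2.-integrable Omega (EFin \o u) -> mu2.-integrable setT (EFin \o (fun y => \1_Omega y * u y)).
Proof.
move=> oO iu; have mO := open_measurable2 oO.
have := (@integrable_mkcond _ _ _ mu2 Omega (EFin \o u) mO).1 iu; apply: eq_integrable => // y _.
by rewrite patchE /= indicE; case: (y \in Omega); rewrite ?mul1r ?mul0r.
Qed.

Lemma integral_restrict Omega u g (b : R) : open Omega -> mu2.-integrable setT (EFin \o (fun y => \1_Omega y * u y)) ->
  measurable_fun setT g -> (forall y, `|g y| <= b) ->
  (\int[mu2]_(y in Omega) (u y * g y)%:E)%E = (\int[mu2]_y (\1_Omega y * u y * g y))%:E.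
Proof.
move=> oO iu mg gb; rewrite integral_mkcond /Rintegral fineK; last first.
  apply: integrable_fin_num => //.
  exact: (integrable_mul_bounded measurableT iu mg (fun y _ => gb y)).
apply: eq_integral => y _; rewrite patchE indicE; case: (y \in Omega); first by rewrite mul1r.
by rewrite !mul0r.
Qed.

Lemma total_var_tv_le Omega u (V : R) : open Omega -> mu2.-integrable Omega (EFin \o u) ->
  ((total_var Omega u <= V%:E)%E <-> tv_le Omega (fun y => \1_Omega y * u y) V).
Proof.
move=> oO iu; have iu' := restrict_measurable oO iu.
have E phi : test_field Omega phi ->
  (\int[mu2]_(y in Omega) (u y * divergence phi y)%:E)%E = (\int[mu2]_y (\1_Omega y * u y * divergence phi y))%:E.
  move=> tphi.
  have [b [_ hb]] := bounded_divergence tphi.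
  by apply: (integral_restrict oO iu' (continuous_measurable2 (continuous_divergence tphi)) hb).
split.
  move=> uV phi tphi; rewrite -lee_fin -E //; apply: le_trans uV; apply: ereal_sup_ubound.
  by exists phi.
by move=> uV; apply: ge_ereal_sup => _ [phi tphi <-]; rewrite E // lee_fin; exact: uV.
Qed.

Lemma vanishing_meanP Omega g x : open Omega -> (forall y, 0 <= g y) ->
  mu2.-integrable setT (EFin \o (fun y => \1_Omega y * g y)) ->
  (((r ^- 2)%:E * \int[mu2]_(y in Omega `&` eball x r) (g y)%:E)%E @[r --> (0 : R)^'+] --> 0%E <->
   vanishing_mean (fun y => \1_Omega y * g y) x).
Proof.
move=> oO g0 ig.
pose J (r : R) := \int[mu2]_y (\1_Omega y * g y * \1_(eball x r) y).
have JE r : (\int[mu2]_(y in Omega `&` eball x r) (g y)%:E)%E = (J r)%:E.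
  have b1 y : `|\1_(eball x r) y : R| <= 1 by rewrite indicE; case: (_ \in _); rewrite ?normr1 ?normr0.
  rewrite /J -(integral_restrict oO ig (measurable_indic (measurable_eball x r)) b1).
  rewrite [LHS]integral_mkcond [RHS]integral_mkcond; apply: eq_integral => y _.
  rewrite !patchE in_setI indicE; case: (y \in Omega) => //=.
  by case: (y \in eball x r); rewrite ?mulr1 ?mulr0.
have J0 r : 0 <= J r.
  by apply: Rintegral_ge0 => y _; do 2 apply: mulr_ge0 => //; rewrite indicE ler0n.
have -> : (fun r : R => (r ^- 2)%:E * \int[mu2]_(y in Omega `&` eball x r) (g y)%:E)%E = EFin \o (fun r => r ^- 2 * J r).
  by apply/funext => r; rewrite JE.
split.
  move=> /fine_cvgP[_] /cvgrPdist_le h e e0; have [d /= d0 hd] := h e e0.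
  exists d; split => // s /andP[s0 sd]; have := hd s; rewrite /= sub0r normrN gtr0_norm // => /(_ sd s0).
  rewrite sub0r normrN ger0_norm; last by rewrite mulr_ge0 // invr_ge0 exprn_ge0 // ltW.
  by rewrite mulrC ler_pdivrMr ?exprn_gt0.
move=> h; apply/fine_cvgP; split; first by apply: nearW.
apply/cvgrPdist_le => e e0; have [d [d0 hd]] := h e e0; exists d => //= s.
rewrite /= sub0r normrN => sd s0; move: sd; rewrite gtr0_norm // => sd.
rewrite sub0r normrN ger0_norm; last by rewrite mulr_ge0 // invr_ge0 exprn_ge0 // ltW.
by rewrite mulrC ler_pdivrMr ?exprn_gt0 //; apply: hd; rewrite s0.
Qed.

Lemma vanishing_mean_le g v x : mu2.-integrable setT (EFin \o g) -> mu2.-integrable setT (EFin \o v) ->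
  (forall y, g y <= v y) -> vanishing_mean v x -> vanishing_mean g x.
Proof.
move=> ig iv gv hv e e0; have [d [d0 hd]] := hv e e0; exists d; split => // s s0d.
apply: le_trans (hd _ s0d).
have b1 y : [set: R * R] y -> `|\1_(eball x s) y : R| <= 1 by move=> _; rewrite indicE; case: (_ \in _); rewrite ?normr1 ?normr0.
have mi : measurable_fun setT (\1_(eball x s) : R * R -> R) by exact: measurable_indic (measurable_eball x s).
apply: le_Rintegral => //.
- exact: (integrable_mul_bounded measurableT ig mi b1).
- exact: (integrable_mul_bounded measurableT iv mi b1).
by move=> y _; apply: ler_wpM2r => //; rewrite indicE ler0n.
Qed.

Lemma vanishing_meanD g v x : mu2.-integrable setT (EFin \o g) -> mu2.-integrable setT (EFin \o v) ->
  vanishing_mean g x -> vanishing_mean v x -> vanishing_mean (fun y => g y + v y) x.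
Proof.
move=> ig iv hg hv e e0; have e2 : 0 < e / 2 by rewrite divr_gt0.
have [d1 [d10 h1]] := hg _ e2; have [d2 [d20 h2]] := hv _ e2.
exists (Num.min d1 d2); split; first by rewrite lt_min d10.
move=> s; rewrite lt_min => /and3P[s0 s1 s2].
have b1 y : [set: R * R] y -> `|\1_(eball x s) y : R| <= 1 by move=> _; rewrite indicE; case: (_ \in _); rewrite ?normr1 ?normr0.
have mi : measurable_fun setT (\1_(eball x s) : R * R -> R) by exact: measurable_indic (measurable_eball x s).
have i1 := integrable_mul_bounded measurableT ig mi b1.
have i2 := integrable_mul_bounded measurableT iv mi b1.
have -> : \int[mu2]_y ((g y + v y) * \1_(eball x s) y) =
    \int[mu2]_y (1 * (g y * \1_(eball x s) y) + 1 * (v y * \1_(eball x s) y)).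
  by apply: eq_Rintegral => y _; rewrite !mul1r mulrDl.
rewrite (Rintegral_lincomb _ _ i1 i2) !mul1r.
have s01 : 0 < s < d1 by rewrite s0.
have s02 : 0 < s < d2 by rewrite s0.
have := lerD (h1 s s01) (h2 s s02); rewrite -mulrDl => H; apply: (le_trans H).
by rewrite -splitr.
Qed.

Lemma hausdorff1_null_setU (A B : set (R * R)) : hausdorff1 A = 0%E -> hausdorff1 B = 0%E -> hausdorff1 (A `|` B) = 0%E.
Proof.
move=> A0 B0; apply/eqP; rewrite eq_le hausdorff1_ge0 andbT.
by rewrite (le_trans (outer_measureU2 (@hausdorff1 R) A B)) //= A0 B0 adde0.
Qed.

Lemma hausdorff1_null_sub (A B : set (R * R)) : A `<=` B -> hausdorff1 B = 0%E -> hausdorff1 A = 0%E.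
Proof. by move=> AB B0; apply/eqP; rewrite eq_le hausdorff1_ge0 andbT -B0; exact: le_hausdorff1. Qed.

(** The exceptional set in the definition of [trace], as a set of its own so that inclusions between
    exceptional sets can be stated; see [trace_defectP]. *)
Definition trace_defect Omega u (f : R * R -> R) : set (R * R) :=
  [set x | boundary Omega x /\ ~ vanishing_mean (fun y => \1_Omega y * `|u y - f x|) x].

Lemma integrable_restrict_dist Omega u (b : R) : open Omega -> bounded_set Omega ->
  mu2.-integrable Omega (EFin \o u) -> mu2.-integrable setT (EFin \o (fun y => \1_Omega y * `|u y - b|)).
Proof.
move=> oO bO iu; have iu' := restrict_measurable oO iu; have mO := open_measurable2 oO.
have [N [N0 hN]] := closure_in_box bO.
have i1 : mu2.-integrable setT (EFin \o (fun y => b * \1_Omega y)).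
  apply: (integrable_scale b measurableT); apply: (@bounded_box_integrable _ _ 1 N).
  - exact: measurable_indic.
  - by move=> y; rewrite indicE; case: (_ \in _); rewrite ?normr1 ?normr0.
  move=> y yN; rewrite indicE memNset // => Oy.
  by have /boxP := hN _ (subset_closure Oy); rewrite leNgt yN.
have := integrable_norm_fin measurableT (integrable_sub iu' i1); apply: eq_integrable => // y _.
rewrite /= indicE; case: (y \in Omega); rewrite ?mul1r ?mulr1 //.
by rewrite !mul0r mulr0 subr0 normr0.
Qed.

Lemma trace_defectP Omega u f : open Omega -> bounded_set Omega -> mu2.-integrable Omega (EFin \o u) ->
  (trace Omega u f <-> L1_boundary Omega f /\ hausdorff1 (trace_defect Omega u f) = 0%E).
Proof.
move=> oO bO iu; rewrite /trace (_ : [set x | _ ] = trace_defect Omega u f) //.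
have P x := @vanishing_meanP Omega (fun y => `|u y - f x|) x oO (fun y => normr_ge0 _)
  (integrable_restrict_dist (f x) oO bO iu).
by apply/seteqP; split => x [bx h]; split => //; apply: contra_not h => h; [exact: (P x).2 h|exact: (P x).1 h].
Qed.

End restriction.

(** * The obstacle class *)

Section caps.
Context {R : realType}.
Notation mu := (@lebesgue_measure R).
Notation mu2 := (mu \x mu)%E.
Implicit Types (x y q : R * R) (w g : R * R -> R) (i : (rat * rat) * (rat * rat)).
Variables (Omega : set (R * R)) (q : R * R) (G : set (R * R)) (W N : R).
Hypotheses (oO : open Omega) (ON : Omega `<=` box N).

(** An index ((m1, m2), (c, k)) of rationals encodes the half-plane where y.m exceeds c together
    with the level k. The type of indices is countable, which is what allows the constraints to be
    imposed as a sequence. *)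
Definition offset i : R := ratr i.2.1.
Definition level i : R := ratr i.2.2.
Definition half i : set (R * R) := [set y | offset i < dot y (rdir i.1)].
Definition cap i : set (R * R) := Omega `&` half i.

Definition in_chart i := exists x0 e1 e2 r h dh,
  C1_chart Omega x0 e1 e2 r h dh /\ cap i `<=` eball x0 (r / 2).

(* G stands for the boundary points at which the datum g is approximately
   continuous; the distinguished boundary point q lies outside the half-plane. *)
Definition admissible g i := [/\ rdir i.1 != 0 :> R * R, ~ half i q, `|level i| <= W, in_chart i &
  forall x, G x -> half i x -> g x <= level i].

Definition excess w i y := \1_(cap i) y * pos (w y - level i).

Lemma measurable_cap i : measurable (cap i).
Proof. exact: (measurableI _ _ (open_measurable2 oO) (measurable_half_open _ _)). Qed.

Lemma excess_integrable w i : bdd W N w -> mu2.-integrable setT (EFin \o excess w i).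
Proof.
move=> [mw wW wN]; apply: (@bounded_box_integrable _ _ (W + `|level i|) N).
- apply: measurable_funM; first exact: measurable_indic (measurable_cap i).
  by apply: measurable_maxr => //; exact: measurable_funB.
- move=> y; have W0 : 0 <= W + `|level i| by rewrite addr_ge0 // (le_trans _ (wW 0)).
  rewrite /excess indicE; case: (y \in cap i); last by rewrite mul0r normr0.
  rewrite mul1r ger0_norm ?pos_ge0 //; apply: pos_le => //.
  by rewrite (le_trans (ler_norm _)) // (le_trans (ler_normB _ _)) // lerD2r.
move=> y yN; rewrite /excess indicE memNset ?mul0r // => -[/ON/boxP]; by rewrite leNgt yN.
Qed.

Lemma cap_truncation_rational w V i : bdd W N w -> tv_le Omega w V -> rdir i.1 != 0 :> R * R -> in_chart i ->
  hausdorff1 [set x | boundary Omega x /\ half i x /\ ~ vanishing_mean (excess w i) x] = 0%E ->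
  tv_le Omega (fun y => w y - excess w i y) V.
Proof.
move=> bw wV m0 [x0 [e1 [e2 [r [h [dh [ch sub]]]]]]] null; have [mw wW wN] := bw.
set m : R * R := rdir i.1 in m0.
have en0 : 0 < enorm m.
  rewrite lt_neqAle enorm_ge0 andbT; apply: contra_neq m0 => g0; apply/eqP.
  by rewrite -normr_le0 (le_trans (norm_le_enorm _)) // -g0.
have en : enorm m != 0 by rewrite gt_eqF.
pose n := (enorm m)^-1 *: m.
have n1 : dot n n = 1 by rewrite /n dotZl dotZr -enorm_sqr; field.
pose c := offset i / enorm m.
have cE y : (c < dot y n) = (offset i < dot y m).
  by rewrite /n dotZr mulrC /c ltr_pM2r // invr_gt0.
have capE : [set y | Omega y /\ c < dot y n] = cap i.
  by apply/seteqP; split => y [Oy]; rewrite /= cE.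
have cap_sub y : Omega y -> c < dot y n -> eball x0 (r / 2) y.
  by move=> Oy; rewrite cE => hy; apply: sub.
have := @cap_truncation R Omega w V N W (level i) oO (bdd_integrable bw) wN wV wW x0 e1 e2 n r c h dh ch n1 cap_sub.
rewrite capE => H; apply: tv_le_ext (H _) => [y Oy|].
  rewrite /excess (_ : \1_(cap i) y = \1_[set y | c < dot y n] y) //.
  by rewrite !indicE; congr (_%:R); congr nat_of_bool; apply/idP/idP => /set_mem; rewrite /cap /half /= => hy; apply/mem_set; rewrite /= ?cE //; [case: hy|split => //; rewrite /half /= -cE].
apply: hausdorff1_null_sub null => x [bx [hx nv]]; split => //; split => //.
by rewrite /half /= -cE.
Qed.

Lemma truncate_caps g w V : bdd W N w -> tv_le Omega w V ->
  (forall i, admissible g i ->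
     hausdorff1 [set x | boundary Omega x /\ half i x /\ ~ vanishing_mean (excess w i) x] = 0%E) ->
  exists w', [/\ bdd W N w', tv_le Omega w' V, forall y, w' y <= w y,
    forall i y, admissible g i -> cap i y -> w' y <= level i &
    forall y b, b <= w y -> (forall i, admissible g i -> cap i y -> b <= level i) -> b <= w' y].
Proof.
move=> bw wV null.
(* Numbers that encode no index and indices that are not admissible get the empty set, so that the
   corresponding truncation changes nothing. *)
pose C (j : nat) : set (R * R) := if unpickle j is Some i then (if `[< admissible g i >] then cap i else set0) else set0.
pose k (j : nat) : R := if unpickle j is Some i then (if `[< admissible g i >] then level i else 0) else 0.
have W0 : 0 <= W by have [_ wW _] := bw; exact: le_trans (normr_ge0 _) (wW 0).
have CP j y : C j y -> exists i, [/\ admissible g i, C j = cap i & k j = level i].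
  by rewrite /C /k; case: unpickle => // i; case: asboolP => // ai _; exists i.
have Cdec j : C j = set0 \/ exists i, [/\ admissible g i, C j = cap i & k j = level i].
  by rewrite /C /k; case: unpickle => [i|]; [case: asboolP => ai; [right; exists i|left]|left].
have [||||w' [bw' w'V w'w w'k w'b]] := @successive_truncation R Omega w W N V C k bw wV.
- by move=> j; case: (Cdec j) => [->|[i [_ -> _]]] //; exact: measurable_cap.
- move=> j; rewrite /k; case: unpickle => [i|]; last by rewrite normr0.
  by case: asboolP => [[]//|_]; rewrite normr0.
- by move=> j y /[dup] /CP [i [_ -> _]] [/ON/boxP].
- move=> j v bv vw vV; have [->|[i [ai -> ->]]] := Cdec j.
    by apply: tv_le_ext vV => y _; rewrite indic0 mul0r subr0.
  have [m0 _ _ ci _] := ai; apply: cap_truncation_rational => //.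
  apply: hausdorff1_null_sub (null i ai) => x [bx [hx nv]]; split => //; split => //.
  apply: contra_not nv; apply: vanishing_mean_le; [exact: excess_integrable|exact: excess_integrable|].
  move=> y; rewrite /excess ler_wpM2l ?indicE ?ler0n //.
  by rewrite /pos ge_max le_max le_max lexx orbT andbT lerD2r vw.
have CI i : admissible g i -> C (pickle i) = cap i /\ k (pickle i) = level i.
  by move=> ai; rewrite /C /k pickleK; case: asboolP.
exists w'; split => //.
- by move=> i y /CI [E1 E2]; rewrite -E1 -E2 => Cy; exact: (w'k (pickle i) y Cy).
- move=> y b bwy bi; apply: w'b => // j Cy; have [i [ai E1 ->]] := CP _ _ Cy.
  by apply: bi; rewrite // -E1.
Qed.

End caps.

Section obstacle_class.
Context {R : realType}.
Notation mu := (@lebesgue_measure R).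
Notation mu2 := (mu \x mu)%E.
Implicit Types (x y : R * R) (u w : R * R -> R) (i j : (rat * rat) * (rat * rat)).
Variables (Omega : set (R * R)) (f : R * R -> R) (L p W N : R) (gamma : R -> R * R) (D Z : set R).
Variables (A B : R -> R) (M1 : R).
Hypotheses (oO : open Omega) (bO : bounded_set Omega) (scO : strictly_convex Omega) (cO : C1_boundary Omega).
Hypotheses (cN : closure Omega `<=` box N) (alp : arc_length_param (boundary Omega) L gamma).
Hypotheses (D_sub : forall t, D t -> p < t < p + L) (fW : forall t, D t -> `|f (gamma t)| + 1 <= W).
Hypotheses (Am : {homo A : s t / s <= t}) (Bm : {homo B : s t / s <= t}).
Hypotheses (A01 : forall t, 0 <= A t <= M1) (B01 : forall t, 0 <= B t <= M1).
Hypothesis AB_near : forall t eta e, p < t < p + L -> 0 < eta -> 0 < e ->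
  (exists s, [/\ D s, `|s - t| < eta & A t - B t + W <= f (gamma s) + e]) /\
  (exists s, [/\ D s, `|s - t| < eta & f (gamma s) - e <= A t - B t + W]).
Hypotheses (nZ : mu.-negligible Z) (f_cont : forall t, p < t < p + L -> ~ Z t ->
  D t /\ forall e, 0 < e -> exists d, 0 < d /\ forall s, D s -> `|s - t| < d -> `|f (gamma s) - f (gamma t)| < e).

Let q := gamma p.
Let G : set (R * R) := gamma @` D.
Let nf x := - f x.

Notation adm := (admissible Omega q G W).

Let ON : Omega `<=` box N. Proof. by apply: subset_trans cN; exact: subset_closure. Qed.

Let L0 : 0 < L. Proof. exact: alp_length_gt0 alp. Qed.

Let D_dense t eta : p < t < p + L -> 0 < eta -> exists s, D s /\ `|s - t| < eta.
Proof. by move=> t01 eta0; have [[s [Ds st _]] _] := AB_near t01 eta0 ltr01; exists s. Qed.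

Let W0 : 0 <= W.
Proof.
have pL : p < p + L / 2 < p + L by rewrite ltrDl divr_gt0 //= ltrD2l gtr_pMr // invf_lt1 // ltr1n.
by have [s [/fW + _]] := D_dense pL ltr01; apply: le_trans; rewrite addr_ge0.
Qed.

(** Lower bounds are stated as upper bounds for - u on the caps admissible for - f, so that a single
    kind of truncation serves both directions. *)
Definition obstacle_class u := [/\ bdd W N u, forall y, ~ Omega y -> u y = 0,
  forall i y, adm f i -> cap Omega i y -> u y <= level i &
  forall i y, adm nf i -> cap Omega i y -> - u y <= level i].

Lemma half_near i t : half i (gamma t) -> exists eta, 0 < eta /\ forall s, `|s - t| < eta -> half i (gamma s).
Proof.
move=> ht; have op : open (half i : set (R * R)) by apply: open_gt_fun; exact: continuous_dot.
have cg := curve_continuous alp; have := cg t _ (open_nbhs_nbhs (conj op ht)).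
move=> /nbhs_normP [eta /= eta0 he]; exists eta; split => // s st; apply: he => /=; by rewrite distrC.
Qed.

(** By [wedge_boundary] overlapping caps have a common boundary point other than [q], and by
    openness a common arc. The arc contains a parameter in [D], where the value of [f] lies between
    the two levels. *)
Lemma admissible_compat i j y : adm f i -> adm nf j -> cap Omega i y -> cap Omega j y -> - level j <= level i :> R.
Proof.
move=> [mi qi _ _ fi] [mj qj _ _ fj] [Oy hi] [_ hj].
have qi' : dot (gamma p) (rdir i.1) <= offset i by rewrite leNgt; apply/negP.
have [t [t01 ti tj]] := wedge_boundary oO bO alp Oy hi hj qi' mi.
have [e1 [e10 h1]] := half_near ti; have [e2 [e20 h2]] := half_near tj.
have eta0 : 0 < Num.min e1 e2 by rewrite lt_min e10.
have [s [Ds]] := D_dense t01 eta0; rewrite lt_min => /andP[s1 s2].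
have Gs : G (gamma s) by exists s.
have := fi _ Gs (h1 _ s1); have := fj _ Gs (h2 _ s2); rewrite /nf; lra.
Qed.

Lemma obstacle_class_midpoint u w : obstacle_class u -> obstacle_class w -> obstacle_class (fun y => 2^-1 * u y + 2^-1 * w y).
Proof.
move=> [[mu_ uW uN] u0 uf unf] [[mw wW wN] w0 wf wnf]; split.
- split => [|y|y yN].
  + by apply: measurable_funD; apply: measurable_funM.
  + by rewrite ler_norml; have := uW y; have := wW y; rewrite !ler_norml => /andP[? ?] /andP[? ?]; apply/andP; split; lra.
  + by rewrite uN // wN // !mulr0 addr0.
- by move=> y nO; rewrite u0 // w0 // !mulr0 addr0.
- by move=> i y ai cy; have := uf i y ai cy; have := wf i y ai cy; lra.
- by move=> i y ai cy; have := unf i y ai cy; have := wnf i y ai cy; lra.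
Qed.

(** The second alternative accommodates the null set on which [minimizer] keeps the values of the
    first function. *)
Lemma limit_or_le (v : nat -> R) (l b : R) : (v @ \oo --> l \/ l = v 0%N) -> (forall n, v n <= b) -> l <= b.
Proof. by move=> [vl|->] // vb; apply: (ler_cvg_to vl (cvg_cst b)); apply: nearW => j; exact: vb. Qed.

Lemma limit_or_leN (v : nat -> R) (l b : R) : (v @ \oo --> l \/ l = v 0%N) -> (forall n, - v n <= b) -> - l <= b.
Proof.
move=> h; apply: (@limit_or_le (fun n => - v n)); case: h => [vl|->]; last by right.
by left; exact: cvgN.
Qed.

Lemma obstacle_class_limit (u_ : nat -> R * R -> R) u : (forall n, obstacle_class (u_ n)) -> measurable_fun setT u ->
  (forall y, u_ ^~ y @ \oo --> u y \/ u y = u_ 0%N y) -> obstacle_class u.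
Proof.
move=> Ku mu_ lim.
have le y b : (forall n, u_ n y <= b) -> u y <= b by exact: (limit_or_le (lim y)).
have leN y b : (forall n, - u_ n y <= b) -> - u y <= b by exact: (limit_or_leN (lim y)).
have zero y : (forall n, u_ n y = 0) -> u y = 0.
  move=> h; apply/eqP; rewrite eq_le le => [|j]; last by rewrite h.
  by rewrite -oppr_le0 leN // => j; rewrite h oppr0.
split.
- split => // y; last by move=> yN; apply: zero => j; have [[_ _ h] _ _ _] := Ku j; exact: h.
  have uW n : `|u_ n y| <= W by have [[_ h _] _ _ _] := Ku n.
  rewrite ler_norml lerNl leN ?le // => j; have := uW j; rewrite ler_norml; lra.
- by move=> y nO; apply: zero => j; have [_ h _ _] := Ku j; exact: h.
- by move=> i y ai cy; apply: le => j; have [_ _ h _] := Ku j; exact: (h i y ai cy).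
- by move=> i y ai cy; apply: leN => j; have [_ _ _ h] := Ku j; exact: (h i y ai cy).
Qed.

(** The function takes at [y] the value of A - B + W at the exit parameter of the ray from [q]
    through [y]. That value is approximated from both sides by [f] at nearby parameters in [D], so
    it inherits the global bound and, because of [far], the bound of every cap containing [y]. *)
Lemma obstacle_class_inhabited : exists u V, obstacle_class u /\ tv_le Omega u V.
Proof.
have [mu0 [V u0V]] := fan_datum_tv p oO bO scO alp Am Bm A01 B01 W0.
set u0 := (fun y => _) in mu0 u0V.
exists u0, V; split => //.
have off y : ~ Omega y -> u0 y = 0 by move=> nO; rewrite /u0 indicE memNset // mul0r.
have on y : Omega y -> u0 y = A (fan L p gamma y) - B (fan L p gamma y) + W.
  by move=> Oy; rewrite /u0 indicE mem_set // mul1r.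
(* The scalar product is at most the offset at [q] and exceeds it at [y], so it increases along the
   ray and still exceeds the offset at the exit point. *)
have far i y : ~ half i q -> cap Omega i y -> half i (gamma (fan L p gamma y)).
  move=> hq [Oy hy]; have [_ [s [s1 ->]]] := fanP p oO bO alp Oy.
  have hq' : dot q (rdir i.1) <= offset i by rewrite leNgt; apply/negP.
  move: hy; rewrite /half /= dotDl dotZl dotBl -/q => hy; nra.
split.
- split => // y; last by move=> yN; apply: off => /ON/boxP; rewrite leNgt yN.
  have [Oy|/off ->] := pselect (Omega y); last by rewrite normr0.
  have [f01 _] := fanP p oO bO alp Oy; rewrite (on _ Oy).
  have [[s [Ds _ h1]] [t [Dt _ h2]]] := AB_near f01 ltr01 ltr01.
  have := fW Ds; have := fW Dt; have := ler_norm (f (gamma s)); have := ler_norm (- f (gamma t)).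
  by rewrite normrN ler_norml => ? ? ? ?; apply/andP; split; lra.
- exact: off.
- move=> i y [mi qi _ _ fi] cy; have Oy := cy.1; rewrite (on _ Oy).
  have [f01 _] := fanP p oO bO alp Oy; have [eta [eta0 he]] := half_near (far _ _ qi cy).
  apply/ler_addgt0Pr => e e0; have [[s [Ds st h1]] _] := AB_near f01 eta0 e0.
  by rewrite (le_trans h1) // lerD2r; apply: fi; [exists s|exact: he].
- move=> i y [mi qi _ _ fi] cy; have Oy := cy.1; rewrite (on _ Oy).
  have [f01 _] := fanP p oO bO alp Oy; have [eta [eta0 he]] := half_near (far _ _ qi cy).
  apply/ler_addgt0Pr => e e0; have [_ [s [Ds st h1]]] := AB_near f01 eta0 e0.
  have Gs : G (gamma s) by exists s.
  have := fi _ Gs (he _ st); rewrite /nf; lra.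
Qed.

Lemma boundary_cover x : boundary Omega x -> ~ (gamma @` (Z `|` [set p])) x -> exists t, [/\ p < t < p + L, ~ Z t & gamma t = x].
Proof.
move=> bx nx; have xq : x != gamma p by apply/eqP => E; apply: nx; exists p => //; right.
have [t [t01 tx]] := boundary_param alp bx xq; exists t; split => // Zt; apply: nx.
by exists t => //; left.
Qed.

Lemma exceptional_null : hausdorff1 (gamma @` (Z `|` [set p])) = 0%E.
Proof.
apply: hausdorff1_negligible_image; first exact: (curve_lipschitz alp).
by apply: negligibleU => //; apply/negligibleP => //; exact: lebesgue_measure_set1.
Qed.

(** Injectivity and compactness: outside a neighbourhood of [t] the curve keeps a positive distance
    from [gamma t]. Both ends of the interval give the point [q], which differs from [gamma t]. *)
Lemma curve_separated t d : p < t < p + L -> 0 < d -> exists rho, 0 < rho /\ forall s, p <= s <= p + L ->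
  eball (gamma t) rho (gamma s) -> `|s - t| < d.
Proof.
move=> /andP[t1 t2] d0; pose d' := Num.min d (Num.min (t - p) (p + L - t)).
have d'0 : 0 < d' by rewrite !lt_min d0 !subr_gt0 t1.
pose K : set R := `[p, p + L] `&` [set s | d' <= `|s - t|].
have cn : continuous (fun s : R => `|s - t|).
  by move=> s; apply: cvg_norm; apply: cvgB; [exact: cvg_id|exact: cvg_cst].
have cK : compact K.
  apply: (subclosed_compact _ (@segment_compact _ p (p + L))); last by move=> s [].
  apply: (@closedI _ `[p, p + L]%classic [set s : R | d' <= `|s - t|]); first exact: itv_closed.
  by apply: closed_ge_fun.
have cf : continuous (fun s => enorm (gamma s - gamma t)).
  move=> s; apply: (@continuous_comp _ _ _ gamma (fun y => enorm (y - gamma t))); first exact: (curve_continuous alp).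
  exact: continuous_enorm_sub.
have pos_ s : K s -> 0 < enorm (gamma s - gamma t).
  move=> [+ sd]; rewrite /= in_itv /= => /andP[s1 s2].
  rewrite lt_neqAle enorm_ge0 andbT eq_sym; apply/eqP => E.
  have gE : gamma s = gamma t.
    apply/eqP; rewrite -subr_eq0 -normr_le0 (le_trans (norm_le_enorm _)) //; by rewrite E.
  have [sL|sL] := ltP s (p + L); last first.
    have sE : s = p + L by apply/eqP; rewrite eq_le s2.
    have := curve_neq alp (lexx p) t1 t2; rewrite -gE sE (alp_periodic alp) eqxx; by [].
  move: sd; rewrite (curve_injective alp (p := p) (s := s) (t := t)) //; try by apply/andP; split; rewrite // ltW.
  by rewrite /= subrr normr0 leNgt d'0.
have [rho [rho0 hr]] := compact_positive_min cK cf pos_.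
exists rho; split => // s s01 sr; rewrite ltNge; apply/negP => ds.
have : K s by split => //=; rewrite (le_trans _ ds) // ge_min lexx.
by move=> /hr; rewrite leNgt => /negP; apply.
Qed.

(** The cap is chosen small enough to lie in one chart, to miss [q] and to see on its arc only
    values close to [f (gamma t)]. Datum and level are left free, so that the same cap serves [f]
    from above and - f from above. *)
Lemma cap_at_boundary t e : p < t < p + L -> ~ Z t -> 0 < e -> exists (m : rat * rat) (c : rat),
  [/\ half (m, (c, 0)) (gamma t) &
  forall (g : R * R -> R) (k : rat), (forall s, D s -> `|f (gamma s) - f (gamma t)| < e -> g (gamma s) <= ratr k) ->
    `|ratr k : R| <= W -> adm g (m, (c, k))].
Proof.
move=> t01 nZt e0; have [Dt ct] := f_cont t01 nZt; have [d [d0 hd]] := ct _ e0.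
(* Bounding the radius by t - p is what keeps [q] = [gamma p] out of the cap. *)
have [t1 t2] := andP t01; pose d' := Num.min d (t - p).
have d'0 : 0 < d' by rewrite lt_min d0 subr_gt0.
have [rho [rho0 hr]] := curve_separated t01 d'0.
have bx : boundary Omega (gamma t) by rewrite -(alp_range alp); exists t.
have [e1 [e2 [r [h [dh ch]]]]] := boundary_chart cO bx; have r0 := cc_r ch.
have s0 : 0 < Num.min rho (r / 2) by rewrite lt_min rho0 divr_gt0.
have [m [c [m0 hx hc]]] := rational_cap oO bO scO cO bx s0.
exists m, c; split => // g k gk kW; split => //.
- move=> hq; have bq : boundary Omega q by rewrite -(alp_range alp); exists p.
  have := hc _ (boundary_closure bq) hq; rewrite /eball /= lt_min => /andP[qr _].
  have pp : p <= p <= p + L by rewrite lexx lerDl ltW.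
  by have := hr p pp qr; rewrite lt_min distrC ger0_norm ?ltxx ?andbF // subr_ge0 ltW.
- exists (gamma t), e1, e2, r, h, dh; split => // y [Oy hy].
  by have := hc _ (subset_closure Oy) hy; rewrite /eball /= lt_min => /andP[].
move=> _ [s Ds <-] hs; apply: gk => //; apply: hd => //.
have bs : boundary Omega (gamma s) by rewrite -(alp_range alp); exists s.
have := hc _ (boundary_closure bs) hs; rewrite /eball /= lt_min => /andP[sr _].
have /andP[s1 s2] := D_sub Ds.
have s01 : p <= s <= p + L by rewrite !ltW.
by have := hr s s01 sr; rewrite lt_min => /andP[].
Qed.

Lemma obstacle_class_near u t e : obstacle_class u -> p < t < p + L -> ~ Z t -> 0 < e ->
  exists d, 0 < d /\ forall y, Omega y -> eball (gamma t) d y -> `|u y - f (gamma t)| <= e.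
Proof.
move=> [_ _ uf unf] t01 nZt e0; have [Dt _] := f_cont t01 nZt.
(* The levels lie within 2 e' of the datum: e / 2 gives the required closeness, and 1 / 2 keeps them
   below [W], which exceeds the absolute value of the datum by at least 1. *)
pose e' := Num.min (e / 2) (1 / 2).
have e'0 : 0 < e' by rewrite lt_min !divr_gt0.
have e'e : e' <= e / 2 by rewrite ge_min lexx.
have e'1 : e' <= 1 / 2 by rewrite ge_min lexx orbT.
have [m [c [ht hadm]]] := cap_at_boundary t01 nZt e'0.
have FW := fW Dt; have F1 := ler_norm (f (gamma t)); have F2 := ler_norm (- f (gamma t)).
rewrite normrN in F2.
have [k1 [a1 b1 _]] := rational_near (f (gamma t) + e') e'0.
have [k2 [a2 b2 _]] := rational_near (- f (gamma t) + e') e'0.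
have ad1 : adm f (m, (c, k1)).
  apply: hadm => [s Ds|]; first by rewrite ltr_norml => /andP[]; lra.
  by rewrite ler_norml; apply/andP; split; lra.
have ad2 : adm nf (m, (c, k2)).
  apply: hadm => [s Ds|]; first by rewrite ltr_norml /nf => /andP[]; lra.
  by rewrite ler_norml; apply/andP; split; lra.
have op : open (half (m, (c, 0)) : set (R * R)) by apply: open_gt_fun; exact: continuous_dot.
have [d [d0 hd]] := nbhs_eball (open_nbhs_nbhs (conj op ht)).
exists d; split => // y Oy yd; have hy := hd _ yd.
have := uf _ y ad1 (conj Oy hy); have := unf _ y ad2 (conj Oy hy); rewrite /level /= => h1 h2.
by rewrite ler_norml; apply/andP; split; lra.
Qed.

Lemma obstacle_class_trace u : obstacle_class u -> hausdorff1 (trace_defect Omega u f) = 0%E.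
Proof.
move=> Ku; apply: hausdorff1_null_sub exceptional_null => x [bx nv]; apply: contrapT => nx; apply: nv.
have [t [t01 nZt <-]] := boundary_cover bx nx; move=> e e0.
(* The area of a ball of radius s is estimated by 4 s^2, which the factor 1/4 compensates. *)
have e4 : 0 < e / 4 by rewrite divr_gt0.
have [d [d0 hd]] := obstacle_class_near Ku t01 nZt e4.
have [bu u0 _ _] := Ku.
exists d; split => // s /andP[s0 sd].
have area := area_eball (gamma t) (ltW s0).
apply: (@le_trans _ _ (\int[mu2]_y (e / 4 * \1_(eball (gamma t) s) y))); last first.
  rewrite (@RintegralZl _ _ _ mu2 setT _ (e / 4) measurableT (integrable_indic_eball (gamma t) s)).
  have := ler_wpM2l (ltW e4) area; move=> h; apply: (le_trans h).
  by rewrite mulrA divfK ?pnatr_eq0.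
have iO : mu2.-integrable Omega (EFin \o u).
  apply: (@integrableS _ _ _ mu2 setT Omega (EFin \o u)); [exact: measurableT|exact: open_measurable2|by []|exact: (bdd_integrable bu)].
apply: le_Rintegral => //.
- apply: (integrable_mul_bounded (C := 1) measurableT (integrable_restrict_dist (f (gamma t)) oO bO iO)).
    exact: measurable_indic (measurable_eball _ _).
  by move=> y _; rewrite indicE; case: (_ \in _); rewrite ?normr1 ?normr0.
- exact: (integrable_scale (e / 4) measurableT (integrable_indic_eball (gamma t) s)).
move=> y _; rewrite !indicE; case: (boolP (y \in eball (gamma t) s)) => [/set_mem ys|_]; last by rewrite !mulr0.
rewrite !mulr1; case: (boolP (y \in Omega)) => [/set_mem Oy|_]; last by rewrite mul0r ltW.
by rewrite mul1r; apply: hd => //; exact: lt_trans sd.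
Qed.

(** Since the datum lies in [-W, W] almost everywhere on the boundary, clipping brings a function no
    further from it and so preserves its trace. *)
Lemma clip_dist (a b : R) : `|b| <= W -> `|Num.max (Num.min a W) (- W) - b| <= `|a - b|.
Proof.
rewrite ler_norml => /andP[b1 b2].
have [aW|Wa] := leP a W.
  have [h|h] := leP (- W) a; first by [].
  by rewrite (@ler0_norm _ (- W - b)) ?(@ler0_norm _ (a - b)); lra.
have W2 : - W <= W by rewrite (le_trans _ W0) // oppr_le0.
by rewrite (max_l W2) (@ger0_norm _ (W - b)) ?(@ger0_norm _ (a - b)); lra.
Qed.

Lemma clip_tv w V : mu2.-integrable setT (EFin \o w) -> (forall y, ~ Omega y -> w y = 0) -> tv_le Omega w V ->
  bdd W N (fun y => Num.max (Num.min (w y) W) (- W)) /\ tv_le Omega (fun y => Num.max (Num.min (w y) W) (- W)) V.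
Proof.
move=> iw w0 wV; have mw : measurable_fun setT w by apply/measurable_EFinP; exact: measurable_int iw.
have wN y : N < `|y| -> w y = 0 by move=> yN; apply: w0 => /ON/boxP; rewrite leNgt yN.
have posE (a b : R) : a - pos (a - b) = Num.min a b.
  by rewrite /pos; case: (leP a b) => h; [rewrite max_r ?subr0 // subr_le0|rewrite max_l ?subr_ge0 ?ltW // opprB addrC subrK].
have t1 := tv_le_truncate W oO iw wN wV.
have E1 : (fun y => w y - pos (w y - W)) = fun y => Num.min (w y) W by apply/funext => y; exact: posE.
rewrite E1 in t1.
have N1 y : N < `|y| -> Num.min (w y) W = 0 by move=> /wN ->; rewrite min_l.
have i1 : mu2.-integrable setT (EFin \o (fun y => Num.min (w y) W)).
  apply: le_integrable iw => //.
    by apply/measurable_EFinP; apply: measurable_minr.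
  move=> y _ /=; rewrite lee_fin; case: (leP (w y) W) => // h.
  by rewrite (ger0_norm W0) (le_trans (ltW h)) // ler_norm.
have iN1 : mu2.-integrable setT (EFin \o (fun y => - Num.min (w y) W)).
  have := integrable_scale (-1) measurableT i1; apply: eq_integrable => // y _.
  by rewrite /= mulN1r.
have N2 y : N < `|y| -> - Num.min (w y) W = 0 by move=> /N1 ->; rewrite oppr0.
have t2 := tv_leN (tv_le_truncate W oO iN1 N2 (tv_leN t1)).
have E2 : (fun y => - (- Num.min (w y) W - pos (- Num.min (w y) W - W))) = fun y => Num.max (Num.min (w y) W) (- W).
  by apply/funext => y; rewrite posE oppr_min opprK.
rewrite E2 in t2; split => //; split.
- by apply: measurable_maxr => //; exact: measurable_minr.
- by move=> y; rewrite ler_norml le_max lexx orbT ge_max ge_min lexx orbT /= (le_trans _ W0) // oppr_le0.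
- by move=> y /N1 ->; rewrite max_l // oppr_le0.
Qed.

(* A competitor is pushed into the class by clipping it at +-W, then cutting it
   down on the caps admissible for f and up on the caps admissible for - f; none
   of these operations increases the variation. *)
Lemma competitor w V : mu2.-integrable Omega (EFin \o w) -> tv_le Omega (fun y => \1_Omega y * w y) V ->
  hausdorff1 (trace_defect Omega w f) = 0%E -> exists u, obstacle_class u /\ tv_le Omega u V.
Proof.
move=> iw wV defect; have iw' := restrict_measurable oO iw.
have w0 y : ~ Omega y -> \1_Omega y * w y = 0 by move=> nO; rewrite indicE memNset // mul0r.
have [] := clip_tv iw' w0 wV.
set w2 := (fun y => _) => bw2 w2V.
have bad_null := hausdorff1_null_setU defect exceptional_null.
have w2f x y : `|f x| <= W -> Omega y -> `|w2 y - f x| <= `|w y - f x|.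
  by move=> fx Oy; rewrite /w2 indicE mem_set // mul1r; exact: clip_dist.
have w20 y : ~ Omega y -> w2 y = 0 by move=> /w0; rewrite /w2 => ->; rewrite min_l // max_l // oppr_le0.
have good x : boundary Omega x -> ~ (trace_defect Omega w f `|` gamma @` (Z `|` [set p])) x ->
    [/\ G x, `|f x| <= W & vanishing_mean (fun y => \1_Omega y * `|w y - f x|) x].
  move=> bx nb; have nx : ~ (gamma @` (Z `|` [set p])) x by move=> h; apply: nb; right.
  have [t [t01 nZt tx]] := boundary_cover bx nx; have [Dt _] := f_cont t01 nZt.
  split; first by exists t.
    by have := fW Dt; rewrite tx; lra.
  by apply: contrapT => nv; apply: nb; left.
(* At a boundary point of the half-plane where [w] has trace f x, the excess over the level is
   dominated by the distance of [w] to f x, and so inherits its vanishing mean. *)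
have null g v i : (forall x, G x -> `|f x| <= W -> half i x -> forall y, cap Omega i y -> pos (v y - level i) <= `|w2 y - f x|) ->
    bdd W N v -> adm g i ->
    hausdorff1 [set x | boundary Omega x /\ half i x /\ ~ vanishing_mean (excess Omega v i) x] = 0%E.
  move=> hv bv ai; apply: hausdorff1_null_sub bad_null => x [bx [hx nv]]; apply: contrapT => nb; apply: nv.
  have [Gx fx vm] := good x bx nb; apply: vanishing_mean_le vm.
  - exact: (excess_integrable oO ON i bv).
  - exact: integrable_restrict_dist.
  move=> y; rewrite /excess [\1_(cap _ _) y]indicE; case: (boolP (y \in cap Omega i)) => [/set_mem cy|_].
    have Oy := cy.1; rewrite indicE mem_set // !mul1r.
    exact: le_trans (hv x Gx fx hx y cy) (w2f _ _ fx Oy).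
  by rewrite mul0r mulr_ge0 // indicE ler0n.
have null1 i : adm f i -> hausdorff1 [set x | boundary Omega x /\ half i x /\ ~ vanishing_mean (excess Omega w2 i) x] = 0%E.
  move=> ai; apply: (null f) => // x Gx fx hx y cy; have [_ _ _ _ fi] := ai.
  by rewrite /pos ge_max normr_ge0 andbT (le_trans _ (ler_norm _)) // lerD2l lerN2; exact: fi.
have [w3 [bw3 w3V w32 w3k w3b]] := truncate_caps oO ON bw2 w2V null1.
have null2 i : adm nf i -> hausdorff1 [set x | boundary Omega x /\ half i x /\ ~ vanishing_mean (excess Omega (fun y => - w3 y) i) x] = 0%E.
  move=> ai; apply: (null nf) => //; last exact: bddN.
  move=> x Gx fx hx y cy; have [_ _ _ _ fi] := ai.
  (* The first round lowers [w2] only to levels of caps admissible for [f], and by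
     [admissible_compat] these are at least - [level i]. The excess of - w3 is therefore no worse
     than that of - w2. *)
  have low : Num.min (- level i) (w2 y) <= w3 y.
    apply: w3b; first by rewrite ge_min lexx orbT.
    by move=> j aj cj; rewrite ge_min (admissible_compat aj ai cj cy).
  have nfx := fi x Gx hx; rewrite /nf in nfx.
  have n1 := ler_norm (- (w2 y - f x)); rewrite normrN in n1; have n0 := normr_ge0 (w2 y - f x).
  by rewrite /pos ge_max n0 andbT; move: low; rewrite ge_min => /orP[]; lra.
have [w4 [bw4 w4V w43 w4k w4b]] := truncate_caps oO ON (bddN bw3) (tv_leN w3V) null2.
have w30 y : ~ Omega y -> w3 y = 0.
  move=> nO; apply/eqP; rewrite eq_le -{1}(w20 y nO) w32 /=.
  by apply: w3b => [|i _ []//]; rewrite w20.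
exists (fun y => - w4 y); split; last exact: tv_leN.
split.
- exact: bddN.
- move=> y nO; apply/eqP; rewrite oppr_eq0 eq_le -{1}oppr0 -{1}(w30 y nO) w43 /=.
  by apply: w4b => [|i _ []//]; rewrite w30 // oppr0.
(* The second round raises the function only as far as lower levels, none of which exceeds an upper
   level of an overlapping cap, so the upper bounds of the first round survive. *)
- move=> i y ai cy; rewrite lerNl; apply: w4b; first by rewrite lerN2; exact: (w3k i y ai cy).
  by move=> j aj cj; rewrite lerNl; exact: (admissible_compat ai aj cy cj).
- by move=> i y ai cy; rewrite opprK; exact: (w4k i y ai cy).
Qed.

Lemma obstacle_class_solution : L1_boundary Omega f -> exists u, least_gradient_solution Omega f u.
Proof.
move=> f1.
have [u [m [Ku um m_min]]] := minimizer (fun u (Ku : obstacle_class u) => let: And4 bu _ _ _ := Ku in bu)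
  obstacle_class_midpoint obstacle_class_limit obstacle_class_inhabited.
have [bu u0 _ _] := Ku.
have iu : mu2.-integrable Omega (EFin \o u).
  by apply: (@integrableS _ _ _ mu2 setT Omega (EFin \o u)); [exact: measurableT|exact: open_measurable2|by []|exact: (bdd_integrable bu)].
have uE y : Omega y -> u y = \1_Omega y * u y by move=> Oy; rewrite indicE mem_set // mul1r.
have um' : (total_var Omega u <= m%:E)%E by apply/(total_var_tv_le m oO iu); exact: (tv_le_ext uE um).
exists u; split.
- by split => //; exact: le_lt_trans um' (ltry _).
- by apply/(trace_defectP f oO bO iu); split => //; exact: obstacle_class_trace.
move=> v [iv _] tv0.
have iuv : mu2.-integrable Omega (EFin \o (fun x => u x + v x)).
  have := @integrableD _ _ _ mu2 Omega (open_measurable2 oO) _ _ iu iv.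
  by apply: eq_integrable => //; exact: open_measurable2.
have defect : hausdorff1 (trace_defect Omega (fun x => u x + v x) f) = 0%E.
  have v0 := ((trace_defectP (fun=> 0) oO bO iv).1 tv0).2.
  apply: hausdorff1_null_sub (hausdorff1_null_setU (obstacle_class_trace Ku) v0) => x [bx nv].
  apply: contrapT => nx.
  have vu : vanishing_mean (fun y => \1_Omega y * `|u y - f x|) x.
    by apply: contrapT => h; apply: nx; left.
  have vv : vanishing_mean (fun y => \1_Omega y * `|v y - 0|) x.
    by apply: contrapT => h; apply: nx; right.
  have i1 := integrable_restrict_dist (f x) oO bO iu.
  have i2 := integrable_restrict_dist 0 oO bO iv.
  apply: nv; apply: vanishing_mean_le (vanishing_meanD i1 i2 vu vv).
  - exact: integrable_restrict_dist.
  - exact: integrable_add i1 i2.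
  move=> y; rewrite -mulrDr subr0; apply: ler_wpM2l; first by rewrite indicE ler0n.
  by rewrite addrAC ler_normD.
(* The sum u + v again has trace [f], so every bound on its variation is inherited by some member of
   the class, over which [u] is minimal. *)
have le_tv (V : R) : (total_var Omega (fun x => u x + v x)%R <= V%:E)%E -> m <= V.
  move=> /(total_var_tv_le V oO iuv) tuv; have [w [Kw wV]] := competitor iuv tuv defect.
  exact: m_min Kw wV.
apply: (le_trans um'); case E : (total_var Omega (fun x => u x + v x)%R) => [r| |].
- by rewrite lee_fin; apply: le_tv; rewrite E.
- exact: leey.
- have : m <= m - 1 by apply: le_tv; rewrite E leNye.
  by rewrite lerDl oppr_ge0 ler10.
Qed.

End obstacle_class.

Theorem theorem1p1 (R : realType) (Omega : set (R * R))
  (Omega_open : open Omega)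
  (Omega_bounded : bounded_set Omega)
  (Omega_strictly_convex : strictly_convex Omega)
  (Omega_C1 : C1_boundary Omega) :
  forall f : R * R -> R, BV_boundary Omega f ->
  exists u : R * R -> R, least_gradient_solution Omega f u.
Proof.
move=> f [f1 [L [gamma [alp [p [_ [M var]]]]]]].
(* The variation bound, the monotone decomposition and the admissible levels refer to [f] only at
   parameters in [D]; on the remaining null set its values are arbitrary. *)
pose D := [set t : R | p < t < p + L /\ approx_continuous (f \o gamma) t].
have [N [nN Nac]] := ae_approx_continuous p f1 alp.
have D_sub t : D t -> p < t < p + L by case.
have D_full t : p < t < p + L -> ~ N t -> D t by move=> t01 nNt; split => //; exact: Nac.
have D_var (n : nat) (x : nat -> R) : (forall i, (i <= n)%N -> D (x i)) ->
    (forall i, (i < n)%N -> x i < x i.+1) -> \sum_(i < n) `|(f \o gamma) (x i.+1) - (f \o gamma) (x i)| <= M.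
  by move=> Dx xx; apply: var.
have [A [B [M0 [M1 [[Am Bm A01 B01] FM near_ [Z [nZ cZ]]]]]]] :=
  bv_decomposition (alp_length_gt0 alp) nN D_full D_var.
have [K [_ cK]] := closure_in_box Omega_bounded.
exact: (obstacle_class_solution Omega_open Omega_bounded Omega_strictly_convex Omega_C1 cK alp D_sub FM
  Am Bm A01 B01 near_ nZ cZ f1).
Qed.
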